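(* Let $V_0\in\mathscr V^{\rm irr}$, let $|\varphi\rangle\in\mathcal H$ be a fixed initial system unit vector, let $C>0$, $d_{\rm id}=2d^2(k-1)$, $0<\delta<(2(d_{\rm id}+3))^{-1}$ and $r_n=Cn^\delta$. Consider (for $n$ large enough) the local system-output models $$\mathbf Q^{\rm s+o}_{V_0}(n)=\{|\Psi_{V(n^{-1/2}A)}(n)\rangle:\ A\in B^{\rm id}_{r_n}(V_0)\}$$ and the restricted quantum Gaussian shift models $$\mathbf G_{V_0}(n)=\{|{\rm Coh}(A)\rangle:\ A\in B^{\rm id}_{r_n}(V_0)\}.$$ Then $$\lim_{n\to\infty}\Delta(\mathbf Q^{\rm s+o}_{V_0}(n),\mathbf G_{V_0}(n))=0,$$ where $\Delta$ is the Le Cam distance. Moreover, if $\delta<(2(11+2d_{\rm id}))^{-1}$, then $$\lim_{n\to\infty}n^{2\delta}\,\Delta(\mathbf Q^{\rm s+o}_{V_0}(n),\mathbf G_{V_0}(n))=0.$$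
   Context: $\mathcal H=\mathbb C^d$, $\mathcal K=\mathbb C^k$. For an isometry $V:\mathcal H\to\mathcal H\otimes\mathcal K$, write $V|\psi\rangle=\sum_iK_i|\psi\rangle\otimes|i\rangle$; the channel has predual $\mathcal T_{V*}(\rho)=\sum_iK_i\rho K_i^*$; $V$ is irreducible if there is a unique state $\rho_V^{\rm ss}>0$ with $\mathcal T_{V*}(\rho_V^{\rm ss})=\rho_V^{\rm ss}$. $\mathscr V^{\rm irr}$ is the manifold of irreducible isometries. The system-output state is $|\Psi_V(n)\rangle=V(n)|\varphi\rangle=\sum_{i_1,\dots,i_n}K_{i_n}\cdots K_{i_1}|\varphi\rangle\otimes|i_1\cdots i_n\rangle\in\mathcal H\otimes\mathcal K^{\otimes n}$. Tangent space convention: $T_V(\mathscr V^{\rm irr})=\{L\in L^\infty(\mathcal H,\mathcal H\otimes\mathcal K):L^*V-V^*L=0\}$, $L$ representing the infinitesimal change $V\mapsto V+i\delta L$. $T_V=T_V^{\rm id}\oplus T_V^{\rm nonid}$, with $T_V^{\rm id}=\{A:VV^*A=0\}$ and $T_V^{\rm nonid}=\{\theta V-(K\otimes\mathbf 1)V+VK:\theta\in\mathbb R,\ K=K^*,\ {\rm Tr}(\rho_V^{\rm ss}K)=0\}$. Fix a Riemannian metric $\nu$ on $\mathscr V^{\rm irr}$ invariant under the action $(c,W)\cdot V=\overline c(W\otimes\mathbf 1)VW^*$ of $U(1)\times PU(d)$, such that $T_V^{\rm id}\perp T_V^{\rm nonid}$ and $\nu_V(A,A)={\rm Tr}(\rho_V^{\rm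 ss}A^*A)$ for $A\in T_V^{\rm id}$ (such metrics exist). $V(\cdot):=\exp_{V_0}$ is its exponential map at $V_0$, defined near $0\in T_{V_0}(\mathscr V^{\rm irr})$ (the geodesic $t\mapsto V(tA)$ has velocity $iA$ at $t=0$). $B_r^{\rm id}(V_0)$ is the ball of radius $r$ centred at $0$ in $T^{\rm id}_{V_0}$. Limit model: $T^{\rm id}_{V_0}$ is a complex Hilbert space with inner product $(A,B)_{V_0}={\rm Tr}(\rho^{\rm ss}_{V_0}A^*B)$. On its symmetric Fock space, $|{\rm Coh}(A)\rangle=e^{-\frac12(A,A)_{V_0}}\bigoplus_{m\ge0}\frac1{\sqrt{m!}}A^{\otimes m}$. Le Cam distance: for families of states $\mathbf Q=\{\rho_\theta\}_{\theta\in\Theta}$ on $\mathcal H_1$ and $\mathbf R=\{\sigma_\theta\}_{\theta\in\Theta}$ on $\mathcal H_2$, $\delta(\mathbf Q,\mathbf R)=\inf_{\mathcal T_*}\sup_\theta\|\mathcal T_*(\rho_\theta)-\sigma_\theta\|_1$ over quantum channels (completely positive trace-preserving maps) $\mathcal T_*:L^1(\mathcal H_1)\to L^1(\mathcal H_2)$, and $\Delta(\mathbf Q,\mathbf R)=\max(\delta(\mathbf Q,\mathbf R),\delta(\mathbf R,\mathbf Q))$. Unit vectors are identified with their rank-one projections. *)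

(* Defs.v *)
From HB Require Import structures.
From mathcomp Require Import all_boot all_order all_algebra finmap.
From mathcomp Require Import sesquilinear spectral.
From mathcomp Require Import complex.
From mathcomp Require mxtens.
From mathcomp Require Import all_classical all_reals all_analysis.
From mathcomp Require Import summability.

Set Implicit Arguments.
Unset Strict Implicit.
Unset Printing Implicit Defensive.

Import Order.TTheory GRing.Theory Num.Theory.
Import numFieldNormedType.Exports.

Local Open Scope classical_set_scope.
Local Open Scope ring_scope.
Local Open Scope complex_scope.
Local Open Scope sesquilinear_scope.

(* The library puts no topology on R[i]; complex-valued sums and derivatives
   are therefore taken on real and imaginary parts. Recall that 0 <= z in R[i]
   means that z is real and nonnegative. *)

(** ** Isometries and the system-output state *)

Section Isometries.
Context {R : realType}.
Local Notation C := R[i].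
Variables d k : nat.

(* An operator V : C^d -> C^d (x) C^k is a matrix whose row
   mxtens_index (a, i) carries the component along e_a (x) |i>. *)
Local Notation op := 'M[C]_(d * k, d).
Implicit Types (V A L : op) (rho K W : 'M[C]_d).

Definition kraus V (i : 'I_k) : 'M[C]_d :=
  \matrix_(a, c) V (mxtens.mxtens_index (a, i)) c.

Definition predual V rho : 'M[C]_d :=
  \sum_(i < k) kraus V i *m rho *m (kraus V i)^t*.

Definition isometry V := V^t* *m V = 1%:M.

Definition is_state rho :=
  (forall v : 'cV[C]_d, 0 <= \tr (v^t* *m rho *m v)) /\ \tr rho = 1.

Definition pos_definite rho :=
  forall v : 'cV[C]_d, v != 0 -> 0 < \tr (v^t* *m rho *m v).

Definition stationary V rho := is_state rho /\ predual V rho = rho.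

Definition irreducible V := isometry V /\
  exists rho, [/\ stationary V rho, pos_definite rho &
    forall sigma, stationary V sigma -> sigma = rho].

Definition rho_ss V : 'M[C]_d := xget 0 [set rho | stationary V rho].

Definition sys_op W : 'M[C]_(d * k) := mxtens.tensmx W (1%:M : 'M[C]_k).

Definition gauge (c : C) W V : op := c^* *: (sys_op W *m V *m W^t*).

(* The component along e_a (x) |i_1 ... i_n>, the tuple being (i_1,...,i_n). *)
Definition system_output V (phi : 'cV[C]_d) (n : nat)
    (p : 'I_d * n.-tuple 'I_k) : C :=
  foldl (fun v i => kraus V i *m v) phi p.2 p.1 0.

(** ** Tangent spaces *)

Definition tangent V : set op := [set L | L^t* *m V - V^t* *m L = 0].

Definition tangent_id V : set op := [set A | V *m V^t* *m A = 0].

Definition tangent_nonid V : set op :=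
  [set L | exists (theta : R) (K : 'M[C]_d),
    [/\ K^t* = K, \tr (rho_ss V *m K) = 0 &
        L = theta%:C *: V - sys_op K *m V + V *m K]].

Definition ip_id V A L : C := \tr (rho_ss V *m A^t* *m L).

Definition ball_id V (r : R) : set op :=
  [set A | tangent_id V A /\ ip_id V A A <= (r ^+ 2)%:C].

Definition d_id : nat := (2 * (d ^ 2 * (k - 1)))%N.

Definition onb_id V (b : 'I_(d ^ 2 * (k - 1)) -> op) :=
  [/\ forall i, tangent_id V (b i),
      forall i j, ip_id V (b i) (b j) = (i == j)%:R &
      forall A, tangent_id V A -> A = \sum_i ip_id V (b i) A *: b i].

End Isometries.

(** ** Riemannian metrics on the manifold of irreducible isometries *)

Section Smooth.
Context {R : realType}.

Fixpoint Cn_on (n m : nat) (U : set 'rV[R]_m) (f : 'rV[R]_m -> R) : Prop :=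
  (forall x, U x -> {for x, continuous f}) /\
  if n is n'.+1 then forall i : 'I_m,
    (forall x, U x -> derivable f x (delta_mx 0 i)) /\
    Cn_on n' U (fun x => 'D_(delta_mx 0 i) f x)
  else True.

Definition smooth_on (m : nat) (U : set 'rV[R]_m) (f : 'rV[R]_m -> R) :=
  forall n, Cn_on n U f.

Definition smooth_curve (a b : R) (f : R -> R) :=
  forall n t, a < t < b -> derivable (derive1n n f) t 1.

Definition mx_pderiv (m p q : nat) (i : 'I_m) (f : 'rV[R]_m -> 'M[R[i]]_(p, q))
    (x : 'rV[R]_m) : 'M[R[i]]_(p, q) :=
  \matrix_(u, v) ('D_(delta_mx 0 i) (fun y => complex.Re (f y u v)) x
               +i* 'D_(delta_mx 0 i) (fun y => complex.Im (f y u v)) x).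

Definition mx_velocity (p q : nat) (f : R -> 'M[R[i]]_(p, q)) (t : R)
    : 'M[R[i]]_(p, q) :=
  \matrix_(u, v) (derive1 (fun s => complex.Re (f s u v)) t
               +i* derive1 (fun s => complex.Im (f s u v)) t).

End Smooth.

Section Riemannian.
Context {R : realType}.
Local Notation C := R[i].
Variables d k : nat.
Local Notation op := 'M[C]_(d * k, d).
Implicit Types (V A B L : op).

(* The real dimension of the set of isometries C^d -> C^d (x) C^k, in which the
   irreducible ones form an open subset. *)
Definition dim_iso : nat := (2 * d ^ 2 * k - d ^ 2)%N.

(* Local coordinates. Since the number of parameters is the dimension of the
   manifold, an injective differential makes phi locally a diffeomorphism onto
   an open subset; no global injectivity is needed for the local notions
   below. *)
Definition local_coord (U : set 'rV[R]_dim_iso) (phi : 'rV[R]_dim_iso -> op) :=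
  [/\ open U,
      forall u v, smooth_on U (fun x => complex.Re (phi x u v)) /\
                  smooth_on U (fun x => complex.Im (phi x u v)),
      forall x, U x -> irreducible (phi x) &
      forall x, U x -> forall c : 'I_dim_iso -> R,
        \sum_i (c i)%:C *: mx_pderiv i phi x = 0 -> forall i, c i = 0].

Variable nu : op -> op -> op -> R.

(* A tangent vector L stands for the infinitesimal change V + i delta L: the
   coordinate vector field d(phi)/dx_i is represented by - i d(phi)/dx_i. *)
Definition metric_coef (phi : 'rV[R]_dim_iso -> op) (i j : 'I_dim_iso)
    (x : 'rV[R]_dim_iso) : R :=
  nu (phi x) (- 'i *: mx_pderiv i phi x) (- 'i *: mx_pderiv j phi x).

Definition riemannian_metric := [/\
  forall V, irreducible V -> forall (a : R) A B L,
    tangent V A -> tangent V B -> tangent V L ->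
    nu V (a%:C *: A + B) L = a * nu V A L + nu V B L,
  forall V, irreducible V -> forall A B,
    tangent V A -> tangent V B -> nu V A B = nu V B A,
  forall V, irreducible V -> forall A,
    tangent V A -> A != 0 -> 0 < nu V A A &
  forall U phi, local_coord U phi ->
    forall i j, smooth_on U (metric_coef phi i j)].

Definition gauge_invariant :=
  forall (c : C) (W : 'M[C]_d) V A B,
    `|c| = 1 -> W^t* *m W = 1%:M -> irreducible V ->
    tangent V A -> tangent V B ->
    nu (gauge c W V) (gauge c W A) (gauge c W B) = nu V A B.

Definition id_compatible :=
  forall V, irreducible V ->
    (forall A B, tangent_id V A -> tangent_nonid V B -> nu V A B = 0) /\
    (forall A, tangent_id V A ->
       (nu V A A)%:C = \tr (rho_ss V *m A^t* *m A)).

Definition christoffel (phi : 'rV[R]_dim_iso -> op) (l i j : 'I_dim_iso)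
    (x : 'rV[R]_dim_iso) : R :=
  2^-1 * \sum_h invmx (\matrix_(u, v) metric_coef phi u v x) l h *
    ('D_(delta_mx 0 i) (metric_coef phi j h) x
   + 'D_(delta_mx 0 j) (metric_coef phi i h) x
   - 'D_(delta_mx 0 h) (metric_coef phi i j) x).

(* A smooth curve in the manifold which satisfies the geodesic equation of the
   Levi-Civita connection in all local coordinates. *)
Definition geodesic (a b : R) (gamma : R -> op) := [/\
  forall t, a < t < b -> irreducible (gamma t),
  forall u v, smooth_curve a b (fun t => complex.Re (gamma t u v)) /\
              smooth_curve a b (fun t => complex.Im (gamma t u v)) &
  forall U phi, local_coord U phi ->
  forall (a' b' : R) (x : R -> 'rV[R]_dim_iso), a <= a' -> b' <= b ->
    (forall l, smooth_curve a' b' (fun t => x t 0 l)) ->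
    (forall t, a' < t < b' -> U (x t) /\ phi (x t) = gamma t) ->
  forall t, a' < t < b' -> forall l,
    derive1n 2 (fun s => x s 0 l) t +
    \sum_i \sum_j christoffel phi l i j (x t) *
      derive1 (fun s => x s 0 i) t * derive1 (fun s => x s 0 j) t = 0].

(* E is the exponential map at V0 near the origin of the tangent space; its
   values elsewhere are unconstrained. *)
Definition exponential_map V0 (E : op -> op) :=
  exists2 r : R, 0 < r & forall A, tangent V0 A -> nu V0 A A < r ^+ 2 ->
    exists (e : R) (gamma : R -> op),
      [/\ 0 < e, geodesic (- e) (1 + e) gamma, gamma 0 = V0,
          mx_velocity gamma 0 = 'i *: A & gamma 1 = E A].

End Riemannian.

(** ** Operators and channels on Hilbert spaces of square-summable families *)

(* A Hilbert space given as the closed subspace of l^2(hidx) formed by the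
   square-summable families in hsub; its trace class operators are described by
   their matrices in the standard basis of l^2(hidx). *)
Record hilbert (R : realType) := Hilbert {
  hidx : choiceType;
  hsub : set (hidx -> R[i]) }.
Arguments Hilbert {R}.

Section Channels.
Context {R : realType}.
Local Notation C := R[i].

Definition has_sum (I : choiceType) (f : I -> C) (s : C) :=
  partial_sum (fun i => complex.Re (f i)) @ totally --> complex.Re s /\
  partial_sum (fun i => complex.Im (f i)) @ totally --> complex.Im s.

Definition psd (I : choiceType) (X : I -> I -> C) :=
  forall (F : {fset I}) (v : I -> C),
    0 <= \sum_(i <- F) \sum_(j <- F) (v i)^* * X i j * v j.

(* P = |X|: P is positive and P P = X^* X, entrywise in the standard basis. *)
Definition is_abs (I : choiceType) (X P : I -> I -> C) :=
  psd P /\ forall i j, exists s,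
    has_sum (fun l => (X l i)^* * X l j) s /\
    has_sum (fun l => P i l * P l j) s.

Definition has_trace_norm (I : choiceType) (X : I -> I -> C) (t : R) :=
  exists2 P, is_abs X P & has_sum (fun i => P i i) t%:C.

(* Tr |X|, which is +oo if X is not trace class. *)
Definition trace_norm (I : choiceType) (X : I -> I -> C) : \bar R :=
  ereal_inf [set t%:E | t in has_trace_norm X].

(* L^1(H): the trace class matrices whose range and whose adjoint's range lie in
   the subspace. *)
Definition trace_class (H : hilbert R) (X : hidx H -> hidx H -> C) :=
  [/\ exists t, has_trace_norm X t,
      forall j, hsub (fun i => X i j) &
      forall i, hsub (fun j => (X i j)^*)].

Definition block (N : nat) (I : choiceType) (X : 'I_N -> 'I_N -> I -> I -> C)
    (p q : 'I_N * I) : C := X p.1 q.1 p.2 q.2.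

(* Only the values of T on L^1(H1) matter. *)
Definition channel (H1 H2 : hilbert R)
    (T : (hidx H1 -> hidx H1 -> C) -> (hidx H2 -> hidx H2 -> C)) := [/\
  forall X, trace_class X -> trace_class (T X),
  forall (a : C) X Y, trace_class X -> trace_class Y ->
    T (fun i j => a * X i j + Y i j) = (fun i j => a * T X i j + T Y i j),
  forall X s, trace_class X ->
    has_sum (fun i => X i i) s -> has_sum (fun i => T X i i) s &
  forall (N : nat) (X : 'I_N -> 'I_N -> hidx H1 -> hidx H1 -> C),
    (forall u v, trace_class (X u v)) ->
    psd (block X) -> psd (block (fun u v => T (X u v)))].

Definition projector (I : Type) (psi : I -> C) (i j : I) : C :=
  psi i * (psi j)^*.

Definition deficiency (H1 H2 : hilbert R) (Theta : Type) (B : set Theta)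
    (Q : Theta -> hidx H1 -> hidx H1 -> C)
    (G : Theta -> hidx H2 -> hidx H2 -> C) : \bar R :=
  ereal_inf [set
    ereal_sup [set trace_norm (fun i j => T (Q theta) i j - G theta i j)
              | theta in B]
  | T in @channel H1 H2].

Definition le_cam (H1 H2 : hilbert R) (Theta : Type) (B : set Theta)
    (Q : Theta -> hidx H1 -> hidx H1 -> C)
    (G : Theta -> hidx H2 -> hidx H2 -> C) : \bar R :=
  maxe (deficiency B Q G) (deficiency B G Q).

End Channels.

(** ** The two models *)

Section Models.
Context {R : realType}.
Local Notation C := R[i].
Variables d k : nat.
Local Notation op := 'M[C]_(d * k, d).

Definition output_space (n : nat) : hilbert R :=
  Hilbert ('I_d * n.-tuple 'I_k)%type setT.

(* The symmetric Fock space of C^D: the subspace of permutation-symmetric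
   families of l^2(words over 'I_D), where a word of length m indexes the product
   basis of (C^D)^(x)m. *)
Definition fock_space (D : nat) : hilbert R :=
  Hilbert (seq 'I_D)
    [set f | forall w w' : seq 'I_D, perm_eq w w' -> f w = f w'].

(* Components of Coh(A) in the product bases obtained from an orthonormal basis
   b of the identifiable tangent space. *)
Definition coherent (V0 : op) (b : 'I_(d ^ 2 * (k - 1)) -> op) (A : op)
    (w : seq 'I_(d ^ 2 * (k - 1))) : C :=
  (expR (- (complex.Re (ip_id V0 A A) / 2)) / Num.sqrt ((size w)`!)%:R)%:C
  * \prod_(i <- w) ip_id V0 (b i) A.

Definition output_model (E : op -> op) (phi : 'cV[C]_d) (n : nat) (A : op)
    : hidx (output_space n) -> hidx (output_space n) -> C :=
  projector (system_output (E (((Num.sqrt (n%:R : R))^-1)%:C *: A)) phi (n := n)).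

Definition gaussian_model (V0 : op) (b : 'I_(d ^ 2 * (k - 1)) -> op) (A : op)
    : hidx (fock_space (d ^ 2 * (k - 1))) ->
      hidx (fock_space (d ^ 2 * (k - 1))) -> C :=
  projector (coherent V0 b A).

Definition local_radius (c delta : R) (n : nat) : R := c * n%:R `^ delta.

Definition local_le_cam (V0 : op) (E : op -> op) (phi : 'cV[C]_d)
    (b : 'I_(d ^ 2 * (k - 1)) -> op) (c delta : R) (n : nat) : \bar R :=
  @le_cam R (output_space n) (fock_space (d ^ 2 * (k - 1))) op
    (ball_id V0 (local_radius c delta n))
    (output_model E phi (n := n)) (gaussian_model V0 b).

End Models.

(* Main.v *)
(** Exponential map.  In a Cayley-type chart of the isometries around V0 the
    geodesic equation has bounded coefficients, so a continuity (bootstrap)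
    argument keeps short geodesics near V0 with acceleration quadratic in the
    velocity: V(A) = V0 + iA + O(|A|^2).

    Gram matrices.  The overlap of the output states of V(A/sqrt n) and
    V(B/sqrt n) is obtained by iterating n times the transfer operator
    X |-> V(A/sqrt n)^* (X (x) 1) V(B/sqrt n), a perturbation of the channel of
    V0, whose eigenvalue 1 is simple.  A perturbed eigenvector near the identity
    reduces the iteration to the n-th power of a scalar.  After a phase depending
    on A alone is removed from each output state, the overlap differs from that
    of Coh(A) and Coh(B) by O(r^3 / sqrt n), uniformly for |A|, |B| <= r.

    Channels.  A Riemann sum on a polar grid turns the coherent-state resolution
    of the identity in D = d_id / 2 modes into a finite frame that almost
    reproduces Coh(z) for |z| <= r.  Transporting this frame to the output states
    with the same parameters gives an almost isometric map, since the Gram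
    matrices are close; it completes to a channel in either direction, with error
    O(sqrt (r^(3 + 2 D) / sqrt n + D exp (-r^2))). *)
From HB Require Import structures.
Require Import Defs.
From mathcomp Require Import all_boot all_order all_algebra finmap.
From mathcomp Require Import sesquilinear spectral complex.
From mathcomp Require mxtens.
From mathcomp Require Import all_classical all_reals all_analysis.
From mathcomp Require Import summability.
From mathcomp Require Import ring lra zify.
Import Order.TTheory GRing.Theory Num.Theory numFieldNormedType.Exports.

Set Implicit Arguments.
Unset Strict Implicit.
Unset Printing Implicit Defensive.

Local Open Scope complex_scope.
Local Open Scope sesquilinear_scope.
Local Open Scope classical_set_scope.
Local Open Scope ring_scope.
Import Normc.

(** Put [h = r / sqrt n]. The isometry is [V0 + i A + D] with [A] of size [h] and [D] of size [h^2].
    Over [n] steps an error of order [h^3] costs [r^3 / sqrt n], but [D] costs [n h^2 = r^2], which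
    does not vanish. It enters a step through the scalar [ip_id V0 V0 D] only. Up to [h^3] the real
    part is forced by the isometry condition to be minus half of [ip_id V0 A A]; the imaginary part
    belongs to a single state, so it is a phase that the projector forgets. There is no linear term,
    since the range of [V0] is orthogonal to identifiable directions. Fock space is truncated to
    words shorter than [M], and [M] is free, so truncation never enters the rate. The exponents: the
    total weight [(4 r^2)^D] of the frame multiplies the Gram error [r^3 / sqrt n], and passing from
    overlaps to trace norms takes a square root. With [r = C n^delta] the plain limit asks for
    [(3 + 2 D) delta < 1/2], the first threshold since [d_id = 2 D]. The factor [n^(2 delta)]
    becomes [n^(4 delta)] under the root and asks for [(7 + 2 D) delta < 1/2], which the second
    threshold implies. *)

Section ComplexNorm.
Context {R : realType}.
Local Notation C := R[i].
Local Notation Re := complex.Re.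
Local Notation Im := complex.Im.
Implicit Types (x y z : C).

Lemma conjE z : Num.conj z = conjc z. Proof. by []. Qed.

Lemma conjcE z : conjc z = z^*. Proof. by []. Qed.

Lemma normc_ge0 z : 0 <= normc z.
Proof. by case: z => a b; exact: sqrtr_ge0. Qed.

Lemma sqr_normcE z : normc z ^+ 2 = Re z ^+ 2 + Im z ^+ 2.
Proof. by case: z => a b; rewrite sqr_sqrtr // addr_ge0 // sqr_ge0. Qed.

Lemma normcJ z : normc z^* = normc z.
Proof. by rewrite conjE; case: z => a b /=; rewrite sqrrN. Qed.

Lemma normcR (a : R) : normc a%:C = `|a|.
Proof. by rewrite /= expr0n addr0 sqrtr_sqr. Qed.

Lemma mulJc z : z^* * z = (normc z ^+ 2)%:C.
Proof.
rewrite sqr_normcE conjE; case: z => a b /=; simpc.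
by congr (_ +i* _); ring.
Qed.

Lemma normc_Re z : `|Re z| <= normc z.
Proof.
rewrite -(ler_pXn2r (n := 2)) ?nnegrE ?normc_ge0 // real_normK ?num_real //.
by rewrite sqr_normcE lerDl sqr_ge0.
Qed.

Lemma normc_Im z : `|Im z| <= normc z.
Proof.
rewrite -(ler_pXn2r (n := 2)) ?nnegrE ?normc_ge0 // real_normK ?num_real //.
by rewrite sqr_normcE lerDr sqr_ge0.
Qed.

Lemma normc_leD z : normc z <= `|Re z| + `|Im z|.
Proof.
rewrite -(ler_pXn2r (n := 2)) ?nnegrE ?normc_ge0 ?addr_ge0 //.
rewrite sqr_normcE sqrrD !real_normK ?num_real // lerD2r lerDl.
by rewrite mulrn_wge0 // mulr_ge0.
Qed.

Lemma normc_eq0 z : (normc z == 0) = (z == 0).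
Proof.
by apply/eqP/eqP => [/eq0_normc//|->]; rewrite normc0.
Qed.

Lemma normcX z n : normc (z ^+ n) = normc z ^+ n.
Proof.
by elim: n => [|n IH]; rewrite ?normc1// !exprS normcM IH.
Qed.

Lemma normcD x y : normc (x + y) <= normc x + normc y.
Proof. exact: le_normcD. Qed.

Lemma normc_sum (I : Type) (r : seq I) (P : pred I) (F : I -> C) :
  normc (\sum_(i <- r | P i) F i) <= \sum_(i <- r | P i) normc (F i).
Proof.
elim/big_ind2 : _ => [|x a y b xa yb|//]; first by rewrite normc0.
by rewrite (le_trans (normcD _ _))// lerD.
Qed.

Lemma Re_sum (I : Type) (r : seq I) (P : pred I) (F : I -> C) :
  Re (\sum_(i <- r | P i) F i) = \sum_(i <- r | P i) Re (F i).
Proof. by elim/big_rec2 : _ => [|i x y _ <-]//; case: (F i); case: y. Qed.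

Lemma Im_sum (I : Type) (r : seq I) (P : pred I) (F : I -> C) :
  Im (\sum_(i <- r | P i) F i) = \sum_(i <- r | P i) Im (F i).
Proof. by elim/big_rec2 : _ => [|i x y _ <-]//; case: (F i); case: y. Qed.

Lemma ReD x y : Re (x + y) = Re x + Re y. Proof. by case: x; case: y. Qed.
Lemma ImD x y : Im (x + y) = Im x + Im y. Proof. by case: x; case: y. Qed.
Lemma ReN x : Re (- x) = - Re x. Proof. by case: x. Qed.
Lemma ImN x : Im (- x) = - Im x. Proof. by case: x. Qed.
Lemma ReJ x : Re x^* = Re x. Proof. by rewrite conjE; case: x. Qed.
Lemma ImJ x : Im x^* = - Im x. Proof. by rewrite conjE; case: x. Qed.
Lemma ReM x y : Re (x * y) = Re x * Re y - Im x * Im y.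
Proof. by case: x; case: y. Qed.
Lemma ImM x y : Im (x * y) = Re x * Im y + Im x * Re y.
Proof. by case: x; case: y. Qed.
Lemma eqC x y : Re x = Re y -> Im x = Im y -> x = y.
Proof. by case: x => a b; case: y => c d /= -> ->. Qed.

Lemma conjcM x y : (x * y)^* = x^* * y^*. Proof. exact: rmorphM. Qed.
Lemma conjcD x y : (x + y)^* = x^* + y^*. Proof. exact: rmorphD. Qed.
Lemma conjcN x : (- x)^* = - x^*. Proof. exact: rmorphN. Qed.
Lemma conjcRe (a : R) : a%:C^* = a%:C. Proof. by rewrite conjE conjc_real. Qed.
Lemma conjcX x n : (x ^+ n)^* = x^* ^+ n. Proof. exact: rmorphXn. Qed.

Lemma conjc_sum (I : Type) (r : seq I) (P : pred I) (F : I -> C) :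
  (\sum_(i <- r | P i) F i)^* = \sum_(i <- r | P i) (F i)^*.
Proof. exact: rmorph_sum. Qed.

Lemma ge0_realc z : 0 <= z -> z = (Re z)%:C.
Proof. by rewrite lecE => /andP[/eqP h _]; apply: eqC => //=. Qed.

Lemma ge0_Re z : 0 <= z -> 0 <= Re z.
Proof. by rewrite lecE => /andP[_]. Qed.

Lemma normcBD x y z : normc (x - z) <= normc (x - y) + normc (y - z).
Proof. by rewrite (le_trans _ (normcD _ _))// addrA subrK. Qed.

(** Factor out [x - y]: each of the [n] products left is at most [b ^+ n.-1]. With [b = 1] a
    one-step error costs only a factor [n] after [n] steps. *)
Lemma normcB_pow x y (b : R) n : normc x <= b -> normc y <= b ->
  normc (x ^+ n - y ^+ n) <= n%:R * normc (x - y) * b ^+ n.-1.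
Proof.
move=> xb yb; rewrite subrXX normcM [n%:R * _]mulrC -mulrA.
apply: ler_wpM2l; first exact: normc_ge0.
apply: le_trans (normc_sum _ _ _) _.
have b0 : 0 <= b := le_trans (normc_ge0 _) xb.
have -> : n%:R * b ^+ n.-1 = \sum_(i < n) b ^+ n.-1.
  by rewrite sumr_const card_ord mulr_natl.
apply: ler_sum => -[i /= ni] _.
rewrite normcM !normcX.
have e : n.-1 = (n.-1 - i + i)%N by rewrite subnK // -ltnS prednK // (leq_trans _ ni).
rewrite [in leRHS]e exprD.
by apply: ler_pM; rewrite ?exprn_ge0 ?normc_ge0 ?lerXn2r ?nnegrE ?normc_ge0.
Qed.

End ComplexNorm.

Section CauchySchwarz.
Context {R : realType}.

Lemma CS_sum (I : Type) (r : seq I) (a b : I -> R) :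
  (\sum_(i <- r) a i * b i) ^+ 2 <=
  (\sum_(i <- r) a i ^+ 2) * (\sum_(i <- r) b i ^+ 2).
Proof.
set A := \sum_(i <- r) a i ^+ 2; set B := \sum_(i <- r) b i ^+ 2.
set M := \sum_(i <- r) a i * b i.
have A0 : 0 <= A by apply: sumr_ge0 => i _; exact: sqr_ge0.
have B0 : 0 <= B by apply: sumr_ge0 => i _; exact: sqr_ge0.
(* This form is evaluated at [(M, A)] and [(B, M)], where it factors through [A * B - M ^+ 2], so no
   square root is taken. If [A] and [B] both vanish, [(1, 1)] and [(1, -1)] give [M = 0]. *)
have key t s : 0 <= t ^+ 2 * A - 2 * t * s * M + s ^+ 2 * B.
  have -> : t ^+ 2 * A - 2 * t * s * M + s ^+ 2 * B =
      \sum_(i <- r) (t * a i - s * b i) ^+ 2.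
    rewrite /A /B /M !mulr_sumr -sumrN -!big_split /=.
    by apply: eq_bigr => i _; ring.
  by apply: sumr_ge0 => i _; exact: sqr_ge0.
have [A1|] := ltP 0 A.
  have := key M A; rewrite (_ : _ + _ = A * (A * B - M ^+ 2)); last by ring.
  by rewrite pmulr_rge0 // subr_ge0.
move=> Ale; have A00 : A = 0 by apply/eqP; rewrite eq_le Ale A0.
have [B1|Ble] := ltP 0 B.
  have := key B M; rewrite (_ : _ + _ = B * (A * B - M ^+ 2)); last by ring.
  by rewrite pmulr_rge0 // subr_ge0.
have B00 : B = 0 by apply/eqP; rewrite eq_le Ble B0.
have := key 1 1; have := key 1 (-1); rewrite A00 B00 => h1 h2.
have -> : M = 0 by lra.
by rewrite expr0n mulr0.
Qed.

Lemma CS_normc (I : Type) (r : seq I) (a b : I -> R[i]) :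
  normc (\sum_(i <- r) a i * b i) ^+ 2 <=
  (\sum_(i <- r) normc (a i) ^+ 2) * (\sum_(i <- r) normc (b i) ^+ 2).
Proof.
apply: le_trans (CS_sum _ _ _); rewrite lerXn2r ?nnegrE ?normc_ge0 //.
  by apply: sumr_ge0 => i _; rewrite mulr_ge0 ?normc_ge0.
apply: le_trans (normc_sum _ _ _) _.
by under eq_bigr => i _ do rewrite normcM.
Qed.

End CauchySchwarz.

Section MatrixNorm.
Context {R : realType}.
Local Notation C := R[i].

(** An entrywise norm: submultiplicative for rectangular products and invariant under the adjoint.
    The identity has norm its size, not 1, whence the factors [n1 1%:M] in the bounds on
    inverses. *)
Definition n1 m n (A : 'M[C]_(m, n)) : R := \sum_i \sum_j normc (A i j).

Lemma n1_ge0 m n (A : 'M[C]_(m, n)) : 0 <= n1 A.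
Proof. by do 2 (apply: sumr_ge0 => ? _); exact: normc_ge0. Qed.

Lemma n1_entry m n (A : 'M[C]_(m, n)) i j : normc (A i j) <= n1 A.
Proof.
rewrite /n1 (bigD1 i) //= (bigD1 j) //= -addrA lerDl addr_ge0 //.
  by apply: sumr_ge0 => ? _; exact: normc_ge0.
by do 2 (apply: sumr_ge0 => ? _); exact: normc_ge0.
Qed.

Lemma n10 m n : n1 (0 : 'M[C]_(m, n)) = 0.
Proof. by apply: big1 => i _; apply: big1 => j _; rewrite mxE normc0. Qed.

Lemma n1_eq0 m n (A : 'M[C]_(m, n)) : n1 A <= 0 -> A = 0.
Proof.
move=> h; apply/matrixP => i j; rewrite mxE; apply: eq0_normc.
by apply/eqP; rewrite eq_le normc_ge0 (le_trans (n1_entry _ _ _) h).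
Qed.

Lemma n1D m n (A B : 'M[C]_(m, n)) : n1 (A + B) <= n1 A + n1 B.
Proof.
rewrite /n1 -big_split; apply: ler_sum => i _ /=.
by rewrite -big_split; apply: ler_sum => j _ /=; rewrite mxE normcD.
Qed.

Lemma n1Z m n (a : C) (A : 'M[C]_(m, n)) : n1 (a *: A) = normc a * n1 A.
Proof.
rewrite /n1 mulr_sumr; apply: eq_bigr => i _; rewrite mulr_sumr.
by apply: eq_bigr => j _; rewrite mxE normcM.
Qed.

Lemma n1N m n (A : 'M[C]_(m, n)) : n1 (- A) = n1 A.
Proof. by rewrite -scaleN1r n1Z normcN normc1 mul1r. Qed.

Lemma n1B m n (A B : 'M[C]_(m, n)) : n1 (A - B) <= n1 A + n1 B.
Proof. by rewrite -[n1 B]n1N n1D. Qed.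

Lemma n1M m n p (A : 'M[C]_(m, n)) (B : 'M[C]_(n, p)) :
  n1 (A *m B) <= n1 A * n1 B.
Proof.
rewrite /n1 mulr_suml; apply: ler_sum => i _.
apply: (@le_trans _ _ (\sum_k \sum_j normc (A i j) * normc (B j k))).
  apply: ler_sum => k _; rewrite mxE (le_trans (normc_sum _ _ _))//.
  by apply: ler_sum => j _; rewrite normcM.
rewrite exchange_big /= mulr_suml; apply: ler_sum => j _.
rewrite -mulr_sumr; apply: ler_wpM2l; first exact: normc_ge0.
rewrite [leRHS](bigD1 j) //= lerDl.
by do 2 (apply: sumr_ge0 => ? _); exact: normc_ge0.
Qed.

Lemma n1_conjt m n (A : 'M[C]_(m, n)) : n1 (A^t*) = n1 A.
Proof.
rewrite /n1 exchange_big; apply: eq_bigr => i _; apply: eq_bigr => j _.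
by rewrite !mxE normcJ.
Qed.

Lemma n1_sum m n (I : Type) (r : seq I) (P : pred I) (F : I -> 'M[C]_(m, n)) :
  n1 (\sum_(i <- r | P i) F i) <= \sum_(i <- r | P i) n1 (F i).
Proof.
elim/big_ind2 : _ => [|x a y b xa yb|//]; first by rewrite n10.
by rewrite (le_trans (n1D _ _))// lerD.
Qed.

Lemma n1_trace n (A : 'M[C]_n) : normc (\tr A) <= n1 A.
Proof.
apply: le_trans (normc_sum _ _ _) _; apply: ler_sum => i _.
by rewrite [leRHS](bigD1 i) //= lerDl; apply: sumr_ge0 => ? _; exact: normc_ge0.
Qed.

Lemma trmxCM m n p (A : 'M[C]_(m, n)) (B : 'M[C]_(n, p)) :
  (A *m B)^t* = B^t* *m A^t*.
Proof. by rewrite trmx_mul map_mxM. Qed.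

Lemma trmxCD m n (A B : 'M[C]_(m, n)) : (A + B)^t* = A^t* + B^t*.
Proof. by rewrite linearD map_mxD. Qed.

Lemma trmxCN m n (A : 'M[C]_(m, n)) : (- A)^t* = - A^t*.
Proof. by rewrite linearN map_mxN. Qed.

Lemma trmxCB m n (A B : 'M[C]_(m, n)) : (A - B)^t* = A^t* - B^t*.
Proof. by rewrite trmxCD trmxCN. Qed.

Lemma trmxCZ m n (a : C) (A : 'M[C]_(m, n)) : (a *: A)^t* = a^* *: A^t*.
Proof. by rewrite linearZ /= map_mxZ. Qed.

Lemma trmxC1 n : (1%:M : 'M[C]_n)^t* = 1%:M.
Proof. by rewrite trmx1 map_mx1. Qed.

Lemma trmxC_sum m n (I : Type) (r : seq I) (P : pred I) (F : I -> 'M[C]_(m, n)) :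
  (\sum_(i <- r | P i) F i)^t* = \sum_(i <- r | P i) (F i)^t*.
Proof.
elim/big_rec2 : _ => [|i x y _ <-]; first by rewrite trmx0 map_mx0.
exact: trmxCD.
Qed.

Lemma trmxC_trace n (A : 'M[C]_n) : \tr (A^t*) = (\tr A)^*.
Proof. by rewrite trace_map_mx mxtrace_tr. Qed.

End MatrixNorm.

(** * Unconditional sums over arbitrary index types *)

Section InfiniteSums.
Context {R : realType}.
Local Notation C := R[i].
Local Notation Re := complex.Re.
Local Notation Im := complex.Im.
Local Open Scope fset_scope.
Local Open Scope ring_scope.
Local Existing Instance totally_filter.

Lemma cvg_totallyP (I : choiceType) (f : I -> R) (s : R) :
  (partial_sum f @ totally --> s) <->
  forall e : R, 0 < e -> exists F0 : {fset I}, forall F : {fset I},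
    F0 `<=` F -> `|\sum_(i <- F) f i - s| < e.
Proof.
split=> [/cvgrPdist_lt h e e0|h].
  have [F0 _ hF] := h e e0; exists F0 => F /hF /=.
  by rewrite /partial_sum distrC big_seq_fsetE.
apply/cvgrPdist_lt => e e0; have [F0 hF] := h e e0; exists F0 => // F /= /hF.
by rewrite /partial_sum distrC big_seq_fsetE.
Qed.

Lemma has_sumP (I : choiceType) (f : I -> C) (s : C) :
  has_sum f s <->
  forall e : R, 0 < e -> exists F0 : {fset I}, forall F : {fset I},
    F0 `<=` F -> normc (\sum_(i <- F) f i - s) < e.
Proof.
split=> [[/cvg_totallyP h1 /cvg_totallyP h2] e e0|h].
  have e20 : 0 < e / 2 by rewrite divr_gt0.
  have [F1 H1] := h1 _ e20; have [F2 H2] := h2 _ e20.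
  exists (F1 `|` F2) => F; rewrite fsubUset => /andP[/H1 K1 /H2 K2].
  apply: le_lt_trans (normc_leD _) _.
  by rewrite ReD ImD ReN ImN Re_sum Im_sum [e]splitr ltrD.
split; apply/cvg_totallyP => e e0; have [F0 H] := h e e0; exists F0 => F /H;
  apply: le_lt_trans.
  by rewrite -Re_sum -ReN -ReD normc_Re.
by rewrite -Im_sum -ImN -ImD normc_Im.
Qed.

Lemma has_sum_ext (I : choiceType) (f g : I -> C) (s : C) :
  f =1 g -> has_sum f s -> has_sum g s.
Proof. by move=> /funext ->. Qed.

Lemma has_sum_unique (I : choiceType) (f : I -> C) (s t : C) :
  has_sum f s -> has_sum f t -> s = t.
Proof.
move=> [h1 h2] [h3 h4]; apply: eqC.
  exact: (cvg_unique _ h1 h3).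
exact: (cvg_unique _ h2 h4).
Qed.

Lemma has_sum_lin (I : choiceType) (f g : I -> C) (a s t : C) :
  has_sum f s -> has_sum g t -> has_sum (fun i => a * f i + g i) (a * s + t).
Proof.
move=> /has_sumP h1 /has_sumP h2; apply/has_sumP => e e0.
have d0 : 0 < e / 2 / (1 + normc a).
  by rewrite !divr_gt0 // ltr_pwDl ?normc_ge0.
have [F1 H1] := h1 _ d0; have [F2 H2] := h2 _ (divr_gt0 e0 (ltr0n _ 2)).
exists (F1 `|` F2) => F; rewrite fsubUset => /andP[/H1 K1 /H2 K2].
rewrite big_split /= -mulr_sumr opprD addrACA -mulrBr.
apply: le_lt_trans (normcD _ _) _; rewrite [e]splitr; apply: ler_ltD => //.
rewrite normcM; move: K1; rewrite ltr_pdivlMr ?ltr_pwDl ?normc_ge0 //.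
move/ltW; apply: le_trans; rewrite mulrC; apply: ler_wpM2l.
  exact: normc_ge0.
by rewrite lerDr.
Qed.

Lemma has_sum0 (I : choiceType) : has_sum (fun _ : I => 0 : C) 0.
Proof.
by apply/has_sumP => e e0; exists fset0 => F _; rewrite big1 // subrr normc0.
Qed.

Lemma has_sumD (I : choiceType) (f g : I -> C) (s t : C) :
  has_sum f s -> has_sum g t -> has_sum (fun i => f i + g i) (s + t).
Proof.
move=> h1 h2; have := has_sum_lin 1 h1 h2; rewrite mul1r.
by apply: has_sum_ext => i; rewrite mul1r.
Qed.

Lemma has_sumZ (I : choiceType) (f : I -> C) (a s : C) :
  has_sum f s -> has_sum (fun i => a * f i) (a * s).
Proof.
move=> h1; have := has_sum_lin a h1 (has_sum0 I); rewrite addr0.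
by apply: has_sum_ext => i; rewrite addr0.
Qed.

Lemma has_sum_sum (I : choiceType) (J : Type) (r : seq J) (f : J -> I -> C)
    (s : J -> C) : (forall j, has_sum (f j) (s j)) ->
  has_sum (fun i => \sum_(j <- r) f j i) (\sum_(j <- r) s j).
Proof.
move=> h; elim: r => [|j r IH].
  by rewrite big_nil; apply: has_sum_ext (has_sum0 I) => i; rewrite big_nil.
rewrite big_cons; apply: has_sum_ext (has_sumD (h j) IH) => i.
by rewrite big_cons.
Qed.

Lemma has_sum_conj (I : choiceType) (f : I -> C) (s : C) :
  has_sum f s -> has_sum (fun i => (f i)^*) s^*.
Proof.
move=> /has_sumP h; apply/has_sumP => e /h[F0 H]; exists F0 => F /H.
by rewrite -conjc_sum -rmorphB normcJ.
Qed.

Lemma has_sum_fin (I : choiceType) (f : I -> C) (F : {fset I}) :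
  (forall i, i \notin F -> f i = 0) -> has_sum f (\sum_(i <- F) f i).
Proof.
move=> h; apply/has_sumP => e e0; exists F => F' FF'.
rewrite [X in X - _](big_fsetID _ (mem F)) /= [X in _ + X - _]big1_fset ?addr0.
  rewrite [X in normc (X - _)](_ : _ = \sum_(i <- F) f i) ?subrr ?normc0 //.
  apply: eq_fbigl => i; rewrite !inE /=.
  by apply/andP/idP => [[]//|iF]; split => //; apply: (fsubsetP FF').
by move=> i; rewrite !inE => /andP[_ /h].
Qed.

Lemma has_sum_finType (T : finType) (f : T -> C) :
  has_sum f (\sum_(i : T) f i).
Proof.
have := @has_sum_fin T f [fset x | x in T].
rewrite (_ : \sum_(i <- [fset x | x in T]) f i = \sum_i f i).
  by apply => i; rewrite !inE.
rewrite -[RHS]big_enum /=; apply: perm_big.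
rewrite uniq_perm ?enum_uniq ?fset_uniq // => i.
by rewrite mem_enum !inE.
Qed.

Lemma sum_fsub_le (I : choiceType) (f : I -> R) (F F' : {fset I}) :
  (forall i, 0 <= f i) -> F `<=` F' ->
  \sum_(i <- F) f i <= \sum_(i <- F') f i.
Proof.
move=> f0 FF'; rewrite [leRHS](big_fsetID _ (mem F)) /=.
rewrite [X in _ <= X + _](_ : _ = \sum_(i <- F) f i); last first.
  apply: eq_fbigl => i; rewrite !inE /=.
  by apply/andP/idP => [[]//|iF]; split => //; apply: (fsubsetP FF').
by rewrite lerDl sumr_ge0.
Qed.

Lemma rsum_bounded_ge0 (I : choiceType) (f : I -> R) (B : R) :
  (forall i, 0 <= f i) -> (forall F : {fset I}, \sum_(i <- F) f i <= B) ->
  exists s : R, partial_sum f @ totally --> s.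
Proof.
move=> f0 fB.
pose E := [set \sum_(i <- F) f i | F in [set: {fset I}]].
have hE : has_sup E.
  split; first by exists (\sum_(i <- fset0) f i); exists fset0.
  by exists B => _ [F _ <-].
exists (sup E); apply/cvg_totallyP => e e0.
have [_ [F0 _ <-] hF0] := sup_adherent e0 hE.
exists F0 => F FF0; rewrite ltr_norml; apply/andP; split.
  rewrite ltrBrDl; apply: lt_le_trans hF0 _; exact: sum_fsub_le.
apply: le_lt_trans e0; rewrite subr_le0; apply: ub_le_sup; last by exists F.
exact: hE.2.
Qed.

(** The positive part [(|f| + f) / 2] and the negative part [(|f| - f) / 2] are bounded increasing
    nets, summed separately. *)
Lemma rsum_bounded (I : choiceType) (f : I -> R) (B : R) :
  (forall F : {fset I}, \sum_(i <- F) `|f i| <= B) ->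
  exists s : R, partial_sum f @ totally --> s.
Proof.
move=> fB.
have [||s1 /cvg_totallyP h1] := @rsum_bounded_ge0 I (fun i => (`|f i| + f i) / 2) B.
- by move=> i; rewrite divr_ge0 // -lerBlDr sub0r -normrN ler_norm.
- move=> F; apply: le_trans (fB F); apply: ler_sum => i _.
  by rewrite ler_pdivrMr // mulr_natr mulr2n lerD2l ler_norm.
have [||s2 /cvg_totallyP h2] := @rsum_bounded_ge0 I (fun i => (`|f i| - f i) / 2) B.
- by move=> i; rewrite divr_ge0 // subr_ge0 ler_norm.
- move=> F; apply: le_trans (fB F); apply: ler_sum => i _.
  by rewrite ler_pdivrMr // mulr_natr mulr2n lerD2l -normrN ler_norm.
exists (s1 - s2); apply/cvg_totallyP => e e0.
have e20 : 0 < e / 2 by rewrite divr_gt0.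
have [F1 H1] := h1 _ e20; have [F2 H2] := h2 _ e20.
exists (F1 `|` F2) => F; rewrite fsubUset => /andP[/H1 K1 /H2 K2].
have -> : \sum_(i <- F) f i - (s1 - s2) =
  (\sum_(i <- F) (`|f i| + f i) / 2 - s1) - (\sum_(i <- F) (`|f i| - f i) / 2 - s2).
  rewrite (_ : \sum_(i <- F) f i = \sum_(i <- F) (`|f i| + f i) / 2 -
     \sum_(i <- F) (`|f i| - f i) / 2); first by ring.
  by rewrite -sumrB; apply: eq_bigr => i _; lra.
by apply: le_lt_trans (ler_normB _ _) _; rewrite [e]splitr ltrD.
Qed.

Lemma has_sum_bounded (I : choiceType) (f : I -> C) (B : R) :
  (forall F : {fset I}, \sum_(i <- F) normc (f i) <= B) ->
  exists s, has_sum f s.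
Proof.
move=> fB.
have [|s1 h1] := @rsum_bounded I (fun i => Re (f i)) B.
  by move=> F; apply: le_trans (fB F); apply: ler_sum => i _; exact: normc_Re.
have [|s2 h2] := @rsum_bounded I (fun i => Im (f i)) B.
  by move=> F; apply: le_trans (fB F); apply: ler_sum => i _; exact: normc_Im.
by exists (s1 +i* s2).
Qed.

(** The bound is asked only above [F0], because the limit sees only a tail of the directed set. In
    [trace_class_diag] this lets [J] contain the support of the vectors involved. *)
Lemma has_sum_Re_le (I : choiceType) (f : I -> C) (s : C) (B : R) (F0 : {fset I}) :
  has_sum f s ->
  (forall F : {fset I}, F0 `<=` F -> Re (\sum_(i <- F) f i) <= B) ->
  Re s <= B.
Proof.
move=> /has_sumP h fB; apply/ler_addgt0Pr => e e0.
have [F1 H1] := h e e0.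
have /H1 H : F1 `<=` F0 `|` F1 by rewrite fsubsetUr.
have /fB K : F0 `<=` F0 `|` F1 by rewrite fsubsetUl.
have := le_lt_trans (normc_Re _) H; rewrite ReD ReN ltr_norml => /andP[a b].
by move: K a b; set x := Re (\sum_(i <- _) _); lra.
Qed.

Lemma has_sum_ge0 (I : choiceType) (f : I -> C) (s : C) :
  (forall i, 0 <= f i) -> has_sum f s ->
  s = (Re s)%:C /\ forall F : {fset I}, Re (\sum_(i <- F) f i) <= Re s.
Proof.
move=> f0 h; split.
  have h' : has_sum f s^*.
    by apply: has_sum_ext (has_sum_conj h) => i; apply: eqC; rewrite ?ReJ // ImJ (ger0_Im (f0 i)) oppr0.
  have := has_sum_unique h h'; case: (s) => a b /= [bb].
  by apply: eqC => //=; lra.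
move=> F; have h' := has_sumZ (-1) h.
have := @has_sum_Re_le _ _ _ (- Re (\sum_(i <- F) f i)) F h'.
rewrite mulN1r ReN lerN2; apply => F' FF'.
rewrite -mulr_sumr mulN1r ReN lerN2 !Re_sum; apply: sum_fsub_le => // i.
exact: ge0_Re.
Qed.

End InfiniteSums.

(** * Trace norms of finite rank operators *)

Section Spectral.
Context {R : realType}.
Local Notation C := R[i].
Local Notation Re := complex.Re.

Lemma herm_spectral N (A : 'M[C]_N) : A^t* = A ->
  exists (f : 'I_N -> 'I_N -> C) (d : 'I_N -> R),
  [/\ forall k l, \sum_i (f k i)^* * f l i = (k == l)%:R,
      forall i j, \sum_k f k i * (f k j)^* = (i == j)%:R &
      forall i j, A i j = \sum_k (d k)%:C * (f k i * (f k j)^*)].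
Proof.
move=> hA.
have hh : A \is hermsymmx.
  by apply/is_hermitianmxP; rewrite expr0 scale1r.
have /orthomx_spectralP hs := hermitian_normalmx hh.
have hd := hermitian_spectral_diag_real hh.
move: hs hd; set U := spectralmx A; set D := spectral_diag A => hs hd.
have Uu : U \is unitarymx by exact: spectral_unitarymx.
have UU : U *m U^t* = 1%:M by exact/unitarymxP.
have UU' : U^t* *m U = 1%:M by apply: mulmx1C.
(* The rows of [U] are conjugated so that [f k] is an eigenvector of [A] with eigenvalue [d k]. *)
exists (fun k i => (U k i)^*), (fun k => Re (D 0 k)); split.
- move=> k l; have /matrixP/(_ k l) := UU; rewrite !mxE => <-.
  by apply: eq_bigr => i _; rewrite !mxE ?conjCK.
- move=> i j; have /matrixP/(_ i j) := UU'; rewrite !mxE => <-.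
  by apply: eq_bigr => k _; rewrite !mxE ?conjCK.
- move=> i j; rewrite [in LHS]hs invmx_unitary // -mulmxA mxE.
  apply: eq_bigr => k _; rewrite mul_diag_mx !mxE conjCK.
  have -> : (Re (D 0 k))%:C = D 0 k.
    by apply: RRe_real; move/mxOverP : hd; apply.
  ring.
Qed.

End Spectral.

Section FiniteRank.
Context {R : realType}.
Local Notation C := R[i].
Local Notation Re := complex.Re.
Variables (I : choiceType) (N : nat) (u : 'I_N -> I -> C) (p : pred 'I_N).

Hypothesis gram : forall a b,
  has_sum (fun l => (u a l)^* * u b l) ((a == b) && p a)%:R.

(** The operator with matrix [M] in the system [u], which is orthonormal on [p] and zero off [p].
    Normalizing a vector may give zero (the tail of [chi] in [trace_norm_pure]), and [p] records
    this without a case split. *)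
Definition sandwich (M : 'M[C]_N) (i j : I) : C :=
  \sum_a \sum_b M a b * (u a i * (u b j)^*).

Lemma conj_sandwich M i j : (sandwich M i j)^* = sandwich (M^t*) j i.
Proof.
rewrite /sandwich conjc_sum; under eq_bigr => a _ do rewrite conjc_sum.
rewrite exchange_big /=; apply: eq_bigr => a _.
apply: eq_bigr => b _.
by rewrite !conjcM conjCK !mxE; congr (_ * _); rewrite mulrC.
Qed.

Lemma has_sum_sandwich (M K : 'M[C]_N) i j : (forall a b, ~~ p b -> M a b = 0) ->
  has_sum (fun l => sandwich M i l * sandwich K l j) (sandwich (M *m K) i j).
Proof.
move=> Mp.
have -> : sandwich (M *m K) i j =
  \sum_a \sum_b \sum_c \sum_e (M a b * u a i) * (K c e * (u e j)^*) *
     ((b == c) && p b)%:R.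
  apply: eq_bigr => a _; rewrite [RHS]exchange_big.
  under [RHS]eq_bigr => c _ do rewrite exchange_big.
  rewrite exchange_big; apply: eq_bigr => e _; rewrite mxE mulr_suml /=.
  apply: eq_bigr => c _; rewrite (bigD1 c) //= eqxx /= big1 ?addr0; last first.
    by move=> b /negPf ->; rewrite mulr0.
  have [_|/Mp ->] := boolP (p c); last by rewrite !mul0r.
  by rewrite mulr1; ring.
have -> : (fun l => sandwich M i l * sandwich K l j) =
  (fun l => \sum_a \sum_b \sum_c \sum_e (M a b * u a i) * (K c e * (u e j)^*) *
     ((u b l)^* * u c l)).
  apply: funext => l; rewrite /sandwich mulr_suml; apply: eq_bigr => a _.
  rewrite mulr_suml; apply: eq_bigr => b _; rewrite mulr_sumr.
  apply: eq_bigr => c _; rewrite mulr_sumr; apply: eq_bigr => e _.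
  ring.
do 4 (apply: has_sum_sum => ?); exact: has_sumZ.
Qed.

Lemma has_sum_sandwich_diag (M : 'M[C]_N) : (forall a b, ~~ p b -> M a b = 0) ->
  has_sum (fun l => sandwich M l l) (\tr M).
Proof.
move=> Mp.
have -> : \tr M = \sum_a \sum_b M a b * ((b == a) && p b)%:R.
  apply: eq_bigr => a _; rewrite (bigD1 a) //= eqxx /= big1 ?addr0; last first.
    by move=> b /negPf ->; rewrite mulr0.
  by have [_|/Mp ->] := boolP (p a); rewrite ?mulr1 // mul0r.
do 2 (apply: has_sum_sum => ?); apply: has_sumZ.
by apply: has_sum_ext (gram _ _) => l; rewrite mulrC.
Qed.

Lemma psd_sandwich (Q P : 'M[C]_N) : P = Q^t* *m Q -> psd (sandwich P).
Proof.
move=> -> F v.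
suff -> : \sum_(i <- F) \sum_(j <- F) (v i)^* * sandwich (Q^t* *m Q) i j * v j =
   \sum_c (\sum_(j <- F) \sum_b Q c b * (u b j)^* * v j)^* *
          (\sum_(j <- F) \sum_b Q c b * (u b j)^* * v j).
  by apply: sumr_ge0 => c _; rewrite mulrC mul_conjC_ge0.
transitivity (\sum_(i <- F) \sum_(j <- F) \sum_c
   (\sum_b Q c b * (u b i)^* * v i)^* * (\sum_b Q c b * (u b j)^* * v j)).
  apply: eq_bigr => i _; apply: eq_bigr => j _.
  rewrite /sandwich mulr_sumr mulr_suml.
  under eq_bigr => a _ do rewrite mulr_sumr mulr_suml.
  transitivity (\sum_a \sum_b \sum_c (Q c a * (u a i)^* * v i)^* * (Q c b * (u b j)^* * v j)).
    apply: eq_bigr => a _; apply: eq_bigr => b _.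
    rewrite mxE mulr_suml mulr_sumr mulr_suml; apply: eq_bigr => c _.
    by rewrite !mxE !conjcM conjCK; ring.
  under eq_bigr => a _ do rewrite exchange_big.
  rewrite exchange_big; apply: eq_bigr => c _ /=.
  rewrite conjc_sum mulr_suml; apply: eq_bigr => a _.
  by rewrite mulr_sumr.
under eq_bigr => i _ do rewrite exchange_big.
rewrite exchange_big; apply: eq_bigr => c _ /=.
rewrite conjc_sum mulr_suml; apply: eq_bigr => i _.
by rewrite mulr_sumr.
Qed.

(** Lifts a finite-dimensional absolute value to the index type. Since [u] vanishes off [p], kernel
    products match matrix products only for matrices that vanish there as well, which the first two
    hypotheses ensure. *)
Lemma has_trace_norm_sandwich (M P Q : 'M[C]_N) (t : R) :
  (forall a b, ~~ p a -> M a b = 0) -> (forall a b, ~~ p b -> P a b = 0) ->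
  P = Q^t* *m Q -> P *m P = M^t* *m M -> \tr P = t%:C ->
  has_trace_norm (sandwich M) t.
Proof.
move=> Mp Pp PQ PP trP; exists (sandwich P); last first.
  by rewrite -trP; exact: has_sum_sandwich_diag.
split; first exact: psd_sandwich PQ.
move=> i j; exists (sandwich (M^t* *m M) i j); split.
  apply: has_sum_ext (@has_sum_sandwich (M^t*) M i j _) => [l|a b].
    by rewrite conj_sandwich.
  by move=> /Mp h; rewrite !mxE h rmorph0.
by rewrite -PP; exact: has_sum_sandwich.
Qed.

Lemma ex_has_trace_norm_sandwich (M : 'M[C]_N) : (forall a, p a) ->
  exists t, has_trace_norm (sandwich M) t.
Proof.
move=> pT.
have [|f [d [fo fc fE]]] := @herm_spectral R N (M^t* *m M).
  by rewrite trmxCM trmxCK.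
have d0 k : 0 <= d k.
  have : (d k)%:C = \sum_c (\sum_b M c b * f k b)^* * (\sum_b M c b * f k b).
    transitivity (\sum_a \sum_b (f k a)^* * (M^t* *m M) a b * f k b).
      transitivity (\sum_l (d l)%:C * ((\sum_a (f k a)^* * f l a) * (\sum_b (f l b)^* * f k b))).
        rewrite (bigD1 k) //= !fo eqxx !mulr1 big1 ?addr0 // => l lk.
        by rewrite !fo (negPf lk) !mulr0.
      under [RHS]eq_bigr => a _ do under eq_bigr => b _ do rewrite fE mulr_sumr mulr_suml.
      under [RHS]eq_bigr => a _ do rewrite exchange_big.
      rewrite [RHS]exchange_big; apply: eq_bigr => l _ /=.
      rewrite mulr_suml mulr_sumr; apply: eq_bigr => a _.
      by rewrite !mulr_sumr; apply: eq_bigr => b _; ring.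
    under eq_bigr => a _ do under eq_bigr => b _ do rewrite mxE mulr_sumr mulr_suml.
    under eq_bigr => a _ do rewrite exchange_big.
    rewrite exchange_big; apply: eq_bigr => l _ /=.
    rewrite conjc_sum mulr_suml; apply: eq_bigr => a _.
    by rewrite mulr_sumr; apply: eq_bigr => b _; rewrite !mxE conjcM; ring.
  move=> h; have : 0 <= (d k)%:C by rewrite h; apply: sumr_ge0 => c _; rewrite mulrC mul_conjC_ge0.
  by rewrite lecR.
(* [s] are the singular values of [M]; their square roots [r] present the absolute value [P] as the
   adjoint square of [Q], the form in which [psd_sandwich] takes positivity. *)
pose s k := Num.sqrt (d k); pose r k := Num.sqrt (s k).
have rr k : (r k)%:C * (r k)%:C = (s k)%:C.
  by rewrite -rmorphM -expr2 sqr_sqrtr ?sqrtr_ge0.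
have ss k : (s k)%:C * (s k)%:C = (d k)%:C by rewrite -rmorphM -expr2 sqr_sqrtr.
pose P := \matrix_(a, b) \sum_k (s k)%:C * (f k a * (f k b)^*).
pose Q := \matrix_(k, b) ((r k)%:C * (f k b)^*).
exists (\sum_k s k); apply: (@has_trace_norm_sandwich M P Q).
- by move=> a b; rewrite pT.
- by move=> a b; rewrite pT.
- apply/matrixP => a b; rewrite !mxE; apply: eq_bigr => k _.
  by rewrite !mxE conjcM conjCK conjcRe -rr; ring.
- apply/matrixP => a b; rewrite fE mxE.
  transitivity (\sum_k \sum_l (s k)%:C * (s l)%:C * (f k a * (f l b)^*) *
      \sum_c (f k c)^* * f l c).
    rewrite exchange_big /=.
    under eq_bigr => c _ do rewrite !mxE mulr_suml.
    rewrite exchange_big [RHS]exchange_big /=; apply: eq_bigr => k _.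
    under eq_bigr => c _ do rewrite mulr_sumr.
    rewrite exchange_big; apply: eq_bigr => l _ /=.
    by rewrite mulr_sumr; apply: eq_bigr => c _; ring.
  apply: eq_bigr => k _; rewrite (bigD1 k) //= fo eqxx mulr1 ss big1 ?addr0 //.
  by move=> l lk; rewrite fo eq_sym (negPf lk) mulr0.
- rewrite rmorph_sum /= /mxtrace.
  under [LHS]eq_bigr => a _ do rewrite mxE.
  rewrite exchange_big; apply: eq_bigr => k _ /=.
  rewrite -mulr_sumr; under eq_bigr => a _ do rewrite mulrC.
  by rewrite fo eqxx mulr1.
Qed.

(** The eigenvalue [d k] is the sum over [j] of [c j] times the squared overlap of [f k] with [a j].
    Taking absolute values and summing over [k], Parseval returns the squared norm of each [a j]. *)
Lemma has_trace_norm_sum (n : nat) (c : 'I_n -> R) (a : 'I_n -> 'I_N -> C) :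
  (forall j x, ~~ p x -> a j x = 0) ->
  exists2 t, t <= \sum_j `|c j| * \sum_x normc (a j x) ^+ 2 &
    has_trace_norm (sandwich (\matrix_(x, y) \sum_j (c j)%:C * (a j x * (a j y)^*))) t.
Proof.
move=> ap; set M := \matrix_(_, _) _.
have hM : M^t* = M.
  apply/matrixP => x y; rewrite !mxE conjc_sum; apply: eq_bigr => j _.
  by rewrite !conjcM conjCK conjcRe; congr (_ * _); rewrite mulrC.
have Mp x y : ~~ p x -> M x y = 0.
  by move=> px; rewrite mxE big1 // => j _; rewrite ap // mul0r mulr0.
have [f [d [fo fc fE]]] := herm_spectral hM.
have fd k x : (d k)%:C * f k x = \sum_y M x y * f k y.
  transitivity (\sum_l (d l)%:C * f l x * \sum_y (f l y)^* * f k y).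
    rewrite (bigD1 k) //= fo eqxx mulr1 big1 ?addr0 // => l lk.
    by rewrite fo (negPf lk) mulr0.
  under [RHS]eq_bigr => y _ do rewrite fE mulr_suml.
  rewrite exchange_big; apply: eq_bigr => l _ /=; rewrite mulr_sumr.
  by apply: eq_bigr => y _; ring.
(* Eigenvectors with a nonzero eigenvalue vanish off [p]; the others may not, but they enter with
   weight 0. *)
have fp k x : ~~ p x -> (`|d k|)%:C * f k x = 0.
  move=> px; have : (d k)%:C * f k x = 0.
    by rewrite fd big1 // => y _; rewrite Mp // mul0r.
  move/eqP; rewrite mulf_eq0 => /orP[|/eqP ->]; last by rewrite mulr0.
  by move=> /eqP[->]; rewrite normr0 mul0r.
pose r k := Num.sqrt `|d k|.
have rr k : (r k)%:C * (r k)%:C = (`|d k|)%:C.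
  by rewrite -rmorphM -expr2 sqr_sqrtr.
pose P := \matrix_(x, y) \sum_k (`|d k|)%:C * (f k x * (f k y)^*).
pose Q := \matrix_(k, y) ((r k)%:C * (f k y)^*).
exists (\sum_k `|d k|).
  pose q k j := \sum_x (f k x)^* * a j x.
  have dE k : (d k)%:C = \sum_j (c j)%:C * (q k j * (q k j)^*).
    transitivity (\sum_x (f k x)^* * ((d k)%:C * f k x)).
      under eq_bigr => x _ do rewrite mulrCA.
      by rewrite -mulr_sumr fo eqxx mulr1.
    under eq_bigr => x _ do rewrite fd mulr_sumr.
    under eq_bigr => x _ do under eq_bigr => y _ do rewrite mxE mulr_suml mulr_sumr.
    under eq_bigr => x _ do rewrite exchange_big.
    rewrite exchange_big; apply: eq_bigr => j _ /=.
    rewrite /q conjc_sum mulr_suml mulr_sumr; apply: eq_bigr => x _.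
    rewrite !mulr_sumr; apply: eq_bigr => y _; rewrite conjcM conjCK; ring.
  have dle k : `|d k| <= \sum_j `|c j| * normc (q k j) ^+ 2.
    rewrite -normcR dE; apply: le_trans (normc_sum _ _ _) _.
    by apply: ler_sum => j _; rewrite !normcM normcR normcJ.
  apply: le_trans (ler_sum _ (fun k _ => dle k)) _.
  rewrite exchange_big; apply: ler_sum => j _ /=; rewrite -mulr_sumr.
  apply: ler_wpM2l => //; rewrite le_eqVlt; apply/orP; left; apply/eqP.
  apply: (@complexI R); rewrite !rmorph_sum /=.
  under eq_bigr => k _ do rewrite -mulJc.
  under [RHS]eq_bigr => k _ do rewrite -mulJc.
  transitivity (\sum_x \sum_y (a j x)^* * a j y * \sum_k f k x * (f k y)^*).
    under [RHS]eq_bigr => x _ do under eq_bigr => y _ do rewrite mulr_sumr.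
    under [RHS]eq_bigr => x _ do rewrite exchange_big.
    rewrite [RHS]exchange_big; apply: eq_bigr => k _ /=.
    rewrite /q conjc_sum mulr_suml; apply: eq_bigr => x _.
    by rewrite mulr_sumr; apply: eq_bigr => y _; rewrite conjcM conjCK; ring.
  apply: eq_bigr => x _; rewrite (bigD1 x) //= fc eqxx mulr1 big1 ?addr0 //.
  by move=> y yx; rewrite fc eq_sym (negPf yx) mulr0.
apply: (@has_trace_norm_sandwich M P Q).
- by [].
- by move=> x y py; rewrite mxE big1 // => k _; rewrite mulrCA -(conjcRe `|d k|) -conjcM fp // rmorph0 mulr0.
- apply/matrixP => x y; rewrite !mxE; apply: eq_bigr => k _.
  by rewrite !mxE conjcM conjCK conjcRe -rr; ring.
- rewrite hM.
  have sq (e : 'I_N -> R) (L : 'M[C]_N) :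
      (forall x y, L x y = \sum_k (e k)%:C * (f k x * (f k y)^*)) ->
      forall x y, (L *m L) x y = \sum_k (e k ^+ 2)%:C * (f k x * (f k y)^*).
    move=> LE x y; rewrite mxE.
    transitivity (\sum_k \sum_l (e k)%:C * (e l)%:C * (f k x * (f l y)^*) *
        \sum_z (f k z)^* * f l z).
      under eq_bigr => z _ do rewrite !LE mulr_suml.
      rewrite exchange_big /=; apply: eq_bigr => k _.
      under eq_bigr => z _ do rewrite mulr_sumr.
      rewrite exchange_big; apply: eq_bigr => l _ /=.
      by rewrite mulr_sumr; apply: eq_bigr => z _; ring.
    apply: eq_bigr => k _; rewrite (bigD1 k) //= fo eqxx mulr1 big1 ?addr0 //.
      by rewrite expr2 rmorphM.
    by move=> l lk; rewrite fo eq_sym (negPf lk) mulr0.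
  apply/matrixP => x y; rewrite (sq _ _ fE) (sq (fun k => `|d k|) P).
    by apply: eq_bigr => k _; rewrite real_normK ?num_real.
  by move=> ? ?; rewrite mxE.
- rewrite rmorph_sum /= /mxtrace.
  under [LHS]eq_bigr => x _ do rewrite mxE.
  rewrite exchange_big; apply: eq_bigr => k _ /=.
  rewrite -mulr_sumr; under eq_bigr => x _ do rewrite mulrC.
  by rewrite fo eqxx mulr1.
Qed.

End FiniteRank.

(** * Positive kernels and the trace of a trace class kernel *)

Section PositiveFamilies.
Context {R : realType}.
Local Notation C := R[i].
Local Notation Re := complex.Re.
Local Notation Im := complex.Im.

(** [psd] tests distinct indices only. Here [e] may repeat, and the coefficients of equal indices
    are added up. *)
Lemma psd_ord (I : choiceType) (X : I -> I -> C) (N : nat) (e : 'I_N -> I)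
    (v : 'I_N -> C) :
  psd X -> 0 <= \sum_a \sum_b (v a)^* * X (e a) (e b) * v b.
Proof.
move=> hX; pose F : {fset I} := seq_fset tt [seq e a | a <- enum 'I_N].
have eF a : e a \in F by rewrite seq_fsetE map_f // mem_enum.
pose v' i := \sum_(a | e a == i) v a.
have key (h : I -> C) (w : 'I_N -> C) :
    \sum_(j <- F) h j * (\sum_(a | e a == j) w a) = \sum_b h (e b) * w b.
  under eq_bigr => j _ do rewrite mulr_sumr.
  rewrite (exchange_big_dep xpredT) //=; apply: eq_bigr => b _.
  rewrite -big_filter (_ : [seq j <- F | e b == j] = [:: e b]) ?big_seq1 //.
  rewrite (@eq_filter _ _ (pred1 (e b))); last by move=> j /=; rewrite eq_sym.
  exact: filter_pred1_uniq (fset_uniq _) (eF b).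
have := hX F v'; congr (_ <= _).
transitivity (\sum_(i <- F) \sum_b (v' i)^* * X i (e b) * v b).
  by apply: eq_bigr => i _; rewrite key.
rewrite exchange_big [RHS]exchange_big; apply: eq_bigr => b _ /=.
transitivity (\sum_(i <- F) (X i (e b) * v b) * (\sum_(a | e a == i) (v a)^*)).
  by apply: eq_bigr => i _; rewrite /v' rmorph_sum /=; ring.
by rewrite key; apply: eq_bigr => a _; ring.
Qed.

(** The form is real on vectors [(1, t)] supported by two indices: [t = 1] gives the imaginary part
    of the identity, [t = i] the real part. *)
Lemma psd_conj (I : choiceType) (X : I -> I -> C) i j :
  psd X -> X j i = (X i j)^*.
Proof.
move=> hX; pose e (a : 'I_2) := if a == ord0 then i else j.
have H t := @psd_ord I X 2 e (fun a => if a == ord0 then 1 else t) hX.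
have {}H t : 0 <= (X i i + X i j * t) + (t^* * X j i + t^* * X j j * t).
  by have := H t; rewrite !big_ord_recl !big_ord0 /e /= !rmorph1 !mul1r !mulr1 !addr0.
have H0 : 0 <= X i i by have := H 0; rewrite rmorph0 !mul0r !mulr0 !addr0.
have H1 : 0 <= X j j.
  have := @psd_ord I X 1 (fun=> j) (fun=> 1) hX.
  by rewrite !big_ord_recl !big_ord0 rmorph1 !mul1r !mulr1 !addr0.
have := ger0_Im (H 1); have := ger0_Im (H (0 +i* 1)).
rewrite (ge0_realc H0) (ge0_realc H1) !conjE.
case: (X i j) => a b; case: (X j i) => c d.
rewrite !(ImD, ImM, ReM, ReD) /= => h1 h2.
by congr (_ +i* _); lra.
Qed.

Lemma psd_diag_ge0 (I : choiceType) (X : I -> I -> C) i : psd X -> 0 <= X i i.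
Proof.
move=> hX; have := @psd_ord I X 1 (fun=> i) (fun=> 1) hX.
by rewrite !big_ord_recl !big_ord0 rmorph1 !mul1r !mulr1 !addr0.
Qed.

Lemma sum_tnth (I : choiceType) (V : zmodType) (J : {fset I}) (g : I -> V) :
  \sum_(i <- J) g i = \sum_(a < size J) g (tnth (in_tuple J) a).
Proof. by rewrite big_tnth. Qed.

(** Expand the squared norm of [h], cut off to [J], minus its projection on the [u k]. For a zero
    vector [u k] the quadratic term drops out, which only helps. *)
Lemma bessel (I : choiceType) (N : nat) (u : 'I_N -> I -> C) (p : pred 'I_N)
    (J : {fset I}) (h : I -> C) :
  (forall a b, has_sum (fun l => (u a l)^* * u b l) ((a == b) && p a)%:R) ->
  \sum_k normc (\sum_(l <- J) (u k l)^* * h l) ^+ 2 <=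
  \sum_(l <- J) normc (h l) ^+ 2.
Proof.
move=> gram; pose c k := \sum_(l <- J) (u k l)^* * h l.
pose H l := if l \in J then h l else 0.
have JH (g : I -> C) : has_sum (fun l => g l * H l) (\sum_(l <- J) g l * h l).
  rewrite (_ : \sum_(l <- J) _ = \sum_(l <- J) g l * H l); last first.
    by rewrite big_seq [RHS]big_seq; apply: eq_bigr => l; rewrite /H => ->.
  by apply: has_sum_fin => l; rewrite /H => /negPf ->; rewrite mulr0.
have S1 : has_sum (fun l => (H l)^* * H l) (\sum_(l <- J) (h l)^* * h l).
  rewrite (_ : \sum_(l <- J) _ = \sum_(l <- J) (H l)^* * h l); first exact: JH.
  by rewrite big_seq [RHS]big_seq; apply: eq_bigr => l; rewrite /H => ->.
have S2 : has_sum (fun l => \sum_k (c k)^* * ((u k l)^* * H l)) (\sum_k (c k)^* * c k).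
  by apply: has_sum_sum => k; apply: has_sumZ; exact: JH.
have S3 : has_sum (fun l => \sum_k (c k) * (u k l * (H l)^*)) (\sum_k c k * (c k)^*).
  apply: has_sum_sum => k; apply: has_sumZ.
  apply: has_sum_ext (has_sum_conj (JH (fun l => (u k l)^*))) => l.
  by rewrite rmorphM /= conjCK.
have S4 : has_sum (fun l => \sum_k \sum_m (c k)^* * c m * ((u k l)^* * u m l))
    (\sum_k \sum_m (c k)^* * c m * ((k == m) && p k)%:R).
  by do 2 apply: has_sum_sum => ?; exact: has_sumZ.
have := has_sumD (has_sumD S1 S4) (has_sumZ (-1) (has_sumD S2 S3)).
set L := fun i => _; set s := (X in has_sum _ X) => hs.
have L0 l : 0 <= L l.
  have -> : L l = (H l - \sum_k c k * u k l)^* * (H l - \sum_k c k * u k l).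
    set W := \sum_k _.
    have e1 : \sum_k (c k)^* * ((u k l)^* * H l) = W^* * H l.
      rewrite rmorph_sum mulr_suml; apply: eq_bigr => k _.
      by rewrite rmorphM /=; ring.
    have e2 : \sum_k c k * (u k l * (H l)^*) = W * (H l)^*.
      by rewrite mulr_suml; apply: eq_bigr => k _; ring.
    have e3 : \sum_k \sum_m (c k)^* * c m * ((u k l)^* * u m l) = W^* * W.
      rewrite rmorph_sum mulr_suml; apply: eq_bigr => k _; rewrite mulr_sumr.
      by apply: eq_bigr => m _; rewrite rmorphM /=; ring.
    by rewrite /L e1 e2 e3 rmorphB /=; ring.
  by rewrite mulrC mul_conjC_ge0.
have [sR sF] := has_sum_ge0 L0 hs.
have := sF fset0; rewrite big_seq_fset0 /= /s.
have cc : \sum_k c k * (c k)^* = (\sum_k normc (c k) ^+ 2)%:C.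
  by rewrite rmorph_sum; apply: eq_bigr => k _; rewrite mulrC mulJc.
have -> : \sum_k (c k)^* * c k = (\sum_k normc (c k) ^+ 2)%:C.
  by rewrite -cc; apply: eq_bigr => k _; rewrite mulrC.
have -> : \sum_(l <- J) (h l)^* * h l = (\sum_(l <- J) normc (h l) ^+ 2)%:C.
  by rewrite rmorph_sum; apply: eq_bigr => k _; rewrite mulJc.
have -> : \sum_k \sum_m (c k)^* * c m * ((k == m) && p k)%:R =
   (\sum_k normc (c k) ^+ 2 * (p k)%:R)%:C.
  rewrite rmorph_sum; apply: eq_bigr => k _.
  rewrite (bigD1 k) //= eqxx big1 ?addr0 /=; last first.
    by move=> m mk; rewrite eq_sym (negPf mk) mulr0.
  by rewrite mulJc; case: (p k); rewrite ?mulr1 ?mulr0.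
rewrite cc !ReD mulN1r ReN ReD /=.
have : \sum_k normc (c k) ^+ 2 * (p k)%:R <= \sum_k normc (c k) ^+ 2.
  by apply: ler_sum => k _; case: (p k); rewrite ?mulr1 ?mulr0 ?sqr_ge0.
set A := \sum_k normc (c k) ^+ 2; set B := \sum_k _ * _; set D := \sum_(l <- J) _.
lra.
Qed.

(** Diagonalize the block of [P] on [J]: each eigenvector contributes its eigenvalue times a Bessel
    sum, which is at most 1. *)
Lemma psd_bessel (I : choiceType) (P : I -> I -> C) (N : nat)
    (u : 'I_N -> I -> C) (p : pred 'I_N) (J : {fset I}) :
  (forall a b, has_sum (fun l => (u a l)^* * u b l) ((a == b) && p a)%:R) ->
  psd P ->
  \sum_k Re (\sum_(l <- J) \sum_(j <- J) (u k l)^* * P l j * u k j) <=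
  \sum_(l <- J) Re (P l l).
Proof.
move=> gram hP; pose e := tnth (in_tuple J).
pose A := \matrix_(a < size J, b < size J) P (e a) (e b).
have hA : A^t* = A.
  by apply/matrixP => a b; rewrite !mxE [in LHS](psd_conj _ _ hP) conjCK.
have [f [d [fo fc fE]]] := herm_spectral hA.
have d0 k : 0 <= d k.
  have := psd_ord e (f k) hP.
  have -> : \sum_a \sum_b (f k a)^* * P (e a) (e b) * f k b = (d k)%:C.
    transitivity (\sum_l (d l)%:C * ((\sum_a (f k a)^* * f l a) * (\sum_b (f l b)^* * f k b))).
      under eq_bigr => a _.
        under eq_bigr => b _.
          have -> : P (e a) (e b) = A a b by rewrite mxE.
          rewrite fE mulr_sumr mulr_suml; over.
        rewrite exchange_big; over.
      rewrite exchange_big; apply: eq_bigr => l _ /=.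
      rewrite mulr_suml mulr_sumr; apply: eq_bigr => a _.
      by rewrite !mulr_sumr; apply: eq_bigr => b _; ring.
    rewrite (bigD1 k) //= !fo eqxx !mulr1 big1 ?addr0 // => l lk.
    by rewrite !fo (negPf lk) !mulr0.
  by rewrite lecR.
have trA : \sum_(l <- J) Re (P l l) = \sum_m d m.
  rewrite sum_tnth.
  have -> : \sum_a Re (P (e a) (e a)) = Re (\sum_a A a a).
    by rewrite Re_sum; apply: eq_bigr => a _; rewrite mxE.
  under [in LHS]eq_bigr => a _ do rewrite fE.
  rewrite exchange_big Re_sum; apply: eq_bigr => m _ /=.
  rewrite -mulr_sumr; under eq_bigr => a _ do rewrite mulrC.
  by rewrite fo eqxx mulr1.
rewrite trA.
pose c k m := \sum_a (u k (e a))^* * f m a.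
have qE k : Re (\sum_(l <- J) \sum_(j <- J) (u k l)^* * P l j * u k j) =
    \sum_m d m * normc (c k m) ^+ 2.
  rewrite sum_tnth.
  transitivity (Re (\sum_m (d m)%:C * (c k m * (c k m)^*))).
    congr Re; under eq_bigr => a _ do rewrite sum_tnth.
    transitivity (\sum_a \sum_b \sum_m (u k (e a))^* * ((d m)%:C * (f m a * (f m b)^*)) * u k (e b)).
      apply: eq_bigr => a _; apply: eq_bigr => b _; rewrite -mulr_suml -mulr_sumr.
      by rewrite -fE mxE.
    under eq_bigr => a _ do rewrite exchange_big.
    rewrite exchange_big; apply: eq_bigr => m _ /=.
    rewrite /c rmorph_sum mulr_suml mulr_sumr; apply: eq_bigr => a _.
    rewrite !mulr_sumr; apply: eq_bigr => b _.
    by rewrite rmorphM /= conjCK; ring.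
  rewrite Re_sum; apply: eq_bigr => m _.
  by rewrite [c k m * _]mulrC mulJc -rmorphM.
under eq_bigr => k _ do rewrite qE.
rewrite exchange_big; apply: ler_sum => m _ /=.
rewrite -mulr_sumr ler_piMr //.
pose h i := if i \in J then \sum_a (e a == i)%:R * f m a else 0.
have einj : injective e by apply/tuple_uniqP; exact: fset_uniq.
have he a : h (e a) = f m a.
  rewrite /h (_ : e a \in J); last exact: mem_tnth.
  rewrite (bigD1 a) //= eqxx mul1r big1 ?addr0 // => b ba.
  by rewrite (inj_eq einj) (negPf ba) mul0r.
have := bessel J h gram.
have -> : \sum_(l <- J) normc (h l) ^+ 2 = 1.
  rewrite sum_tnth; apply: (@complexI R); rewrite rmorph_sum rmorph1 /=.
  under eq_bigr => a _ do rewrite -mulJc -/e he.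
  by rewrite fo eqxx.
congr (_ <= _); apply: eq_bigr => k _; rewrite sum_tnth.
by under eq_bigr => a _ do rewrite -/e he.
Qed.

Lemma phase_exists (z : C) : exists2 t : C, normc t = 1 & t * z = (normc z)%:C.
Proof.
have [->|z0] := eqVneq z 0.
  by exists 1; rewrite ?normc1 // normc0 mulr0.
have n0 : normc z != 0 by rewrite normc_eq0.
exists (z^* / (normc z)%:C).
  by rewrite normcM normcJ normcV normcR ger0_norm ?normc_ge0 // divff.
rewrite mulrAC mulJc expr2 rmorphM /= mulfK //.
by rewrite -(inj_eq (@complexI R)) in n0.
Qed.

(** This is what makes the trace of a trace class kernel converge. [is_abs] only identifies the
    squares of [X] and [P], so the comparison runs through Gram matrices of columns. *)
Lemma trace_class_diag (I : choiceType) (X P : I -> I -> C) (t : R) :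
  is_abs X P -> has_sum (fun i => P i i) t%:C ->
  forall F : {fset I}, \sum_(i <- F) normc (X i i) <= t.
Proof.
move=> [hP AB] ht F; pose e := tnth (in_tuple F); pose N := size F.
have einj : injective e by apply/tuple_uniqP; exact: fset_uniq.
have Ple (J : {fset I}) : \sum_(l <- J) Re (P l l) <= t.
  have [_ /(_ J)] := has_sum_ge0 (fun i => psd_diag_ge0 i hP) ht.
  by rewrite Re_sum.
(* A single Gram matrix for the columns of [X] indexed by [F] and for those of [P]: this equality
   replaces the polar decomposition. *)
have [G hG] : exists G : 'M[C]_N, forall a b,
    has_sum (fun l => (X l (e a))^* * X l (e b)) (G a b) /\
    has_sum (fun l => P (e a) l * P l (e b)) (G a b).
  exists (\matrix_(a, b) projT1 (cid (AB (e a) (e b)))) => a b.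
  by rewrite mxE; case: cid.
have GH : G^t* = G.
  apply/matrixP => a b; rewrite !mxE.
  apply: (has_sum_unique _ (hG a b).1).
  apply: has_sum_ext (has_sum_conj (hG b a).1) => l.
  by rewrite rmorphM /= conjCK mulrC.
have [f [d [fo fc fE]]] := herm_spectral GH.
pose y k l := \sum_a f k a * X l (e a).
pose q k l := \sum_a f k a * P l (e a).
have gd k m : \sum_a \sum_b (f k a)^* * f m b * G a b = (d k)%:C * (k == m)%:R.
  transitivity (\sum_l (d l)%:C * ((\sum_a (f k a)^* * f l a) * (\sum_b (f l b)^* * f m b))).
    under eq_bigr => a _ do under eq_bigr => b _ do rewrite fE mulr_sumr.
    under eq_bigr => a _ do rewrite exchange_big.
    rewrite exchange_big; apply: eq_bigr => l _ /=.
    rewrite mulr_suml mulr_sumr; apply: eq_bigr => a _.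
    by rewrite !mulr_sumr; apply: eq_bigr => b _; ring.
  rewrite (bigD1 k) //= !fo eqxx mul1r big1 ?addr0 // => l lk.
  by rewrite !fo (eq_sym k) (negPf lk) mul0r mulr0.
have hy k m : has_sum (fun l => (y k l)^* * y m l) ((d k)%:C * (k == m)%:R).
  rewrite -gd; have : has_sum (fun l => \sum_a \sum_b (f k a)^* * f m b *
     ((X l (e a))^* * X l (e b))) (\sum_a \sum_b (f k a)^* * f m b * G a b).
    by do 2 apply: has_sum_sum => ?; apply: has_sumZ; exact: (hG _ _).1.
  apply: has_sum_ext => l; rewrite rmorph_sum mulr_suml; apply: eq_bigr => a _.
  rewrite mulr_sumr; apply: eq_bigr => b _; rewrite rmorphM /=; ring.
have hq k m : has_sum (fun l => (q k l)^* * q m l) ((d k)%:C * (k == m)%:R).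
  rewrite -gd; have : has_sum (fun l => \sum_a \sum_b (f k a)^* * f m b *
     (P (e a) l * P l (e b))) (\sum_a \sum_b (f k a)^* * f m b * G a b).
    by do 2 apply: has_sum_sum => ?; apply: has_sumZ; exact: (hG _ _).2.
  apply: has_sum_ext => l; rewrite rmorph_sum mulr_suml; apply: eq_bigr => a _.
  rewrite mulr_sumr; apply: eq_bigr => b _; rewrite rmorphM /=.
  by rewrite (psd_conj (e a) l hP) conjCK; ring.
have d0 k : 0 <= d k.
  have h0 l : 0 <= (y k l)^* * y k l by rewrite mulrC mul_conjC_ge0.
  have [_ /(_ fset0)] := has_sum_ge0 h0 (hy k k).
  by rewrite big_seq_fset0 eqxx mulr1.
pose s k := Num.sqrt (d k).
have s2 k : s k ^+ 2 = d k by rewrite sqr_sqrtr.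
(* Rotated by the eigenvectors of [G], the columns become orthogonal with norms [s k]. A phase on
   each diagonal entry turns the sum of moduli into a trace, whose terms are at most [s k] by
   Cauchy-Schwarz. *)
have step1 : \sum_(i <- F) normc (X i i) <= \sum_k s k.
  have [th th1 thE] : exists2 th : 'I_N -> C, forall a, normc (th a) = 1 &
      forall a, th a * X (e a) (e a) = (normc (X (e a) (e a)))%:C.
    have ph a := cid2 (phase_exists (X (e a) (e a))).
    by exists (fun a => s2val (ph a)) => a; case: (ph a).
  pose z k := \sum_a (th a * (f k a)^*) * y k (e a).
  have -> : \sum_(i <- F) normc (X i i) = Re (\sum_k z k).
    rewrite sum_tnth exchange_big Re_sum; apply: eq_bigr => a _ /=.
    rewrite (_ : \sum_k _ = th a * X (e a) (e a)); first by rewrite thE.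
    transitivity (th a * \sum_b (\sum_k f k b * (f k a)^*) * X (e a) (e b)).
      rewrite mulr_sumr.
      under [RHS]eq_bigr => b _ do rewrite mulr_suml mulr_sumr.
      rewrite [RHS]exchange_big; apply: eq_bigr => k _ /=.
      by rewrite /y mulr_sumr; apply: eq_bigr => b _; ring.
    congr (_ * _); rewrite (bigD1 a) //= fc eqxx mul1r big1 ?addr0 // => b ba.
    by rewrite fc (negPf ba) mul0r.
  rewrite Re_sum; apply: ler_sum => k _.
  apply: le_trans (ler_norm _) _; apply: le_trans (normc_Re _) _.
  rewrite -(ler_pXn2r (n := 2)) ?nnegrE ?normc_ge0 ?sqrtr_ge0 // s2.
  apply: le_trans (CS_normc _ _ _) _; rewrite -[leRHS]mul1r.
  apply: ler_pM; try by apply: sumr_ge0 => ? _; exact: sqr_ge0.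
    have -> : 1 = \sum_a normc (f k a) ^+ 2 :> R.
      apply: (@complexI R); rewrite rmorph_sum rmorph1 /=.
      by under eq_bigr => a _ do rewrite -mulJc; rewrite fo eqxx.
    by apply: ler_sum => a _; rewrite normcM normcJ exprMn th1 expr1n mul1r.
  have h0 l : 0 <= (y k l)^* * y k l by rewrite mulrC mul_conjC_ge0.
  have [_ /(_ F)] := has_sum_ge0 h0 (hy k k).
  rewrite eqxx mulr1 /=; congr (_ <= _); rewrite sum_tnth Re_sum.
  by apply: eq_bigr => a _; rewrite mulJc.
apply: le_trans step1 _.
(* The normalized [q k]. The default [0^-1 = 0] leaves [w k = 0] when [s k = 0], which the predicate
   in [bessel] allows. *)
pose w k l := q k l * ((s k)^-1)%:C.
have gramw k m : has_sum (fun l => (w k l)^* * w m l) ((k == m) && (s k != 0))%:R.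
  have := has_sumZ (((s k)^-1)%:C * ((s m)^-1)%:C) (hq k m).
  have -> : ((s k)^-1)%:C * ((s m)^-1)%:C * ((d k)%:C * (k == m)%:R) =
      ((k == m) && (s k != 0))%:R.
    have [<-|_] := eqVneq k m; last by rewrite !mulr0.
    rewrite mulr1 -!rmorphM /= -s2; have [->|sk0] := eqVneq (s k) 0.
      by rewrite expr0n /= mulr0.
    by rewrite -expr2 -exprMn mulVf // expr1n.
  by apply: has_sum_ext => l; rewrite /w rmorphM /= conjcRe; ring.
have hwq : has_sum (fun l => \sum_k (w k l)^* * q k l) (\sum_k (s k)%:C).
  apply: has_sum_sum => k; have := has_sumZ ((s k)^-1)%:C (hq k k).
  rewrite eqxx mulr1 -rmorphM /= -s2.
  have -> : (s k)^-1 * s k ^+ 2 = s k.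
    have [->|sk0] := eqVneq (s k) 0; first by rewrite invr0 mul0r.
    by rewrite expr2 mulKf.
  by apply: has_sum_ext => l; rewrite /w rmorphM /= conjcRe; ring.
have -> : \sum_k s k = Re (\sum_k (s k)%:C) by rewrite Re_sum.
apply: (has_sum_Re_le hwq (F0 := F)) => J FJ.
(* On [J] the vector [q k] is [P] applied to [g k], so the partial sums of [hwq] are values of the
   form [P] on [(w k, g k)]. By [CSP] they are at most the mean of two sums, each bounded by [t]. *)
pose g k l := \sum_a (e a == l)%:R * f k a.
have eJ a : e a \in J by apply: (fsubsetP FJ); exact: mem_tnth.
have gsum k (h : I -> C) : \sum_(j <- J) h j * g k j = \sum_a h (e a) * f k a.
  under eq_bigr => j _ do rewrite mulr_sumr.
  rewrite exchange_big; apply: eq_bigr => a _ /=.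
  rewrite (bigD1_seq (e a)) ?fset_uniq //= eqxx mul1r big1 ?addr0 //.
  by move=> j ja; rewrite eq_sym (negPf ja) mul0r mulr0.
pose ip (x z : I -> C) := \sum_(l <- J) \sum_(j <- J) (x l)^* * P l j * z j.
have ipge x : 0 <= Re (ip x x) by exact/ge0_Re/hP.
have ipC x z : ip z x = (ip x z)^*.
  rewrite /ip exchange_big rmorph_sum; apply: eq_bigr => l _ /=.
  rewrite rmorph_sum; apply: eq_bigr => j _ /=.
  by rewrite !rmorphM /= conjCK -(psd_conj _ _ hP); ring.
have CSP x z : Re (ip x z) <= (Re (ip x x) + Re (ip z z)) / 2.
  have := ipge (fun l => x l - z l).
  have -> : ip (fun l => x l - z l) (fun l => x l - z l) =
      ip x x + ip z z - (ip x z + ip z x).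
    rewrite /ip -!big_split -sumrB /=; apply: eq_bigr => l _.
    rewrite -!big_split -sumrB /=; apply: eq_bigr => j _.
    by rewrite rmorphB /=; ring.
  by rewrite ReD ReN !ReD (ipC x z) ReJ; lra.
have -> : Re (\sum_(l <- J) \sum_k (w k l)^* * q k l) = \sum_k Re (ip (w k) (g k)).
  rewrite exchange_big Re_sum; apply: eq_bigr => k _ /=; congr Re.
  apply: eq_bigr => l _; rewrite gsum /q mulr_sumr.
  by apply: eq_bigr => a _; ring.
apply: le_trans (ler_sum _ (fun k _ => CSP (w k) (g k))) _.
rewrite -mulr_suml big_split /=.
have h1 : \sum_k Re (ip (w k) (w k)) <= t.
  exact: le_trans (psd_bessel J gramw hP) (Ple J).
have h2 : \sum_k Re (ip (g k) (g k)) <= t.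
  apply: le_trans (Ple F); rewrite le_eqVlt; apply/orP; left; apply/eqP.
  transitivity (Re (\sum_a \sum_b (\sum_k f k b * (f k a)^*) * P (e a) (e b))).
    rewrite -Re_sum; congr Re.
    under [RHS]eq_bigr => a _ do under eq_bigr => b _ do rewrite mulr_suml.
    under [RHS]eq_bigr => a _ do rewrite exchange_big.
    rewrite [RHS]exchange_big; apply: eq_bigr => k _ /=.
    transitivity (\sum_(l <- J) \sum_a ((g k l)^* * P l (e a)) * f k a).
      by apply: eq_bigr => l _; exact: (gsum k (fun j => (g k l)^* * P l j)).
    transitivity (\sum_(l <- J) (\sum_a P l (e a) * f k a) * (g k l)^*).
      apply: eq_bigr => l _; rewrite mulr_suml; apply: eq_bigr => a _; ring.
    transitivity ((\sum_(l <- J) (\sum_a P l (e a) * f k a)^* * g k l)^*).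
      rewrite rmorph_sum; apply: eq_bigr => l _ /=.
      by rewrite rmorphM /= conjCK.
    rewrite gsum rmorph_sum; apply: eq_bigr => a _ /=.
    by rewrite rmorphM /= conjCK mulr_suml; apply: eq_bigr => b _; ring.
  rewrite sum_tnth Re_sum; apply: eq_bigr => a _; congr Re.
  rewrite (bigD1 a) //= fc eqxx mul1r big1 ?addr0 // => b ba.
  by rewrite fc (negPf ba) mul0r.
by move: h1 h2; set A := \sum_k _; set B := \sum_k _; lra.
Qed.

End PositiveFamilies.

(** * Channels built from a contraction, and their error on pure states *)

Section GeneralChannel.
Context {R : realType}.
Local Notation C := R[i].
Local Notation Re := complex.Re.
Local Notation Im := complex.Im.

Lemma psd_seq (I : choiceType) (X : I -> I -> C) (J : Type) (L : seq J)
    (e : J -> I) (v : J -> C) :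
  psd X -> 0 <= \sum_(a <- L) \sum_(b <- L) (v a)^* * X (e a) (e b) * v b.
Proof.
move=> hX; rewrite big_tnth; under eq_bigr => a _ do rewrite big_tnth.
exact: (psd_ord (e \o tnth (in_tuple L)) (v \o tnth (in_tuple L)) hX).
Qed.

(** The default 0 covers a diagonal that is not summable; on trace class kernels [trace_class_sum]
    excludes this case. *)
Definition op_trace (I : choiceType) (X : I -> I -> C) : C :=
  xget 0 [set s | has_sum (fun i => X i i) s].

Lemma op_traceE (I : choiceType) (X : I -> I -> C) s :
  has_sum (fun i => X i i) s -> op_trace X = s.
Proof.
move=> h; rewrite /op_trace; case: xgetP => [x _ hx|/(_ s)//].
exact: has_sum_unique hx h.
Qed.

Lemma trace_class_sum (H : hilbert R) (X : hidx H -> hidx H -> C) :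
  trace_class X -> has_sum (fun i => X i i) (op_trace X).
Proof.
move=> [[t [P hP ht]] _ _].
have [s hs] := has_sum_bounded (trace_class_diag hP ht).
by rewrite (op_traceE hs).
Qed.

(** The subtracted sum pairs [Y] with the adjoint square of [W]. Diagonalizing the block of [Y] on
    [F1] reduces it to the contraction property on each eigenvector; the diagonal of [Y] outside
    [F1] only helps. *)
Lemma psd_trace_contraction (I : choiceType) (Y : I -> I -> C) (s : C)
    (F1 : {fset I}) (I2 : choiceType) (F2 : {fset I2}) (W : I2 -> I -> C) :
  psd Y -> has_sum (fun i => Y i i) s ->
  (forall v : I -> C, \sum_(i <- F2) normc (\sum_(j <- F1) W i j * v j) ^+ 2 <=
                      \sum_(j <- F1) normc (v j) ^+ 2) ->
  0 <= s - \sum_(p <- F1) \sum_(q <- F1)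
             (\sum_(i <- F2) W i p * (W i q)^*) * Y p q.
Proof.
move=> hY hs hW; pose e := tnth (in_tuple F1).
pose A := \matrix_(a < size F1, b < size F1) Y (e a) (e b).
have hA : A^t* = A.
  by apply/matrixP => a b; rewrite !mxE [in LHS](psd_conj _ _ hY) conjCK.
have [f [d [fo fc fE]]] := herm_spectral hA.
have d0 k : 0 <= d k.
  have := psd_ord e (f k) hY.
  have -> : \sum_a \sum_b (f k a)^* * Y (e a) (e b) * f k b = (d k)%:C.
    transitivity (\sum_l (d l)%:C * ((\sum_a (f k a)^* * f l a) * (\sum_b (f l b)^* * f k b))).
      under eq_bigr => a _.
        under eq_bigr => b _.
          have -> : Y (e a) (e b) = A a b by rewrite mxE.
          rewrite fE mulr_sumr mulr_suml; over.
        rewrite exchange_big; over.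
      rewrite exchange_big; apply: eq_bigr => l _ /=.
      rewrite mulr_suml mulr_sumr; apply: eq_bigr => a _.
      by rewrite !mulr_sumr; apply: eq_bigr => b _; ring.
    rewrite (bigD1 k) //= !fo eqxx !mulr1 big1 ?addr0 // => l lk.
    by rewrite !fo (negPf lk) !mulr0.
  by rewrite lecR.
have [sR sF] := has_sum_ge0 (fun i => psd_diag_ge0 i hY) hs.
have trA : \sum_(l <- F1) Re (Y l l) = \sum_m d m.
  rewrite sum_tnth.
  have -> : \sum_a Re (Y (e a) (e a)) = Re (\sum_a A a a).
    by rewrite Re_sum; apply: eq_bigr => a _; rewrite mxE.
  under [in LHS]eq_bigr => a _ do rewrite fE.
  rewrite exchange_big Re_sum; apply: eq_bigr => m _ /=.
  rewrite -mulr_sumr; under eq_bigr => a _ do rewrite mulrC.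
  by rewrite fo eqxx mulr1.
pose g m i := \sum_a W i (e a) * f m a.
have -> : \sum_(p <- F1) \sum_(q <- F1) (\sum_(i <- F2) W i p * (W i q)^*) * Y p q =
    (\sum_m d m * \sum_(i <- F2) normc (g m i) ^+ 2)%:C.
  rewrite sum_tnth; under eq_bigr => a _ do rewrite sum_tnth.
  rewrite -/e rmorph_sum /=.
  transitivity (\sum_a \sum_b \sum_m \sum_(i <- F2) (d m)%:C *
      ((W i (e b) * f m b)^* * (W i (e a) * f m a))).
    apply: eq_bigr => a _; apply: eq_bigr => b _.
    have -> : Y (e a) (e b) = A a b by rewrite mxE.
    rewrite fE mulr_sumr; apply: eq_bigr => m _.
    rewrite mulr_suml; apply: eq_bigr => i _; rewrite rmorphM /=; ring.
  under [LHS]eq_bigr => a _ do rewrite exchange_big.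
  rewrite exchange_big; apply: eq_bigr => m _ /=.
  under [LHS]eq_bigr => a _ do rewrite exchange_big.
  rewrite exchange_big rmorphM rmorph_sum /= mulr_sumr; apply: eq_bigr => i _ /=.
  rewrite -mulJc /g rmorph_sum mulr_suml mulr_sumr exchange_big.
  apply: eq_bigr => b _; rewrite mulr_sumr mulr_sumr; apply: eq_bigr => a _.
  by [].
rewrite sR -rmorphB /= lecR subr_ge0.
apply: le_trans (sF F1); rewrite Re_sum trA; apply: ler_sum => m _.
rewrite ler_piMr //.
pose h j := \sum_a (e a == j)%:R * f m a.
have einj : injective e by apply/tuple_uniqP; exact: fset_uniq.
have he a : h (e a) = f m a.
  rewrite /h (bigD1 a) //= eqxx mul1r big1 ?addr0 // => b ba.
  by rewrite (inj_eq einj) (negPf ba) mul0r.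
have := hW h.
have -> : \sum_(l <- F1) normc (h l) ^+ 2 = 1.
  rewrite sum_tnth; apply: (@complexI R); rewrite rmorph_sum rmorph1 /=.
  under eq_bigr => a _ do rewrite -mulJc -/e he.
  by rewrite fo eqxx.
congr (_ <= _); apply: eq_bigr => i _; rewrite sum_tnth.
by under eq_bigr => a _ do rewrite -/e he.
Qed.

Section Construction.
Variables (H1 H2 : hilbert R) (F1 : {fset hidx H1}) (F2 : {fset hidx H2}).
Variables (W : hidx H2 -> hidx H1 -> C) (e0 : hidx H2).

(** Compression by [W], with the lost trace prepared in the basis state [e0]. Only the block of [X]
    on [F1] and its trace are read, so every sum but the trace is finite. *)
Definition compress_prepare (X : hidx H1 -> hidx H1 -> C) (i j : hidx H2) : C :=
  \sum_(p <- F1) \sum_(q <- F1) W i p * (W j q)^* * X p q +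
  (op_trace X - \sum_(p <- F1) \sum_(q <- F1)
      (\sum_(l <- F2) W l p * (W l q)^*) * X p q) * ((i == e0)%:R * (j == e0)%:R).

Hypothesis WF2 : forall i j, i \notin F2 -> W i j = 0.
Hypothesis W_le1 : forall v : hidx H1 -> C,
  \sum_(i <- F2) normc (\sum_(j <- F1) W i j * v j) ^+ 2 <=
  \sum_(j <- F1) normc (v j) ^+ 2.
Hypothesis hsub_lin : forall (a : C) (f g : hidx H2 -> C),
  hsub f -> hsub g -> hsub (fun i => a * f i + g i).
Hypothesis hsubW : forall j, hsub (fun i => W i j).
Hypothesis hsub_e0 : hsub (fun i : hidx H2 => (i == e0)%:R).

Lemma compress_prepare_fin X i j :
  (i \notin F2 `|` [fset e0])%fset || (j \notin F2 `|` [fset e0])%fset ->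
  compress_prepare X i j = 0.
Proof.
rewrite !inE !negb_or => h; rewrite /compress_prepare.
have -> : (i == e0)%:R * (j == e0)%:R = 0 :> C.
  by case/orP : h => /andP[_ /negPf ->]; rewrite ?mul0r ?mulr0.
rewrite mulr0 addr0; apply: big1 => p _; apply: big1 => q _.
by case/orP : h => /andP[/WF2 h _]; rewrite h ?rmorph0 ?mulr0 !mul0r.
Qed.

Lemma hsub_sum (J : Type) (r : seq J) (c : J -> C) (f : J -> hidx H2 -> C) :
  (forall j, hsub (f j)) -> hsub (fun i => \sum_(j <- r) c j * f j i).
Proof.
move=> hf; elim: r => [|j r IH].
  have := hsub_lin (-1) hsub_e0 hsub_e0; congr hsub; apply: funext => i.
  by rewrite big_nil mulN1r addNr.
have := hsub_lin (c j) (hf j) IH; congr hsub; apply: funext => i.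
by rewrite big_cons.
Qed.

Lemma compress_prepare_trace_class X : trace_class (compress_prepare X).
Proof.
split.
- pose F := (F2 `|` [fset e0])%fset; pose e := tnth (in_tuple F).
  pose u (a : 'I_(size F)) i : C := (i == e a)%:R.
  have einj : injective e by apply/tuple_uniqP; exact: fset_uniq.
  have gram a b : has_sum (fun l => (u a l)^* * u b l) ((a == b) && xpredT a)%:R.
    rewrite andbT; have := @has_sum_fin R _ (fun l => (u a l)^* * u b l) [fset e a]%fset.
    rewrite big_seq_fset1 /u eqxx rmorph1 mul1r (inj_eq einj); apply => l.
    by rewrite !inE => /negPf ->; rewrite rmorph0 mul0r.
  pose M := \matrix_(a, b) compress_prepare X (e a) (e b).
  have [t ht] := ex_has_trace_norm_sandwich gram M (fun=> isT).
  exists t; move: ht; congr has_trace_norm; apply: funext => i; apply: funext => j.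
  rewrite /sandwich.
  have [iF|iF] := boolP (i \in F); last first.
    rewrite compress_prepare_fin ?iF // big1 // => a _; rewrite big1 // => b _.
    suff -> : u a i = 0 by rewrite mul0r mulr0.
    rewrite /u; case: eqP => // ie; move: iF; rewrite ie.
    by rewrite (_ : e a \in F) // mem_tnth.
  have [jF|jF] := boolP (j \in F); last first.
    rewrite compress_prepare_fin ?jF ?orbT // big1 // => a _; rewrite big1 // => b _.
    suff -> : u b j = 0 by rewrite rmorph0 !mulr0.
    rewrite /u; case: eqP => // ie; move: jF; rewrite ie.
    by rewrite (_ : e b \in F) // mem_tnth.
  have [a ia] : exists a, i = e a by apply/tnthP.
  have [b jb] : exists b, j = e b by apply/tnthP.
  rewrite (bigD1 a) //= [X in _ + X]big1 ?addr0; last first.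
    move=> a' aa; apply: big1 => b' _; rewrite /u ia (inj_eq einj) eq_sym.
    by rewrite (negPf aa) mul0r mulr0.
  rewrite (bigD1 b) //= big1 ?addr0; last first.
    move=> b' bb; rewrite /u jb (inj_eq einj) [_ == b']eq_sym.
    by rewrite (negPf bb) rmorph0 !mulr0.
  have -> : u a i = 1 by rewrite /u ia eqxx.
  have -> : u b j = 1 by rewrite /u jb eqxx.
  by rewrite rmorph1 mulr1 mulr1 mxE ia jb.
- move=> j.
  have h1 := hsub_sum F1 (fun p => \sum_(q <- F1) (W j q)^* * X p q) hsubW.
  have := hsub_lin ((op_trace X - \sum_(p <- F1) \sum_(q <- F1)
      (\sum_(l <- F2) W l p * (W l q)^*) * X p q) * (j == e0)%:R) hsub_e0 h1.
  congr hsub; apply: funext => i; rewrite /compress_prepare addrC; congr (_ + _).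
    by apply: eq_bigr => p _; rewrite mulr_suml; apply: eq_bigr => q _; ring.
  ring.
- move=> i.
  have h1 := hsub_sum F1 (fun q => \sum_(p <- F1) (W i p * X p q)^*) hsubW.
  have := hsub_lin ((op_trace X - \sum_(p <- F1) \sum_(q <- F1)
      (\sum_(l <- F2) W l p * (W l q)^*) * X p q) * (i == e0)%:R)^* hsub_e0 h1.
  congr hsub; apply: funext => j; rewrite conjcE /compress_prepare rmorphD /= addrC; congr (_ + _).
    rewrite exchange_big rmorph_sum; apply: eq_bigr => q _ /=.
    rewrite mulr_suml rmorph_sum; apply: eq_bigr => p _ /=.
    by rewrite !rmorphM /= conjCK; ring.
  by rewrite !rmorphM /= !rmorph_nat; ring.
Qed.

Lemma compress_prepare_channel : @channel R H1 H2 compress_prepare.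
Proof.
split.
- by move=> X _; exact: compress_prepare_trace_class.
- move=> a X Y hX hY; apply: funext => i; apply: funext => j.
  rewrite /compress_prepare.
  have -> : op_trace (fun i j => a * X i j + Y i j) = a * op_trace X + op_trace Y.
    by apply: op_traceE; apply: has_sum_lin; exact: trace_class_sum.
  have L (G : hidx H1 -> hidx H1 -> C) :
      \sum_(p <- F1) \sum_(q <- F1) G p q * (a * X p q + Y p q) =
      a * (\sum_(p <- F1) \sum_(q <- F1) G p q * X p q) +
      \sum_(p <- F1) \sum_(q <- F1) G p q * Y p q.
    rewrite mulr_sumr -big_split; apply: eq_bigr => p _ /=.
    by rewrite mulr_sumr -big_split; apply: eq_bigr => q _ /=; ring.
  by rewrite !L; ring.
- move=> X s hX hs; have tE := op_traceE hs.
  pose F := (F2 `|` [fset e0])%fset.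
  have := @has_sum_fin R _ (fun i => compress_prepare X i i) F.
  have -> : \sum_(i <- F) compress_prepare X i i = s.
    rewrite /compress_prepare big_split /=.
    rewrite -[in X in _ + X]mulr_sumr.
    have -> : \sum_(i <- F) (i == e0)%:R * (i == e0)%:R = 1 :> C.
      rewrite (bigD1_seq e0) ?fset_uniq /F ?inE ?eqxx ?orbT //=.
      by rewrite mulr1 big1 ?addr0 // => i /negPf ->; rewrite mul0r.
    have -> : \sum_(i <- F) \sum_(p <- F1) \sum_(q <- F1) W i p * (W i q)^* * X p q =
      \sum_(p <- F1) \sum_(q <- F1) (\sum_(l <- F2) W l p * (W l q)^*) * X p q.
      rewrite exchange_big; apply: eq_bigr => p _ /=.
      rewrite exchange_big; apply: eq_bigr => q _ /=.
      rewrite -mulr_suml; congr (_ * _); symmetry.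
      have := has_sum_unique
        (@has_sum_fin R _ (fun l => W l p * (W l q)^*) F2 _)
        (@has_sum_fin R _ (fun l => W l p * (W l q)^*) F _).
      apply; first by move=> i /WF2 ->; rewrite mul0r.
      by move=> i; rewrite inE negb_or => /andP[/WF2 -> _]; rewrite mul0r.
    by rewrite tE mulr1 addrC subrK.
  by apply => i iF; apply: compress_prepare_fin; rewrite iF.
- move=> N X hX hp F v.
  have -> : \sum_(i <- F) \sum_(j <- F) (v i)^* *
      block (fun u v => compress_prepare (X u v)) i j * v j =
    (\sum_(i <- F) \sum_(j <- F) \sum_(p <- F1) \sum_(q <- F1)
      (v i)^* * W i.2 p * X i.1 j.1 p q * (v j * (W j.2 q)^*)) +
    (\sum_(i <- F) \sum_(j <- F)
       ((v i * (i.2 == e0)%:R)^* * (v j * (j.2 == e0)%:R)) * op_trace (X i.1 j.1) -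
     \sum_(p <- F1) \sum_(q <- F1) (\sum_(l <- F2) W l p * (W l q)^*) *
       \sum_(i <- F) \sum_(j <- F)
       ((v i * (i.2 == e0)%:R)^* * (v j * (j.2 == e0)%:R)) * X i.1 j.1 p q).
    have -> : \sum_(p <- F1) \sum_(q <- F1) (\sum_(l <- F2) W l p * (W l q)^*) *
       (\sum_(i <- F) \sum_(j <- F)
       ((v i * (i.2 == e0)%:R)^* * (v j * (j.2 == e0)%:R)) * X i.1 j.1 p q) =
      \sum_(i <- F) \sum_(j <- F)
       ((v i * (i.2 == e0)%:R)^* * (v j * (j.2 == e0)%:R)) *
        \sum_(p <- F1) \sum_(q <- F1) (\sum_(l <- F2) W l p * (W l q)^*) * X i.1 j.1 p q.
      under eq_bigr => p _ do under eq_bigr => q _ do rewrite mulr_sumr.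
      under eq_bigr => p _ do rewrite exchange_big.
      rewrite exchange_big; apply: eq_bigr => i _ /=.
      under eq_bigr => p _ do under eq_bigr => q _ do rewrite mulr_sumr.
      under eq_bigr => p _ do rewrite exchange_big.
      rewrite exchange_big; apply: eq_bigr => j _ /=.
      rewrite mulr_sumr; apply: eq_bigr => p _.
      by rewrite mulr_sumr; apply: eq_bigr => q _; ring.
    rewrite -sumrB -big_split; apply: eq_bigr => i _ /=.
    rewrite -sumrB -big_split; apply: eq_bigr => j _ /=.
    rewrite /block /compress_prepare mulrDr mulrDl; congr (_ + _).
      rewrite mulr_sumr mulr_suml; apply: eq_bigr => p _.
      by rewrite mulr_sumr mulr_suml; apply: eq_bigr => q _; ring.
    by rewrite rmorphM /= rmorph_nat; ring.
  apply: addr_ge0.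
    have := psd_seq [seq (i, p) | i <- F, p <- F1] (fun a => (a.1.1, a.2))
       (fun a => v a.1 * (W a.1.2 a.2)^*) hp.
    rewrite big_allpairs; congr (_ <= _); apply: eq_bigr => i _.
    rewrite [RHS]exchange_big; apply: eq_bigr => p _ /=.
    rewrite big_allpairs; apply: eq_bigr => j _; apply: eq_bigr => q _.
    by rewrite /block /= rmorphM /= conjCK; ring.
  (* The prepared summand is a trace defect: contracting the block indices with [y] leaves one
     positive kernel on [hidx H1], to which [psd_trace_contraction] applies. *)
  pose y (i : 'I_N * hidx H2) := v i * (i.2 == e0)%:R.
  apply: (@psd_trace_contraction _
     (fun p q => \sum_(i <- F) \sum_(j <- F) ((y i)^* * y j) * X i.1 j.1 p q)) => //.
    move=> J w.
    have := psd_seq [seq (i, p) | i <- F, p <- J] (fun a => (a.1.1, a.2))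
       (fun a => y a.1 * w a.2) hp.
    rewrite big_allpairs; congr (_ <= _); rewrite exchange_big; apply: eq_bigr => p _ /=.
    under eq_bigr => i _ do rewrite big_allpairs.
    under eq_bigr => i _ do rewrite exchange_big.
    rewrite exchange_big; apply: eq_bigr => q _ /=.
    rewrite mulr_sumr mulr_suml; apply: eq_bigr => i _.
    rewrite mulr_sumr mulr_suml; apply: eq_bigr => j _.
    by rewrite /block /= rmorphM /=; ring.
  do 2 (apply: has_sum_sum => ?); apply: has_sumZ; exact: trace_class_sum.
Qed.

End Construction.

Section PureModels.
Local Open Scope fset_scope.
Local Open Scope ring_scope.

Lemma big_ord3 (V : zmodType) (f : 'I_3 -> V) :
  \sum_j f j = f ord0 + (f (lift ord0 ord0) + f (lift ord0 (lift ord0 ord0))).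
Proof. by rewrite !big_ord_recl big_ord0 addr0. Qed.

Lemma parallelogram (a b : C) (x y : R) :
  normc (x%:C * a + y%:C * b) ^+ 2 + normc (x%:C * a - y%:C * b) ^+ 2 =
  2 * (x ^+ 2 * normc a ^+ 2 + y ^+ 2 * normc b ^+ 2).
Proof.
rewrite !sqr_normcE; case: a => a1 a2; case: b => b1 b2.
by rewrite !(ReD, ReN, ReM, ImD, ImN, ImM) /=; ring.
Qed.

(** The difference of the two projectors polarizes into [t g + chi], of squared norm at most 4,
    against [t g - chi], of squared norm at most [2 eta]; the phase [t] makes the overlap real and
    positive. These terms cost [3 sqrt eta], and the lost mass [1 - G2 <= 2 eta] costs the remaining
    [2 sqrt eta]. *)
Lemma trace_norm_pure (I : choiceType) (F : {fset I}) (e0 : I) (g chi : I -> C)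
    (eta : R) :
  0 < eta -> eta <= 1 -> e0 \in F -> (forall i, i \notin F -> g i = 0) ->
  has_sum (fun i => (chi i)^* * chi i) 1 ->
  \sum_(i <- F) normc (g i) ^+ 2 <= 1 ->
  1 - eta <= normc (\sum_(i <- F) (chi i)^* * g i) ->
  (trace_norm (fun i j => (g i * (g j)^* +
     (1 - \sum_(i <- F) normc (g i) ^+ 2)%:C * ((i == e0)%:R * (j == e0)%:R) -
     chi i * (chi j)^*)%R) <= (5 * Num.sqrt eta)%:E)%E.
Proof.
move=> eta0 eta1 e0F gF hchi g1 hz.
set z := \sum_(i <- F) _ in hz.
set G2 := \sum_(i <- F) normc (g i) ^+ 2 in g1 *.
pose e := tnth (in_tuple F); pose n := size F.
have einj : injective e by apply/tuple_uniqP; exact: fset_uniq.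
have [t t1 tz] := phase_exists z.
have chi0 i : 0 <= (chi i)^* * chi i by rewrite mulrC mul_conjC_ge0.
pose X2 := \sum_(i <- F) normc (chi i) ^+ 2.
have X21 : X2 <= 1.
  have [_ /(_ F)] := has_sum_ge0 chi0 hchi.
  by rewrite Re_sum; congr (_ <= _); apply: eq_bigr => i _; rewrite mulJc.
pose tau := Num.sqrt (1 - X2).
have tau2 : tau ^+ 2 = 1 - X2 by rewrite sqr_sqrtr // subr_ge0.
(* [chi] may have infinite support: its part off [F], divided by its norm [tau], becomes one extra
   basis vector, at index [ord_max]. *)
pose tl i := if i \in F then 0 else chi i.
have htl : has_sum (fun i => (tl i)^* * tl i) (1 - X2)%:C.
  have h1 := @has_sum_fin R _ (fun i => if i \in F then (chi i)^* * chi i else 0) F.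
  have := has_sum_lin (-1) (h1 _) hchi.
  have -> : -1 * (\sum_(i <- F) (if i \in F then (chi i)^* * chi i else 0)) + 1 = (1 - X2)%:C.
    rewrite rmorphB rmorph1 /X2 rmorph_sum /= addrC mulN1r; congr (_ - _).
    by rewrite big_seq [RHS]big_seq; apply: eq_bigr => i ->; rewrite mulJc.
  move=> h2; apply: has_sum_ext (h2 _) => [i|i /negPf -> //].
  rewrite /tl; case: (i \in F); rewrite ?mulN1r ?addNr ?rmorph0 ?mul0r //.
  by rewrite oppr0 add0r.
pose u (a : 'I_n.+1) i : C :=
  if unlift ord_max a is Some a' then (i == e a')%:R else tl i * (tau^-1)%:C.
pose p (a : 'I_n.+1) := (unlift ord_max a == None) ==> (tau != 0).
have gram a b : has_sum (fun l => (u a l)^* * u b l) ((a == b) && p a)%:R.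
  rewrite /u /p; case: (unliftP ord_max a) => [a'|] -> ;
    case: (unliftP ord_max b) => [b'|] ->; rewrite /= ?andbT.
  - rewrite (inj_eq lift_inj).
    have := @has_sum_fin R _ (fun l => ((l == e a')%:R : C)^* * (l == e b')%:R) [fset e a'].
    rewrite big_seq_fset1 eqxx rmorph1 mul1r (inj_eq einj); apply => l.
    by rewrite !inE => /negPf ->; rewrite rmorph0 mul0r.
  - rewrite eq_sym (negPf (neq_lift _ _)) /=.
    apply: has_sum_ext (has_sum0 _) => l; case: eqP => [->|_]; last by rewrite rmorph0 mul0r.
    by rewrite /tl (_ : e a' \in F) ?mul0r ?mulr0 // mem_tnth.
  - rewrite (negPf (neq_lift _ _)) /=.
    apply: has_sum_ext (has_sum0 _) => l; case: eqP => [->|_]; last by rewrite mulr0.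
    by rewrite /tl (_ : e b' \in F) ?mul0r ?rmorph0 ?mul0r // mem_tnth.
  - rewrite eqxx /=; have := has_sumZ (tau^-1 ^+ 2)%:C htl.
    rewrite -tau2 -rmorphM /= -exprMn.
    have -> : ((tau^-1 * tau) ^+ 2)%:C = (tau != 0)%:R.
      have [->|tau0] := eqVneq tau 0; first by rewrite mulr0 expr0n.
      by rewrite mulVf // expr1n.
    by apply: has_sum_ext => l; rewrite rmorphXn rmorphM /= conjcRe; ring.
pose ext (v : I -> C) (w : C) (a : 'I_n.+1) :=
  if unlift ord_max a is Some a' then v (e a') else w.
(* The fourth root of [eta]: scaling [A] by [x] and [B] by its inverse makes both squared norms of
   order [sqrt eta]. *)
pose x := Num.sqrt (Num.sqrt eta).
have x0 : 0 < x by rewrite !sqrtr_gt0.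
have x2 : x ^+ 2 = Num.sqrt eta by rewrite sqr_sqrtr ?sqrtr_ge0.
have x4 : x ^+ 2 * x ^+ 2 = eta by rewrite x2 -expr2 sqr_sqrtr // ltW.
pose Av := fun i => t * g i + chi i.
pose Bv := fun i => t * g i - chi i.
pose A := ext Av tau%:C. pose B := ext Bv (- tau%:C).
pose D := ext (fun i => (i == e0)%:R) 0.
pose c (j : 'I_3) : R := if j == 0 :> nat then 4^-1 else if j == 1%N :> nat then - 4^-1 else 1 - G2.
pose a (j : 'I_3) k := if j == 0 :> nat then x%:C * A k + (x^-1)%:C * B k
  else if j == 1%N :> nat then x%:C * A k - (x^-1)%:C * B k else D k.
have ap j k : ~~ p k -> a j k = 0.
  rewrite /p /a /A /B /D /ext; case: (unliftP ord_max k) => //= _.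
  rewrite negbK => /eqP ->; rewrite oppr0 mulr0 mulr0 addr0 subr0.
  by case: eqP => // _; case: eqP.
have [s sle hs] := has_trace_norm_sum gram c ap.
apply: (@le_trans _ _ s%:E).
  apply: ereal_inf_lbound; exists s => //; move: hs; congr has_trace_norm.
  apply: funext => i; apply: funext => j.
  pose V (v : 'I_n.+1 -> C) i := \sum_k v k * u k i.
  have tl0 l : tau = 0 -> tl l = 0.
    move=> tau0; have tl_ge0 i' : 0 <= (tl i')^* * tl i' by rewrite mulrC mul_conjC_ge0.
    have [_ /(_ [fset l])] := has_sum_ge0 tl_ge0 htl.
    rewrite big_seq_fset1 mulJc -tau2 tau0 expr0n /= => h.
    by apply: eq0_normc; apply/eqP; rewrite -sqrf_eq0 eq_le sqr_ge0 andbT.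
  have VE v w l : V (ext v (w * tau%:C)) l = (if l \in F then v l else 0) + w * tl l.
    rewrite /V /ext (bigD1 ord_max) //= unlift_none /= addrC; congr (_ + _); last first.
      rewrite /u unlift_none; have [tau0|tau0] := eqVneq tau 0.
        by rewrite tl0 // mul0r !mulr0.
      rewrite -mulrA [tau%:C * _]mulrCA -rmorphM /= divff //.
      by rewrite mulr1.
    transitivity (\sum_a v (e a) * (l == e a)%:R).
      rewrite (reindex_omap (lift ord_max) (unlift ord_max)) /=; last first.
        by move=> k; case: unliftP => [k'|] -> //=; rewrite eqxx.
      apply: eq_big => [k|k _]; first by rewrite liftK eqxx eq_sym neq_lift.
      by rewrite /u liftK.
    have [lF|lF] := boolP (l \in F); last first.
      apply: big1 => k _; case: eqP => [le|_]; last by rewrite mulr0.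
      by move: lF; rewrite le mem_tnth.
    have [k lk] : exists k, l = e k by apply/tnthP.
    rewrite (bigD1 k) //= -lk eqxx mulr1 big1 ?addr0 // => k' kk.
    by rewrite lk (inj_eq einj) eq_sym (negPf kk) mulr0.
  have VA l : V A l = t * g l + chi l.
    rewrite /A -[tau%:C]mul1r VE /Av /tl mul1r.
    by have [lF|lF] := boolP (l \in F); rewrite ?addr0 // gF // mulr0.
  have VB l : V B l = t * g l - chi l.
    rewrite /B -[- tau%:C]mulN1r VE /Bv /tl mulN1r.
    by have [lF|lF] := boolP (l \in F); rewrite ?oppr0 ?addr0 // gF // mulr0.
  have VD l : V D l = (l == e0)%:R.
    rewrite /D -[0](mul0r tau%:C) VE mul0r addr0.
    by have [lF|lF] := boolP (l \in F) => //; case: eqP lF => // ->; rewrite e0F.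
  transitivity (\sum_m (c m)%:C * (V (a m) i * (V (a m) j)^*)).
    rewrite /sandwich.
    transitivity (\sum_k \sum_l \sum_m (c m)%:C * ((a m k * u k i) * (a m l * u l j)^*)).
      apply: eq_bigr => k _; apply: eq_bigr => l _; rewrite mxE mulr_suml.
      by apply: eq_bigr => m _; rewrite rmorphM /=; ring.
    under eq_bigr => k _ do rewrite exchange_big.
    rewrite exchange_big; apply: eq_bigr => m _ /=.
    rewrite /V rmorph_sum mulr_suml mulr_sumr; apply: eq_bigr => k _.
    by rewrite !mulr_sumr.
  rewrite big_ord3 /c /a /=.
  have Vp l (y1 y2 : C) : V (fun k => y1 * A k + y2 * B k) l = y1 * V A l + y2 * V B l.
    rewrite /V !mulr_sumr -big_split; apply: eq_bigr => k _ /=; ring.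
  have Vm l (y1 y2 : C) : V (fun k => y1 * A k - y2 * B k) l = y1 * V A l - y2 * V B l.
    rewrite /V !mulr_sumr -sumrB; apply: eq_bigr => k _ /=; ring.
  rewrite !Vp !Vm (VD i) (VD j) !VA !VB.
  rewrite !(rmorphD, rmorphB, rmorphN, rmorphM) /= !conjcRe !rmorph_nat.
  have tt : t * t^* = 1 by rewrite mulrC mulJc t1 expr1n.
  have xx : x%:C * (x^-1)%:C = 1 by rewrite -rmorphM /= divff ?gt_eqF.
  have c4 : (4^-1)%:C * 4 = 1 :> C.
    by rewrite -(rmorph_nat (real_complex R)) -rmorphM /= mulVf.
  have -> : g i * (g j)^* = (t * t^*) * (g i * (g j)^*) by rewrite tt mul1r.
  move: tt xx c4; set y := (x^-1)%:C; set q := (4^-1)%:C => tt xx c4.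
  transitivity (q * 4 * (x%:C * y) * (t * t^* * (g i * (g j)^*) - chi i * (chi j)^*)
     + (1 - G2)%:C * ((i == e0)%:R * (j == e0)%:R)).
    rewrite rmorphB rmorph1; ring.
  by rewrite c4 xx rmorphB rmorph1; ring.
rewrite lee_fin; apply: le_trans sle _.
rewrite big_ord3 /c /a /=.
have sumext v w : \sum_k normc (ext v w k) ^+ 2 = \sum_(i <- F) normc (v i) ^+ 2 + normc w ^+ 2.
  rewrite (bigD1 ord_max) //= /ext unlift_none addrC; congr (_ + _).
  rewrite sum_tnth (reindex_omap (lift ord_max) (unlift ord_max)) /=; last first.
    by move=> k; case: unliftP => [k'|] -> //=; rewrite eqxx.
  apply: eq_big => [k|k _]; first by rewrite liftK eqxx eq_sym neq_lift.
  by rewrite liftK.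
have SD : \sum_k normc (D k) ^+ 2 = 1.
  rewrite /D sumext normc0 expr0n addr0 (bigD1_seq e0) ?fset_uniq //= eqxx normc1.
  by rewrite expr1n big1 ?addr0 // => k /negPf ->; rewrite normc0 expr0n.
have ABpar (v w : C) : normc (v + w) ^+ 2 + normc (v - w) ^+ 2 = 2 * (normc v ^+ 2 + normc w ^+ 2).
  by have := parallelogram v w 1 1; rewrite !mul1r expr1n !mul1r.
have tg k : normc (t * g k) ^+ 2 = normc (g k) ^+ 2 by rewrite normcM t1 mul1r.
have SAB : \sum_k normc (A k) ^+ 2 + \sum_k normc (B k) ^+ 2 = 2 * (G2 + 1).
  rewrite /A /B !sumext normcN normcR (ger0_norm (sqrtr_ge0 _)) -/tau tau2.
  rewrite addrACA -big_split /=; under eq_bigr => k _ do rewrite ABpar tg.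
  by rewrite -mulr_sumr big_split /= -/G2 -/X2; ring.
have SB : \sum_k normc (B k) ^+ 2 = G2 + 1 - 2 * normc z.
  rewrite /B sumext normcN normcR (ger0_norm (sqrtr_ge0 _)) -/tau tau2.
  have -> : normc z = Re (\sum_(i <- F) (chi i)^* * (t * g i)).
    rewrite -[normc z]/(Re (normc z)%:C) -tz mulr_sumr; congr Re.
    by apply: eq_bigr => k _; ring.
  have -> : \sum_(i <- F) normc (Bv i) ^+ 2 =
     \sum_(i <- F) (normc (g i) ^+ 2 + normc (chi i) ^+ 2 - 2 * Re ((chi i)^* * (t * g i))).
    apply: eq_bigr => k _; rewrite -tg /Bv !sqr_normcE.
    by rewrite !(ReD, ImD, ReN, ImN, ReM (_^*), ReJ, ImJ); ring.
  rewrite sumrB big_split /= -mulr_sumr -Re_sum -/G2 -/X2; ring.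
have zG : normc z ^+ 2 <= G2.
  apply: le_trans (CS_normc _ _ _) _.
  have -> : \sum_(i <- F) normc (chi i)^* ^+ 2 = X2 by under eq_bigr => k _ do rewrite normcJ.
  by rewrite -/G2 ler_piMl // sumr_ge0 // => k _; exact: sqr_ge0.
have q4 : `|4^-1 : R| = 4^-1 by rewrite ger0_norm.
rewrite normrN q4 (ger0_norm (_ : 0 <= 1 - G2)) ?subr_ge0 // SD mulr1 addrA -mulrDr.
rewrite -big_split /=; under eq_bigr => k _ do rewrite parallelogram.
rewrite -mulr_sumr big_split /= -!mulr_sumr exprVn.
have SB0 : 0 <= \sum_k normc (B k) ^+ 2 by apply: sumr_ge0 => k _; exact: sqr_ge0.
have SA4 : \sum_k normc (A k) ^+ 2 <= 4 by lra.
have SB2 : \sum_k normc (B k) ^+ 2 <= 2 * eta by lra.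
have h1 : x ^+ 2 * \sum_k normc (A k) ^+ 2 <= x ^+ 2 * 4 by apply: ler_wpM2l => //; exact: sqr_ge0.
have h2 : x ^- 2 * \sum_k normc (B k) ^+ 2 <= 2 * x ^+ 2.
  rewrite mulrC ler_pdivrMr ?exprn_gt0 // -mulrA x4 //.
have h3 : 1 - G2 <= 2 * eta.
  have : (1 - eta) ^+ 2 <= normc z ^+ 2.
    by rewrite lerXn2r ?nnegrE ?normc_ge0 // subr_ge0.
  move: zG; have := sqr_ge0 eta; rewrite sqrrB expr1n mul1r mulr2n; lra.
have h4 : eta <= x ^+ 2.
  rewrite -x4 ler_piMr ?sqr_ge0 // x2.
  by rewrite -sqrtr1 ler_wsqrtr.
rewrite -x2; move: h1 h2.
set U1 := _ * \sum_k _; set U2 := x ^- 2 * _; lra.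
Qed.
End PureModels.
End GeneralChannel.

Section Deficiency.
Context {R : realType}.
Local Notation C := R[i].
Local Notation Re := complex.Re.
Local Notation Im := complex.Im.

(** A contraction with large overlaps suffices: the mass that it loses on [psi t] is itself
    controlled by [eta], because a small loss of overlap bounds it. *)
Lemma deficiency_pure (H1 H2 : hilbert R) (Theta : Type) (B : set Theta)
    (psi : Theta -> hidx H1 -> C) (chi : Theta -> hidx H2 -> C)
    (F1 : {fset hidx H1}) (F2 : {fset hidx H2})
    (W : hidx H2 -> hidx H1 -> C) (e0 : hidx H2) (eta : R) :
  (forall i j, i \notin F2 -> W i j = 0) ->
  (forall v : hidx H1 -> C,
    \sum_(i <- F2) normc (\sum_(j <- F1) W i j * v j) ^+ 2 <=
    \sum_(j <- F1) normc (v j) ^+ 2) ->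
  (forall (a : C) (f g : hidx H2 -> C),
    hsub f -> hsub g -> hsub (fun i => a * f i + g i)) ->
  (forall j, hsub (fun i => W i j)) ->
  hsub (fun i : hidx H2 => (i == e0)%:R) -> e0 \in F2 ->
  0 < eta -> eta <= 1 ->
  (forall t, B t -> has_sum (fun i => (psi t i)^* * psi t i) 1) ->
  (forall t, B t -> has_sum (fun i => (chi t i)^* * chi t i) 1) ->
  (forall t, B t -> 1 - eta <=
    normc (\sum_(i <- F2) (chi t i)^* * \sum_(j <- F1) W i j * psi t j)) ->
  (deficiency (H1 := H1) (H2 := H2) B (fun t => projector (psi t))
     (fun t => projector (chi t)) <= (5 * Num.sqrt eta)%:E)%E.
Proof.
move=> WF2 W1 hlin hW he e0F eta0 eta1 hpsi hchi hov.
pose T := compress_prepare F1 F2 W e0.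
apply: (@le_trans _ _ (ereal_sup [set trace_norm
  (fun i j => (T (projector (psi t)) i j - projector (chi t) i j)%R) | t in B])).
  apply: ereal_inf_lbound; exists T => //.
  exact: compress_prepare_channel.
apply: ub_ereal_sup => _ [t Bt <-].
pose g i := \sum_(j <- F1) W i j * psi t j.
have g1 : \sum_(i <- F2) normc (g i) ^+ 2 <= 1.
  apply: le_trans (W1 _) _.
  have psi0 i : 0 <= (psi t i)^* * psi t i by rewrite mulrC mul_conjC_ge0.
  have [_ /(_ F1)] := has_sum_ge0 psi0 (hpsi t Bt).
  by rewrite Re_sum; congr (_ <= _); apply: eq_bigr => i _; rewrite mulJc.
have gF i : i \notin F2 -> g i = 0.
  by move=> /WF2 h; rewrite /g big1 // => j _; rewrite h mul0r.
have := trace_norm_pure eta0 eta1 e0F gF (hchi t Bt) g1 (hov t Bt).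
congr (_ <= _)%E; congr trace_norm; apply: funext => i; apply: funext => j.
rewrite /T /compress_prepare /projector ?conjcE; congr (_ + _ * _ - _).
  rewrite /g rmorph_sum mulr_suml; apply: eq_bigr => p _ /=.
  by rewrite mulr_sumr; apply: eq_bigr => q _; rewrite rmorphM /=; ring.
rewrite (@op_traceE R _ _ 1); last first.
  by apply: has_sum_ext (hpsi t Bt) => p; rewrite mulrC.
rewrite rmorphB rmorph1 rmorph_sum /=; congr (_ - _).
transitivity (\sum_(i <- F2) \sum_(p <- F1) \sum_(q <- F1)
   W i p * (W i q)^* * (psi t p * (psi t q)^*)); last first.
  rewrite exchange_big; apply: eq_bigr => p _ /=.
  rewrite exchange_big; apply: eq_bigr => q _ /=.
  by rewrite mulr_suml.
apply: eq_bigr => l _; rewrite -mulJc /g rmorph_sum mulr_suml exchange_big.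
apply: eq_bigr => p _ /=; rewrite mulr_sumr; apply: eq_bigr => q _.
by rewrite rmorphM /=; ring.
Qed.

Lemma trace_norm_ge0 (I : choiceType) (X : I -> I -> C) : (0 <= trace_norm X)%E.
Proof.
apply: le_ereal_inf_tmp => _ [t [P [hP _] ht] <-]; rewrite lee_fin.
have [_ /(_ fset0)] := has_sum_ge0 (fun i => psd_diag_ge0 i hP) ht.
by rewrite big_seq_fset0.
Qed.

(** The witness [Bt] matters: over an empty parameter set the supremum would be [-oo]. *)
Lemma le_cam_ge0 (H1 H2 : hilbert R) (Theta : Type) (B : set Theta) t
    (Q : Theta -> hidx H1 -> hidx H1 -> C) (G : Theta -> hidx H2 -> hidx H2 -> C) :
  B t -> (0 <= le_cam (H1 := H1) (H2 := H2) B Q G)%E.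
Proof.
move=> Bt; rewrite /le_cam le_max; apply/orP; left.
apply: le_ereal_inf_tmp => _ [T _ <-].
apply: le_trans (trace_norm_ge0 _) _; apply: ereal_sup_ubound.
by exists t.
Qed.

End Deficiency.

(** * Transporting a frame between families with close Gram matrices *)

Section FrameOperator.
Context {R : realType}.
Local Notation C := R[i].
Local Notation Re := complex.Re.
Local Notation Im := complex.Im.

(** With [y] the image of [u] under the adjoint, [N = |y|^2] is also the pairing of [W y] with [u].
    Cauchy-Schwarz gives [N^2 <= b N U], and [N] cancels. *)
Lemma adjoint_bound (I1 I2 : Type) (F1 : seq I1) (F2 : seq I2)
    (W : I2 -> I1 -> C) (b : R) : 0 <= b ->
  (forall v : I1 -> C,
    \sum_(i <- F2) normc (\sum_(j <- F1) W i j * v j) ^+ 2 <=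
    b * \sum_(j <- F1) normc (v j) ^+ 2) ->
  forall u : I2 -> C,
    \sum_(j <- F1) normc (\sum_(i <- F2) (W i j)^* * u i) ^+ 2 <=
    b * \sum_(i <- F2) normc (u i) ^+ 2.
Proof.
move=> b0 hW u; pose y j := \sum_(i <- F2) (W i j)^* * u i.
set N := \sum_(j <- F1) _; set U := \sum_(i <- F2) _.
have U0 : 0 <= U by apply: sumr_ge0 => i _; exact: sqr_ge0.
have N0 : 0 <= N by apply: sumr_ge0 => i _; exact: sqr_ge0.
have NE : N = normc (\sum_(i <- F2) (\sum_(j <- F1) W i j * y j)^* * u i).
  have -> : \sum_(i <- F2) (\sum_(j <- F1) W i j * y j)^* * u i = N%:C.
    rewrite /N rmorph_sum /=.
    under eq_bigr => i _ do rewrite rmorph_sum mulr_suml.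
    rewrite exchange_big; apply: eq_bigr => j _ /=.
    rewrite -mulJc -/(y j) /= [X in _ = _ * X]/y mulr_sumr; apply: eq_bigr => i _.
    by rewrite rmorphM /=; ring.
  by rewrite normcR ger0_norm.
have : N ^+ 2 <= b * N * U.
  rewrite {1}NE; apply: le_trans (CS_normc _ _ _) _; apply: ler_wpM2r => //.
  by under eq_bigr => i _ do rewrite normcJ; exact: hW.
have [->|N1] := eqVneq N 0; first by rewrite mulr_ge0.
by rewrite mulrAC expr2 ler_pM2r // lt_neqAle eq_sym N1.
Qed.

Lemma CS_weight (J : finType) (w : J -> R) (a : J -> C) :
  (forall j, 0 <= w j) ->
  (\sum_j w j * normc (a j)) ^+ 2 <= (\sum_j w j) * \sum_j w j * normc (a j) ^+ 2.
Proof.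
move=> w0; have := CS_sum (index_enum J) (fun j => Num.sqrt (w j))
  (fun j => Num.sqrt (w j) * normc (a j)).
have -> : \sum_j Num.sqrt (w j) * (Num.sqrt (w j) * normc (a j)) =
    \sum_j w j * normc (a j).
  by apply: eq_bigr => j _; rewrite mulrA -expr2 sqr_sqrtr.
have -> : \sum_j Num.sqrt (w j) ^+ 2 = \sum_j w j.
  by apply: eq_bigr => j _; rewrite sqr_sqrtr.
suff -> : \sum_j (Num.sqrt (w j) * normc (a j)) ^+ 2 = \sum_j w j * normc (a j) ^+ 2 by [].
by apply: eq_bigr => j _; rewrite exprMn sqr_sqrtr.
Qed.

Variables (T I : Type) (E : seq T) (F : seq I) (J : finType) (w : J -> R).
Variables (psi : J -> T -> C) (Q : J -> I -> C) (s eps : R).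
Hypothesis w0 : forall j, 0 <= w j.
Hypothesis s0 : 0 <= s.
Hypothesis eps0 : 0 <= eps.
Hypothesis gram_close : forall i j,
  normc (\sum_(p <- E) (psi i p)^* * psi j p - \sum_(x <- F) (Q i x)^* * Q j x) <= eps.
Hypothesis frame_le : forall u : I -> C,
  \sum_j w j * normc (\sum_(x <- F) (Q j x)^* * u x) ^+ 2 <=
  s * \sum_(x <- F) normc (u x) ^+ 2.

(** The operator [sum_j w_j |Q_j><psi_j|]. If the two Gram matrices were equal, it would send
    [psi i] to the frame operator of [Q] applied to [Q i]. *)
Definition transfer (x : I) (p : T) : C :=
  \sum_j (w j)%:C * (Q j x * (psi j p)^*).

(** The left side is a quadratic form in the Gram matrix of [psi]. With that of [Q] instead it is
    [|S u|^2], [S] being the frame operator, at most [s^2 |u|^2]. The exchange costs [eps] times the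
    square of [sum w |a|], which the weighted Cauchy-Schwarz inequality and the frame bound
    control. *)
Lemma transfer_adjoint_bound (u : I -> C) :
  \sum_(p <- E) normc (\sum_(x <- F) (transfer x p)^* * u x) ^+ 2 <=
  (s ^+ 2 + eps * (\sum_j w j) * s) * \sum_(x <- F) normc (u x) ^+ 2.
Proof.
set U := \sum_(x <- F) _; set Om := \sum_j w j.
have U0 : 0 <= U by apply: sumr_ge0 => i _; exact: sqr_ge0.
have Om0 : 0 <= Om by apply: sumr_ge0 => i _; exact: w0.
pose a j := \sum_(x <- F) (Q j x)^* * u x.
pose Su x := \sum_j (w j)%:C * (a j * Q j x).
have yE p : \sum_(x <- F) (transfer x p)^* * u x = \sum_j (w j)%:C * (a j * psi j p).
  rewrite /transfer; under eq_bigr => x _ do rewrite rmorph_sum mulr_suml.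
  rewrite exchange_big; apply: eq_bigr => j _ /=.
  rewrite /a mulr_suml mulr_sumr; apply: eq_bigr => x _.
  by rewrite !rmorphM /= conjCK conjcRe; ring.
have quad (X : Type) (r : seq X) (f : J -> X -> C) :
    (\sum_(x <- r) normc (\sum_j (w j)%:C * (a j * f j x)) ^+ 2)%:C =
    \sum_i \sum_j (w i)%:C * (w j)%:C * ((a i)^* * a j) * \sum_(x <- r) (f i x)^* * f j x.
  rewrite rmorph_sum /=.
  transitivity (\sum_(x <- r) \sum_i \sum_j (w i)%:C * (w j)%:C * ((a i)^* * a j) * ((f i x)^* * f j x)).
    apply: eq_bigr => x _; rewrite -mulJc rmorph_sum mulr_suml; apply: eq_bigr => i _ /=.
    rewrite mulr_sumr; apply: eq_bigr => j _; rewrite !rmorphM /= conjcRe; ring.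
  rewrite exchange_big; apply: eq_bigr => i _ /=; rewrite exchange_big /=.
  by apply: eq_bigr => j _; rewrite [RHS]mulr_sumr.
under eq_bigr => p _ do rewrite yE.
have frA : \sum_j w j * normc (a j) ^+ 2 <= s * U by exact: frame_le.
(* [N = |S u|^2] is the frame form paired on [S u] and [u]. Bounding it by the two frame sums and
   cancelling [N] avoids any spectral theory of [S]. *)
have SuU : \sum_(x <- F) normc (Su x) ^+ 2 <= s ^+ 2 * U.
  set N := \sum_(x <- F) _.
  have N0 : 0 <= N by apply: sumr_ge0 => i _; exact: sqr_ge0.
  pose b j := \sum_(x <- F) (Q j x)^* * Su x.
  have frB : \sum_j w j * normc (b j) ^+ 2 <= s * N by exact: frame_le.
  have NE : N = normc (\sum_j (w j)%:C * ((b j)^* * a j)).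
    have -> : \sum_j (w j)%:C * ((b j)^* * a j) = N%:C.
      rewrite /N rmorph_sum /=.
      transitivity (\sum_j \sum_(x <- F) (Su x)^* * ((w j)%:C * (a j * Q j x))).
        apply: eq_bigr => j _; rewrite /b rmorph_sum mulr_suml mulr_sumr.
        by apply: eq_bigr => x _; rewrite rmorphM /= conjCK; ring.
      rewrite exchange_big; apply: eq_bigr => x _ /=.
      by rewrite -mulr_sumr mulJc.
    by rewrite normcR ger0_norm.
  have : N ^+ 2 <= (s * N) * (s * U).
    have h1 : N <= \sum_j (Num.sqrt (w j) * normc (b j)) * (Num.sqrt (w j) * normc (a j)).
      rewrite {1}NE; apply: le_trans (normc_sum _ _ _) _; apply: ler_sum => j _.
      rewrite !normcM normcR ger0_norm // normcJ mulrACA -expr2 sqr_sqrtr //.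
    apply: (@le_trans _ _ ((\sum_j (Num.sqrt (w j) * normc (b j)) * (Num.sqrt (w j) * normc (a j))) ^+ 2)).
      by rewrite lerXn2r ?nnegrE // (le_trans N0).
    apply: le_trans (CS_sum _ _ _) _; apply: ler_pM.
    - by apply: sumr_ge0 => ? _; exact: sqr_ge0.
    - by apply: sumr_ge0 => ? _; exact: sqr_ge0.
    - by under eq_bigr => j _ do rewrite exprMn sqr_sqrtr //.
    - by under eq_bigr => j _ do rewrite exprMn sqr_sqrtr //.
  have [->|N1] := eqVneq N 0; first by rewrite mulr_ge0 ?sqr_ge0.
  have N2 : 0 < N by rewrite lt_neqAle eq_sym N1.
  have -> : s * N * (s * U) = N * (s ^+ 2 * U) by ring.
  by rewrite expr2 ler_pM2l.
have err : normc (\sum_i \sum_j (w i)%:C * (w j)%:C * ((a i)^* * a j) *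
    (\sum_(p <- E) (psi i p)^* * psi j p - \sum_(x <- F) (Q i x)^* * Q j x)) <=
    eps * Om * s * U.
  apply: (@le_trans _ _ (\sum_i \sum_j (w i * normc (a i)) * (w j * normc (a j)) * eps)).
    apply: le_trans (normc_sum _ _ _) _; apply: ler_sum => i _.
    apply: le_trans (normc_sum _ _ _) _; apply: ler_sum => j _.
    rewrite !normcM !normcR !ger0_norm // normcJ.
    rewrite [w i * w j * _]mulrACA; apply: ler_wpM2l => //.
    by rewrite !mulr_ge0 ?normc_ge0.
  have -> : \sum_i \sum_j w i * normc (a i) * (w j * normc (a j)) * eps =
      eps * (\sum_j w j * normc (a j)) ^+ 2.
    rewrite expr2 mulr_suml mulr_sumr; apply: eq_bigr => i _.
    by rewrite !mulr_sumr; apply: eq_bigr => j _; ring.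
  rewrite -!mulrA; apply: ler_wpM2l => //; apply: le_trans (CS_weight _ w0) _.
  exact: ler_wpM2l.
rewrite -[leLHS]/(Re (\sum_(p <- E) normc (\sum_j (w j)%:C * (a j * psi j p)) ^+ 2)%:C).
rewrite quad.
have -> : \sum_i \sum_j (w i)%:C * (w j)%:C * ((a i)^* * a j) * (\sum_(x <- E) (psi i x)^* * psi j x) =
  (\sum_(x <- F) normc (Su x) ^+ 2)%:C +
  \sum_i \sum_j (w i)%:C * (w j)%:C * ((a i)^* * a j) *
    (\sum_(p <- E) (psi i p)^* * psi j p - \sum_(x <- F) (Q i x)^* * Q j x).
  rewrite quad -big_split; apply: eq_bigr => i _ /=; rewrite -big_split.
  by apply: eq_bigr => j _ /=; ring.
rewrite ReD mulrDl; apply: lerD => //.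
by apply: le_trans (ler_norm _) _; apply: le_trans (normc_Re _) _; exact: err.
Qed.

(** The overlap is the frame sum of [c], which [hc] makes close to 1, plus a term linear in the Gram
    errors; Cauchy-Schwarz in the weights bounds the latter. *)
Lemma transfer_overlap (eta : R) (phi : T -> C) (c : I -> C) :
  (forall j, normc (\sum_(p <- E) (psi j p)^* * phi p - \sum_(x <- F) (Q j x)^* * c x) <= eps) ->
  \sum_(x <- F) normc (c x) ^+ 2 <= 1 ->
  1 - eta <= \sum_j w j * normc (\sum_(x <- F) (Q j x)^* * c x) ^+ 2 ->
  1 - eta - eps * Num.sqrt ((\sum_j w j) * s) <=
  normc (\sum_(x <- F) (c x)^* * \sum_(p <- E) transfer x p * phi p).
Proof.
move=> hphi c1 hc.
have Om0 : 0 <= \sum_j w j by apply: sumr_ge0 => i _; exact: w0.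
pose a j := \sum_(x <- F) (Q j x)^* * c x.
have -> : \sum_(x <- F) (c x)^* * (\sum_(p <- E) transfer x p * phi p) =
    (\sum_j w j * normc (a j) ^+ 2)%:C +
    \sum_j (w j)%:C * (a j)^* * (\sum_(p <- E) (psi j p)^* * phi p - a j).
  transitivity (\sum_j (w j)%:C * (a j)^* * \sum_(p <- E) (psi j p)^* * phi p).
    transitivity (\sum_(x <- F) \sum_j (w j)%:C * ((c x)^* * Q j x) * \sum_(p <- E) (psi j p)^* * phi p).
      apply: eq_bigr => x _; rewrite mulr_sumr /transfer.
      under [RHS]eq_bigr => j _ do rewrite mulr_sumr.
      rewrite [RHS]exchange_big; apply: eq_bigr => p _ /=.
      by rewrite mulr_suml mulr_sumr; apply: eq_bigr => j _; ring.
    rewrite exchange_big; apply: eq_bigr => j _ /=.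
    rewrite -mulr_suml; congr (_ * _); rewrite /a rmorph_sum mulr_sumr.
    by apply: eq_bigr => x _; rewrite rmorphM /= conjCK; ring.
  rewrite rmorph_sum -big_split; apply: eq_bigr => j _ /=.
  by rewrite rmorphM /= -mulJc; ring.
set X := (\sum_j w j * _)%:C; set Y := \sum_j (_ * _).
have hY : normc Y <= eps * Num.sqrt ((\sum_j w j) * s).
  apply: (@le_trans _ _ (eps * \sum_j w j * normc (a j))).
    apply: le_trans (normc_sum _ _ _) _; rewrite mulr_sumr; apply: ler_sum => j _.
    rewrite !normcM normcR ger0_norm // normcJ [leRHS]mulrC.
    by apply: ler_wpM2l; [rewrite mulr_ge0 ?normc_ge0|exact: hphi].
  apply: ler_wpM2l => //.
  have S0 : 0 <= \sum_j w j * normc (a j) by apply: sumr_ge0 => j _; rewrite mulr_ge0 ?normc_ge0.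
  rewrite -(ger0_norm S0) -sqrtr_sqr; apply: ler_wsqrtr.
  apply: le_trans (CS_weight _ w0) _; apply: ler_wpM2l => //.
  by apply: le_trans (frame_le _) _; rewrite ler_piMr.
have XE : normc X = \sum_j w j * normc (a j) ^+ 2.
  by rewrite /X normcR ger0_norm // sumr_ge0 // => j _; rewrite mulr_ge0 ?sqr_ge0.
have : normc X <= normc (X + Y) + normc Y.
  by rewrite -[X in normc X <= _](addrK Y) (le_trans (normcD _ _))// normcN.
rewrite XE; move: hc hY; rewrite -/(a _); set A := \sum_j w j * _ ^+ 2.
set Z := eps * _; lra.
Qed.

End FrameOperator.

(** * A finite frame of coherent states *)

Section PoissonWeights.
Context {R : realType}.
Implicit Types (s x : R).

Definition pois (k : nat) (s : R) : R := (k`!%:R)^-1 * (s ^+ k * expR (- s)).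

Lemma is_derive_expRN s : is_derive s 1 (fun s => expR (- s) : R) (- expR (- s)).
Proof.
have h := is_derive1_comp (is_derive_expR (- s)) (is_deriveN (is_derive_id s 1)).
by apply: is_derive_eq; rewrite mulrN1.
Qed.

Lemma is_derive_pois0 s : is_derive s 1 (pois 0) (- pois 0 s).
Proof.
have -> : pois 0 = (fun s => expR (- s)).
  by apply: funext => y; rewrite /pois fact0 invr1 expr0 !mul1r.
exact: is_derive_expRN.
Qed.

Lemma is_derive_poisS k s : is_derive s 1 (pois k.+1) (pois k s - pois k.+1 s).
Proof.
have h1 : is_derive s 1 (fun s : R => s ^+ k.+1) (k.+1%:R * s ^+ k).
  have h := is_deriveX k.+1 (is_derive_id s (1 : R)).
  have -> : (fun s : R => s ^+ k.+1) = (id : R -> R) ^+ k.+1.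
    by apply: funext => y; rewrite exprfctE.
  by apply: is_derive_eq; rewrite /GRing.scale /= mulr1.
have h2 := is_deriveM h1 (is_derive_expRN s).
have h3 := is_deriveZ ((k.+1)`!%:R)^-1 h2.
apply: is_derive_eq.
rewrite /pois /GRing.scale /= factS natrM invfM.
have k0 : k.+1%:R != 0 :> R by rewrite pnatr_eq0.
have -> : forall u f E X : R, u / f * (s ^+ k.+1 * - E + E * (X * s ^+ k)) =
    u * X * (f^-1 * (s ^+ k * E)) - u / f * (s ^+ k.+1 * E) by move=> u f E X; ring.
by rewrite mulVf // mul1r.
Qed.

Lemma expR_partial x M : 0 <= x -> \sum_(m < M) x ^+ m / m`!%:R <= expR x.
Proof.
move=> x0; have := @is_cvg_series_exp_coeff R x => cv.
have -> : \sum_(m < M) x ^+ m / m`!%:R = series (exp_coeff x) M.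
  by rewrite /series /= big_mkord; apply: eq_bigr => i _; rewrite /exp_coeff.
rewrite /expR; apply: nondecreasing_cvgn_le => //.
apply/nondecreasing_seqP => n; rewrite /series /= big_nat_recr //= lerDl.
exact: exp_coeff_ge0.
Qed.

(** For [m >= M] one has [2^(m - M) >= 1], so the tail at [x] is at most [2^-M] times the series at
    [2 x]. *)
Lemma expR_partial_tail x M : 0 <= x ->
  expR x - \sum_(m < M) x ^+ m / m`!%:R <= 2 ^- M * expR (2 * x).
Proof.
move=> x0; rewrite lerBlDr.
have cv := @is_cvg_series_exp_coeff R x.
rewrite {1}/expR; apply: limr_le => //.
near=> N.
have -> : series (exp_coeff x) N = \sum_(m < N) x ^+ m / m`!%:R.
  by rewrite /series /= big_mkord; apply: eq_bigr => i _; rewrite /exp_coeff.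
have MN : (M <= N)%N by near: N; exact: nbhs_infty_ge.
rewrite -!(big_mkord xpredT (fun m => x ^+ m / m`!%:R)).
rewrite (big_cat_nat _ MN) //= addrC lerD2r.
apply: (@le_trans _ _ (2 ^- M * \sum_(M <= i < N) (2 * x) ^+ i / i`!%:R)).
  rewrite mulr_sumr [leLHS]big_nat_cond [leRHS]big_nat_cond; apply: ler_sum => i.
  rewrite andbT => /andP[Mi _].
  have -> : 2 ^- M * ((2 * x) ^+ i / i`!%:R) = 2 ^- M * 2 ^+ i * (x ^+ i / i`!%:R).
    by rewrite exprMn; ring.
  rewrite -[leLHS]mul1r ler_wpM2r //.
    by rewrite mulr_ge0 ?exprn_ge0 ?invr_ge0.
  by rewrite mulrC ler_pdivlMr ?exprn_gt0 // mul1r ler_weXn2l // ler1n.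
rewrite ler_pM2l ?invr_gt0 ?exprn_gt0 //.
apply: le_trans (expR_partial N _); last by rewrite mulr_ge0.
rewrite -(big_mkord xpredT (fun m => (2 * x) ^+ m / m`!%:R)).
rewrite [leRHS](big_cat_nat _ MN) //= lerDr sumr_ge0 // => i _.
by rewrite mulr_ge0 ?invr_ge0 // exprn_ge0 // mulr_ge0.
Unshelve. all: by end_near. Qed.

Lemma pois_ge0 k s : 0 <= s -> 0 <= pois k s.
Proof. by move=> s0; rewrite mulr_ge0 ?invr_ge0 // mulr_ge0 ?exprn_ge0 ?expR_ge0. Qed.

Lemma pois_le1 k s : 0 <= s -> pois k s <= 1.
Proof.
move=> s0; rewrite /pois expRN mulrA ler_pdivrMr ?expR_gt0 // mul1r mulrC.
apply: le_trans (expR_partial k.+1 s0); rewrite big_ord_recr /= lerDr.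
by apply: sumr_ge0 => i _; rewrite mulr_ge0 ?exprn_ge0 ?invr_ge0.
Qed.

(** The primitive of [pois a] that vanishes at 0, that is, the probability that a Poisson variable
    of mean [s] exceeds [a]. It is the radial moment of coherent states cut off at squared modulus
    [s]. *)
Definition poisF (a : nat) (s : R) : R := 1 - \sum_(k < a.+1) pois k s.

Lemma is_derive_poisF a s : is_derive s 1 (poisF a) (pois a s).
Proof.
elim: a => [|a IH].
  have -> : poisF 0 = cst 1 - pois 0.
    by apply: funext => y; rewrite /poisF big_ord_recl big_ord0 addr0.
  have h := is_deriveB (is_derive_cst (1 : R) s 1) (is_derive_pois0 s).
  by apply: is_derive_eq; rewrite sub0r opprK.
have -> : poisF a.+1 = poisF a - pois a.+1.
  by apply: funext => y; rewrite /poisF big_ord_recr /= opprD addrA.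
have h := is_deriveB IH (is_derive_poisS a s).
by apply: is_derive_eq; rewrite opprB addrC subrK.
Qed.

Lemma is_derive_within (f : R -> R) (df : R -> R) (a b : R) :
  (forall x, is_derive x 1 f (df x)) -> {within `[a, b], continuous f}.
Proof.
move=> h; apply: derivable_within_continuous => x _.
exact: (@ex_derive _ _ _ _ _ _ _ (h x)).
Qed.

(** The derivative is a difference of two Poisson weights, or minus a single one for [k = 0], hence
    between -1 and 1. *)
Lemma pois_lip k s t : 0 <= s -> s <= t -> `|pois k t - pois k s| <= t - s.
Proof.
move=> s0 st.
have [df hdf df1] : exists2 df : R -> R, forall x, is_derive x 1 (pois k) (df x) &
    forall x, 0 <= x -> `|df x| <= 1.
  case: k => [|k].
    exists (fun x => - pois 0 x) => [x|x x0]; first exact: is_derive_pois0.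
    by rewrite normrN ger0_norm ?pois_le1 ?pois_ge0.
  exists (fun x => pois k x - pois k.+1 x) => [x|x x0]; first exact: is_derive_poisS.
  have := pois_le1 k x0; have := pois_le1 k.+1 x0.
  have := pois_ge0 k x0; have := pois_ge0 k.+1 x0.
  by rewrite ler_norml; lra.
have [c cst ->] := MVT_segment st (fun x _ => hdf x) (is_derive_within hdf).
rewrite normrM (ger0_norm (_ : 0 <= t - s)) ?subr_ge0 //.
rewrite ler_piMl ?subr_ge0 // df1 //.
by move: cst; rewrite in_itv /= => /andP[sc _]; exact: le_trans sc.
Qed.

Lemma poisF0 a : poisF a 0 = 0.
Proof.
rewrite /poisF big_ord_recl big1 ?addr0.
  by rewrite /pois fact0 invr1 expr0 oppr0 expR0 !mul1r subrr.
by move=> i _; rewrite /pois expr0n /= mul0r mulr0.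
Qed.

Lemma poisF_le1 a s : 0 <= s -> poisF a s <= 1.
Proof. by move=> s0; rewrite /poisF gerBl sumr_ge0 // => i _; exact: pois_ge0. Qed.

(** For [k <= a] one has [s^k <= 2^a (s / 2)^k], so the partial sum is at most [2^a exp(s / 2)]. The
    dependence on [a] is only geometric, which the weights of a coherent state absorb. *)
Lemma poisF_ge a s : 0 <= s -> 1 - 2 ^+ a * expR (- (s / 2)) <= poisF a s.
Proof.
move=> s0; rewrite /poisF lerD2l lerN2.
apply: (@le_trans _ _ (2 ^+ a * \sum_(k < a.+1) (s / 2) ^+ k / k`!%:R * expR (- s))).
  rewrite mulr_sumr; apply: ler_sum => -[k ka] _ /=.
  rewrite /pois exprMn exprVn.
  have -> : (k`!%:R)^-1 * (s ^+ k * expR (- s)) = 1 * (s ^+ k / k`!%:R * expR (- s)) by ring.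
  have -> : 2 ^+ a * (s ^+ k * 2 ^- k / k`!%:R * expR (- s)) =
      2 ^+ a / 2 ^+ k * (s ^+ k / k`!%:R * expR (- s)) by ring.
  apply: ler_wpM2r.
    by rewrite mulr_ge0 ?expR_ge0 // mulr_ge0 ?exprn_ge0 ?invr_ge0.
  by rewrite ler_pdivlMr ?exprn_gt0 // mul1r ler_weXn2l ?ler1n // -ltnS.
rewrite ler_pM2l ?exprn_gt0 // -mulr_suml.
have -> : expR (- (s / 2)) = expR (s / 2) * expR (- s).
  by rewrite -expRD; congr expR; lra.
by rewrite ler_pM2r ?expR_gt0 // expR_partial // divr_ge0.
Qed.

Definition grid_moment (H : nat) (step : R) (a : nat) : R :=
  \sum_(h < H) step * pois a (h%:R * step).

(** Each of the [H] cells costs [step ^+ 2], by the mean value theorem and the Lipschitz constant 1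
    of [pois]. *)
Lemma grid_moment_close H step a : 0 <= step ->
  `|grid_moment H step a - poisF a (H%:R * step)| <= step * (H%:R * step).
Proof.
move=> st0; elim: H => [|H IH].
  by rewrite /grid_moment big_ord0 mul0r poisF0 subrr normr0 mulr0.
rewrite /grid_moment big_ord_recr /= -/(grid_moment H step a).
have Hs0 : 0 <= H%:R * step by rewrite mulr_ge0.
have Hle : H%:R * step <= H.+1%:R * step by rewrite ler_wpM2r // ler_nat.
have [c cin hc] := MVT_segment Hle (fun x _ => is_derive_poisF a x)
  (is_derive_within (is_derive_poisF a)).
have -> : grid_moment H step a + step * pois a (H%:R * step) - poisF a (H.+1%:R * step) =
  (grid_moment H step a - poisF a (H%:R * step)) +
  (step * pois a (H%:R * step) - (poisF a (H.+1%:R * step) - poisF a (H%:R * step))) by ring.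
apply: le_trans (ler_normD _ _) _.
have -> : step * (H.+1%:R * step) = step * (H%:R * step) + step * step.
  by rewrite -natr1; ring.
apply: lerD => //; rewrite hc.
have -> : H.+1%:R * step - H%:R * step = step by rewrite -natr1; ring.
rewrite [step * pois _ _]mulrC -mulrBl normrM (ger0_norm st0) ler_wpM2r //.
move: cin; rewrite in_itv /= => /andP[c1 c2].
rewrite distrC; apply: le_trans (pois_lip a Hs0 c1) _.
by rewrite lerBlDl; apply: le_trans c2 _; rewrite -natr1 mulrDl mul1r.
Qed.

End PoissonWeights.

Section RootsOfUnity.
Context {R : realType}.
Local Notation C := R[i].

(** A root of [1 + z + ... + z^(p-1)]; at [z = 1] this sum is [p], not 0. *)
Lemma prime_unity_root (p : nat) : prime p -> exists2 z : C, z ^+ p = 1 & z != 1.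
Proof.
move=> pp; have p1 := prime_gt1 pp.
pose q : {poly C} := \poly_(i < p) 1.
have sq : size q = p by rewrite size_poly_eq // oner_neq0.
have [z] : exists z, root q z by apply/closed_rootP; rewrite sq gtn_eqF.
rewrite /root horner_poly => /eqP hz.
have hz' : \sum_(i < p) z ^+ i = 0 by rewrite -[RHS]hz; apply: eq_bigr => i _; rewrite mul1r.
exists z.
  by apply/eqP; rewrite -subr_eq0 subrX1 hz' mulr0.
apply/eqP => z1; move: hz'; rewrite z1.
under eq_bigr => i _ do rewrite expr1n.
rewrite sumr_const card_ord => /eqP; rewrite pnatr_eq0 => /eqP p0.
by rewrite p0 in p1.
Qed.

(** Primality makes every nontrivial root primitive: by Bezout, [z^k = 1] with [0 < k < p] would
    give [z = 1]. The bounds on [a] and [b] exclude aliasing. *)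
Lemma unity_root_orthogonal (p : nat) (z : C) (a b : nat) :
  prime p -> z ^+ p = 1 -> z != 1 -> (a < p)%N -> (b < p)%N ->
  \sum_(i < p) (z ^+ i) ^+ a * ((z ^+ i) ^+ b)^* = (p * (a == b))%:R.
Proof.
move=> pp zp z1 ap bp; have p0 := prime_gt0 pp.
have nz : normc z = 1.
  have : normc z ^+ p = 1 by rewrite -normcX zp normc1.
  by move/eqP; rewrite pexpr_eq1 ?normc_ge0 // => /eqP.
have zz : z * z^* = 1 by rewrite mulrC mulJc nz expr1n.
pose r := z ^+ a * (z ^+ b)^*.
have -> : \sum_(i < p) (z ^+ i) ^+ a * ((z ^+ i) ^+ b)^* = \sum_(i < p) r ^+ i.
  apply: eq_bigr => i _; rewrite /r exprMn -rmorphXn /= -!exprM.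
  by rewrite ![(i * _)%N]mulnC.
have zk k : (0 < k < p)%N -> z ^+ k != 1.
  move=> /andP[k0 kp]; apply: contra z1 => /eqP zk1.
  have cop : coprime k p.
    rewrite coprime_sym prime_coprime //; apply/negP => /(dvdn_leq k0).
    by rewrite leqNgt kp.
  case: (egcdnP p k0) => u v e _.
  have : z ^+ (u * k) = z ^+ (v * p + 1) by rewrite e (eqP cop).
  by rewrite mulnC exprM zk1 expr1n exprD mulnC exprM zp expr1n mul1r expr1 => <-.
have rpow k m : z ^+ (m + k) * (z ^+ m)^* = z ^+ k.
  rewrite addnC exprD -mulrA rmorphXn -exprMn zz expr1n mulr1 //.
have [eab|ab] := eqVneq a b.
  rewrite muln1 /r -eab rmorphXn -exprMn zz expr1n.
  under eq_bigr => i _ do rewrite expr1n.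
  by rewrite sumr_const card_ord.
rewrite muln0 mulr0n.
have rp : r ^+ p = 1.
  by rewrite /r exprMn -rmorphXn /= -!exprM ![(_ * p)%N]mulnC !exprM zp !expr1n rmorph1 mulr1.
have r1 : r != 1.
  case: (ltngtP a b) ab => // lab _; last first.
    rewrite /r -(subnKC (ltnW lab)) rpow; apply: zk.
    by rewrite subn_gt0 lab (leq_ltn_trans (leq_subr _ _)).
  rewrite -(inj_eq (inv_inj (@conjCK C))) rmorph1 /r rmorphM /= conjCK mulrC.
  rewrite -(subnKC (ltnW lab)) rpow; apply: zk.
  by rewrite subn_gt0 lab (leq_ltn_trans (leq_subr _ _)).
apply/eqP; have := subrX1 r p; rewrite rp subrr => /esym/eqP.
by rewrite mulf_eq0 subr_eq0 (negPf r1).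
Qed.

End RootsOfUnity.

Section Counting.
Variable D : nat.

Lemma sum_count (w : seq 'I_D) : (\sum_(l < D) count_mem l w = size w)%N.
Proof.
elim: w => [|i w IH]; first by rewrite big1.
rewrite big_split /= IH (bigD1 i) //= eqxx big1 ?addn0 // => l li.
by rewrite eq_sym (negPf li).
Qed.

(** The multinomial count of rearrangements, by induction on the first letter. It cancels the
    factorials when [frame_gram] is summed along a row. *)
Lemma size_permutations_count (w : seq 'I_D) :
  (size (permutations w) * \prod_(l < D) (count_mem l w)`! = (size w)`!)%N.
Proof.
move sw : (size w) => n; elim: n w sw => [|n IH] w sw.
  by case: w sw => // _; rewrite big1.
have w0 : (0 < size w)%N by rewrite sw.
rewrite (perm_size (permutationsE w0)) size_allpairs_dep sumnE big_map big_distrl /=.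
transitivity (\sum_(x <- undup w) count_mem x w * n`!)%N.
  apply: eq_big_seq => x; rewrite mem_undup => xw.
  have srem : size (rem x w) = n by rewrite size_rem // sw.
  rewrite -(IH _ srem) mulnCA; congr (_ * _)%N.
  rewrite (bigD1 x) //= [in RHS](bigD1 x) //= mulnA.
  have cx : (count_mem x (rem x w)).+1 = count_mem x w.
    by rewrite count_rem xw /= eqxx subn1 prednK // -has_count has_pred1.
  rewrite -cx factS; congr (_ * _)%N; apply: eq_bigr => l lx.
  by rewrite count_rem xw /= eq_sym (negPf lx) subn0.
rewrite -big_distrl /= factS -sw -(sum_count w); congr (_ * _)%N.
rewrite big_uniq ?undup_uniq //= [RHS](bigID (fun l => l \in w)) /=.
rewrite [X in (_ + X)%N]big1 ?addn0; last by move=> l /count_memPn.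
by apply: eq_bigl => l; rewrite mem_undup.
Qed.

End Counting.

Section Words.
Context {R : realType}.
Local Notation C := R[i].
Local Notation Re := complex.Re.
Variable D : nat.

Lemma sum_tupleS (T : finType) (V : zmodType) m (F : m.+1.-tuple T -> V) :
  \sum_t F t = \sum_x \sum_t F (cons_tuple x t).
Proof.
rewrite pair_bigA /= (reindex (fun p : T * m.-tuple T => cons_tuple p.1 p.2)) //=.
exists (fun t : m.+1.-tuple T => (thead t, behead_tuple t)) => [[x t] _|t _] /=.
  by congr pair; apply: val_inj.
by apply: val_inj => /=; case/tupleP: t.
Qed.

Lemma sum_tuple0 (T : finType) (V : zmodType) (F : 0.-tuple T -> V) :
  \sum_t F t = F [tuple].
Proof. by rewrite (bigD1 [tuple]) //= big1 ?addr0 // => t /eqP[]; exact: tuple0. Qed.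

Lemma sum_tuple_prod (A : comNzRingType) m (f : 'I_D -> A) :
  \sum_(t : m.-tuple 'I_D) \prod_(i <- t) f i = (\sum_l f l) ^+ m.
Proof.
elim: m => [|m IH]; first by rewrite sum_tuple0 big_nil expr0.
rewrite sum_tupleS exprS mulr_suml; apply: eq_bigr => l _.
rewrite -IH mulr_sumr; apply: eq_bigr => t _.
by rewrite /= big_cons.
Qed.

Definition word_seq (M : nat) : seq (seq 'I_D) :=
  flatten [seq [seq val t | t <- enum {: m.-tuple 'I_D}] | m <- iota 0 M].

Definition words (M : nat) : {fset seq 'I_D} := seq_fset tt (word_seq M).

Lemma mem_word_seq M w : (w \in word_seq M) = (size w < M)%N.
Proof.
apply/flatten_mapP/idP => [[m]|sw].
  by rewrite mem_iota add0n => /andP[_ mM] /mapP[t _ ->]; rewrite size_tuple.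
exists (size w); first by rewrite mem_iota.
by apply/mapP; exists (in_tuple w); rewrite ?mem_enum.
Qed.

Lemma mem_words M w : (w \in words M) = (size w < M)%N.
Proof. by rewrite seq_fsetE mem_word_seq. Qed.

Lemma uniq_word_seq M : uniq (word_seq M).
Proof.
elim: M => [//|M IH]; rewrite /word_seq -[M.+1]addn1 iotaD map_cat flatten_cat.
rewrite cat_uniq -/(word_seq M) IH /= cats0 map_inj_uniq ?enum_uniq ?andbT; last exact: val_inj.
by apply/hasPn => _ /mapP[t _ ->] /=; rewrite mem_word_seq size_tuple ltnn.
Qed.

Lemma sum_words (V : zmodType) M (f : seq 'I_D -> V) :
  \sum_(w <- words M) f w = \sum_(m < M) \sum_(t : m.-tuple 'I_D) f t.
Proof.
have -> : \sum_(w <- words M) f w = \sum_(w <- word_seq M) f w.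
  by apply: perm_big; rewrite (perm_trans (seq_fset_perm _ _)) // undup_id ?uniq_word_seq.
rewrite /word_seq big_flatten /= big_map.
have -> : iota 0 M = index_iota 0 M by rewrite /index_iota subn0.
rewrite big_mkord.
by apply: eq_bigr => m _; rewrite big_map big_enum.
Qed.

Definition coh (z : 'I_D -> C) (w : seq 'I_D) : C :=
  (expR (- ((\sum_l normc (z l) ^+ 2) / 2)) / Num.sqrt ((size w)`!)%:R)%:C
  * \prod_(i <- w) z i.

Lemma sqrt_fact_sqr m : Num.sqrt (m`!)%:R * Num.sqrt (m`!)%:R = (m`!)%:R :> R.
Proof. by rewrite -expr2 sqr_sqrtr. Qed.

Lemma coh_conj_mul z z' w : (coh z w)^* * coh z' w =
  (expR (- ((\sum_l normc (z l) ^+ 2) / 2)) * expR (- ((\sum_l normc (z' l) ^+ 2) / 2))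
    / ((size w)`!)%:R)%:C * \prod_(i <- w) ((z i)^* * z' i).
Proof.
rewrite /coh rmorphM /= conjcRe rmorph_prod /= big_split /= mulrACA -rmorphM /=.
by rewrite mulrACA -invfM sqrt_fact_sqr.
Qed.

Lemma coh_dot M z z' : \sum_(w <- words M) (coh z w)^* * coh z' w =
  (expR (- ((\sum_l normc (z l) ^+ 2) / 2)) * expR (- ((\sum_l normc (z' l) ^+ 2) / 2)))%:C *
  \sum_(m < M) ((m`!%:R)^-1)%:C * (\sum_l (z l)^* * z' l) ^+ m.
Proof.
rewrite sum_words mulr_sumr; apply: eq_bigr => m _.
rewrite -sum_tuple_prod !mulr_sumr; apply: eq_bigr => t _.
by rewrite coh_conj_mul size_tuple rmorphM /= mulrA.
Qed.

Lemma normc_coh z w : normc (coh z w) ^+ 2 =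
  expR (- \sum_l normc (z l) ^+ 2) / ((size w)`!)%:R * \prod_(i <- w) normc (z i) ^+ 2.
Proof.
apply: (@complexI R); rewrite -mulJc coh_conj_mul [RHS]rmorphM /=; congr (_ * _).
  by rewrite -expRD; congr (expR _ / _)%:C; lra.
by rewrite rmorph_prod; apply: eq_bigr => i _; rewrite mulJc.
Qed.

(** The case [c = 1] is the truncated norm; [c = 2] pays for the factor [2 ^ size w] that [poisF_ge]
    introduces. *)
Lemma coh_weighted M z (c : R) : 
  \sum_(w <- words M) c ^+ size w * normc (coh z w) ^+ 2 =
  expR (- \sum_l normc (z l) ^+ 2) *
    \sum_(m < M) (c * \sum_l normc (z l) ^+ 2) ^+ m / m`!%:R.
Proof.
rewrite sum_words mulr_sumr; apply: eq_bigr => m _.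
rewrite exprMn -(sum_tuple_prod m (fun l => normc (z l) ^+ 2)).
rewrite mulr_sumr mulr_suml mulr_sumr; apply: eq_bigr => t _.
by rewrite normc_coh size_tuple; ring.
Qed.

Lemma coh_norm M z : \sum_(w <- words M) normc (coh z w) ^+ 2 =
  expR (- \sum_l normc (z l) ^+ 2) *
    \sum_(m < M) (\sum_l normc (z l) ^+ 2) ^+ m / m`!%:R.
Proof.
have := coh_weighted M z 1; rewrite mul1r => <-.
by apply: eq_bigr => w _; rewrite expr1n mul1r.
Qed.

Lemma sqnorm_ge0 z : 0 <= \sum_(l < D) normc (z l : C) ^+ 2.
Proof. by apply: sumr_ge0 => l _; exact: sqr_ge0. Qed.

Lemma coh_norm_le1 M z : \sum_(w <- words M) normc (coh z w) ^+ 2 <= 1.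
Proof.
rewrite coh_norm expRN mulrC ler_pdivrMr ?expR_gt0 // mul1r.
exact: expR_partial (sqnorm_ge0 z).
Qed.

Lemma coh_norm_ge M z :
  1 - 2 ^- M * expR (\sum_l normc (z l) ^+ 2) <=
  \sum_(w <- words M) normc (coh z w) ^+ 2.
Proof.
rewrite coh_norm; have := expR_partial_tail M (sqnorm_ge0 z).
set x := \sum_l _; set S := \sum_(m < M) _ => h.
have -> : 1 - 2 ^- M * expR x = expR (- x) * (expR x - 2 ^- M * expR (2 * x)).
  have -> : 2 * x = x + x by ring.
  have E0 : expR x != 0 by rewrite gt_eqF ?expR_gt0.
  rewrite expRD expRN; have -> : 2 ^- M * (expR x * expR x) = expR x * (2 ^- M * expR x) by ring.
  by rewrite mulrBr mulVf // mulKf.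
by rewrite ler_pM2l ?expR_gt0 //; lra.
Qed.

Lemma ex_pow2_gt (B : R) : exists n, forall m, (n <= m)%N -> B < 2 ^+ m.
Proof.
exists (Num.truncn B).+1 => m nm.
apply: lt_le_trans (truncnS_gt B) _.
rewrite -natrX ler_nat; apply: leq_trans nm _.
exact: ltnW (ltn_expl m _).
Qed.

Lemma has_sum_coh z : has_sum (fun w => (coh z w)^* * coh z w) 1.
Proof.
apply/has_sumP => e e0.
set x := \sum_l normc (z l) ^+ 2.
have [M hM] := ex_pow2_gt (expR x / e).
exists (words M) => F MF.
have -> : \sum_(w <- F) (coh z w)^* * coh z w = (\sum_(w <- F) normc (coh z w) ^+ 2)%:C.
  by rewrite rmorph_sum; apply: eq_bigr => w _; rewrite mulJc.
rewrite -(rmorph1 (real_complex R)) -rmorphB normcR /=.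
have lo : 1 - 2 ^- M * expR x <= \sum_(w <- F) normc (coh z w) ^+ 2.
  apply: le_trans (coh_norm_ge M z) _.
  by apply: sum_fsub_le MF => w; exact: sqr_ge0.
have hi : \sum_(w <- F) normc (coh z w) ^+ 2 <= 1.
  pose M' := (\max_(w <- F) size w).+1.
  apply: le_trans (coh_norm_le1 M' z); apply: sum_fsub_le => [w|]; first exact: sqr_ge0.
  by apply/fsubsetP => w wF; rewrite mem_words ltnS; exact: leq_bigmax_seq.
have : 2 ^- M * expR x < e.
  have h := hM M (leqnn _).
  by move: h; rewrite [2 ^- M * _]mulrC ltr_pdivrMr // ltr_pdivrMr ?exprn_gt0 // [e * _]mulrC.
move: lo hi; set S := \sum_(w <- F) _; rewrite ltr_norml; lra.
Qed.

Lemma coh_perm z w w' : perm_eq w w' -> coh z w = coh z w'.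
Proof.
by move=> h; rewrite /coh (perm_size h); congr (_ * _); apply: perm_big.
Qed.

Lemma prod_count (A : comNzRingType) (f : 'I_D -> A) (w : seq 'I_D) :
  \prod_(i <- w) f i = \prod_l f l ^+ count_mem l w.
Proof.
elim: w => [|i w IH]; first by rewrite big_nil big1 // => l _; rewrite expr0.
rewrite big_cons IH [RHS](bigD1 i) //= eqxx /= exprD expr1 -mulrA; congr (_ * _).
rewrite (bigD1 i) //=; congr (_ * _); apply: eq_bigr => l li.
by rewrite eq_sym (negPf li) add0n.
Qed.

End Words.

Lemma real_complexM (R : realType) (x y : R) : (x * y)%:C = x%:C * y%:C.
Proof. exact: rmorphM. Qed.

Section CoherentFrame.
Context {R : realType}.
Local Notation C := R[i].
Local Notation Re := complex.Re.
Variables (D M H p : nat) (step : R) (zeta : C).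
Hypothesis p_prime : prime p.
Hypothesis Mp : (M <= p)%N.
Hypothesis zetap : zeta ^+ p = 1.
Hypothesis zeta1 : zeta != 1.
Hypothesis step0 : 0 <= step.

Local Notation J := {ffun 'I_D -> 'I_H * 'I_p}.

Definition grid_point (x : 'I_H * 'I_p) : C :=
  (Num.sqrt (x.1%:R * step))%:C * zeta ^+ x.2.

Definition grid (j : J) (l : 'I_D) : C := grid_point (j l).

(** Equal weights, because Lebesgue measure over pi is uniform in the squared modulus and in the
    angle; this is also why [grid_point] spaces the squared modulus evenly. *)
Definition grid_weight (j : J) : R := (step / p%:R) ^+ D.

Lemma normc_grid_point x : normc (grid_point x) ^+ 2 = x.1%:R * step.
Proof.
have nz : normc zeta = 1.
  have : normc zeta ^+ p = 1 by rewrite -normcX zetap normc1.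
  by move/eqP; rewrite pexpr_eq1 ?normc_ge0 // ?prime_gt0 // => /eqP.
by rewrite normcM normcR normcX nz expr1n mulr1 ger0_norm // sqr_sqrtr ?mulr_ge0.
Qed.

Lemma grid_weight_ge0 j : 0 <= grid_weight j.
Proof. by rewrite exprn_ge0 // divr_ge0. Qed.

Lemma sum_grid_weight : \sum_j grid_weight j = (H%:R * step) ^+ D.
Proof.
rewrite /grid_weight sumr_const card_ffun card_prod !card_ord.
rewrite -[LHS]mulr_natl natrX natrM -exprMn; congr (_ ^+ _).
have p0 : p%:R != 0 :> R by rewrite pnatr_eq0 -lt0n prime_gt0.
by rewrite [step / _]mulrC mulrA mulfK.
Qed.

Lemma sqnorm_grid j : \sum_l normc (grid j l) ^+ 2 <= D%:R * (H%:R * step).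
Proof.
rewrite -[D in D%:R]card_ord mulr_natl -sumr_const; apply: ler_sum => l _.
by rewrite normc_grid_point ler_wpM2r // ler_nat ltnW.
Qed.

(** The angular sum is a discrete Fourier transform and kills [a != b]; what remains is [a!] times
    the Riemann sum of [pois a]. *)
Lemma grid_point_moment a b : (a < p)%N -> (b < p)%N ->
  \sum_(x : 'I_H * 'I_p) (step / p%:R * expR (- (x.1%:R * step)))%:C *
     (grid_point x ^+ a * (grid_point x ^+ b)^*) =
  ((a == b)%:R * (a`!%:R * grid_moment H step a))%:C.
Proof.
move=> ap bp.
rewrite -(pair_bigA _ (fun (h : 'I_H) (q : 'I_p) => (step / p%:R * expR (- (h%:R * step)))%:C *
     (grid_point (h, q) ^+ a * (grid_point (h, q) ^+ b)^*))) /=.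
transitivity (\sum_(h < H) ((a == b)%:R * (step * (expR (- (h%:R * step)) * (h%:R * step) ^+ a)))%:C).
  apply: eq_bigr => h _.
  transitivity ((step / p%:R * expR (- (h%:R * step)) * (Num.sqrt (h%:R * step) ^+ a * Num.sqrt (h%:R * step) ^+ b))%:C * \sum_(q < p) (zeta ^+ q) ^+ a * ((zeta ^+ q) ^+ b)^*).
    rewrite mulr_sumr; apply: eq_bigr => q _; rewrite /grid_point /=.
    rewrite !exprMn !rmorphM /= -!rmorphXn /= conjcRe; ring.
  rewrite (unity_root_orthogonal p_prime zetap zeta1 ap bp).
  have [<-|_] := eqVneq a b; last by rewrite muln0 !mul0r mulr0.
  rewrite muln1 mul1r -(rmorph_nat (real_complex R)) -rmorphM /=; congr (_%:C).
  rewrite -exprD addnn -mul2n exprM sqr_sqrtr ?mulr_ge0 //.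
  have p0 : p%:R != 0 :> R by rewrite pnatr_eq0 -lt0n prime_gt0.
  by field; rewrite p0.
rewrite -rmorph_sum /=; congr (_%:C); rewrite -mulr_sumr; congr (_ * _).
rewrite /grid_moment mulr_sumr; apply: eq_bigr => h _; rewrite /pois.
have f0 : a`!%:R != 0 :> R by rewrite pnatr_eq0 -lt0n fact_gt0.
by rewrite [RHS]mulrCA !mulrA mulrAC -!mulrA mulVKf // [X in _ * X]mulrC.
Qed.

(** Entries of the frame operator on short words. The coherent states span symmetric vectors only,
    so the operator approximates the symmetric projection, not the identity; with all moments equal
    to 1 it is that projection. *)
Definition frame_gram (w w' : seq 'I_D) : R :=
  if perm_eq w w' then ((size w)`!%:R)^-1 *
    \prod_l ((count_mem l w)`!%:R * grid_moment H step (count_mem l w))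
  else 0.

Lemma frame_gramE w w' : (size w < M)%N -> (size w' < M)%N ->
  \sum_j (grid_weight j)%:C * (coh (grid j) w * (coh (grid j) w')^*) =
  (frame_gram w w')%:C.
Proof.
move=> sw sw'.
have cw (v : seq 'I_D) l : (size v < M)%N -> (count_mem l v < p)%N.
  by move=> sv; rewrite (leq_ltn_trans (count_size _ _)) // (leq_trans sv).
pose f := (Num.sqrt (size w)`!%:R * Num.sqrt (size w')`!%:R : R)^-1.
transitivity (f%:C * \prod_l \sum_(x : 'I_H * 'I_p)
    (step / p%:R * expR (- (x.1%:R * step)))%:C *
     (grid_point x ^+ count_mem l w * (grid_point x ^+ count_mem l w')^*)).
  rewrite bigA_distr_bigA mulr_sumr; apply: eq_bigr => j _ /=.
  have -> : \prod_l ((step / p%:R * expR (- ((j l).1%:R * step)))%:C *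
      (grid_point (j l) ^+ count_mem l w * (grid_point (j l) ^+ count_mem l w')^*)) =
    (grid_weight j * expR (- \sum_l normc (grid j l) ^+ 2))%:C *
    (\prod_(i <- w) grid j i * (\prod_(i <- w') grid j i)^*).
    rewrite [LHS]big_split /=; congr (_ * _).
      rewrite -rmorph_prod big_split /=; congr (_%:C); congr (_ * _).
        by rewrite prodr_const card_ord.
      rewrite -sumrN expR_sum; apply: eq_bigr => l _.
      by rewrite normc_grid_point.
    by rewrite [LHS]big_split /= (prod_count _ w) (prod_count _ w') rmorph_prod.
  rewrite /coh [(_ * \prod_(i <- w') _)^*]rmorphM /= conjcRe.
  set x := \sum_l _; set P1 := \prod_(i <- w) _; set P2 := \prod_(i <- w') _.
  have -> : expR (- x) = expR (- (x / 2)) * expR (- (x / 2)).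
    by rewrite -expRD; congr expR; lra.
  rewrite /f invfM !rmorphM /=; ring.
under eq_bigr => l _ do rewrite grid_point_moment ?cw //.
rewrite -rmorph_prod -rmorphM /frame_gram /=; congr (_%:C).
have [ww'|nww'] := boolP (perm_eq w w').
  rewrite /f -(perm_size ww') sqrt_fact_sqr; congr (_ * _).
  apply: eq_bigr => l _; rewrite (permP ww') eqxx mul1r //.
have : ~~ [forall l, count_mem l w == count_mem l w'].
  apply: contra nww' => /forallP h; rewrite /perm_eq; apply/allP => l _.
  exact: h.
rewrite negb_forall => /existsP[l hl].
by rewrite (bigD1 l) //= (negPf hl) !mul0r mulr0.
Qed.

Lemma grid_moment_ge0 a : 0 <= grid_moment H step a.
Proof.
apply: sumr_ge0 => h _; rewrite mulr_ge0 // pois_ge0 // mulr_ge0 //.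
Qed.

Lemma frame_gram_ge0 w w' : 0 <= frame_gram w w'.
Proof.
rewrite /frame_gram; case: ifP => // _; rewrite mulr_ge0 ?invr_ge0 //.
by apply: prodr_ge0 => l _; rewrite mulr_ge0 ?grid_moment_ge0.
Qed.

Lemma frame_gramC w w' : frame_gram w w' = frame_gram w' w.
Proof.
rewrite /frame_gram perm_sym; case: ifP => // ww'.
rewrite (perm_size ww'); congr (_ * _); apply: eq_bigr => l _.
by rewrite (permP ww').
Qed.

(** The factorials cancel against the number of rearrangements. Row sums serve twice: in Schur's
    test for the upper bound, and as eigenvalue of the operator on symmetric vectors for the lower
    one. *)
Lemma frame_gram_row w : (size w < M)%N ->
  \sum_(w' <- words D M) frame_gram w w' = \prod_l grid_moment H step (count_mem l w).
Proof.
move=> sw; rewrite /frame_gram -big_mkcond -big_filter big_const_seq count_predT.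
rewrite (@perm_size _ _ (permutations w)); last first.
  rewrite uniq_perm ?permutations_uniq ?filter_uniq ?fset_uniq // => w'.
  rewrite mem_filter mem_permutations mem_words [perm_eq w' w]perm_sym.
  by case: (boolP (perm_eq w w')) => //= /perm_size <-.
rewrite iter_addr_0 big_split /= -[LHS]mulr_natl.
have := congr1 (fun n => n%:R : R) (size_permutations_count w).
rewrite natrM natr_prod => h.
have f0 : (size w)`!%:R != 0 :> R by rewrite pnatr_eq0 -lt0n fact_gt0.
set a := \prod_(i < D) (count_mem i w)`!%:R; set g := \prod_(i < D) _.
transitivity ((size w)`!%:R^-1 * ((size (permutations w))%:R * a) * g); first by ring.
by rewrite h mulVf // mul1r.
Qed.

Lemma frame_quad (u : seq 'I_D -> C) :
  (\sum_j grid_weight j * normc (\sum_(x <- words D M) (coh (grid j) x)^* * u x) ^+ 2)%:C =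
  \sum_(x <- words D M) \sum_(y <- words D M) (frame_gram x y)%:C * ((u x)^* * u y).
Proof.
rewrite rmorph_sum /=.
transitivity (\sum_(x <- words D M) \sum_(y <- words D M)
  (\sum_j (grid_weight j)%:C * (coh (grid j) x * (coh (grid j) y)^*)) * ((u x)^* * u y)).
  under [RHS]eq_bigr => x _ do under eq_bigr => y _ do rewrite mulr_suml.
  under [RHS]eq_bigr => x _ do rewrite exchange_big.
  rewrite [RHS]exchange_big; apply: eq_bigr => j _ /=.
  rewrite rmorphM /= -mulJc rmorph_sum mulr_suml mulr_sumr; apply: eq_bigr => x _ /=.
  rewrite !mulr_sumr; apply: eq_bigr => y _; rewrite rmorphM /= conjCK; ring.
rewrite big_seq [RHS]big_seq; apply: eq_bigr => x; rewrite mem_words => xM.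
rewrite big_seq [RHS]big_seq; apply: eq_bigr => y; rewrite mem_words => yM.
by rewrite frame_gramE.
Qed.

Lemma grid_moment_le a : grid_moment H step a <= 1 + step * (H%:R * step).
Proof.
have := grid_moment_close H a step0; rewrite ler_norml => /andP[_].
by have := @poisF_le1 R a (H%:R * step); rewrite mulr_ge0 // => /(_ isT); lra.
Qed.

(** Schur's test for a symmetric nonnegative matrix, through [2 |u_x| |u_y| <= |u_x|^2 + |u_y|^2];
    [u] need not be symmetric. *)
Lemma frame_upper (u : seq 'I_D -> C) :
  \sum_j grid_weight j * normc (\sum_(x <- words D M) (coh (grid j) x)^* * u x) ^+ 2 <=
  (1 + step * (H%:R * step)) ^+ D * \sum_(x <- words D M) normc (u x) ^+ 2.
Proof.
rewrite -[leLHS]/(Re (_)%:C) frame_quad.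
apply: le_trans (ler_norm _) _; apply: le_trans (normc_Re _) _.
apply: (@le_trans _ _ (\sum_(x <- words D M) \sum_(y <- words D M)
   frame_gram x y * ((normc (u x) ^+ 2 + normc (u y) ^+ 2) / 2))).
  apply: le_trans (normc_sum _ _ _) _; apply: ler_sum => x _.
  apply: le_trans (normc_sum _ _ _) _; apply: ler_sum => y _.
  rewrite !normcM normcR ger0_norm ?frame_gram_ge0 // normcJ.
  apply: ler_wpM2l; first exact: frame_gram_ge0.
  by have := sqr_ge0 (normc (u x) - normc (u y)); rewrite sqrrB; lra.
have -> : \sum_(x <- words D M) \sum_(y <- words D M)
   frame_gram x y * ((normc (u x) ^+ 2 + normc (u y) ^+ 2) / 2) =
  \sum_(x <- words D M) normc (u x) ^+ 2 * \sum_(y <- words D M) frame_gram x y.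
  transitivity (2^-1 * \sum_(x <- words D M) \sum_(y <- words D M) frame_gram x y * normc (u x) ^+ 2 +
    2^-1 * \sum_(x <- words D M) \sum_(y <- words D M) frame_gram x y * normc (u y) ^+ 2).
    rewrite -mulrDr -big_split mulr_sumr; apply: eq_bigr => x _ /=.
    rewrite -big_split mulr_sumr; apply: eq_bigr => y _ /=; ring.
  rewrite [X in _ + _ * X]exchange_big /=.
  have -> : \sum_(j <- words D M) \sum_(i <- words D M) frame_gram i j * normc (u j) ^+ 2 =
    \sum_(x <- words D M) \sum_(y <- words D M) frame_gram x y * normc (u x) ^+ 2.
    by apply: eq_bigr => x _; apply: eq_bigr => y _; rewrite frame_gramC.
  rewrite -mulrDl.
  have -> : 2^-1 + 2^-1 = 1 :> R by lra.
  rewrite mul1r; apply: eq_bigr => x _.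
  by rewrite mulr_sumr; apply: eq_bigr => y _; rewrite mulrC.
rewrite mulr_sumr big_seq [leRHS]big_seq; apply: ler_sum => x; rewrite mem_words => xM.
rewrite [leRHS]mulrC; apply: ler_wpM2l; first exact: sqr_ge0.
rewrite frame_gram_row // -[in leRHS](card_ord D) -prodr_const.
by apply: ler_prod => l _; rewrite grid_moment_ge0 grid_moment_le.
Qed.

(** [coh z] is symmetric, so the frame sum averages products of grid moments over the weights of
    [coh z]. A moment falls short of 1 by at most the Riemann error plus [2^count exp(- S / 2)],
    with [S] the radial cutoff; averaging [2 ^ size w] costs a factor [exp x]. *)
Lemma frame_lower (z : 'I_D -> C) :
  1 - 2 ^- M * expR (\sum_l normc (z l) ^+ 2)
    - D%:R * (expR (\sum_l normc (z l) ^+ 2 - H%:R * step / 2) + step * (H%:R * step)) <=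
  \sum_j grid_weight j *
    normc (\sum_(x <- words D M) (coh (grid j) x)^* * coh z x) ^+ 2.
Proof.
set x := \sum_l _; set S := H%:R * step; set k := step * S.
have S0 : 0 <= S by rewrite mulr_ge0.
have k0 : 0 <= k by rewrite mulr_ge0.
rewrite -[leRHS]/(Re (_)%:C) frame_quad.
have -> : \sum_(x <- words D M) \sum_(y <- words D M)
    (frame_gram x y)%:C * ((coh z x)^* * coh z y) =
   (\sum_(w <- words D M) normc (coh z w) ^+ 2 * \prod_l grid_moment H step (count_mem l w))%:C.
  rewrite rmorph_sum /= big_seq [RHS]big_seq; apply: eq_bigr => w; rewrite mem_words => wM.
  rewrite -frame_gram_row // mulr_sumr rmorph_sum /=; apply: eq_bigr => y _ /=.
  rewrite real_complexM -mulJc mulrC /frame_gram; case: ifP => [wy|_]; last by rewrite !mulr0.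
  by rewrite (coh_perm z wy).
rewrite /=.
apply: (@le_trans _ _ (\sum_(w <- words D M)
   (normc (coh z w) ^+ 2 * (1 - D%:R * k) - D%:R * expR (- (S / 2)) * (2 ^+ size w * normc (coh z w) ^+ 2)))).
  rewrite sumrB -mulr_suml -mulr_sumr coh_weighted -/x.
  have h1 := coh_norm_ge M z; have h2 := coh_norm_le1 M z; rewrite -/x in h1.
  have h3 : \sum_(m < M) (2 * x) ^+ m / m`!%:R <= expR (2 * x).
    by apply: expR_partial; rewrite mulr_ge0 // sqnorm_ge0.
  have h4 : expR (- x) * \sum_(m < M) (2 * x) ^+ m / m`!%:R <= expR x.
    apply: le_trans (ler_wpM2l (expR_ge0 _) h3) _.
    by rewrite -expRD; have -> : - x + 2 * x = x by ring.
  have -> : expR (x - S / 2) = expR (- (S / 2)) * expR x by rewrite -expRD addrC.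
  have h5 := ler_wpM2l (mulr_ge0 (ler0n _ D) (expR_ge0 (- (S / 2)))) h4.
  move: h1 h2 h5; set A := \sum_(w <- _) _; set B := expR (- x) * _ => h1 h2 h5.
  have h6 : D%:R * k * A <= D%:R * k by rewrite ler_piMr // mulr_ge0.
  by rewrite mulrBr mulrDr mulr1 [A * _]mulrC mulrA; lra.
apply: ler_sum => w _.
have -> : forall a b c e : R, a * (1 - b) - c * (e * a) = a * (1 - (b + c * e)) by move=> *; ring.
apply: ler_wpM2l; first exact: sqr_ge0.
pose g l := grid_moment H step (count_mem l w).
(* Riemann sums may exceed 1, so they are capped: bounding a product below by 1 minus the sum of the
   deficits, as [key] does, takes factors in [0, 1]. *)
have gl l : 1 - (k + 2 ^+ size w * expR (- (S / 2))) <= Num.min (g l) 1.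
  rewrite le_min; apply/andP; split; last first.
    by rewrite gerBl addr_ge0 // mulr_ge0 ?exprn_ge0 ?expR_ge0.
  have := grid_moment_close H (count_mem l w) step0; rewrite ler_norml -/S -/(g l) => /andP[g1 _].
  have g2 := poisF_ge (count_mem l w) S0.
  have g3 : 2 ^+ count_mem l w * expR (- (S / 2)) <= 2 ^+ size w * expR (- (S / 2)).
    by rewrite ler_wpM2r ?expR_ge0 // ler_weXn2l ?ler1n // count_size.
  by rewrite -/k in g1; lra.
have min0 l : 0 <= Num.min (g l) 1 by rewrite le_min grid_moment_ge0 ler01.
apply: (@le_trans _ _ (\prod_(l < D) Num.min (g l) 1)); last first.
  by apply: ler_prod => l _; rewrite min0 ge_min lexx.
have key : forall r : seq 'I_D, 1 - (size r)%:R * (k + 2 ^+ size w * expR (- (S / 2))) <=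
     \prod_(l <- r) Num.min (g l) 1 <= 1.
  elim=> [|l r /andP[IH1 IH2]]; first by rewrite big_nil mul0r subr0 lexx.
  rewrite big_cons.
  have m1 : Num.min (g l) 1 <= 1 by rewrite ge_min lexx orbT.
  have p0 : 0 <= \prod_(l <- r) Num.min (g l) 1 by apply: prodr_ge0.
  have h := mulr_ge0 (_ : 0 <= 1 - Num.min (g l) 1) (_ : 0 <= 1 - \prod_(l <- r) Num.min (g l) 1).
  have {}h := h ltac:(by rewrite subr_ge0) ltac:(by rewrite subr_ge0).
  apply/andP; split; last by rewrite -[leRHS]mul1r ler_pM.
  rewrite /= -natr1 mulrDl mul1r; have := gl l; move: h IH1.
  set X := Num.min _ _; set Y := \prod_(_ <- r) _; set E := _ + _ * _.
  by rewrite mulrBl mul1r mulrBr mulr1; lra.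
have := key (enum 'I_D); rewrite size_enum_ord big_enum /= => /andP[h _].
apply: le_trans h; rewrite lerD2l lerN2.
have -> : D%:R * k + D%:R * expR (- (S / 2)) * 2 ^+ size w =
  D%:R * (k + 2 ^+ size w * expR (- (S / 2))) by ring.
by [].
Qed.

End CoherentFrame.

(** * Deficiency bounds from close Gram matrices *)

Section FrameToDeficiency.
Context {R : realType}.
Local Notation C := R[i].
Local Notation Re := complex.Re.

(** Convexity of the power: on [0, 1] it lies below its chord, of slope [2^D - 1]. *)
Lemma expr1D_bound (D : nat) (k : R) : 0 <= k <= 1 -> (1 + k) ^+ D <= 1 + 2 ^+ D * k.
Proof.
move=> /andP[k0 k1]; apply: (@le_trans _ _ (1 + (2 ^+ D - 1) * k)); last first.
  by rewrite mulrBl mul1r; lra.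
elim: D => [|D IH]; first by rewrite !expr0 subrr mul0r addr0.
rewrite !exprS; apply: le_trans (ler_wpM2l _ IH) _; first by lra.
have h2 : (1 : R) <= 2 ^+ D by rewrite exprn_ege1 // ler1n.
move: h2; set u := 2 ^+ D => h2.
have h : 0 <= (u - 1) * k * (1 - k) by rewrite !mulr_ge0 ?subr_ge0.
rewrite -subr_ge0; apply: le_trans h _; rewrite le_eqVlt; apply/orP; left.
by apply/eqP; ring.
Qed.

Lemma big_fsetT (T : finType) : exists2 F : {fset T}, forall x, x \in F &
  forall (V : zmodType) (f : T -> V), \sum_(p <- F) f p = \sum_p f p.
Proof.
exists [fset x | x in T]%fset => [x|V f]; first by rewrite !inE.
rewrite -[RHS]big_enum /=; apply: perm_big.
by rewrite uniq_perm ?enum_uniq ?fset_uniq // => p; rewrite mem_enum !inE.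
Qed.

(** The cutoff [4 r^2] on the squared modulus of each mode leaves [exp(r^2 - 2 r^2)] for parameters
    of norm at most [r]; it also fixes the total weight and the size of the frame points. The mesh,
    the word length and the prime are then refined until [kappa] dominates their errors, without any
    trace in the bounds. *)
Lemma coherent_frame (D M0 : nat) (r kappa : R) : 1 <= r -> 0 < kappa <= 1 ->
  exists (M : nat) (J : finType) (w : J -> R) (z : J -> 'I_D -> C) (s : R),
  [/\ (M0 < M)%N, forall j, 0 <= w j, \sum_j w j = (4 * r ^+ 2) ^+ D,
      forall j, \sum_l normc (z j l) ^+ 2 <= 4 * D%:R * r ^+ 2 &
  [/\ 1 <= s <= 1 + kappa,
      forall u : seq 'I_D -> C,
        \sum_j w j * normc (\sum_(x <- words D M) (coh (z j) x)^* * u x) ^+ 2 <=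
        s * \sum_(x <- words D M) normc (u x) ^+ 2 &
      forall y : 'I_D -> C, \sum_l normc (y l) ^+ 2 <= r ^+ 2 ->
        1 - (2 * kappa + D%:R * expR (- r ^+ 2)) <=
        \sum_j w j * normc (\sum_(x <- words D M) (coh (z j) x)^* * coh y x) ^+ 2]].
Proof.
move=> r1 /andP[kappa0 kappa1].
have r0 : 0 <= r by apply: le_trans r1.
pose S := 4 * r ^+ 2; have S0 : 0 < S by rewrite mulr_gt0 // exprn_gt0 // (lt_le_trans ltr01).
(* [N] covers both uses of the mesh error [k]: [2^D k] in the upper frame bound and [D k] in the
   lower one. *)
pose N := 2 ^+ D + D%:R : R; have N1 : 1 <= N.
  by rewrite /N ler_wpDr ?ler0n // exprn_ege1 // ler1n.
have N0 : 0 < N by apply: lt_le_trans N1.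
pose H := (Num.truncn (N * S ^+ 2 / kappa)).+1.
have HS : N * S ^+ 2 / kappa < H%:R by exact: truncnS_gt.
have H0 : 0 < H%:R :> R by [].
pose step := S / H%:R.
have Hstep : H%:R * step = S by rewrite /step mulrC divfK // gt_eqF.
have step0 : 0 <= step by rewrite divr_ge0 ?ltW.
pose k := step * S.
have Nk : N * k <= kappa.
  have -> : N * k = N * S ^+ 2 / H%:R by rewrite /k /step; ring.
  by rewrite ler_pdivrMr //; move: HS; rewrite ltr_pdivrMr // [H%:R * _]mulrC => /ltW.
have k0 : 0 <= k by rewrite mulr_ge0 // ltW.
have k1 : k <= 1 by apply: le_trans kappa1; apply: le_trans Nk; rewrite ler_peMl.
have [M1 hM1] := ex_pow2_gt (expR (r ^+ 2) / kappa).
pose M := maxn M0.+1 M1.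
have tailM : 2 ^- M * expR (r ^+ 2) <= kappa.
  have /ltW := hM1 M (leq_maxr _ _); rewrite [_ * expR _]mulrC.
  by rewrite ler_pdivrMr // => h; rewrite ler_pdivrMr ?exprn_gt0 // [kappa * _]mulrC.
have [p Mp pp] := prime_above M.
have [zeta zp z1] := @prime_unity_root R p pp.
exists M, {ffun 'I_D -> 'I_H * 'I_p}, (@grid_weight R D H p step),
  (fun j => grid step zeta j), ((1 + step * (H%:R * step)) ^+ D).
split.
- exact: leq_maxl.
- by move=> j; exact: grid_weight_ge0.
- by rewrite sum_grid_weight // Hstep.
- move=> j; have := @sqnorm_grid R D H p step zeta pp zp step0 j.
  rewrite Hstep /S; congr (_ <= _); ring.
rewrite Hstep -/k; split.
- apply/andP; split; first by rewrite exprn_ege1 // lerDl.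
  apply: le_trans (expr1D_bound D _) _; first by rewrite k0 k1.
  rewrite lerD2l; apply: le_trans Nk; apply: ler_wpM2r => //.
  by rewrite /N lerDl.
- move=> u; have := @frame_upper R D M H p step zeta pp (ltnW Mp) zp z1 step0 u.
  by rewrite Hstep -/k.
move=> y hy.
have := @frame_lower R D M H p step zeta pp (ltnW Mp) zp z1 step0 y.
rewrite Hstep -/k; apply: le_trans.
set x := \sum_l _ in hy *.
have h1 : 2 ^- M * expR x <= kappa.
  by apply: le_trans tailM; rewrite ler_wpM2l ?invr_ge0 ?exprn_ge0 // ler_expR.
have h2 : D%:R * expR (x - S / 2) <= D%:R * expR (- r ^+ 2).
  by rewrite ler_wpM2l // ler_expR /S; lra.
have h3 : D%:R * k <= kappa.
  by apply: le_trans Nk; apply: ler_wpM2r => //; rewrite /N lerDr exprn_ge0.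
rewrite mulrDr; lra.
Qed.

Variables (d k n D : nat).
Local Notation out := ('I_d * n.-tuple 'I_k)%type.
Variables (Theta : Type) (B : set Theta) (zof : Theta -> 'I_D -> C).
Variables (psi : ('I_D -> C) -> out -> C) (r eps : R) (e0 : out) (M0 : nat).

Hypothesis r1 : 1 <= r.
Hypothesis eps0 : 0 < eps.
Hypothesis zofB : forall t, B t -> \sum_l normc (zof t l) ^+ 2 <= r ^+ 2.
Hypothesis psi1 : forall z, \sum_l normc (z l) ^+ 2 <= (4 * D%:R + 1) * r ^+ 2 ->
  \sum_p (psi z p)^* * psi z p = 1.
Hypothesis psi_gram : forall z z' M,
  \sum_l normc (z l) ^+ 2 <= (4 * D%:R + 1) * r ^+ 2 ->
  \sum_l normc (z' l) ^+ 2 <= (4 * D%:R + 1) * r ^+ 2 -> (M0 < M)%N ->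
  normc (\sum_p (psi z p)^* * psi z' p -
         \sum_(w <- words D M) (coh z w)^* * coh z' w) <= eps.

Let eta := D%:R * expR (- r ^+ 2) + 5 * (eps * (4 * r ^+ 2) ^+ D).

(** One frame serves both directions: the rescaled [transfer] map goes from the outputs to Fock
    space, and its adjoint, a contraction with conjugate overlaps, goes back. *)
Lemma models_deficiency : eta <= 1 ->
  (deficiency (H1 := output_space d k n) (H2 := fock_space D) B
     (fun t => projector (psi (zof t))) (fun t => projector (coh (zof t)))
   <= (5 * Num.sqrt eta)%:E)%E /\
  (deficiency (H1 := fock_space D) (H2 := output_space d k n) B
     (fun t => projector (coh (zof t))) (fun t => projector (psi (zof t)))
   <= (5 * Num.sqrt eta)%:E)%E.
Proof.
move=> eta1; pose Om := (4 * r ^+ 2) ^+ D.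
have r2 : 1 <= r ^+ 2 by rewrite exprn_ege1.
have Om1 : 1 <= Om by rewrite exprn_ege1 //; lra.
have Om0 : 0 < Om by apply: lt_le_trans Om1.
have E0 : 0 <= D%:R * expR (- r ^+ 2) by rewrite mulr_ge0 ?expR_ge0.
have eO : 0 < eps * Om by rewrite mulr_gt0.
have eta0 : 0 < eta by rewrite /eta -/Om; lra.
(* With this choice the losses sum to [eta]: besides the exponential term, [2 kappa + 2 eps Om] come
   from the overlap and [3 kappa + 2 eps Om] from normalizing the map. *)
pose kappa := eps * Om / 5.
have [|M [J [w [z [s [M0M w0 wsum zle [/andP[s1 s2] up lo]]]]]]] :=
    @coherent_frame D M0 r kappa r1.
  by move: eta1; rewrite /eta /kappa -/Om; lra.
have s0 : 0 <= s by apply: le_trans s1.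
(* The radius in the hypotheses adds [4 D r^2], for the frame points, to [r^2], for the parameters,
   so that [psi_gram] compares any two of them. *)
have radz j : \sum_l normc (z j l) ^+ 2 <= (4 * D%:R + 1) * r ^+ 2.
  by apply: le_trans (zle j) _; rewrite [leRHS]mulrDl mul1r lerDl sqr_ge0.
have radt t : B t -> \sum_l normc (zof t l) ^+ 2 <= (4 * D%:R + 1) * r ^+ 2.
  move=> /zofB h; apply: le_trans h _.
  by rewrite [leRHS]mulrDl mul1r lerDr mulr_ge0 ?sqr_ge0 ?mulr_ge0.
pose T := index_enum out.
pose L := transfer w (fun j => psi (z j)) (fun j => coh (z j)).
pose b := s ^+ 2 + eps * (\sum_j w j) * s.
have bE : b = s ^+ 2 + eps * Om * s by rewrite /b wsum.
have b1 : 1 <= b.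
  by rewrite bE ler_wpDr ?exprn_ege1 // mulr_ge0 // ltW.
have b0 : 0 < b by apply: lt_le_trans b1.
have Lad (u : seq 'I_D -> C) :
  \sum_(p <- T) normc (\sum_(x <- words D M) (L x p)^* * u x) ^+ 2 <=
  b * \sum_(x <- words D M) normc (u x) ^+ 2.
  apply: (@transfer_adjoint_bound R _ _ T (words D M) J w _ _ s eps) => //.
    exact: ltW.
  by move=> i j; exact: psi_gram.
have Lb (v : out -> C) :
  \sum_(x <- words D M) normc (\sum_(p <- T) L x p * v p) ^+ 2 <=
  b * \sum_(p <- T) normc (v p) ^+ 2.
  have := @adjoint_bound R _ _ (words D M) T (fun p x => (L x p)^*) b (ltW b0) Lad v.
  congr (_ <= _); apply: eq_bigr => x _; congr (normc _ ^+ 2).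
  by apply: eq_bigr => p _; rewrite conjCK.
(* Division by the square root of the bound [b] makes the map a contraction; [W] moreover cuts off
   the words of length at least [M], for a finite range. *)
pose c := (Num.sqrt b)^-1.
have c0 : 0 < c by rewrite invr_gt0 sqrtr_gt0.
have c2 : c ^+ 2 * b = 1 by rewrite exprVn sqr_sqrtr ?mulVf ?gt_eqF // ltW.
pose W (x : seq 'I_D) (p : out) : C := if (size x < M)%N then c%:C * L x p else 0.
have WL x p : x \in words D M -> W x p = c%:C * L x p.
  by rewrite mem_words /W => ->.
have [FT inFT sumFT] := big_fsetT out.
have W1 (v : out -> C) :
  \sum_(x <- words D M) normc (\sum_(p <- FT) W x p * v p) ^+ 2 <=
  \sum_(p <- FT) normc (v p) ^+ 2.
  rewrite !sumFT -[leRHS]mul1r -c2 -mulrA.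
  apply: le_trans (ler_wpM2l (sqr_ge0 c) (Lb v)); rewrite mulr_sumr.
  rewrite big_seq [leRHS]big_seq; apply: ler_sum => x xM.
  rewrite le_eqVlt; apply/orP; left; apply/eqP.
  rewrite -[c ^+ 2](_ : normc c%:C ^+ 2 = _); last first.
    by rewrite normcR ger0_norm // ltW.
  rewrite -exprMn -normcM mulr_sumr sumFT; congr (normc _ ^+ 2).
  by apply: eq_bigr => p _; rewrite WL // mulrA.
have Wad (u : seq 'I_D -> C) :
  \sum_(p <- FT) normc (\sum_(x <- words D M) (W x p)^* * u x) ^+ 2 <=
  \sum_(x <- words D M) normc (u x) ^+ 2.
  have A := @adjoint_bound R _ _ FT (words D M) W 1 ler01.
  have := A _ u; rewrite mul1r; apply => v; rewrite mul1r; exact: W1.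
have ov t : B t -> 1 - eta <=
    normc (\sum_(x <- words D M) (coh (zof t) x)^* * \sum_(p <- FT) W x p * psi (zof t) p).
  move=> Bt.
  have -> : \sum_(x <- words D M) (coh (zof t) x)^* * (\sum_(p <- FT) W x p * psi (zof t) p) =
     c%:C * \sum_(x <- words D M) (coh (zof t) x)^* * \sum_(p <- T) L x p * psi (zof t) p.
    rewrite mulr_sumr big_seq [RHS]big_seq; apply: eq_bigr => x xM.
    rewrite mulrCA; congr (_ * _); rewrite mulr_sumr sumFT; apply: eq_bigr => p _.
    by rewrite WL // mulrA.
  rewrite normcM normcR ger0_norm ?(ltW c0) //.
  have := @transfer_overlap R _ _ T (words D M) J w (fun j => psi (z j))
    (fun j => coh (z j)) s eps w0 s0 (ltW eps0) up
    (2 * kappa + D%:R * expR (- r ^+ 2)) (psi (zof t)) (coh (zof t)).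
  move=> /(_ (fun j => psi_gram (radz j) (radt t Bt) M0M)).
  move=> /(_ (coh_norm_le1 _ _) (lo _ (zofB Bt))).
  rewrite wsum -/Om; set X := normc _.
  have sq : Num.sqrt (Om * s) <= 2 * Om.
    have h : 1 <= Om * s by rewrite -[leLHS]mulr1 ler_pM.
    apply: (@le_trans _ _ (Om * s)).
      rewrite -[leRHS]ger0_norm ?(le_trans _ h) // -sqrtr_sqr ler_wsqrtr //.
      by rewrite expr2 ler_peMl // (le_trans _ h).
    rewrite mulrC ler_wpM2r ?(ltW Om0) //.
    by move: eta1; rewrite /eta -/Om => eta1; move: s2; rewrite /kappa; lra.
  have sq' := ler_wpM2l (ltW eps0) sq.
  pose x := 2 * kappa + D%:R * expR (- r ^+ 2) + 2 * (eps * Om).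
  move=> hX.
  have {}hX : 1 - x <= X.
    apply: le_trans hX; rewrite /x; move: sq'; rewrite mulrCA; lra.
  have x0 : 0 <= x by rewrite /x /kappa; lra.
  have x1 : x <= 1 by move: eta1; rewrite /eta /x /kappa -/Om; lra.
  have bl : b - 1 <= 3 * kappa + 2 * (eps * Om).
    rewrite bE; have := ler_pM s0 s0 s2 s2; rewrite -expr2.
    have := ler_wpM2l (ltW eO) s2.
    have k1 : kappa <= 1 by move: eta1; rewrite /eta /kappa -/Om; lra.
    have kk : kappa * kappa <= kappa by rewrite ler_piMr // /kappa; lra.
    have ek : eps * Om * kappa <= eps * Om by rewrite ler_piMr // ltW.
    rewrite mulrDl mul1r !mulrDr !mulr1; lra.
  have cb : 1 - (b - 1) <= c.
    have hb : 1 - (b - 1) <= b^-1.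
      rewrite -(ler_pM2r b0) mulVf ?gt_eqF //.
      by have := sqr_ge0 (b - 1); rewrite sqrrB expr1n mulr1; lra.
    apply: le_trans hb _; rewrite /c lef_pV2 ?posrE ?sqrtr_gt0 //.
    by rewrite -[leRHS]ger0_norm ?(ltW b0) // -sqrtr_sqr ler_wsqrtr // expr2 ler_peMl // ltW.
  apply: (@le_trans _ _ ((1 - (b - 1)) * (1 - x))).
    have h : (b - 1) * x >= 0 by rewrite mulr_ge0 // subr_ge0.
    rewrite mulrBl mul1r mulrBr mulr1; rewrite /eta -/Om.
    by move: bl h; rewrite /x /kappa; lra.
  apply: (@le_trans _ _ (c * (1 - x))).
    by apply: ler_wpM2r; rewrite ?subr_ge0.
  by rewrite ler_pM2l.
have hpsi t : B t -> has_sum (fun p => (psi (zof t) p)^* * psi (zof t) p) 1.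
  by move=> /radt /psi1 <-; exact: has_sum_finType.
split.
  (* The lost mass goes to the vacuum, the empty word, which is a symmetric vector. *)
  apply: (@deficiency_pure R (output_space d k n) (fock_space D) Theta B
    (fun t => psi (zof t)) (fun t => coh (zof t)) FT (words D M) W [::] eta) => //.
  - by move=> x p; rewrite mem_words /W => /negPf ->.
  - move=> a f g hf hg x y xy /=; rewrite (hf _ _ xy) (hg _ _ xy) //.
  - move=> p x y xy; rewrite /W (perm_size xy); case: ifP => // _; congr (_ * _).
    by apply: eq_bigr => j _; rewrite (coh_perm _ xy).
  - move=> x y xy; congr (_%:R); congr nat_of_bool.
    by rewrite -!size_eq0 (perm_size xy).
  - by rewrite mem_words (leq_ltn_trans _ M0M).
  - by move=> t _; exact: has_sum_coh.
apply: (@deficiency_pure R (fock_space D) (output_space d k n) Theta B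
  (fun t => coh (zof t)) (fun t => psi (zof t)) (words D M) FT (fun p x => (W x p)^*) e0 eta) => //.
- by move=> p x; rewrite inFT.
- by move=> t _; exact: has_sum_coh.
move=> t Bt; apply: le_trans (ov t Bt) _; rewrite -normcJ le_eqVlt; apply/orP; left.
apply/eqP; congr normc; rewrite rmorph_sum /=.
under eq_bigr => x _ do rewrite rmorphM /= conjCK rmorph_sum /= mulr_sumr.
rewrite exchange_big; apply: eq_bigr => p _ /=.
rewrite mulr_sumr; apply: eq_bigr => x _; rewrite rmorphM /=; ring.
Qed.

End FrameToDeficiency.

(** * The transfer operator of an irreducible isometry and its perturbations *)

Section LinearInverse.
Context {R : realType}.
Local Notation C := R[i].
Local Notation Re := complex.Re.

Lemma inj_linear_inverse m n (F : {linear 'M[C]_(m, n) -> 'M[C]_(m, n)}) :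
  (forall X, F X = 0 -> X = 0) ->
  exists G : 'M[C]_(m, n) -> 'M[C]_(m, n), exists2 K : R, 0 <= K &
    forall Y, F (G Y) = Y /\ n1 (G Y) <= K * n1 Y.
Proof.
move=> Finj; pose L := lin_mx F.
have Lu : L \in unitmx.
  rewrite -row_free_unit -kermx_eq0; apply/eqP/row_matrixP => i; rewrite row0.
  have h : row i (kermx L) *m L = 0 by rewrite -row_mul mulmx_ker row0.
  have : F (vec_mx (row i (kermx L))) = 0.
    by apply: (can_inj mxvecK); rewrite -mul_vec_lin vec_mxK h linear0.
  by move=> /Finj /(congr1 mxvec); rewrite vec_mxK linear0.
pose G Y := vec_mx (mxvec Y *m invmx L).
exists G, (\sum_i \sum_j n1 (G (delta_mx i j))).
  by do 2 (apply: sumr_ge0 => ? _); exact: n1_ge0.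
move=> Y; split.
  by apply: (can_inj mxvecK); rewrite -mul_vec_lin /G vec_mxK mulmxKV.
have -> : G Y = \sum_i \sum_j Y i j *: G (delta_mx i j).
  rewrite {1}[Y]matrix_sum_delta /G !linear_sum mulmx_suml linear_sum /=.
  apply: eq_bigr => i _; rewrite !linear_sum mulmx_suml linear_sum /=.
  by apply: eq_bigr => j _; rewrite !linearZ /= -scalemxAl linearZ.
apply: le_trans (n1_sum _ _ _) _; rewrite mulr_suml; apply: ler_sum => i _.
apply: le_trans (n1_sum _ _ _) _; rewrite mulr_suml; apply: ler_sum => j _.
by rewrite n1Z mulrC; apply: ler_wpM2l; [exact: n1_ge0|exact: n1_entry].
Qed.

Definition sqn n (v : 'cV[C]_n) : R := \sum_i normc (v i 0) ^+ 2.

Lemma sqn_ge0 n (v : 'cV[C]_n) : 0 <= sqn v.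
Proof. by apply: sumr_ge0 => i _; exact: sqr_ge0. Qed.

Lemma qfE n (v : 'cV[C]_n) (X : 'M[C]_n) :
  \tr (v^t* *m X *m v) = \sum_i \sum_j (v i 0)^* * X i j * v j 0.
Proof.
rewrite /mxtrace big_ord1 mxE exchange_big; apply: eq_bigr => j _ /=.
by rewrite mxE mulr_suml; apply: eq_bigr => i _; rewrite !mxE.
Qed.

Lemma normc_le_sqn n (v : 'cV[C]_n) i : normc (v i 0) ^+ 2 <= sqn v.
Proof.
rewrite /sqn (bigD1 i) //= lerDl; apply: sumr_ge0 => j _; exact: sqr_ge0.
Qed.

Lemma qf_bound n (v w : 'cV[C]_n) (X : 'M[C]_n) :
  normc (\sum_i \sum_j (v i 0)^* * X i j * w j 0) <= n1 X * ((sqn v + sqn w) / 2).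
Proof.
apply: le_trans (normc_sum _ _ _) _; rewrite /n1 mulr_suml; apply: ler_sum => i _.
apply: le_trans (normc_sum _ _ _) _; rewrite mulr_suml; apply: ler_sum => j _.
rewrite !normcM normcJ mulrAC [leRHS]mulrC; apply: ler_wpM2r; first exact: normc_ge0.
have := sqr_ge0 (normc (v i 0) - normc (w j 0)); rewrite sqrrB.
have := normc_le_sqn v i; have := normc_le_sqn w j; lra.
Qed.

Lemma trace_delta_mul n (Y : 'M[C]_n) i j : \tr (delta_mx j i *m Y) = Y i j.
Proof.
rewrite /mxtrace (bigD1 j) //= mxE (bigD1 i) //= mxE !eqxx mul1r.
rewrite big1 ?addr0 => [|b /negPf bi]; last by rewrite mxE bi andbF mul0r.
rewrite big1 ?addr0 // => a /negPf aj; rewrite mxE big1 // => b _.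
by rewrite mxE aj mul0r.
Qed.

Lemma psd_mx_herm n (X : 'M[C]_n) :
  (forall v : 'cV[C]_n, 0 <= \tr (v^t* *m X *m v)) -> X^t* = X.
Proof.
move=> hX; apply/matrixP => i j; rewrite !mxE.
have hp : psd (fun i j : 'I_n => X i j).
  move=> F v.
  pose w : 'cV[C]_n := \col_i (if i \in F then v i else 0).
  have := hX w; rewrite qfE; congr (_ <= _).
  have sumF (V : zmodType) (f : 'I_n -> V) : (forall i, i \notin F -> f i = 0) ->
      \sum_(i <- F) f i = \sum_i f i.
    move=> f0; rewrite [RHS](bigID (fun i => i \in F)) /= [X in _ + X]big1 ?addr0 //.
    by rewrite big_uniq ?fset_uniq.
  rewrite -[LHS]sumF; last first.
    by move=> a /negPf aF; apply: big1 => c _; rewrite mxE aF rmorph0 !mul0r.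
  rewrite big_seq [RHS]big_seq; apply: eq_bigr => a aF.
  rewrite -[LHS]sumF; last by move=> c /negPf cF; rewrite !mxE cF mulr0.
  by rewrite big_seq [RHS]big_seq; apply: eq_bigr => c cF; rewrite !mxE aF cF.
by rewrite (psd_conj i j hp) conjCK.
Qed.

Lemma pos_definite_lower n (X : 'M[C]_n) : X^t* = X -> pos_definite X ->
  exists2 c : R, 0 < c & forall v : 'cV[C]_n, c * sqn v <= Re (\tr (v^t* *m X *m v)).
Proof.
move=> hX pX; have [f [d [fo fc fE]]] := herm_spectral hX.
have quad (v : 'cV[C]_n) : \tr (v^t* *m X *m v) =
    \sum_k (d k)%:C * (normc (\sum_j (f k j)^* * v j 0) ^+ 2)%:C.
  rewrite qfE.
  under eq_bigr => i _ do under eq_bigr => j _ do rewrite fE mulr_sumr mulr_suml.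
  under eq_bigr => i _ do rewrite exchange_big.
  rewrite exchange_big; apply: eq_bigr => k _ /=.
  rewrite -mulJc rmorph_sum mulr_suml mulr_sumr; apply: eq_bigr => i _.
  rewrite !mulr_sumr; apply: eq_bigr => j _; rewrite rmorphM /= conjCK; ring.
have d0 k : 0 < d k.
  pose v : 'cV[C]_n := \col_j f k j.
  have fk l : \sum_j (f l j)^* * v j 0 = (l == k)%:R.
    by rewrite -fo; apply: eq_bigr => j _; rewrite mxE.
  have v0 : v != 0.
    apply/eqP => v0; have := fk k; rewrite v0 eqxx.
    rewrite big1 => [/eqP|j _]; last by rewrite mxE mulr0.
    by rewrite eq_sym oner_eq0.
  have := pX v v0; rewrite quad (bigD1 k) //= fk eqxx normc1 expr1n mulr1 big1 ?addr0.
    by rewrite ltcR.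
  by move=> l lk; rewrite fk (negPf lk) normc0 expr0n /= mulr0.
have parseval (v : 'cV[C]_n) : \sum_k normc (\sum_j (f k j)^* * v j 0) ^+ 2 = sqn v.
  apply: (@complexI R); rewrite /sqn !rmorph_sum /=.
  transitivity (\sum_i \sum_j (\sum_k f k i * (f k j)^*) * ((v i 0)^* * v j 0)).
    under [RHS]eq_bigr => i _ do under eq_bigr => j _ do rewrite mulr_suml.
    under [RHS]eq_bigr => i _ do rewrite exchange_big.
    rewrite [RHS]exchange_big; apply: eq_bigr => k _ /=.
    rewrite -mulJc rmorph_sum mulr_suml; apply: eq_bigr => i _.
    rewrite mulr_sumr; apply: eq_bigr => j _; rewrite rmorphM /= conjCK; ring.
  apply: eq_bigr => i _; rewrite (bigD1 i) //= fc eqxx mul1r big1 ?addr0 ?mulJc //.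
  by move=> j ji; rewrite fc eq_sym (negPf ji) mul0r.
(* A number below every eigenvalue, obtained without a minimum over an index set that may be
   empty. *)
pose c := (1 + \sum_k (d k)^-1)^-1.
have S0 : 0 <= \sum_k (d k)^-1 by apply: sumr_ge0 => k _; rewrite invr_ge0 ltW.
exists c => [|v]; first by rewrite invr_gt0 ltr_pwDl.
rewrite quad Re_sum -parseval mulr_sumr; apply: ler_sum => k _.
rewrite -real_complexM /=; apply: ler_wpM2r; first exact: sqr_ge0.
rewrite /c -[leRHS]invrK lef_pV2 ?posrE ?invr_gt0 ?ltr_pwDl //.
rewrite (bigD1 k) //= addrCA lerDl addr_ge0 //.
by apply: sumr_ge0 => l _; rewrite invr_ge0 ltW.
Qed.

End LinearInverse.

Section TransferMaps.
Context {R : realType}.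
Local Notation C := R[i].
Local Notation Re := complex.Re.
Variables d k : nat.
Local Notation op := 'M[C]_(d * k, d).
Implicit Types (V A L : op) (X Y rho : 'M[C]_d).

(** The adjoint of [V1] times [X] tensor identity times [V2], in Kraus form; for [V1 = V2 = V] it is
    the dual of [predual V]. *)
Definition twist V1 V2 X : 'M[C]_d :=
  \sum_(i < k) (kraus V1 i)^t* *m X *m kraus V2 i.

Lemma sum_mxtens (V : zmodType) (f : 'I_(d * k) -> V) :
  \sum_q f q = \sum_i \sum_a f (mxtens.mxtens_index (a, i)).
Proof.
rewrite exchange_big pair_bigA /= (reindex (@mxtens.mxtens_index d k)) /=.
  by apply: eq_bigr => -[a i].
exists (@mxtens.mxtens_unindex d k) => x _.
  by rewrite mxtens.mxtens_indexK.
by rewrite mxtens.mxtens_unindexK.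
Qed.

Lemma twist1 V1 V2 : twist V1 V2 1%:M = V1^t* *m V2.
Proof.
apply/matrixP => a c; rewrite /twist summxE mxE sum_mxtens; apply: eq_bigr => i _.
by rewrite mulmx1 mxE; apply: eq_bigr => b _; rewrite !mxE.
Qed.

Lemma twist_linear V1 V2 (a : C) X Y :
  twist V1 V2 (a *: X + Y) = a *: twist V1 V2 X + twist V1 V2 Y.
Proof.
rewrite /twist scaler_sumr -big_split; apply: eq_bigr => i _ /=.
by rewrite mulmxDr mulmxDl -scalemxAr -scalemxAl.
Qed.

Lemma twistD V1 V2 X Y : twist V1 V2 (X + Y) = twist V1 V2 X + twist V1 V2 Y.
Proof. by have := twist_linear V1 V2 1 X Y; rewrite !scale1r. Qed.

Lemma krausB V1 V2 i : kraus (V1 - V2) i = kraus V1 i - kraus V2 i.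
Proof. by apply/matrixP => a c; rewrite !mxE. Qed.

Lemma twistB V0 V1 V2 X : twist V1 V2 X - twist V0 V0 X =
  twist (V1 - V0) V2 X + twist V0 (V2 - V0) X.
Proof.
rewrite /twist -sumrB -big_split; apply: eq_bigr => i _ /=.
rewrite !krausB trmxCB !mulmxBl mulmxBr.
by rewrite addrA subrK.
Qed.

Lemma n1_kraus V : \sum_i n1 (kraus V i) = n1 V.
Proof.
rewrite /n1 sum_mxtens; apply: eq_bigr => i _; apply: eq_bigr => a _.
by apply: eq_bigr => c _; rewrite mxE.
Qed.

Lemma n1_twist V1 V2 X : n1 (twist V1 V2 X) <= n1 V1 * n1 V2 * n1 X.
Proof.
apply: le_trans (n1_sum _ _ _) _.
apply: (@le_trans _ _ (\sum_i n1 (kraus V1 i) * n1 V2 * n1 X)).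
  apply: ler_sum => i _; apply: le_trans (n1M _ _) _.
  rewrite -mulrA [n1 V2 * _]mulrC mulrA; apply: ler_pM; rewrite ?n1_ge0 //.
    by apply: le_trans (n1M _ _) _; rewrite n1_conjt.
  by rewrite -n1_kraus (bigD1 i) //= lerDl; apply: sumr_ge0 => j _; exact: n1_ge0.
by rewrite -!mulr_suml n1_kraus.
Qed.

Lemma trace_predual V rho X :
  \tr (predual V rho *m X) = \tr (rho *m twist V V X).
Proof.
rewrite /predual /twist mulmx_suml mulmx_sumr !linear_sum; apply: eq_bigr => i _ /=.
by rewrite -!mulmxA mxtrace_mulC -!mulmxA.
Qed.

Lemma trace_predual1 V rho : Defs.isometry V -> \tr (predual V rho) = \tr rho.
Proof.
by move=> hV; rewrite -[predual V rho]mulmx1 trace_predual twist1 hV mulmx1.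
Qed.

Lemma predual_linear V : linear (predual V).
Proof.
move=> a X Y; rewrite /predual scaler_sumr -big_split; apply: eq_bigr => i _ /=.
by rewrite mulmxDr mulmxDl -scalemxAr -scalemxAl.
Qed.

Lemma predual_conjt V X : predual V (X^t*) = (predual V X)^t*.
Proof.
rewrite /predual trmxC_sum; apply: eq_bigr => i _.
by rewrite !trmxCM trmxCK mulmxA.
Qed.

Lemma predualD V X Y : predual V (X + Y) = predual V X + predual V Y.
Proof. by have := predual_linear V 1 X Y; rewrite !scale1r. Qed.

Lemma predualZ V (a : C) X : predual V (a *: X) = a *: predual V X.
Proof.
have := predual_linear V a X 0; rewrite addr0 => ->; rewrite -[RHS]addr0; congr (_ + _).
by rewrite /predual big1 // => i _; rewrite mulmx0 mul0mx.
Qed.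

Lemma rho_ssP V : irreducible V ->
  [/\ stationary V (rho_ss V), pos_definite (rho_ss V),
      (rho_ss V)^t* = rho_ss V & forall s, stationary V s -> s = rho_ss V].
Proof.
move=> [_ [rho [st pd un]]].
have e : rho_ss V = rho.
  by apply: un; rewrite /rho_ss; case: xgetP => [x _ //|/(_ rho) []].
by rewrite e; split => //; apply: psd_mx_herm; case: st => -[].
Qed.

(* A fixed Hermitian matrix of trace zero, scaled to be small, can be added to
   the faithful stationary state without leaving the set of states. *)
Lemma predual_fixed_traceless V X : irreducible V ->
  predual V X = X -> \tr X = 0 -> X = 0.
Proof.
move=> iV; have [[[r0 r1] rf] pd rh un] := rho_ssP iV.
have [c c0 hc] := pos_definite_lower rh pd.
have herm (A : 'M[C]_d) : A^t* = A -> predual V A = A -> \tr A = 0 -> A = 0.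
  move=> hA fA tA; pose e := c / (n1 A + 1).
  have nA := n1_ge0 A.
  have e0 : 0 < e by rewrite divr_gt0 // ltr_wpDl.
  have s : stationary V (rho_ss V + e%:C *: A).
    split; last by rewrite predualD predualZ rf fA.
    split; last by rewrite mxtraceD mxtraceZ tA mulr0 addr0.
    move=> v.
    have hq : \tr (v^t* *m (rho_ss V + e%:C *: A) *m v) =
       \tr (v^t* *m rho_ss V *m v) + e%:C * \tr (v^t* *m A *m v).
      by rewrite mulmxDr mulmxDl mxtraceD -scalemxAr -scalemxAl mxtraceZ.
    have real B : B^t* = B -> complex.Im (\tr (v^t* *m B *m v)) = 0.
      move=> hB; have : (\tr (v^t* *m B *m v))^* = \tr (v^t* *m B *m v).
        by rewrite -trmxC_trace !trmxCM trmxCK hB mulmxA.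
      by move=> /(congr1 (@complex.Im R)); rewrite ImJ; lra.
    rewrite hq lecE; apply/andP; split.
      by rewrite ImD ImM (real _ rh) (real _ hA) /= !mulr0 mul0r !addr0.
    rewrite ReD ReM (real _ hA) /= mulr0 subr0.
    have h1 := hc v.
    have h2 : `|Re (\tr (v^t* *m A *m v))| <= n1 A * sqn v.
      apply: le_trans (normc_Re _) _; rewrite qfE.
      by apply: le_trans (qf_bound _ _ _) _; rewrite -mulr2n -[sqn v *+ 2]mulr_natr mulfK ?pnatr_eq0.
    have h3 : e * (n1 A * sqn v) <= c * sqn v.
      rewrite mulrA; apply: ler_wpM2r; first exact: sqn_ge0.
      by rewrite /e mulrAC ler_pdivrMr ?ltr_wpDl // ler_pM2l // lerDl.
    move: h2; rewrite ler_norml => /andP[h2 _].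
    have h4 := ler_wpM2l (ltW e0) h2; rewrite mulrN in h4; lra.
  have := un _ s; move=> /eqP; rewrite -subr_eq0 addrAC subrr add0r scaler_eq0.
  case/orP => /eqP // e00; move: e0; have [->] : e = 0 by move/(congr1 (@complex.Re R)): e00.
  by rewrite ltxx.
move=> fX tX.
have fX' : predual V (X^t*) = X^t* by rewrite predual_conjt fX.
have tX' : \tr (X^t*) = 0 by rewrite trmxC_trace tX rmorph0.
have e1 : X + X^t* = 0.
  apply: herm; first by rewrite trmxCD trmxCK addrC.
    by rewrite predualD fX fX'.
  by rewrite mxtraceD tX tX' addr0.
have e2 : 'i *: (X - X^t*) = 0.
  apply: herm.
  - by rewrite trmxCZ trmxCB trmxCK conjCi scaleNr -scalerN opprB.
  - by rewrite predualZ predualD -scaleN1r predualZ fX fX'.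
  - by rewrite mxtraceZ linearB /= tX tX' subr0 mulr0.
have {}e2 : X - X^t* = 0.
  by apply/eqP; move/eqP: e2; rewrite scaler_eq0 (negPf (neq0Ci _)).
have : X + X = (X + X^t*) + (X - X^t*) by rewrite addrACA subrr addr0.
rewrite e1 e2 addr0 => /eqP; rewrite -mulr2n -scaler_nat scaler_eq0 pnatr_eq0 /= => /eqP //.
Qed.

(** The Poisson equation of the channel. The operator [Lam'] is inverted through its dual [Lam] on
    states: a traceless fixed point vanishes, so [Lam] is injective, hence onto, and duality makes
    [Lam'] injective. Pairing the solution with [rho_ss V] shows that its trace term is that of
    [M]. *)
Lemma coboundary V : irreducible V ->
  exists G : 'M[C]_d -> 'M[C]_d, exists2 K : R, 0 <= K &
   forall M, G M - twist V V (G M) = M - \tr (rho_ss V *m M) *: 1%:M /\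
     n1 (G M) <= K * n1 M.
Proof.
move=> iV; have [[[r0 r1] rf] pd rh un] := rho_ssP iV.
have isoV : Defs.isometry V := iV.1.
pose Lam X := X - predual V X + \tr X *: rho_ss V.
have LamL : linear Lam.
  move=> a X Y; rewrite /Lam predual_linear mxtraceD mxtraceZ.
  by apply/matrixP => i j; rewrite !mxE; ring.
pose LamH := HB.pack Lam (GRing.isLinear.Build C 'M[C]_d 'M[C]_d _ Lam LamL)
   : {linear 'M[C]_d -> 'M[C]_d}.
have [|GL [K1 _ HL]] := @inj_linear_inverse R d d LamH.
  move=> X /= h.
  have tX : \tr X = 0.
    have := congr1 mxtrace h; rewrite /Lam mxtraceD linearB /= trace_predual1 //.
    by rewrite subrr add0r mxtraceZ r1 mulr1 linear0.
  apply: (predual_fixed_traceless iV) => //.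
  move/eqP: h; rewrite /Lam tX scale0r addr0 subr_eq0 => /eqP; exact: esym.
pose Lam' Y := Y - twist V V Y + \tr (rho_ss V *m Y) *: 1%:M.
have LamL' : linear Lam'.
  move=> a X Y; rewrite /Lam' twist_linear mulmxDr -scalemxAr mxtraceD mxtraceZ.
  by apply/matrixP => i j; rewrite !mxE; ring.
pose LamH' := HB.pack Lam' (GRing.isLinear.Build C 'M[C]_d 'M[C]_d _ Lam' LamL')
   : {linear 'M[C]_d -> 'M[C]_d}.
have dual X Y : \tr (Lam X *m Y) = \tr (X *m Lam' Y).
  rewrite /Lam /Lam' mulmxDl mulmxBl mulmxDr mulmxBr !mxtraceD !linearN /=.
  rewrite trace_predual -scalemxAl -scalemxAr !mxtraceZ mulmx1.
  by rewrite [\tr X * _]mulrC.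
have [|G [K K0 HG]] := @inj_linear_inverse R d d LamH'.
  move=> Y /= h; apply/matrixP => i j; rewrite mxE.
  have := dual (GL (delta_mx j i)) Y; rewrite h mulmx0 linear0.
  have /= -> := (HL (delta_mx j i)).1.
  by rewrite trace_delta_mul.
exists G, K => // M; have /= [h1 h2] := HG M; split => //.
have tr1 : \tr (rho_ss V *m G M) = \tr (rho_ss V *m M).
  have := congr1 (fun Z => \tr (rho_ss V *m Z)) h1.
  rewrite /Lam' mulmxDr mulmxBr -scalemxAr mulmx1 mxtraceD linearB /= mxtraceZ r1 mulr1.
  by rewrite -trace_predual rf subrr add0r.
by apply/esym/eqP; rewrite subr_eq -tr1; apply/eqP; exact: esym h1.
Qed.

End TransferMaps.

Section OutputOverlap.
Context {R : realType}.
Local Notation C := R[i].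
Local Notation Re := complex.Re.
Local Notation Im := complex.Im.
Variables d k : nat.
Local Notation op := 'M[C]_(d * k, d).
Implicit Types (V A L D : op) (X Y rho : 'M[C]_d) (v w : 'cV[C]_d).

Definition run V v (s : seq 'I_k) : 'cV[C]_d := foldl (fun v i => kraus V i *m v) v s.

Definition qf v Y w : C := (v^t* *m Y *m w) 0 0.

Lemma qfE2 v Y w : qf v Y w = \sum_i \sum_j (v i 0)^* * Y i j * w j 0.
Proof.
rewrite /qf mxE exchange_big; apply: eq_bigr => j _ /=.
by rewrite mxE mulr_suml; apply: eq_bigr => i _; rewrite !mxE.
Qed.

Lemma qf1 v w : qf v 1%:M w = \sum_i (v i 0)^* * w i 0.
Proof. by rewrite /qf mulmx1 mxE; apply: eq_bigr => i _; rewrite !mxE. Qed.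

Lemma qf1_sqn v : qf v 1%:M v = (sqn v)%:C.
Proof. by rewrite qf1 rmorph_sum; apply: eq_bigr => i _; rewrite mulJc. Qed.

Lemma qf_sum v w (I : Type) (r : seq I) (F : I -> 'M[C]_d) :
  qf v (\sum_(i <- r) F i) w = \sum_(i <- r) qf v (F i) w.
Proof. by rewrite /qf mulmx_sumr mulmx_suml summxE. Qed.

Lemma qfD v w X Y : qf v (X + Y) w = qf v X w + qf v Y w.
Proof. by rewrite /qf mulmxDr mulmxDl mxE. Qed.

Lemma qfZ v w (a : C) Y : qf v (a *: Y) w = a * qf v Y w.
Proof. by rewrite /qf -scalemxAr -scalemxAl mxE. Qed.

Lemma sum_run_qf V1 V2 n v w Y :
  \sum_(t : n.-tuple 'I_k) qf (run V1 v t) Y (run V2 w t) =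
  qf v (iter n (twist V1 V2) Y) w.
Proof.
elim: n v w => [|n IH] v w; first by rewrite sum_tuple0.
rewrite sum_tupleS iterS /twist qf_sum; apply: eq_bigr => i _ /=.
transitivity (\sum_(t : n.-tuple 'I_k)
    qf (run V1 (kraus V1 i *m v) t) Y (run V2 (kraus V2 i *m w) t)) => //.
by rewrite IH /qf trmxCM !mulmxA.
Qed.

Lemma twist_unital V n : Defs.isometry V -> iter n (twist V V) 1%:M = 1%:M.
Proof. by move=> hV; elim: n => // n IH; rewrite iterS IH twist1. Qed.

Lemma sum_run_sqn V n v : Defs.isometry V ->
  \sum_(t : n.-tuple 'I_k) sqn (run V v t) = sqn v.
Proof.
move=> hV; apply: (@complexI R); rewrite rmorph_sum /=.
under eq_bigr => t _ do rewrite -qf1_sqn.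
by rewrite sum_run_qf twist_unital // qf1_sqn.
Qed.

(** [twist V1 V2] need not contract [n1], yet its iterates stay bounded uniformly in [n]: in the
    expansion over output strings both families of vectors have total squared norm 1. *)
Lemma qf_iter_bound V1 V2 n v Y : Defs.isometry V1 -> Defs.isometry V2 ->
  sqn v = 1 -> normc (qf v (iter n (twist V1 V2) Y) v) <= n1 Y.
Proof.
move=> h1 h2 v1; rewrite -sum_run_qf; apply: le_trans (normc_sum _ _ _) _.
apply: (@le_trans _ _ (\sum_(t : n.-tuple 'I_k)
   (n1 Y * ((sqn (run V1 v t) + sqn (run V2 v t)) / 2)))).
  by apply: ler_sum => t _; rewrite qfE2; exact: qf_bound.
rewrite -mulr_sumr -mulr_suml big_split /= !sum_run_sqn // v1.
by rewrite -mulr2n -mulr_natr mul1r divff ?pnatr_eq0 // mulr1.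
Qed.

Lemma system_output_overlap V1 V2 n v :
  \sum_p (system_output V1 v (n := n) p)^* * system_output V2 v (n := n) p =
  qf v (iter n (twist V1 V2) 1%:M) v.
Proof.
rewrite -sum_run_qf -(pair_bigA _ (fun (i : 'I_d) (t : n.-tuple 'I_k) => (run V1 v t i 0)^* * run V2 v t i 0)) /=.
by rewrite exchange_big; apply: eq_bigr => t _; rewrite qf1.
Qed.

(** The residual of an approximate eigenvector is paid once per step and does not grow, by
    [qf_iter_bound] and [normc lam <= 1]. Exchanging [1 + X] for [1] before and after the iteration
    costs [2 * n1 X]. *)
Lemma twist_iter_eigen V1 V2 n v (lam : C) X (Err : 'M[C]_d) :
  Defs.isometry V1 -> Defs.isometry V2 -> sqn v = 1 -> normc lam <= 1 ->
  twist V1 V2 (1%:M + X) = lam *: (1%:M + X) + Err ->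
  normc (qf v (iter n (twist V1 V2) 1%:M) v - lam ^+ n) <=
    n%:R * n1 Err + 2 * n1 X.
Proof.
move=> h1 h2 v1 lam1 hT; pose T := twist V1 V2; pose f m Y := qf v (iter m T Y) v.
have fD m Y Z : f m (Y + Z) = f m Y + f m Z.
  rewrite /f -qfD; congr (qf _ _ _); elim: m Y Z => //= m IH Y Z.
  by rewrite IH /T twistD.
have fZ m (a : C) Y : f m (a *: Y) = a * f m Y.
  rewrite /f -qfZ; congr (qf _ _ _); elim: m Y => //= m IH Y.
  have := twist_linear V1 V2 a (iter m T Y) 0; rewrite addr0 -/T IH => ->.
  have -> : T 0 = 0 by rewrite /T /twist big1 // => i _; rewrite mulmx0 mul0mx.
  by rewrite addr0.
have rec m : normc (f m (1%:M + X) - lam ^+ m * f 0 (1%:M + X)) <= m%:R * n1 Err.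
  elim: m => [|m IH]; first by rewrite expr0 mul1r subrr normc0 mul0r.
  have -> : f m.+1 (1%:M + X) = lam * f m (1%:M + X) + f m Err.
    by rewrite -fZ -fD -hT /f iterSr.
  have -> : lam * f m (1%:M + X) + f m Err - lam ^+ m.+1 * f 0 (1%:M + X) =
     lam * (f m (1%:M + X) - lam ^+ m * f 0 (1%:M + X)) + f m Err.
    by rewrite exprS -mulrA mulrBr addrAC.
  rewrite (le_trans (normcD _ _)) // -natr1 mulrDl mul1r; apply: lerD.
    rewrite normcM; apply: le_trans IH; apply: ler_piMl => //; exact: normc_ge0.
  exact: qf_iter_bound.
have := rec n; rewrite !fD.
have -> : f 0 1%:M = 1 by rewrite /f /= qf1_sqn v1.
rewrite -/(f n 1%:M).
have b0 : normc (f 0 X) <= n1 X by exact: (@qf_iter_bound V1 V2 0).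
have bn : normc (f n X) <= n1 X by exact: qf_iter_bound.
have ln : normc (lam ^+ n) <= 1 by rewrite normcX exprn_ile1 // normc_ge0.
move=> hn.
have -> : f n 1%:M - lam ^+ n = (f n 1%:M + f n X - lam ^+ n * (1 + f 0 X)) -
   f n X + lam ^+ n * f 0 X.
  by move: (f n _) (f n X) (lam ^+ n) (f 0 X) => p q s t; ring.
rewrite (le_trans (normcD _ _)) //.
have h3 := normcD (f n 1%:M + f n X - lam ^+ n * (1 + f 0 X)) (- f n X).
have h4 : normc (lam ^+ n * f 0 X) <= n1 X.
  by rewrite normcM; apply: le_trans b0; apply: ler_piMl => //; exact: normc_ge0.
rewrite normcN in h3; lra.
Qed.

Lemma ip_idE V A L : ip_id V A L = \tr (rho_ss V *m (A^t* *m L)).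
Proof. by rewrite /ip_id mulmxA. Qed.

Lemma ip_idD V A L L' : ip_id V A (L + L') = ip_id V A L + ip_id V A L'.
Proof. by rewrite !ip_idE !mulmxDr mxtraceD. Qed.

Lemma ip_idZ V A (a : C) L : ip_id V A (a *: L) = a * ip_id V A L.
Proof. by rewrite !ip_idE -!scalemxAr mxtraceZ. Qed.

Lemma ip_idDl V A A' L : ip_id V (A + A') L = ip_id V A L + ip_id V A' L.
Proof. by rewrite !ip_idE trmxCD mulmxDl mulmxDr mxtraceD. Qed.

Lemma ip_idZl V A (a : C) L : ip_id V (a *: A) L = a^* * ip_id V A L.
Proof. by rewrite !ip_idE trmxCZ -scalemxAl -scalemxAr mxtraceZ. Qed.

Lemma ip_idC V A L : irreducible V -> (ip_id V A L)^* = ip_id V L A.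
Proof.
move=> /rho_ssP[_ _ rh _]; rewrite !ip_idE -trmxC_trace !trmxCM trmxCK rh.
by rewrite mxtrace_mulC.
Qed.

Lemma ip_id_ge0 V A : irreducible V -> 0 <= ip_id V A A.
Proof.
move=> /rho_ssP[[[r0 _] _] _ _ _]; rewrite ip_idE mulmxA mxtrace_mulC.
rewrite mulmxA; apply: sumr_ge0 => q _.
have := r0 (A^t* *m delta_mx q 0); rewrite trmxCM trmxCK.
congr (_ <= _); rewrite -!mulmxA mxtrace_mulC !mulmxA.
have -> : (delta_mx q 0 : 'cV[C]_(d * k))^t* = delta_mx 0 q.
  by apply/matrixP => i j; rewrite !mxE andbC; case: andP => _; rewrite ?rmorph1 ?rmorph0.
by rewrite -[X in \tr X]mulmxA mul_delta_mx mxtrace_mulC trace_delta_mul.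
Qed.

(** Positivity of the square of [A - t L], with [t] the phase that makes the pairing positive. The
    arithmetic mean is the form that cancels against the Gaussian prefactors. *)
Lemma ip_id_bound V A L : irreducible V ->
  normc (ip_id V A L) <= (Re (ip_id V A A) + Re (ip_id V L L)) / 2.
Proof.
move=> iV; have [t t1 ht] := phase_exists (ip_id V A L).
have tt : t * t^* = 1 by rewrite mulrC mulJc t1 expr1n.
have := ge0_Re (ip_id_ge0 (A + (- t) *: L) iV).
rewrite ip_idD ip_idZ !ip_idDl !ip_idZl -(ip_idC A L iV).
move: ht; move: (ip_id V A L) (ip_id V A A) (ip_id V L L) => x a l ht.
have -> : a + (- t)^* * x^* + - t * (x + (- t)^* * l) =
   a + (t * t^*) * l - t * x - (t * x)^*.
  by rewrite conjcM conjcN; ring.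
rewrite tt ht mul1r conjcRe !ReD !ReN /=; lra.
Qed.

End OutputOverlap.

(** * Overlap of two output states *)

Section OneStep.
Context {R : realType}.
Local Notation C := R[i].
Local Notation Re := complex.Re.
Local Notation Im := complex.Im.

Lemma expRN_quadratic (s : R) : 0 <= s -> `|1 - s - expR (- s)| <= s ^+ 2.
Proof.
move=> s0; rewrite ler_norml; apply/andP; split; last first.
  by have := expR_ge1Dx (- s); have := sqr_ge0 s; lra.
rewrite expRN; have s1 : 0 < 1 + s by rewrite ltr_pwDl.
have h : (expR s)^-1 <= (1 + s)^-1.
  by rewrite lef_pV2 ?posrE ?expR_gt0 // expR_ge1Dx.
have : (1 + s)^-1 <= 1 - s + s ^+ 2.
  rewrite -[leLHS]mulr1 mulrC ler_pdivrMr //.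
  have : 0 <= s ^+ 3 by rewrite exprn_ge0.
  have -> : (1 - s + s ^+ 2) * (1 + s) = 1 + s ^+ 3 by ring.
  lra.
lra.
Qed.

Definition phase (z : C) : C := z / (normc z)%:C.

Lemma normc_phase z : z != 0 -> normc (phase z) = 1.
Proof.
move=> z0; rewrite /phase normcM normcV normcR ger0_norm ?normc_ge0 //.
by rewrite divff // normc_eq0.
Qed.

(** The modulus of [1 + p] exceeds its real part by at most the square of the imaginary part, and
    that real part is [exp(- s)] up to [e + s^2]. *)
Lemma phase_close (p : C) (s b e : R) : 0 <= s -> normc p <= b -> b <= 2^-1 ->
  `|Re p + s| <= e ->
  normc (1 + p - phase (1 + p) * (expR (- s))%:C) <= b ^+ 2 + e + s ^+ 2.
Proof.
move=> s0 pb b2 he; set q := 1 + p.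
have hr := le_trans (normc_Re p) pb; have hi := le_trans (normc_Im p) pb.
have rq : Re q = 1 + Re p by rewrite ReD.
have iq : Im q = Im p by rewrite ImD add0r.
move: hr; rewrite ler_norml => /andP[hr1 hr2].
have nq : Re q <= normc q by apply: le_trans (normc_Re q); exact: ler_norm.
have nq0 : normc q != 0 by apply/eqP => h; rewrite h rq in nq; lra.
have hq : q = phase q * (normc q)%:C.
  rewrite /phase divfK //; apply/eqP => h.
  by have := congr1 (@complex.Re R) h; move=> /= /eqP; rewrite (negPf nq0).
rewrite {1}hq -mulrBr normcM normc_phase; last by rewrite -normc_eq0.
rewrite mul1r -rmorphB normcR.
(* As [b <= 1/2], the sum [normc q + Re q] is at least 1, so a difference of squares bounds the
   difference. *)
have e1 : normc q - Re q <= b ^+ 2.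
  have h : (normc q - Re q) * (normc q + Re q) <= b ^+ 2.
    have -> : (normc q - Re q) * (normc q + Re q) = normc q ^+ 2 - Re q ^+ 2 by ring.
    rewrite sqr_normcE iq addrAC subrr add0r -real_normK ?num_real //.
    by rewrite lerXn2r ?nnegrE // (le_trans _ hi).
  apply: le_trans h; apply: ler_peMr; first by rewrite subr_ge0.
  rewrite rq in nq *; lra.
have e2 := expRN_quadratic s0.
move: e2 he; rewrite !ler_norml rq in e1 nq * => /andP[e2 e3] /andP[e4 e5].
by apply/andP; split; lra.
Qed.

(** [p1] and [p2] are the second-order terms of each isometry, [a] the cross term, [e] the
    remainder. The sum is the product of the conjugate of [1 + p1], of [1 + p2] and of [1 + a], up
    to products of small factors of order [h^4]; then each [1 + p] is exchanged for its [w], a phase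
    times an exponential. *)
Lemma step_close (p1 p2 a e w1 w2 : C) (P r Ee K h : R) :
  0 <= h <= 1 -> 0 <= P -> 0 <= r ->
  normc p1 <= P * h ^+ 2 -> normc p2 <= P * h ^+ 2 -> normc a <= r * h ^+ 2 ->
  normc e <= Ee * h ^+ 3 ->
  normc (1 + p1 - w1) <= K * h ^+ 3 -> normc (1 + p2 - w2) <= K * h ^+ 3 ->
  normc (1 + p2) <= 1 -> normc w1 <= 1 ->
  normc (1 + (p2 + p1^* + a + e) - w1^* * w2 * (1 + a)) <=
   (Ee + (P ^+ 2 + 2 * P * r + P ^+ 2 * r) + 2 * K * (1 + r)) * h ^+ 3.
Proof.
move=> /andP[h0 h1] P0 r0 b1 b2 ba be c1 c2 q2 w11.
have hh : h ^+ 2 <= 1 by rewrite exprn_ile1.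
have h20 : 0 <= h ^+ 2 by exact: exprn_ge0.
have h30 : 0 <= h ^+ 3 by exact: exprn_ge0.
have h4 : h ^+ 2 * h ^+ 2 <= h ^+ 3.
  by rewrite -exprD [X in h ^+ X](_ : _ = 4)%N // exprSr; apply: ler_piMr.
have -> : 1 + (p2 + p1^* + a + e) - w1^* * w2 * (1 + a) =
   e - (p1^* * p2 + p1^* * a + p2 * a + p1^* * p2 * a) +
   ((1 + p1 - w1)^* * (1 + p2) + w1^* * (1 + p2 - w2)) * (1 + a).
  by rewrite conjcD conjcD conjcN rmorph1; ring.
have H (x y : C) X Y : 0 <= X -> 0 <= Y -> normc x <= X * h ^+ 2 ->
    normc y <= Y * h ^+ 2 -> normc (x * y) <= X * Y * h ^+ 3.
  move=> X0 Y0 hx hy; rewrite normcM.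
  apply: (@le_trans _ _ ((X * h ^+ 2) * (Y * h ^+ 2))).
    by apply: ler_pM => //; exact: normc_ge0.
  by rewrite mulrACA; apply: ler_wpM2l => //; exact: mulr_ge0.
have b1' : normc p1^* <= P * h ^+ 2 by rewrite normcJ.
have t1 := H _ _ _ _ P0 P0 b1' b2.
have t2 := H _ _ _ _ P0 r0 b1' ba.
have t3 := H _ _ _ _ P0 r0 b2 ba.
have t4 : normc (p1^* * p2 * a) <= P * P * r * h ^+ 3.
  rewrite normcM mulrAC; apply: ler_pM; rewrite ?normc_ge0 //.
  by apply: le_trans ba _; apply: ler_piMr.
have na : normc (1 + a) <= 1 + r.
  apply: le_trans (normcD _ _) _; rewrite normc1 lerD2l.
  by apply: le_trans ba _; apply: ler_piMr.
have t5 : normc ((1 + p1 - w1)^* * (1 + p2)) <= K * h ^+ 3.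
  rewrite normcM normcJ; apply: le_trans c1; apply: ler_piMr => //; exact: normc_ge0.
have t6 : normc (w1^* * (1 + p2 - w2)) <= K * h ^+ 3.
  rewrite normcM normcJ; apply: le_trans c2; apply: ler_piMl => //; exact: normc_ge0.
have t7 : normc (((1 + p1 - w1)^* * (1 + p2) + w1^* * (1 + p2 - w2)) * (1 + a)) <=
    2 * K * (1 + r) * h ^+ 3.
  rewrite normcM [2 * K * (1 + r) * _]mulrAC; apply: ler_pM; rewrite ?normc_ge0 //.
  by apply: le_trans (normcD _ _) _; lra.
apply: le_trans (normcD _ _) _; apply: le_trans (lerD (normcD _ _) t7) _.
rewrite normcN; apply: le_trans (lerD (lerD be _) (lexx _)) _.
  apply: le_trans (normcD _ _) (lerD _ t4); apply: le_trans (normcD _ _) (lerD _ t3).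
  exact: le_trans (normcD _ _) (lerD t1 t2).
by rewrite le_eqVlt; apply/orP; left; apply/eqP; ring.
Qed.

End OneStep.

Section OutputGram.
Context {R : realType}.
Local Notation C := R[i].
Local Notation Re := complex.Re.
Local Notation Im := complex.Im.
Variables d k : nat.
Local Notation op := 'M[C]_(d * k, d).
Implicit Types (V A L D : op) (X Y rho : 'M[C]_d) (v w : 'cV[C]_d).

Lemma ip_id_n1 V A L : normc (ip_id V A L) <= n1 (rho_ss V) * (n1 A * n1 L).
Proof.
rewrite ip_idE; apply: le_trans (n1_trace _) _; apply: le_trans (n1M _ _) _.
by apply: ler_wpM2l; rewrite ?n1_ge0 // (le_trans (n1M _ _)) // n1_conjt.
Qed.

Lemma ip_id_isometry V0 V : irreducible V0 -> Defs.isometry V -> ip_id V0 V V = 1.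
Proof.
by move=> /rho_ssP[[[_ r1] _] _ _ _] hV; rewrite ip_idE hV mulmx1.
Qed.

Lemma ip_id_isometry_le1 V0 V1 V2 : irreducible V0 -> Defs.isometry V1 ->
  Defs.isometry V2 -> normc (ip_id V0 V1 V2) <= 1.
Proof.
move=> iV h1 h2; apply: le_trans (ip_id_bound _ _ iV) _.
rewrite !ip_id_isometry //=; lra.
Qed.

(** The phase produced by the second-order term in one step. It depends on [V] alone, so it can be
    removed from each output state separately. *)
Definition tangent_phase V0 V : C := phase (ip_id V0 V0 V).

(** One step of the limiting overlap. With the phases removed, its [n]-th power at directions scaled
    by [1 / sqrt n] is the coherent overlap, with a compound power in place of the exponential of
    the inner product. *)
Definition overlap_limit V0 V1 V2 A1 A2 : C :=
  (tangent_phase V0 V1)^* * tangent_phase V0 V2 *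
  (expR (- (Re (ip_id V0 A1 A1) / 2)) * expR (- (Re (ip_id V0 A2 A2) / 2)))%:C *
  (1 + ip_id V0 A1 A2).

Variable V0 : op.
Hypothesis iV : irreducible V0.

(** The error per step has order [h^3], whence [n h^3]; the term [h^2] is the eigenvector
    correction, paid once and not at each step. *)
Lemma overlap_step (Kp : R) : 0 <= Kp -> exists h0 K : R, [/\ 0 < h0, h0 <= 1, 0 <= K &
  forall (h : R) V1 V2 A1 A2 n v, 0 <= h <= h0 ->
    Defs.isometry V1 -> Defs.isometry V2 ->
    V0^t* *m A1 = 0 -> V0^t* *m A2 = 0 -> n1 A1 <= h -> n1 A2 <= h ->
    n1 (V1 - V0 - 'i *: A1) <= Kp * h ^+ 2 ->
    n1 (V2 - V0 - 'i *: A2) <= Kp * h ^+ 2 -> sqn v = 1 ->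
    [/\ normc (tangent_phase V0 V1) = 1, normc (tangent_phase V0 V2) = 1 &
    normc (qf v (iter n (twist V1 V2) 1%:M) v - overlap_limit V0 V1 V2 A1 A2 ^+ n) <=
      K * (n%:R * h ^+ 3 + h ^+ 2)]].
Proof.
move=> Kp0; have iso0 : Defs.isometry V0 := iV.1.
have [G [Kg Kg0 hG]] := coboundary iV.
pose r := n1 (rho_ss V0); pose N0 := n1 V0.
have r0 : 0 <= r by exact: n1_ge0. have N00 : 0 <= N0 by exact: n1_ge0.
pose KE := 2 * Kp + Kp ^+ 2.
have KE0 : 0 <= KE by rewrite /KE addr_ge0 ?mulr_ge0 ?sqr_ge0.
pose P := r * (N0 * Kp). have P0 : 0 <= P by rewrite /P !mulr_ge0.
pose C1 := 2 * N0 * Kp + 1 + KE.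
have C10 : 0 <= C1 by rewrite /C1 !addr_ge0 ?mulr_ge0.
pose K3 := P ^+ 2 + r * KE + r ^+ 2.
pose K4 := r * KE + (P ^+ 2 + 2 * P * r + P ^+ 2 * r) + 2 * K3 * (1 + r).
pose C5 := ((1 + Kp) * (N0 + (1 + Kp)) + N0 * (1 + Kp) + r * C1) * (Kg * C1).
have K30 : 0 <= K3 by rewrite /K3 !addr_ge0 ?mulr_ge0 ?sqr_ge0.
have K40 : 0 <= K4 by rewrite /K4 !addr_ge0 ?mulr_ge0 // ?addr_ge0 ?sqr_ge0.
have C50 : 0 <= C5.
  rewrite /C5 mulr_ge0 //; last exact: mulr_ge0.
  have Kp1 : 0 <= 1 + Kp by rewrite addr_ge0.
  exact: addr_ge0 (addr_ge0 (mulr_ge0 Kp1 (addr_ge0 N00 Kp1)) (mulr_ge0 N00 Kp1)) (mulr_ge0 r0 C10).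
have P1 : 1 <= 2 * P + 1 by rewrite lerDr mulr_ge0.
(* Below this threshold [P h^2 <= 1/2], the smallness that [phase_close] asks for. *)
exists (2 * P + 1)^-1, (C5 + 2 * (Kg * C1) + K4); split.
- by rewrite invr_gt0; lra.
- by rewrite invf_le1 //; lra.
- exact: addr_ge0 (addr_ge0 C50 (mulr_ge0 (ler0n _ 2) (mulr_ge0 Kg0 C10))) K40.
move=> h V1 V2 A1 A2 n v /andP[h0 hh0] iso1 iso2 o1 o2 a1 a2 d1 d2 v1.
have h1 : h <= 1 by apply: le_trans hh0 _; rewrite invf_le1 //; lra.
have hP : P * h ^+ 2 <= 2^-1.
  apply: (@le_trans _ _ (P * h)); first by apply: ler_wpM2l => //; rewrite expr2 ler_piMl.
  apply: (@le_trans _ _ (P * (2 * P + 1)^-1)); first exact: ler_wpM2l.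
  by rewrite ler_pdivrMr; lra.
have h20 : 0 <= h ^+ 2 by exact: exprn_ge0.
have h30 : 0 <= h ^+ 3 by exact: exprn_ge0.
have h2h : h ^+ 2 <= h by rewrite expr2 ler_piMl.
have h32 : h ^+ 3 <= h ^+ 2 by rewrite exprSr ler_piMr.
have h4 : h ^+ 2 * h ^+ 2 <= h ^+ 3 by rewrite -exprD [X in h ^+ X](_ : _ = 4)%N // exprSr ler_piMr.
have splitD V A : n1 (V - V0 - 'i *: A) <= Kp * h ^+ 2 ->
    exists2 D, V = V0 + 'i *: A + D & n1 D <= Kp * h ^+ 2.
  move=> hD; exists (V - V0 - 'i *: A) => //.
  by rewrite -[X in _ = _ + X]addrA -opprD [RHS]addrC subrK.
have {d1} [D1 V1E d1] := splitD _ _ d1; have {d2} [D2 V2E d2] := splitD _ _ d2.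
(* The part of the adjoint of [W] times [W'] of order at least [h^3]. No term is linear in [h],
   because the directions are orthogonal to [V0]. *)
pose remE (A A' D D' : op) := 'i *: (D^t* *m A') - 'i *: (A^t* *m D') + D^t* *m D'.
have prodE (A A' D D' W W' : op) : V0^t* *m A = 0 -> V0^t* *m A' = 0 ->
   W = V0 + 'i *: A + D -> W' = V0 + 'i *: A' + D' ->
   W^t* *m W' - 1%:M = V0^t* *m D' + D^t* *m V0 + A^t* *m A' + remE A A' D D'.
  move=> oA oA' -> ->.
  have oA2 : A^t* *m V0 = 0 by rewrite -[LHS]trmxCK trmxCM trmxCK oA trmx0 map_mx0.
  rewrite !trmxCD trmxCZ conjCi !mulmxDl !mulmxDr.
  rewrite -!scalemxAl -!scalemxAr oA' oA2 iso0 !scaler0 scalerA mulNr -expr2 sqrCi opprK scale1r.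
  rewrite /remE; move: (D^t* *m A') (A^t* *m D') (D^t* *m D') (V0^t* *m D') => M1 M2 M3 M4.
  move: (D^t* *m V0) (A^t* *m A') => M5 M6.
  by apply/matrixP => i j; rewrite !mxE; ring.
have remB A A' (D D' : op) : n1 A <= h -> n1 A' <= h -> n1 D <= Kp * h ^+ 2 ->
    n1 D' <= Kp * h ^+ 2 -> n1 (remE A A' D D') <= KE * h ^+ 3.
  move=> hA hA' hD hD'.
  apply: le_trans (n1D _ _) _; apply: le_trans (lerD (n1B _ _) (lexx _)) _.
  have ni : normc ('i : C) = 1 by rewrite /= expr0n add0r expr1n sqrtr1.
  rewrite !n1Z ni !mul1r.
  have q1 : n1 (D^t* *m A') <= Kp * h ^+ 2 * h.
    by apply: le_trans (n1M _ _) _; rewrite n1_conjt; apply: ler_pM; rewrite ?n1_ge0.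
  have q2 : n1 (A^t* *m D') <= h * (Kp * h ^+ 2).
    by apply: le_trans (n1M _ _) _; rewrite n1_conjt; apply: ler_pM; rewrite ?n1_ge0.
  have q3 : n1 (D^t* *m D') <= Kp * h ^+ 2 * (Kp * h ^+ 2).
    by apply: le_trans (n1M _ _) _; rewrite n1_conjt; apply: ler_pM; rewrite ?n1_ge0.
  have q4 : Kp * h ^+ 2 * (Kp * h ^+ 2) <= Kp ^+ 2 * h ^+ 3.
    by rewrite mulrACA -expr2 ler_wpM2l ?sqr_ge0.
  have -> : KE * h ^+ 3 = Kp * h ^+ 2 * h + h * (Kp * h ^+ 2) + Kp ^+ 2 * h ^+ 3.
    by rewrite /KE; ring.
  exact: lerD (lerD q1 q2) (le_trans q3 q4).
pose q V := ip_id V0 V0 V.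
have qE A D V : V0^t* *m A = 0 -> V = V0 + 'i *: A + D -> q V = 1 + ip_id V0 V0 D.
  move=> oA ->; rewrite /q !ip_idD ip_idZ ip_id_isometry // [ip_id V0 V0 A]ip_idE oA.
  by rewrite mulmx0 linear0 mulr0 addr0.
have pB D : n1 D <= Kp * h ^+ 2 -> normc (ip_id V0 V0 D) <= P * h ^+ 2.
  move=> hD; apply: le_trans (ip_id_n1 _ _ _) _.
  by rewrite /P -!mulrA; do 2 (apply: ler_wpM2l; first exact: n1_ge0).
have traceB Y (c : R) : n1 Y <= c -> normc (\tr (rho_ss V0 *m Y)) <= r * c.
  move=> hY; apply: le_trans (n1_trace _) _; apply: le_trans (n1M _ _) _.
  by apply: ler_wpM2l.
have xE A : ip_id V0 A A = (Re (ip_id V0 A A))%:C by apply: ge0_realc; exact: ip_id_ge0.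
have x0 A : 0 <= Re (ip_id V0 A A) by apply: ge0_Re; exact: ip_id_ge0.
have ipB A A' : n1 A <= h -> n1 A' <= h -> normc (ip_id V0 A A') <= r * h ^+ 2.
  move=> hA hA'; apply: le_trans (ip_id_n1 _ _ _) _; apply: ler_wpM2l => //.
  by rewrite expr2; apply: ler_pM; rewrite ?n1_ge0.
have ip_adj D : \tr (rho_ss V0 *m (D^t* *m V0)) = (ip_id V0 V0 D)^*.
  by rewrite ip_idC // ip_idE.
have phaseB A D V : V0^t* *m A = 0 -> n1 A <= h -> n1 D <= Kp * h ^+ 2 ->
    V = V0 + 'i *: A + D -> Defs.isometry V ->
    normc (1 + ip_id V0 V0 D - tangent_phase V0 V * (expR (- (Re (ip_id V0 A A) / 2)))%:C)
      <= K3 * h ^+ 3 /\ normc (tangent_phase V0 V) = 1.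
  move=> oA hA hD VE isoV; have hp := pB _ hD.
  (* Tracing the isometry condition of [V] against the stationary state determines the real part of
     the second-order term. *)
  have e1 : `|Re (ip_id V0 V0 D) + Re (ip_id V0 A A) / 2| <= r * (KE * h ^+ 3).
    have := prodE A A D D V V oA oA VE VE; rewrite isoV subrr.
    move: (remE A A D D) (remB A A D D hA hA hD hD) => Q hQ.
    move=> /(congr1 (fun Y => \tr (rho_ss V0 *m Y))).
    rewrite mulmx0 linear0 !mulmxDr !mxtraceD ip_adj -!ip_idE.
    have := traceB _ _ hQ.
    move: (\tr (_ *m Q)) => t ht /(congr1 (@complex.Re R)); rewrite !ReD ReJ /= => he.
    have -> : Re (ip_id V0 V0 D) + Re (ip_id V0 A A) / 2 = - (Re t / 2).
      by move: he; move: (Re _) (Re _) (Re _) => y1 y2 y3; clear; lra.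
    rewrite normrN normrM (@ger0_norm _ 2^-1) ?invr_ge0 //.
    by have := le_trans (normc_Re t) ht; have := normr_ge0 (Re t); lra.
  rewrite /tangent_phase -/(q V) (qE A D V oA VE); split; last first.
    apply: normc_phase; apply/eqP => /eqP; rewrite addrC addr_eq0 => /eqP hq.
    by move: hp; rewrite hq normcN normc1; lra.
  apply: le_trans (phase_close (divr_ge0 (x0 A) (ler0n _ 2)) hp hP e1) _.
  have s1 : Re (ip_id V0 A A) / 2 <= r * h ^+ 2.
    have := le_trans (normc_Re _) (ipB _ _ hA hA).
    by rewrite ger0_norm //; have := x0 A; lra.
  have s2 : (Re (ip_id V0 A A) / 2) ^+ 2 <= r ^+ 2 * h ^+ 3.
    apply: (@le_trans _ _ ((r * h ^+ 2) ^+ 2)).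
      by rewrite lerXn2r ?nnegrE ?mulr_ge0 ?divr_ge0.
    by rewrite exprMn [(h ^+ 2) ^+ 2]expr2 ler_wpM2l ?sqr_ge0.
  have s3 : (P * h ^+ 2) ^+ 2 <= P ^+ 2 * h ^+ 3.
    by rewrite exprMn [(h ^+ 2) ^+ 2]expr2 ler_wpM2l ?sqr_ge0.
  have -> : K3 * h ^+ 3 = P ^+ 2 * h ^+ 3 + r * (KE * h ^+ 3) + r ^+ 2 * h ^+ 3.
    by rewrite /K3; ring.
  exact: lerD (lerD s3 (lexx _)) s2.
have [c1 u1] := phaseB _ _ _ o1 a1 d1 V1E iso1.
have [c2 u2] := phaseB _ _ _ o2 a2 d2 V2E iso2.
split => //.
(* First-order perturbation theory: [1 + c] is the moved eigenvalue, and [X], which solves the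
   Poisson equation for [M], corrects the eigenvector [1]. *)
pose M := V1^t* *m V2 - 1%:M; pose X := G M; pose c := \tr (rho_ss V0 *m M).
have ME : M = V0^t* *m D2 + D1^t* *m V0 + A1^t* *m A2 + remE A1 A2 D1 D2 by exact: prodE.
have MB : n1 M <= C1 * h ^+ 2.
  rewrite ME; apply: le_trans (n1D _ _) _.
  have m1 := remB A1 A2 D1 D2 a1 a2 d1 d2.
  have m2 : n1 (V0^t* *m D2) <= N0 * (Kp * h ^+ 2).
    by apply: le_trans (n1M _ _) _; rewrite n1_conjt ler_wpM2l.
  have m3 : n1 (D1^t* *m V0) <= N0 * (Kp * h ^+ 2).
    by apply: le_trans (n1M _ _) _; rewrite n1_conjt mulrC ler_wpM2l.
  have m4 : n1 (A1^t* *m A2) <= h ^+ 2.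
    by apply: le_trans (n1M _ _) _; rewrite n1_conjt expr2 ler_pM ?n1_ge0.
  have m5 := n1D (V0^t* *m D2 + D1^t* *m V0) (A1^t* *m A2).
  have m6 := n1D (V0^t* *m D2) (D1^t* *m V0).
  have m7 := ler_wpM2l KE0 h32.
  have -> : C1 * h ^+ 2 = N0 * (Kp * h ^+ 2) + N0 * (Kp * h ^+ 2) + h ^+ 2 + KE * h ^+ 2.
    by rewrite /C1; ring.
  exact: lerD (le_trans m5 (lerD (le_trans m6 (lerD m2 m3)) m4)) (le_trans m1 m7).
have XB : n1 X <= Kg * C1 * h ^+ 2.
  by rewrite -mulrA; apply: le_trans (hG M).2 _; apply: ler_wpM2l.
have cB : normc c <= r * C1 * h ^+ 2 by rewrite -mulrA; exact: traceB.
have cE : c = ip_id V0 V0 D2 + (ip_id V0 V0 D1)^* + ip_id V0 A1 A2 +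
     \tr (rho_ss V0 *m remE A1 A2 D1 D2).
  rewrite /c ME; move: (remE _ _ _ _) => Q.
  by rewrite !mulmxDr !mxtraceD ip_adj -!ip_idE.
(* Of order [h^3]: [X] has size [h^2], while [V1 - V0] and [V2 - V0] have size [h] and [c] has size
   [h^2]. *)
pose Err := (twist V1 V2 X - twist V0 V0 X) - c *: X.
(* The approximate eigenvalue is exactly the stationary overlap of the two isometries, so its
   modulus is at most 1. A bound [1 + O(h^2)] would grow like [exp(O(r^2))] in the [n]-th power. *)
have lamE : 1 + c = ip_id V0 V1 V2.
  rewrite /c mulmxBr mulmx1 linearB /= ip_idE.
  by have [[[_ ->] _] _ _ _] := rho_ssP iV; rewrite addrCA subrr addr0.
have hT : twist V1 V2 (1%:M + X) = (1 + c) *: (1%:M + X) + Err.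
  rewrite twistD twist1 /Err.
  have := (hG M).1; rewrite -/X -/c => hX.
  have -> : twist V0 V0 X = X - (M - c *: 1%:M) by rewrite -hX opprB addrCA subrr addr0.
  rewrite /M scalerDr !scalerDl !scale1r; move: (twist V1 V2 X) (V1^t* *m V2) => T1 T2.
  by apply/matrixP => i j; rewrite !mxE; ring.
have ErrB : n1 Err <= C5 * h ^+ 3.
  have vB A D V : n1 A <= h -> n1 D <= Kp * h ^+ 2 -> V = V0 + 'i *: A + D ->
      n1 (V - V0) <= (1 + Kp) * h.
    move=> hA hD ->; rewrite -[V0 + _ + D]addrA [V0 + _]addrC addrK; apply: le_trans (n1D _ _) _.
    rewrite n1Z /= expr0n add0r expr1n sqrtr1 mul1r mulrDl mul1r; apply: lerD => //.
    by apply: le_trans hD _; rewrite ler_wpM2l.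
  have w1 := vB _ _ _ a1 d1 V1E; have w2 := vB _ _ _ a2 d2 V2E.
  have w3 : n1 V2 <= N0 + (1 + Kp).
    rewrite -[V2](subrK V0) addrC; apply: le_trans (n1D _ _) _; rewrite lerD2l.
    by apply: le_trans w2 _; rewrite ler_piMr // addr_ge0.
  have X0 := n1_ge0 X.
  have z1 : n1 (twist (V1 - V0) V2 X) <= (1 + Kp) * h * (N0 + (1 + Kp)) * (Kg * C1 * h ^+ 2).
    apply: le_trans (n1_twist _ _ _) _; apply: ler_pM => //.
      by rewrite mulr_ge0 ?n1_ge0.
    by apply: ler_pM; rewrite ?n1_ge0.
  have z2 : n1 (twist V0 (V2 - V0) X) <= N0 * ((1 + Kp) * h) * (Kg * C1 * h ^+ 2).
    apply: le_trans (n1_twist _ _ _) _; apply: ler_pM => //.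
      by rewrite mulr_ge0 ?n1_ge0.
    by apply: ler_pM; rewrite ?n1_ge0.
  have z3 : n1 (c *: X) <= r * C1 * (Kg * C1) * h ^+ 3.
    rewrite n1Z; apply: (@le_trans _ _ ((r * C1 * h ^+ 2) * (Kg * C1 * h ^+ 2))).
      by apply: ler_pM => //; exact: normc_ge0.
    by rewrite mulrACA ler_wpM2l // !mulr_ge0.
  apply: le_trans (n1B _ _) _; rewrite twistB; apply: le_trans (lerD (n1D _ _) (lexx _)) _.
  apply: le_trans (lerD (lerD z1 z2) z3) _.
  by rewrite le_eqVlt; apply/orP; left; apply/eqP; rewrite /C5; ring.
have lam1 : normc (1 + c) <= 1 by rewrite lamE; exact: ip_id_isometry_le1.
have key := @twist_iter_eigen R d k V1 V2 n v _ _ _ iso1 iso2 v1 lam1 hT.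
have p2 : normc (1 + ip_id V0 V0 D2) <= 1.
  by rewrite -(qE A2 D2 V2) //; exact: ip_id_isometry_le1.
pose t A := expR (- (Re (ip_id V0 A A) / 2)).
have tB A : 0 < t A <= 1.
  rewrite expR_gt0 /= -expR0 ler_expR oppr_le0 divr_ge0 //.
have wB A V : normc (tangent_phase V0 V) = 1 -> normc (tangent_phase V0 V * (t A)%:C) <= 1.
  by move=> hu; rewrite normcM hu mul1r normcR; have /andP[t0 t1] := tB A; rewrite gtr0_norm.
have step : normc (1 + c - overlap_limit V0 V1 V2 A1 A2) <= K4 * h ^+ 3.
  have he := traceB _ _ (remB A1 A2 D1 D2 a1 a2 d1 d2); rewrite mulrA in he.
  have h01 : 0 <= h <= 1 by rewrite h0.
  have := step_close h01 P0 r0 (pB _ d1) (pB _ d2) (ipB _ _ a1 a2) he c1 c2 p2 (wB A1 V1 u1).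
  rewrite -cE; congr (normc (_ - _) <= _).
  by rewrite /overlap_limit conjcM conjcRe real_complexM /t; ring.
(* By [ip_id_bound] the factor [1 + ip_id V0 A1 A2] is at most the exponential of half the sum of
   the squared norms, which the Gaussian prefactor cancels. *)
have limB : normc (overlap_limit V0 V1 V2 A1 A2) <= 1.
  rewrite /overlap_limit 3!normcM normcJ u1 u2 !mul1r normcR ger0_norm ?mulr_ge0 ?expR_ge0 //.
  have e1 : normc (1 + ip_id V0 A1 A2) <=
     1 + (Re (ip_id V0 A1 A1) + Re (ip_id V0 A2 A2)) / 2.
    by apply: le_trans (normcD _ _) _; rewrite normc1 lerD2l; exact: ip_id_bound.
  rewrite -expRD; set y := (X in expR X).
  have e2 := le_trans e1 (expR_ge1Dx _).
  have := ler_wpM2l (expR_ge0 y) e2; rewrite -expRD.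
  have -> : y + (Re (ip_id V0 A1 A1) + Re (ip_id V0 A2 A2)) / 2 = 0 by rewrite /y -opprD -mulrDl addNr.
  by rewrite expR0.
have pw := @normcB_pow R (1 + c) (overlap_limit V0 V1 V2 A1 A2) 1 n lam1 limB.
rewrite expr1n mulr1 in pw.
apply: le_trans (normcBD _ ((1 + c) ^+ n) _) _.
apply: le_trans (lerD key pw) _.
have f1 : n%:R * n1 Err <= n%:R * (C5 * h ^+ 3) by rewrite ler_wpM2l.
have f2 := ler_wpM2l (ler0n R n) step.
have f3 : 0 <= 2 * (Kg * C1) * (n%:R * h ^+ 3) by rewrite !mulr_ge0.
have f4 : 0 <= (C5 + K4) * h ^+ 2 := mulr_ge0 (addr_ge0 C50 K40) h20.
have -> : (C5 + 2 * (Kg * C1) + K4) * (n%:R * h ^+ 3 + h ^+ 2) =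
  n%:R * (C5 * h ^+ 3) + n%:R * (K4 * h ^+ 3) + 2 * (Kg * C1) * (n%:R * h ^+ 3) +
  (2 * (Kg * C1 * h ^+ 2) + (C5 + K4) * h ^+ 2) by ring.
by move: f1 f2 f3 f4 XB; clear; lra.
Qed.

End OutputGram.

(** * Comparison with the coherent Gram matrix *)

Section Compound.
Context {R : realType}.
Local Notation C := R[i].

Lemma bernoulli (x : R) n : x <= 1 -> 1 - n%:R * x <= (1 - x) ^+ n.
Proof.
move=> x1; elim: n => [|n IH]; first by rewrite expr0 mul0r subr0.
rewrite exprS; apply: (@le_trans _ _ ((1 - x) * (1 - n%:R * x))); last first.
  by apply: ler_wpM2l => //; rewrite subr_ge0.
rewrite -natr1; have : 0 <= n%:R * x ^+ 2 by rewrite mulr_ge0 ?sqr_ge0.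
have -> : (1 - x) * (1 - n%:R * x) = 1 - (n%:R + 1) * x + n%:R * x ^+ 2 by ring.
lra.
Qed.

(** With [s = u / n]: Bernoulli on the [n]-th power of [1 - s^2], and [1 - s <= exp(- s)]. For
    [s > 1] the right side already exceeds [exp u]. *)
Lemma compound_expR (u : R) n : 0 <= u -> (0 < n)%N ->
  expR u - (1 + u / n%:R) ^+ n <= expR u * (u ^+ 2 / n%:R).
Proof.
move=> u0 n0; pose s := u / n%:R.
have nR : 0 < n%:R :> R by rewrite ltr0n.
have s0 : 0 <= s by rewrite divr_ge0 // ltW.
have us : u = n%:R * s by rewrite /s mulrC divfK // gt_eqF.
have -> : u ^+ 2 / n%:R = n%:R * s ^+ 2.
  by rewrite /s expr_div_n [n%:R ^+ 2]expr2 invfM mulrCA !mulrA mulfK ?gt_eqF // mulrC.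
have key : expR u * (1 - n%:R * s ^+ 2) <= (1 + s) ^+ n.
  have [s1|s1] := leP s 1; last first.
    apply: (@le_trans _ _ 0); last by rewrite exprn_ge0 // addr_ge0.
    rewrite pmulr_rle0 ?expR_gt0 // subr_le0.
    have h1 : 1 <= s ^+ 2 by rewrite exprn_ege1 // ltW.
    have h2 : 1 <= n%:R :> R by rewrite ler1n.
    by rewrite -[leLHS]mulr1; apply: ler_pM.
  apply: (@le_trans _ _ (expR u * (1 - s ^+ 2) ^+ n)).
    by rewrite ler_wpM2l ?expR_ge0 // bernoulli // exprn_ile1.
  rewrite us mulrC expRM_natl -exprMn lerXn2r ?nnegrE //.
  - by rewrite mulr_ge0 ?expR_ge0 // subr_ge0 exprn_ile1.
  - exact: addr_ge0.
  have -> : 1 - s ^+ 2 = (1 + s) * (1 - s) by ring.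
  rewrite -mulrA -[leRHS]mulr1; apply: ler_wpM2l; first exact: addr_ge0.
  have h := expR_ge1Dx (- s); have := ler_wpM2r (expR_ge0 s) h.
  by rewrite -expRD addNr expR0.
by rewrite -/s; move: key; rewrite mulrBr mulr1; lra.
Qed.

(** The binomial coefficients over [n^m] lie below [1 / m!], so the complex error at [y] is at most
    the real one at [|y|]. The truncation [M > n] keeps every binomial term. *)
Lemma compound_partial_exp (y : C) n M : (0 < n)%N -> (n < M)%N ->
  normc ((1 + y / n%:R) ^+ n - \sum_(m < M) ((m`!%:R)^-1)%:C * y ^+ m) <=
  expR (normc y) * (normc y ^+ 2 / n%:R).
Proof.
move=> n0 nM; pose c m : R := 'C(n, m)%:R / n%:R ^+ m.
have nR : 0 < n%:R :> R by rewrite ltr0n.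
have expand (A : comNzRingType) (f : {rmorphism R -> A}) (x : A) :
    (1 + x * f (n%:R^-1)) ^+ n = \sum_(m < M) f (c m) * x ^+ m.
  rewrite exprDn (big_ord_widen_cond M xpredT
      (fun i => (1 ^+ (n - i) * (x * f (n%:R^-1)) ^+ i) *+ 'C(n, i)) nM) big_mkcond /=.
  apply: eq_bigr => m _; case: ltnP => hm.
    rewrite expr1n mul1r exprMn -[in LHS]rmorphXn /c rmorphM /= rmorph_nat exprVn.
    by rewrite -mulr_natl mulrA mulrAC -mulrA mulrA.
  by rewrite /c bin_small // mul0r rmorph0 mul0r.
have c_le m : c m <= (m`!%:R)^-1.
  rewrite /c ler_pdivrMr ?exprn_gt0 // -ler_pdivrMl ?invr_gt0 ?ltr0n ?fact_gt0 //.
  rewrite invrK -natrX -natrM ler_nat mulnC bin_ffact.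
  elim: m => // m IH; rewrite ffactnSr expnSr; apply: leq_mul => //; exact: leq_subr.
have -> : y / n%:R = y * (n%:R^-1)%:C.
  by congr (_ * _); rewrite fmorphV rmorph_nat.
rewrite (expand _ (real_complex R)) -sumrB.
apply: le_trans (normc_sum _ _ _) _.
apply: (@le_trans _ _ (\sum_(m < M) ((m`!%:R)^-1 - c m) * normc y ^+ m)).
  apply: ler_sum => m _; rewrite -mulrBl -rmorphB normcM normcX normcR.
  by rewrite -normrN opprB ger0_norm // subr_ge0.
under eq_bigr => m _ do rewrite mulrBl.
rewrite sumrB -(expand _ idfun) /=.
apply: le_trans (compound_expR (normc_ge0 y) n0); apply: lerB => //.
apply: le_trans (expR_partial M (normc_ge0 y)).
by rewrite le_eqVlt; apply/orP; left; apply/eqP; apply: eq_bigr => m _; rewrite mulrC.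
Qed.

Lemma phase_cancel (u u' w : C) (t t' : R) n : normc u = 1 -> normc u' = 1 ->
  (u * u'^*) ^+ n * (u^* * u' * (t * t')%:C * w) ^+ n = (t ^+ n * t' ^+ n)%:C * w ^+ n.
Proof.
move=> u1 u2; have e1 : u^* * u = 1 by rewrite mulJc u1 expr1n.
have e2 : u'^* * u' = 1 by rewrite mulJc u2 expr1n.
rewrite -exprMn; have -> : u * u'^* * (u^* * u' * (t * t')%:C * w) = (t * t')%:C * w.
  move: (u^*) (u'^*) ((t * t')%:C) e1 e2 => v v' a e1 e2.
  have -> : u * v' * (v * u' * a * w) = (v * u) * (v' * u') * (a * w) by ring.
  by rewrite e1 e2 !mul1r.
by rewrite exprMn -rmorphXn /= exprMn.
Qed.

(** The Gaussian prefactors cancel the factor [exp |y|] of [compound_partial_exp], which leaves an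
    error polynomial in [r]. *)
Lemma coherent_compound (x x' r : R) (y : C) n M : (0 < n)%N -> (n < M)%N ->
  normc y <= (x + x') / 2 -> x <= r ^+ 2 -> x' <= r ^+ 2 ->
  normc (expR (- (x / 2)) * expR (- (x' / 2)))%:C * normc ((1 + y / n%:R) ^+ n -
    \sum_(m < M) ((m`!%:R)^-1)%:C * y ^+ m) <= r ^+ 4 / n%:R.
Proof.
move=> n0 nM yb hz hz'; have y0 := normc_ge0 y.
set g := expR _ * _; have g0 : 0 <= g by rewrite mulr_ge0 ?expR_ge0.
apply: (@le_trans _ _ (g * (expR (normc y) * (normc y ^+ 2 / n%:R)))).
  by rewrite normcR ger0_norm // ler_wpM2l // compound_partial_exp.
rewrite mulrA; apply: (@le_trans _ _ (1 * (normc y ^+ 2 / n%:R))).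
  apply: ler_wpM2r; first by rewrite divr_ge0 ?sqr_ge0.
  have e1 : - (x / 2) - x' / 2 + normc y <= 0 by lra.
  by rewrite -(expR0 R) /g -expRD -expRD ler_expR.
rewrite mul1r ler_wpM2r ?invr_ge0 // -[4%N]/(2 * 2)%N exprM.
by rewrite lerXn2r ?nnegrE ?sqr_ge0 //; lra.
Qed.

(** Here [q] is [sqrt n] and [cb r / q] is the step size [h]: the main term is [n h^3], and
    [1 <= r <= q] lets it dominate the other two. *)
Lemma gram_error (cb r q h0 K : R) : 0 < h0 -> h0 <= 1 -> 1 <= cb -> 1 <= r -> 0 < q ->
  0 <= K -> cb * r / q <= h0 ->
  K * (q ^+ 2 * (cb * r / q) ^+ 3 + (cb * r / q) ^+ 2) + r ^+ 4 / q ^+ 2 <=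
  (K * (cb ^+ 3 + cb ^+ 3) + 1) * (r ^+ 3 / q).
Proof.
move=> h00 h01 cb1 r1 q0 K0 hh.
have cb0 : 0 < cb by apply: lt_le_trans cb1.
have r0 : 0 < r by apply: lt_le_trans r1.
have q1 : r <= q.
  have : cb * r <= q.
    by move: (le_trans hh h01); rewrite ler_pdivrMr // mul1r.
  by apply: le_trans; rewrite ler_peMl // ltW.
have r3 : 0 <= r ^+ 3 / q by rewrite divr_ge0 ?exprn_ge0 // ltW.
have a1 : q ^+ 2 * (cb * r / q) ^+ 3 = cb ^+ 3 * (r ^+ 3 / q).
  by field; rewrite gt_eqF.
have a2 : (cb * r / q) ^+ 2 <= cb ^+ 3 * (r ^+ 3 / q).
  have -> : (cb * r / q) ^+ 2 = cb ^+ 2 * (r ^+ 2 / q ^+ 2) by field; rewrite gt_eqF.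
  apply: ler_pM; first exact: sqr_ge0.
  - by rewrite divr_ge0 ?sqr_ge0.
  - by rewrite [cb ^+ 3]exprSr ler_peMr // exprn_ge0 // ltW.
  rewrite ler_pdivrMr ?exprn_gt0 //.
  have -> : r ^+ 3 / q * q ^+ 2 = r ^+ 2 * (r * q) by field; rewrite gt_eqF.
  rewrite ler_peMr ?sqr_ge0 //; apply: (le_trans r1); apply: ler_peMr; first exact: ltW.
  exact: le_trans r1 q1.
have a3 : r ^+ 4 / q ^+ 2 <= r ^+ 3 / q.
  rewrite ler_pdivrMr ?exprn_gt0 //.
  have -> : r ^+ 3 / q * q ^+ 2 = r ^+ 3 * q by field; rewrite gt_eqF.
  by rewrite [r ^+ 4]exprSr ler_wpM2l ?exprn_ge0 // ltW.
rewrite [leRHS]mulrDl mul1r; apply: lerD a3; rewrite -[leRHS]mulrA ler_wpM2l //.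
by rewrite mulrDl a1; apply: lerD.
Qed.

End Compound.

Section ModelGram.
Context {R : realType}.
Local Notation C := R[i].
Local Notation Re := complex.Re.
Local Notation Im := complex.Im.
Variables d k : nat.
Local Notation op := 'M[C]_(d * k, d).
Local Notation D := (d ^ 2 * (k - 1))%N.
Variables (V0 : op) (E : op -> op) (phi : 'cV[C]_d) (b : 'I_D -> op) (e0 Kp : R).
Hypothesis iV : irreducible V0.
Hypothesis onb : onb_id V0 b.
Hypothesis phi1 : phi^t* *m phi = 1%:M.
Hypothesis e00 : 0 < e0.
Hypothesis Kp0 : 0 <= Kp.
Hypothesis expE : forall A h, 0 < h -> h <= e0 -> tangent_id V0 A -> n1 A <= h ->
  Defs.isometry (E A) /\ n1 (E A - V0 - 'i *: A) <= Kp * h ^+ 2.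

Definition of_coord (z : 'I_D -> C) : op := \sum_i z i *: b i.

Definition scaled_op n z : op := E (((Num.sqrt (n%:R : R))^-1)%:C *: of_coord z).

(** One conjugate phase per step; the projector does not see it, but the overlaps then converge. *)
Definition phased_output n (z : 'I_D -> C) (p : 'I_d * n.-tuple 'I_k) : C :=
  (tangent_phase V0 (scaled_op n z))^* ^+ n * system_output (scaled_op n z) phi p.

Lemma sqn_phi : sqn phi = 1.
Proof.
apply: (@complexI R); rewrite -qf1_sqn /qf mulmx1 phi1.
by rewrite mxE.
Qed.

Lemma tangent_id_coord z : tangent_id V0 (of_coord z).
Proof.
rewrite /tangent_id /= mulmx_sumr big1 // => i _; have [h _ _] := onb.
by rewrite -scalemxAr h scaler0.
Qed.

Lemma tangent_idZ (a : C) A : tangent_id V0 A -> tangent_id V0 (a *: A).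
Proof. by rewrite /tangent_id /= => h; rewrite -scalemxAr h scaler0. Qed.

Lemma tangent_id_orth A : tangent_id V0 A -> V0^t* *m A = 0.
Proof.
rewrite /tangent_id /= => h; have h0 : V0^t* *m V0 = 1%:M := iV.1.
by rewrite -[LHS]mul1mx -h0 -mulmxA [V0 *m _]mulmxA h mulmx0.
Qed.

Lemma ip_id_coord z z' : ip_id V0 (of_coord z) (of_coord z') = \sum_i (z i)^* * z' i.
Proof.
have [_ hb _] := onb.
have ipr A : ip_id V0 A (of_coord z') = \sum_j z' j * ip_id V0 A (b j).
  rewrite /of_coord; elim/big_rec2: _ => [|i x y _ <-].
    by rewrite ip_idE !mulmx0 linear0.
  by rewrite ip_idD ip_idZ.
rewrite -[LHS]conjCK ip_idC //.
have -> : ip_id V0 (of_coord z') (of_coord z) = \sum_j z j * (z' j)^*.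
  rewrite {2}/of_coord; elim/big_rec2: _ => [|i x y _ <-].
    by rewrite ip_idE !mulmx0 linear0.
  rewrite ip_idD ip_idZ -[ip_id V0 _ (b i)]ip_idC // ipr; congr (_ * _^* + _).
  rewrite (bigD1 i) //= hb eqxx mulr1 big1 ?addr0 // => j ji.
  by rewrite hb eq_sym (negPf ji) mulr0.
by rewrite conjc_sum; apply: eq_bigr => i _; rewrite conjcM conjCK.
Qed.

Lemma n1_coord z (r : R) : 0 <= r -> \sum_l normc (z l) ^+ 2 <= r ^+ 2 ->
  n1 (of_coord z) <= r * \sum_i n1 (b i).
Proof.
move=> r0 hz; apply: le_trans (n1_sum _ _ _) _; rewrite mulr_sumr.
apply: ler_sum => i _; rewrite n1Z; apply: ler_wpM2r; first exact: n1_ge0.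
rewrite -(ler_pXn2r (n := 2)) ?nnegrE ?normc_ge0 //; apply: le_trans hz.
by rewrite (bigD1 i) //= lerDl; apply: sumr_ge0 => j _; exact: sqr_ge0.
Qed.

Lemma phased_output_gram : exists K0 K : R, [/\ 0 <= K0, 0 <= K &
  forall n (r : R), (0 < n)%N -> 1 <= r -> K0 * r <= Num.sqrt n%:R ->
  (forall z, \sum_l normc (z l) ^+ 2 <= r ^+ 2 ->
     normc (tangent_phase V0 (scaled_op n z)) = 1 /\
     \sum_p (phased_output z p)^* * phased_output (n := n) z p = 1) /\
  forall z z' M, \sum_l normc (z l) ^+ 2 <= r ^+ 2 ->
    \sum_l normc (z' l) ^+ 2 <= r ^+ 2 -> (n < M)%N ->
    normc (\sum_p (phased_output z p)^* * phased_output (n := n) z' p -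
           \sum_(w <- words D M) (coh z w)^* * coh z' w) <=
      K * (r ^+ 3 / Num.sqrt n%:R)].
Proof.
have [h0 [K [h00 h01 K0 stepH]]] := overlap_step iV Kp0.
pose cb := 1 + \sum_i n1 (b i).
have sb0 : 0 <= \sum_i n1 (b i) by apply: sumr_ge0 => i _; exact: n1_ge0.
have cb1 : 1 <= cb by rewrite lerDl.
have cb0 : 0 < cb by apply: lt_le_trans cb1.
(* This [K0] keeps [h] below both [h0], for [overlap_step], and [e0], for the expansion of [E]. *)
exists (cb / h0 + cb / e0), (K * (cb ^+ 3 + cb ^+ 3) + 1); split.
- by rewrite addr_ge0 // divr_ge0 // ltW.
- by rewrite addr_ge0 // mulr_ge0 // addr_ge0 // exprn_ge0 // ltW.
move=> n r n0 r1 hn; pose q := Num.sqrt (n%:R : R).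
have q0 : 0 < q by rewrite sqrtr_gt0 ltr0n.
have qq : q ^+ 2 = n%:R by rewrite sqr_sqrtr.
have r0 : 0 < r by apply: lt_le_trans r1.
pose h := cb * r / q.
have h0' : 0 < h by rewrite divr_gt0 ?mulr_gt0.
have hh0 : 0 <= h by exact: ltW.
have [hh he] : h <= h0 /\ h <= e0.
  move: hn; rewrite mulrDl -/q => hn.
  have t1 : 0 <= cb / h0 * r by rewrite mulr_ge0 ?divr_ge0 // ltW.
  have t2 : 0 <= cb / e0 * r by rewrite mulr_ge0 ?divr_ge0 // ltW.
  have l1 : cb / h0 * r <= q by lra.
  have l2 : cb / e0 * r <= q by lra.
  have aux w : 0 < w -> cb / w * r <= q -> h <= w.
    by move=> w0; rewrite mulrAC ler_pdivrMr // => hw; rewrite /h ler_pdivrMr // [w * q]mulrC.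
  by split; exact: aux.
pose Az z : op := (q^-1)%:C *: of_coord z.
have small z : \sum_l normc (z l) ^+ 2 <= r ^+ 2 -> n1 (Az z) <= h.
  move=> hz; rewrite n1Z normcR ger0_norm ?invr_ge0 ?(ltW q0) // mulrC.
  rewrite /h ler_wpM2r ?invr_ge0 ?(ltW q0) //; apply: le_trans (n1_coord (ltW r0) hz) _.
  by rewrite mulrC ler_wpM2r ?(ltW r0) // lerDr.
have good z : \sum_l normc (z l) ^+ 2 <= r ^+ 2 -> [/\ Defs.isometry (scaled_op n z),
    V0^t* *m Az z = 0, n1 (Az z) <= h & n1 (scaled_op n z - V0 - 'i *: Az z) <= Kp * h ^+ 2].
  move=> hz; have tA : tangent_id V0 (Az z) by exact/tangent_idZ/tangent_id_coord.
  have sA := small z hz; have [i1 i2] := expE h0' he tA sA.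
  by split => //; exact: tangent_id_orth.
have ov z z' : \sum_p (phased_output z p)^* * phased_output (n := n) z' p =
    (tangent_phase V0 (scaled_op n z) * (tangent_phase V0 (scaled_op n z'))^*) ^+ n *
    qf phi (iter n (twist (scaled_op n z) (scaled_op n z')) 1%:M) phi.
  rewrite -system_output_overlap mulr_sumr; apply: eq_bigr => p _.
  rewrite /phased_output; move: (tangent_phase _ _) (tangent_phase _ _) => t t'.
  rewrite conjcM conjcX conjCK exprMn.
  by rewrite mulrACA.
have h0h : 0 <= h <= h0 by rewrite hh0.
split=> [z hz|z z' M hz hz' nM].
  have [g1 g2 g3 g4] := good z hz.
  have [u1 _ _] := stepH h _ _ _ _ n phi h0h g1 g1 g2 g2 g3 g3 g4 g4 sqn_phi.
  split=> //; rewrite ov twist_unital // qf1_sqn sqn_phi mulr1 mulrC mulJc u1 expr1n.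
  by rewrite expr1n.
have [g1 g2 g3 g4] := good z hz; have [g1' g2' g3' g4'] := good z' hz'.
have [u1 u2] := stepH h _ _ _ _ n phi h0h g1 g1' g2 g2' g3 g3' g4 g4' sqn_phi.
rewrite ov; set u := tangent_phase V0 _; set u' := tangent_phase V0 _.
rewrite -/u in u1; rewrite -/u' in u2.
set f := qf _ _ _ => hf.
pose x := \sum_l normc (z l) ^+ 2; pose x' := \sum_l normc (z' l) ^+ 2.
pose y := \sum_l (z l)^* * z' l.
have ipA z1 z2 : ip_id V0 (Az z1) (Az z2) = (\sum_l (z1 l)^* * z2 l) / n%:R.
  rewrite /Az ip_idZ ip_idZl conjcRe ip_id_coord mulrA -real_complexM -invfM -expr2 qq.
  by rewrite mulrC fmorphV rmorph_nat.
have ipR z1 : Re (ip_id V0 (Az z1) (Az z1)) / 2 = (\sum_l normc (z1 l) ^+ 2) / 2 / n%:R.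
  rewrite ipA; under eq_bigr => l _ do rewrite mulJc.
  rewrite -rmorph_sum /= -(rmorph_nat (real_complex R)) -fmorphV -real_complexM /=.
  by rewrite mulrAC.
have expn (w : R) : expR (- (w / n%:R)) ^+ n = expR (- w).
  by rewrite -expRM_natl mulrN mulrC divfK // gt_eqF // ltr0n.
pose g := expR (- (x / 2)) * expR (- (x' / 2)).
have limE : (u * u'^*) ^+ n * overlap_limit V0 (scaled_op n z) (scaled_op n z')
     (Az z) (Az z') ^+ n = g%:C * (1 + y / n%:R) ^+ n.
  by rewrite /overlap_limit -/u -/u' phase_cancel // !ipR ipA !expn.
rewrite coh_dot -/x -/x' -/g -/y.
apply: le_trans (normcBD _ (g%:C * (1 + y / n%:R) ^+ n) _) _.
rewrite -{1}limE -!mulrBr !normcM.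
clearbody u u' f.
have uu : normc ((u * u'^*) ^+ n) = 1 by rewrite normcX normcM normcJ u1 u2 mulr1 expr1n.
rewrite uu mul1r.
have x0 : 0 <= x by apply: sumr_ge0 => l _; exact: sqr_ge0.
have x'0 : 0 <= x' by apply: sumr_ge0 => l _; exact: sqr_ge0.
have yb : normc y <= (x + x') / 2.
  have := ip_id_bound (of_coord z) (of_coord z') iV; rewrite !ip_id_coord -/y.
  by under eq_bigr => l _ do rewrite mulJc; under [X in _ + Re X]eq_bigr => l _ do rewrite mulJc;
     rewrite -!rmorph_sum.
apply: le_trans (lerD hf (coherent_compound n0 nM yb hz hz')) _.
by have := gram_error h00 h01 cb1 r1 q0 K0 hh; rewrite qq.
Qed.

End ModelGram.

(** * Calculus of smooth complex matrix functions *)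

Section IteratedDerivatives.
Context {R : realType} {T : normedModType R} {I : Type} (dir : I -> T).
Local Notation C := R[i].
Local Notation Re := complex.Re.
Local Notation Im := complex.Im.

(** [Cn_on] over any normed space and family of directions, so that charts (coordinate directions)
    and curves (the direction 1) share one calculus. *)
Fixpoint Cdir (n : nat) (U : set T) (f : T -> R) : Prop :=
  (forall x, U x -> {for x, continuous f}) /\
  if n is n'.+1 then forall i,
    (forall x, U x -> derivable f x (dir i)) /\ Cdir n' U (fun x => 'D_(dir i) f x)
  else True.

Variable U : set T.
Hypothesis oU : open U.

Lemma near_open (P : T -> Prop) x : (forall y, U y -> P y) -> U x -> \near x, P x.
Proof. by move=> h Ux; apply: filterS h _; exact: open_nbhs_nbhs. Qed.

Lemma for_continuous_ext f g x : (forall y, U y -> f y = g y) -> U x ->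
  {for x, continuous f} -> {for x, continuous (g : T -> R)}.
Proof.
move=> fg Ux h; rewrite /prop_for /continuous_at -(fg _ Ux); apply: cvg_trans h.
by apply: near_eq_cvg; apply: near_open Ux.
Qed.

Lemma Cdir_ext n f g : (forall x, U x -> f x = g x) -> Cdir n U f -> Cdir n U g.
Proof.
elim: n f g => [|n IH] f g fg [cf df].
  by split=> // x Ux; exact: for_continuous_ext fg Ux (cf x Ux).
split=> [x Ux|i]; first exact: for_continuous_ext fg Ux (cf x Ux).
have [d1 d2] := df i; split=> [x Ux|].
  by apply: near_eq_derivable (d1 x Ux); exact: near_open Ux.
by apply: IH d2 => x Ux; apply: near_eq_derive; exact: near_open Ux.
Qed.

Lemma CdirW n f : Cdir n.+1 U f -> Cdir n U f.
Proof.
elim: n f => [|n IH] f [cf df]; split=> // i.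
by have [d1 d2] := df i; split=> //; exact: IH.
Qed.

Lemma Cdir_cst n (a : R) : Cdir n U (fun=> a).
Proof.
elim: n a => [|n IH] a; split=> //; [by move=> x _; exact: cst_continuous|..].
  by move=> x _; exact: cst_continuous.
move=> i; split=> [x _|]; first exact: derivable_cst.
have -> : (fun x => 'D_(dir i) (fun=> a) x) = (fun=> 0); last exact: IH.
by apply/funext => x; rewrite -[LHS]/('D_(dir i) (cst a) x) derive_cst.
Qed.

Lemma CdirD n f g : Cdir n U f -> Cdir n U g -> Cdir n U (fun x => f x + g x).
Proof.
elim: n f g => [|n IH] f g [cf df] [cg dg]; split=> //.
- by move=> x Ux; apply: continuousD; [exact: cf|exact: cg].
- by move=> x Ux; apply: continuousD; [exact: cf|exact: cg].
move=> i; have [f1 f2] := df i; have [g1 g2] := dg i; split=> [x Ux|].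
  by apply: derivableD; [exact: f1|exact: g1].
apply: (Cdir_ext _ (IH _ _ f2 g2)) => x Ux.
by rewrite -[RHS]/('D_(dir i) (f + g) x) deriveD //; [exact: f1|exact: g1].
Qed.

Lemma CdirM n f g : Cdir n U f -> Cdir n U g -> Cdir n U (fun x => f x * g x).
Proof.
elim: n f g => [|n IH] f g hf hg; have [cf df] := hf; have [cg dg] := hg; split=> //.
- by move=> x Ux; apply: continuousM; [exact: cf|exact: cg].
- by move=> x Ux; apply: continuousM; [exact: cf|exact: cg].
move=> i; have [f1 f2] := df i; have [g1 g2] := dg i; split=> [x Ux|].
  by apply: derivableM; [exact: f1|exact: g1].
apply: (Cdir_ext _ (CdirD (IH _ _ (CdirW hf) g2) (IH _ _ (CdirW hg) f2))) => x Ux.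
by rewrite -[RHS]/('D_(dir i) (f * g) x) deriveM //; [exact: f1|exact: g1].
Qed.

Lemma CdirN n f : Cdir n U f -> Cdir n U (fun x => - f x).
Proof.
move=> hf; have -> : (fun x => - f x) = (fun x => -1 * f x).
  by apply/funext => x; rewrite mulN1r.
exact: CdirM (Cdir_cst _ _) hf.
Qed.

Lemma CdirV n f : (forall x, U x -> f x != 0) -> Cdir n U f ->
  Cdir n U (fun x => (f x)^-1).
Proof.
move=> f0; elim: n => [|n IH] hf; have [cf df] := hf; split=> //.
- by move=> x Ux; apply: continuousV; [exact: f0|exact: cf].
- by move=> x Ux; apply: continuousV; [exact: f0|exact: cf].
move=> i; have [f1 f2] := df i; split=> [x Ux|].
  by apply: derivableV; [exact: f0|exact: f1].
have h := IH (CdirW hf).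
apply: (Cdir_ext _ (CdirN (CdirM (CdirM h h) f2))) => x Ux.
rewrite deriveV; [|exact: f0|exact: f1].
by rewrite -expr2 exprVn /GRing.scale /= mulNr.
Qed.

Definition csmooth (f : T -> C) : Prop :=
  forall n, Cdir n U (fun x => Re (f x)) /\ Cdir n U (fun x => Im (f x)).

Lemma csmooth_cst (a : C) : csmooth (fun=> a).
Proof. by move=> n; split; exact: Cdir_cst. Qed.

Lemma csmoothD f g : csmooth f -> csmooth g -> csmooth (fun x => f x + g x).
Proof.
move=> hf hg n; have [f1 f2] := hf n; have [g1 g2] := hg n; split.
  by under eq_fun do rewrite ReD; exact: CdirD.
by under eq_fun do rewrite ImD; exact: CdirD.
Qed.

Lemma csmoothM f g : csmooth f -> csmooth g -> csmooth (fun x => f x * g x).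
Proof.
move=> hf hg n; have [f1 f2] := hf n; have [g1 g2] := hg n; split.
  by under eq_fun do rewrite ReM; exact: CdirD (CdirM f1 g1) (CdirN (CdirM f2 g2)).
by under eq_fun do rewrite ImM; exact: CdirD (CdirM f1 g2) (CdirM f2 g1).
Qed.

Lemma csmoothJ f : csmooth f -> csmooth (fun x => (f x)^*).
Proof.
move=> hf n; have [f1 f2] := hf n; split.
  by under eq_fun do rewrite ReJ; exact: f1.
by under eq_fun do rewrite ImJ; exact: CdirN.
Qed.

Lemma csmoothV f : (forall x, U x -> f x != 0) -> csmooth f ->
  csmooth (fun x => (f x)^-1).
Proof.
move=> f0 hf n; have [f1 f2] := hf n.
pose q x := Re (f x) * Re (f x) + Im (f x) * Im (f x).
have q0 x : U x -> q x != 0.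
  move=> Ux; rewrite /q -!expr2 -sqr_normcE expf_neq0 //.
  by rewrite normc_eq0 f0.
have hq : Cdir n U (fun x => (q x)^-1).
  by apply: CdirV q0 _; exact: CdirD (CdirM f1 f1) (CdirM f2 f2).
split.
  apply: (Cdir_ext _ (CdirM f1 hq)) => x Ux; rewrite /q -!expr2.
  by case: (f x).
apply: (Cdir_ext _ (CdirN (CdirM f2 hq))) => x Ux; rewrite /q -!expr2.
by case: (f x).
Qed.

Lemma csmooth_sum (J : Type) (r : seq J) (P : pred J) (F : J -> T -> C) :
  (forall j, csmooth (F j)) -> csmooth (fun x => \sum_(j <- r | P j) F j x).
Proof.
move=> hF; elim: r => [|j r IH].
  by under eq_fun do rewrite big_nil; exact: csmooth_cst.
under eq_fun do rewrite big_cons; case: (P j) => //; exact: csmoothD.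
Qed.

Lemma csmooth_prod (J : Type) (r : seq J) (P : pred J) (F : J -> T -> C) :
  (forall j, csmooth (F j)) -> csmooth (fun x => \prod_(j <- r | P j) F j x).
Proof.
move=> hF; elim: r => [|j r IH].
  by under eq_fun do rewrite big_nil; exact: csmooth_cst.
under eq_fun do rewrite big_cons; case: (P j) => //; exact: csmoothM.
Qed.

Definition msmooth p q (f : T -> 'M[C]_(p, q)) : Prop :=
  forall a b, csmooth (fun x => f x a b).

Lemma msmooth_cst p q (A : 'M[C]_(p, q)) : msmooth (fun=> A).
Proof. by move=> a b; exact: csmooth_cst. Qed.

Lemma msmoothD p q (f g : T -> 'M[C]_(p, q)) :
  msmooth f -> msmooth g -> msmooth (fun x => f x + g x).
Proof. by move=> hf hg a b; under eq_fun do rewrite mxE; exact: csmoothD. Qed.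

Lemma msmoothZ p q (c : C) (f : T -> 'M[C]_(p, q)) :
  msmooth f -> msmooth (fun x => c *: f x).
Proof.
move=> hf a b; under eq_fun do rewrite mxE.
exact: csmoothM (csmooth_cst c) (hf a b).
Qed.

Lemma msmoothB p q (f g : T -> 'M[C]_(p, q)) :
  msmooth f -> msmooth g -> msmooth (fun x => f x - g x).
Proof.
move=> hf hg; under eq_fun do rewrite -scaleN1r.
exact: msmoothD hf (msmoothZ _ hg).
Qed.

Lemma msmoothM p q s (f : T -> 'M[C]_(p, q)) (g : T -> 'M[C]_(q, s)) :
  msmooth f -> msmooth g -> msmooth (fun x => f x *m g x).
Proof.
move=> hf hg a b; under eq_fun do rewrite mxE.
by apply: csmooth_sum => c; exact: csmoothM.
Qed.

Lemma msmoothJ p q (f : T -> 'M[C]_(p, q)) :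
  msmooth f -> msmooth (fun x => (f x)^t*).
Proof. by move=> hf a b; under eq_fun do rewrite !mxE; exact: csmoothJ. Qed.

Lemma csmooth_det p (f : T -> 'M[C]_p) : msmooth f -> csmooth (fun x => \det (f x)).
Proof.
move=> hf; rewrite /determinant; apply: csmooth_sum => s.
by apply: csmoothM (csmooth_cst _) _; apply: csmooth_prod => a.
Qed.

(** Cramer's formula reduces the inverse to polynomials and one division. *)
Lemma msmoothV p (f : T -> 'M[C]_p) : (forall x, U x -> f x \in unitmx) ->
  msmooth f -> msmooth (fun x => invmx (f x)).
Proof.
move=> f0 hf a b n.
have h : csmooth (fun x => (\det (f x))^-1 * cofactor (f x) b a).
  apply: csmoothM.
    apply: csmoothV (csmooth_det hf) => x /f0.
    by rewrite unitmxE unitfE.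
  rewrite /cofactor; apply: csmoothM (csmooth_cst _) _; apply: csmooth_det => c e.
  by under eq_fun do rewrite !mxE; exact: hf.
have [h1 h2] := h n.
by split; [apply: Cdir_ext h1|apply: Cdir_ext h2] => x Ux;
  rewrite /invmx f0 // !mxE.
Qed.

End IteratedDerivatives.

Section MatrixDerivative.
Context {R : realType} {T : normedModType R}.
Local Notation C := R[i].
Local Notation Re := complex.Re.
Local Notation Im := complex.Im.
Variables (w x : T).

(** A relation rather than a function: identities between derivatives follow from uniqueness, by
    deriving one function in two ways. *)
Definition cder (f : T -> C) (df : C) : Prop :=
  is_derive x w (fun y => Re (f y)) (Re df) /\ is_derive x w (fun y => Im (f y)) (Im df).

Lemma cder_cst (a : C) : cder (fun=> a) 0.
Proof. by split; exact: is_derive_cst. Qed.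

Lemma cderD f g df dg : cder f df -> cder g dg -> cder (fun y => f y + g y) (df + dg).
Proof.
move=> [f1 f2] [g1 g2]; split.
  by under eq_fun do rewrite ReD; rewrite ReD; exact: is_deriveD.
by under eq_fun do rewrite ImD; rewrite ImD; exact: is_deriveD.
Qed.

Lemma cderM f g df dg : cder f df -> cder g dg ->
  cder (fun y => f y * g y) (df * g x + f x * dg).
Proof.
move=> [f1 f2] [g1 g2]; split.
  under eq_fun do rewrite ReM.
  have h := is_deriveB (is_deriveM f1 g1) (is_deriveM f2 g2).
  apply: (is_derive_eq h).
  by rewrite /GRing.scale /= ReD !ReM; ring.
under eq_fun do rewrite ImM.
have h := is_deriveD (is_deriveM f1 g2) (is_deriveM f2 g1).
apply: (is_derive_eq h).
by rewrite /GRing.scale /= ImD !ImM; ring.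
Qed.

Lemma cderJ f df : cder f df -> cder (fun y => (f y)^*) df^*.
Proof.
move=> [f1 f2]; split.
  by under eq_fun do rewrite ReJ; rewrite ReJ.
by under eq_fun do rewrite ImJ; rewrite ImJ; exact: is_deriveN.
Qed.

Lemma cder_sum (J : Type) (r : seq J) (F : J -> T -> C) (dF : J -> C) :
  (forall j, cder (F j) (dF j)) ->
  cder (fun y => \sum_(j <- r) F j y) (\sum_(j <- r) dF j).
Proof.
move=> hF; elim: r => [|j r IH].
  by under eq_fun do rewrite big_nil; rewrite big_nil; exact: cder_cst.
by under eq_fun do rewrite big_cons; rewrite big_cons; exact: cderD.
Qed.

Lemma cder_unique f df dg : cder f df -> cder f dg -> df = dg.
Proof.
by move=> [[_ f1] [_ f2]] [[_ g1] [_ g2]]; apply: eqC; rewrite -?f1 -?f2 -?g1 -?g2.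
Qed.

Definition mder p q (f : T -> 'M[C]_(p, q)) (df : 'M[C]_(p, q)) : Prop :=
  forall a b, cder (fun y => f y a b) (df a b).

Lemma mder_cst p q (A : 'M[C]_(p, q)) : mder (fun=> A) 0.
Proof. by move=> a b; rewrite mxE; exact: cder_cst. Qed.

Lemma mderD p q (f g : T -> 'M[C]_(p, q)) df dg : mder f df -> mder g dg ->
  mder (fun y => f y + g y) (df + dg).
Proof.
by move=> hf hg a b; under eq_fun do rewrite mxE; rewrite mxE; exact: cderD.
Qed.

Lemma mderM p q s (f : T -> 'M[C]_(p, q)) (g : T -> 'M[C]_(q, s)) df dg :
  mder f df -> mder g dg -> mder (fun y => f y *m g y) (df *m g x + f x *m dg).
Proof.
move=> hf hg a b; under eq_fun do rewrite mxE.
have -> : (df *m g x + f x *m dg) a b =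
   \sum_j (df a j * g x j b + f x a j * dg j b) by rewrite !mxE -big_split.
by apply: cder_sum => j; exact: (cderM (hf a j) (hg j b)).
Qed.

Lemma mderMl p q s (A : 'M[C]_(p, q)) (g : T -> 'M[C]_(q, s)) dg :
  mder g dg -> mder (fun y => A *m g y) (A *m dg).
Proof. by move=> hg; have := mderM (mder_cst A) hg; rewrite mul0mx add0r. Qed.

Lemma mderZ p q (c : C) (g : T -> 'M[C]_(p, q)) dg :
  mder g dg -> mder (fun y => c *: g y) (c *: dg).
Proof.
move=> hg a b; under eq_fun do rewrite mxE; rewrite mxE.
by have := cderM (cder_cst c) (hg a b); rewrite mul0r add0r.
Qed.

Lemma mderB p q (f g : T -> 'M[C]_(p, q)) df dg : mder f df -> mder g dg ->
  mder (fun y => f y - g y) (df - dg).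
Proof.
move=> hf hg; have := mderD hf (mderZ (-1) hg); rewrite scaleN1r.
by have -> : (fun y => f y + -1 *: g y) = (fun y => f y - g y)
  by apply/funext => y; rewrite scaleN1r.
Qed.

Lemma mderJ p q (f : T -> 'M[C]_(p, q)) df : mder f df ->
  mder (fun y => (f y)^t*) (df^t*).
Proof. by move=> hf a b; under eq_fun do rewrite !mxE; rewrite !mxE; exact: cderJ. Qed.

Lemma mder_unique p q (f : T -> 'M[C]_(p, q)) df dg :
  mder f df -> mder f dg -> df = dg.
Proof. by move=> hf hg; apply/matrixP => a b; exact: cder_unique (hf a b) (hg a b). Qed.

End MatrixDerivative.

(** * Irreducibility is an open condition among isometries *)

Section IrreducibleOpen.
Context {R : realType}.
Local Notation C := R[i].
Local Notation Re := complex.Re.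
Local Notation Im := complex.Im.
Variables d k : nat.
Local Notation op := 'M[C]_(d * k, d).
Implicit Types (V : op) (X rho : 'M[C]_d).

Lemma predualB_bound V0 V X :
  n1 (predual V X - predual V0 X) <= n1 (V - V0) * (n1 V + n1 V0) * n1 X.
Proof.
have -> : predual V X - predual V0 X =
    \sum_(i < k) (kraus (V - V0) i *m X *m (kraus V i)^t* +
                  kraus V0 i *m X *m (kraus (V - V0) i)^t*).
  rewrite /predual -sumrB; apply: eq_bigr => i _.
  by rewrite !krausB trmxCB !mulmxBl mulmxBr addrA subrK.
apply: le_trans (n1_sum _ _ _) _.
apply: (@le_trans _ _ (\sum_i n1 (kraus (V - V0) i) * ((n1 V + n1 V0) * n1 X))).
  have kn W i : n1 (kraus W i) <= n1 W.
    by rewrite -n1_kraus (bigD1 i) //= lerDl; apply: sumr_ge0 => j _; exact: n1_ge0.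
  apply: ler_sum => i _; apply: le_trans (n1D _ _) _.
  rewrite mulrDl mulrDr; apply: lerD.
    apply: le_trans (n1M _ _) _; rewrite n1_conjt.
    apply: (@le_trans _ _ (n1 (kraus (V - V0) i) * n1 X * n1 V)).
      by apply: ler_pM; rewrite ?n1_ge0 ?n1M ?kn.
    by rewrite -mulrA [n1 X * _]mulrC.
  apply: le_trans (n1M _ _) _; rewrite n1_conjt mulrC ler_wpM2l ?n1_ge0 //.
  by apply: le_trans (n1M _ _) _; rewrite ler_wpM2r ?n1_ge0 ?kn.
by rewrite -mulr_suml n1_kraus mulrA.
Qed.

Lemma absorb (x y a K : R) : 0 <= x -> 2 * (K * a) <= 1 -> x <= K * (y + a * x) ->
  x <= 2 * K * y.
Proof.
move=> x0 h1 h2; have := ler_wpM2r x0 h1; rewrite mulrDr in h2.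
rewrite mul1r -!mulrA in h2 *; lra.
Qed.

(** The equation [balance rho V X = rho] merges stationarity and normalization: for an isometry [V]
    and [rho] of trace 1, taking traces gives [X] trace 1, and then [X] is fixed by the channel. *)
Definition balance rho V X : 'M[C]_d := X - predual V X + \tr X *: rho.

Lemma balance_linear rho V : linear (balance rho V).
Proof.
move=> a X Y; rewrite /balance predual_linear mxtraceD mxtraceZ.
by apply/matrixP => i j; rewrite !mxE; ring.
Qed.

Lemma trace_balance rho V X : Defs.isometry V -> \tr rho = 1 ->
  \tr (balance rho V X) = \tr X.
Proof.
move=> hV r1; rewrite /balance mxtraceD linearB /= trace_predual1 // subrr add0r.
by rewrite mxtraceZ r1 mulr1.
Qed.

Lemma balance_coercive V0 : irreducible V0 -> exists2 K : R, 0 < K &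
  forall X, n1 X <= K * n1 (balance (rho_ss V0) V0 X).
Proof.
move=> iV; have [[[r0 r1] rf] pd rh un] := rho_ssP iV.
pose L := HB.pack (balance (rho_ss V0) V0)
   (GRing.isLinear.Build C 'M[C]_d 'M[C]_d _ (balance (rho_ss V0) V0)
      (balance_linear (rho_ss V0) V0)) : {linear 'M[C]_d -> 'M[C]_d}.
have inj X : L X = 0 -> X = 0.
  move=> /= h; have tX : \tr X = 0.
    by rewrite -(trace_balance X iV.1 r1) h linear0.
  apply: (predual_fixed_traceless iV) => //.
  move/eqP: h; rewrite /balance tX scale0r addr0 subr_eq0 => /eqP; exact: esym.
have [G [K K0 HG]] := inj_linear_inverse inj.
exists (K + 1) => [|X]; first by rewrite ltr_wpDl.
have [h1 h2] := HG (L X).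
have e : X = G (L X).
  by apply/eqP; rewrite -subr_eq0; apply/eqP/inj; rewrite linearB h1 subrr.
rewrite {1}e; apply: le_trans h2 _; rewrite mulrDl mul1r lerDl; exact: n1_ge0.
Qed.

(* Near [V0] the equation [balance V X = rho_ss V0] has a unique solution, which
   is close to [rho_ss V0], hence faithful; its trace is 1, so it is stationary. *)
Lemma irreducible_open V0 : irreducible V0 -> exists2 e : R, 0 < e &
  forall V, Defs.isometry V -> n1 (V - V0) <= e -> irreducible V.
Proof.
move=> iV; have [[[r0 r1] rf] pd rh un] := rho_ssP iV.
have [K K0 hK] := balance_coercive iV.
have [c c0 hc] := pos_definite_lower rh pd.
set rho := rho_ss V0 in r0 r1 rf pd rh un hK hc *.
have [N N0 NE] : exists2 N : R, 1 <= N & N = 2 * n1 V0 + 1.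
  by exists (2 * n1 V0 + 1); rewrite // lerDr mulr_ge0 ?n1_ge0.
pose r := n1 rho.
have rr : 0 <= r by exact: n1_ge0.
(* One constant for two needs: [2 K e N <= 1], so that coercivity passes from [V0] to [V], and
   [2 K e N r < c], so that the solution stays faithful. *)
pose S := 2 * K * N * (1 + (1 + r) / c).
have S0 : 0 < S.
  have q0 : 0 < 1 + (1 + r) / c by rewrite ltr_pwDl // divr_ge0 ?addr_ge0 // ltW.
  by rewrite /S !mulr_gt0 // (lt_le_trans _ N0).
exists (S + 1)^-1 => [|V isoV hV]; first by rewrite invr_gt0 ltr_wpDl // ltW.
pose e := n1 (V - V0); have e0 : 0 <= e by exact: n1_ge0.
have e1 : e * S < 1.
  apply: (@le_lt_trans _ _ ((S + 1)^-1 * S)); first by rewrite ler_wpM2r // ltW.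
  by rewrite mulrC ltr_pdivrMr ?ltr_wpDl ?(ltW S0) // mul1r ltrDl.
have hVn : e <= 1.
  by apply: le_trans hV _; rewrite invf_le1 ?ltr_wpDl ?(ltW S0) // lerDr ltW.
have nV : n1 V + n1 V0 <= N.
  have : n1 V <= e + n1 V0 by rewrite -[in leLHS](subrK V0 V) n1D.
  by rewrite NE; lra.
have diff X : n1 (predual V X - predual V0 X) <= e * N * n1 X.
  apply: le_trans (predualB_bound _ _ _) _; rewrite ler_wpM2r ?n1_ge0 //.
  by rewrite ler_wpM2l.
have eKN : 2 * (K * (e * N)) <= e * S.
  rewrite /S; have -> : e * (2 * K * N * (1 + (1 + r) / c)) =
     2 * (K * (e * N)) * (1 + (1 + r) / c) by ring.
  rewrite ler_peMr ?lerDl ?divr_ge0 ?addr_ge0 ?(ltW c0) //.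
  by rewrite !mulr_ge0 ?(ltW K0) // (le_trans _ N0).
have coer X : n1 X <= 2 * K * n1 (balance rho V X).
  have h1 := hK X.
  have h2 : n1 (balance rho V0 X) <= n1 (balance rho V X) + e * N * n1 X.
    have -> : balance rho V0 X = balance rho V X + (predual V X - predual V0 X).
      by rewrite /balance; apply/matrixP => i j; rewrite !mxE; ring.
    by apply: le_trans (n1D _ _) _; rewrite lerD2l.
  apply: absorb (le_trans h1 (ler_wpM2l (ltW K0) h2)); first exact: n1_ge0.
  by rewrite (le_trans eKN) // ltW.
pose L := HB.pack (balance rho V)
   (GRing.isLinear.Build C 'M[C]_d 'M[C]_d _ (balance rho V)
      (balance_linear rho V)) : {linear 'M[C]_d -> 'M[C]_d}.
have inj X : L X = 0 -> X = 0.
  by move=> /= h; apply: n1_eq0; apply: le_trans (coer X) _; rewrite h n10 mulr0.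
have injE X Y : balance rho V X = balance rho V Y -> X = Y.
  move=> h; apply/eqP; rewrite -subr_eq0; apply/eqP/inj; rewrite linearB /=.
  by rewrite h subrr.
have [G [K' _ HG]] := inj_linear_inverse inj.
pose X := G rho; have hX : balance rho V X = rho := (HG rho).1.
have tX : \tr X = 1 by rewrite -(trace_balance X isoV r1) hX.
have fX : predual V X = X.
  move/eqP: hX; rewrite /balance tX scale1r -subr_eq0 addrK subr_eq0 => /eqP; exact: esym.
have hXX : X^t* = X.
  by apply: injE; rewrite /balance predual_conjt trmxC_trace fX tX rmorph1 !subrr.
have close : n1 (X - rho) <= 2 * K * (e * N * r).
  apply: le_trans (coer _) _; rewrite ler_wpM2l ?mulr_ge0 ?(ltW K0) //.
  have -> : balance rho V (X - rho) = predual V rho - predual V0 rho.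
    rewrite -[LHS]/(L (X - rho)) linearB /= hX /balance r1 scale1r rf.
    by rewrite opprD opprB addrCA subrr addr0.
  exact: diff.
have small : 2 * K * (e * N * r) < c.
  have h1 : 2 * K * (e * N * r) * c^-1 <= e * S.
    rewrite /S; have -> : e * (2 * K * N * (1 + (1 + r) / c)) =
      2 * K * (e * N * r) * c^-1 + 2 * (K * (e * N)) * (1 + c^-1) by ring.
    rewrite lerDl !mulr_ge0 ?(ltW K0) ?addr_ge0 ?invr_ge0 ?(ltW c0) //.
    by rewrite (le_trans _ N0).
  by have := le_lt_trans h1 e1; rewrite ltr_pdivrMr // mul1r.
have quad (v : 'cV[C]_d) : (c - n1 (X - rho)) * sqn v <= Re (\tr (v^t* *m X *m v)).
  have -> : X = rho + (X - rho) by rewrite addrC subrK.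
  rewrite mulmxDr mulmxDl mxtraceD ReD.
  have h1 := hc v.
  have h2 : `|Re (\tr (v^t* *m (X - rho) *m v))| <= n1 (X - rho) * sqn v.
    apply: le_trans (normc_Re _) _; rewrite qfE.
    apply: le_trans (qf_bound _ _ _) _.
    by rewrite -mulr2n -[sqn v *+ 2]mulr_natr mulfK ?pnatr_eq0.
  move: h2; rewrite ler_norml [rho + _]addrC subrK mulrBl => /andP[h2 _]; lra.
have real (v : 'cV[C]_d) : Im (\tr (v^t* *m X *m v)) = 0.
  have : (\tr (v^t* *m X *m v))^* = \tr (v^t* *m X *m v).
    by rewrite -trmxC_trace !trmxCM trmxCK hXX mulmxA.
  by move=> /(congr1 (@complex.Im R)); rewrite ImJ; lra.
have cpos : 0 < c - n1 (X - rho) by rewrite subr_gt0 (le_lt_trans close).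
split=> //; exists X; split.
- split; last by []; split; [move=> v|by []].
  rewrite lecE; apply/andP; split; first by rewrite (real v).
  by apply: le_trans (quad v); rewrite mulr_ge0 ?(ltW cpos) // sqn_ge0.
- move=> v v0; rewrite ltcE real eqxx /=; apply: lt_le_trans (quad v).
  rewrite mulr_gt0 // lt_neqAle sqn_ge0 andbT; apply: contra_neq v0 => h.
  apply/matrixP => i j; rewrite ord1 mxE; apply: eq0_normc; apply/eqP.
  rewrite -sqrf_eq0 eq_le sqr_ge0 andbT h; exact: normc_le_sqn.
move=> s [[_ s1] sf]; apply: injE; rewrite hX /balance s1 sf subrr add0r.
by rewrite scale1r.
Qed.

End IrreducibleOpen.

(** * A chart of the isometries around [V0] *)

Section ChartAlgebra.
Context {R : realType}.
Local Notation C := R[i].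
Local Notation Re := complex.Re.
Local Notation Im := complex.Im.

(** Gram-Schmidt on the orthogonal of the range of [V]; completeness holds because the two
    orthonormal families stack into a square unitary matrix. *)
Lemma isometry_complement m d (V : 'M[C]_(m, d)) : V^t* *m V = 1%:M ->
  exists N : 'M[C]_(m, m - d), [/\ N^t* *m N = 1%:M, N^t* *m V = 0 &
    V *m V^t* + N *m N^t* = 1%:M].
Proof.
move=> hV; pose Q := V^t*.
have Qu : Q \is unitarymx by apply/unitarymxP; rewrite /Q trmxCK.
have rQ : \rank Q = d := mxrank_unitary Qu.
pose O := orthomx (@Num.conj C) (mx_of_hermitian (hermitian1mx _)) Q.
have rO : \rank O = (m - d)%N by rewrite /O rank_ortho rQ.
have : exists P : 'M[C]_(\rank O, m),
    P \is unitarymx /\ Q *m P^t* = 0.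
  exists (schmidt (row_base O)); split.
    by rewrite schmidt_unitarymx // rank_leq_col.
  apply/orthomx1P.
  by rewrite orthomx_sym eqmx_schmidt_free ?eq_row_base ?row_base_free // orthomx_sym.
rewrite rO => -[P [Pu QP]].
have dm : (d <= m)%N by rewrite -rQ rank_leq_col.
have PQ : P *m Q^t* = 0 by rewrite -[LHS]trmxCK trmxCM trmxCK QP trmx0 map_mx0.
exists (P^t*); split; rewrite ?trmxCK.
- exact/unitarymxP.
- by rewrite -[V]trmxCK.
have Uu : col_mx Q P \is unitarymx.
  apply/unitarymxP; rewrite tr_col_mx map_row_mx mul_col_row QP PQ.
  by rewrite (unitarymxP Qu) (unitarymxP Pu) -scalar_mx_block.
have := mulmxKtV (1%:M : 'M[C]_m) Uu (subnKC dm).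
by rewrite mul1mx tr_col_mx map_row_mx mul_row_col /Q trmxCK.
Qed.

(** The bounds on the inverse [u] come from [u - 1 = - D u] by absorption, without a Neumann series;
    invertibility follows in the same way from the kernel. *)
Lemma inv_perturb n (D : 'M[C]_n) : n1 D <= 2^-1 ->
  [/\ 1%:M + D \in unitmx, n1 (invmx (1%:M + D)) <= 2 * n1 (1%:M : 'M[C]_n) &
      n1 (invmx (1%:M + D) - 1%:M) <= 2 * n1 (1%:M : 'M[C]_n) * n1 D].
Proof.
move=> hD.
have U : 1%:M + D \in unitmx.
  rewrite -row_free_unit -kermx_eq0; apply/eqP; apply: n1_eq0.
  set K := kermx _; have h : K *m (1%:M + D) = 0 := mulmx_ker _.
  have e : K = - (K *m D) by apply/eqP; rewrite -addr_eq0 -{1}[K]mulmx1 -mulmxDr h.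
  have := n1M K D; rewrite -n1N -e => h2.
  have := ler_wpM2l (n1_ge0 K) hD; lra.
set u := invmx _.
have e : u - 1%:M = - (D *m u).
  have := mulmxV U; rewrite mulmxDl mul1mx -/u => <-.
  by rewrite opprD addrA subrr add0r.
have b : n1 (u - 1%:M) <= n1 D * n1 u by rewrite e n1N n1M.
have b1 : n1 u <= n1 (1%:M : 'M[C]_n) + n1 (u - 1%:M).
  by rewrite -[in leLHS](subrK 1%:M u) addrC n1D.
have b2 := ler_wpM2r (n1_ge0 u) hD.
have b3 : n1 u <= 2 * n1 (1%:M : 'M[C]_n) by lra.
split=> //; apply: le_trans b _; rewrite mulrC; apply: ler_wpM2r b3; exact: n1_ge0.
Qed.

Variables (m d : nat) (V0 : 'M[C]_(m, d)) (N : 'M[C]_(m, m - d)).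
Hypothesis V0V0 : V0^t* *m V0 = 1%:M.
Hypothesis NN : N^t* *m N = 1%:M.
Hypothesis NV0 : N^t* *m V0 = 0.
Hypothesis VN1 : V0 *m V0^t* + N *m N^t* = 1%:M.
Implicit Types (Y : 'M[C]_(m - d, d)) (H w : 'M[C]_d) (V : 'M[C]_(m, d)).

Lemma V0N : V0^t* *m N = 0.
Proof. by rewrite -[LHS]trmxCK trmxCM trmxCK NV0 trmx0 map_mx0. Qed.

(* A Cayley-type parametrization of the isometries close to [V0]; [chart_w] is
   the inverse of [1 + V0^* V]. *)
Definition chart_w Y H : 'M[C]_d := 2^-1 *: (1%:M + Y^t* *m Y) + H.
Definition chart_frame Y : 'M[C]_(m, d) := V0 + N *m Y.
Definition chart Y H : 'M[C]_(m, d) := chart_frame Y *m invmx (chart_w Y H) - V0.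

Lemma chart_frame_norm Y : (chart_frame Y)^t* *m chart_frame Y = 1%:M + Y^t* *m Y.
Proof.
rewrite /chart_frame trmxCD trmxCM mulmxDl !mulmxDr V0V0 !mulmxA.
rewrite -[_ *m N^t* *m V0]mulmxA NV0 mulmx0 V0N mul0mx -[_ *m N^t* *m N]mulmxA NN mulmx1.
by rewrite addr0 add0r.
Qed.

Lemma invmx_scaled n (c : C) (A : 'M[C]_n) : c != 0 -> A \in unitmx ->
  c *: A \in unitmx /\ invmx (c *: A) = c^-1 *: invmx A.
Proof.
move=> c0 Au; have cu : c *: A \in unitmx by rewrite unitmxZ ?unitfE.
by split=> //; rewrite invmxZ.
Qed.

Lemma half2 n (X : 'M[C]_n) : 2^-1 *: X + 2^-1 *: X = X.
Proof. by rewrite -scalerDl -mulr2n -[_ *+ 2]mulr_natr mulVf ?pnatr_eq0 // scale1r. Qed.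

Lemma conj_half : (2^-1 : C)^* = 2^-1.
Proof. by rewrite fmorphV rmorph_nat. Qed.

Lemma chart_w_herm Y H : H^t* = - H ->
  chart_w Y H + (chart_w Y H)^t* = 1%:M + Y^t* *m Y.
Proof.
move=> hH; rewrite /chart_w trmxCD hH trmxCZ conj_half trmxCD trmxC1 trmxCM trmxCK.
by rewrite addrACA subrr addr0 half2.
Qed.

(** By [ZZ] the adjoint square of [Z w^-1] is [w^-1] plus its adjoint. By [VZ] the cross terms with
    [V0] remove exactly this, and [V0] contributes the identity. *)
Lemma mulmx_isometry_frame Z w : w \in unitmx ->
  Z^t* *m Z = w + w^t* -> V0^t* *m Z = 1%:M ->
  (Z *m invmx w - V0)^t* *m (Z *m invmx w - V0) = 1%:M.
Proof.
move=> wu ZZ VZ.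
have ZV : Z^t* *m V0 = 1%:M by rewrite -[LHS]trmxCK trmxCM trmxCK VZ trmxC1.
have wu' : w^t* *m (invmx w)^t* = 1%:M by rewrite -trmxCM mulVmx // trmxC1.
have wu2 : (invmx w)^t* *m w^t* = 1%:M by rewrite -trmxCM mulmxV // trmxC1.
rewrite trmxCB trmxCM mulmxBl !mulmxBr !mulmxA VZ -[_ *m Z^t* *m Z]mulmxA ZZ.
rewrite -[_ *m Z^t* *m V0]mulmxA ZV mulmx1 mul1mx V0V0 mulmxDr wu2 mulmxDl mul1mx.
rewrite -mulmxA mulmxV // mulmx1.
by rewrite [_^t* + _]addrC addrK opprB addrC subrK.
Qed.

Lemma chart_isometry Y H : H^t* = - H -> chart_w Y H \in unitmx ->
  (chart Y H)^t* *m chart Y H = 1%:M.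
Proof.
move=> hH wu; apply: mulmx_isometry_frame => //.
  by rewrite chart_frame_norm chart_w_herm.
by rewrite /chart_frame mulmxDr V0V0 mulmxA V0N mul0mx addr0.
Qed.

Lemma chart_frameE Y H : chart_w Y H \in unitmx ->
  (chart Y H + V0) *m chart_w Y H = chart_frame Y.
Proof. by move=> wu; rewrite /chart subrK mulmxKV. Qed.

Lemma chart_wV Y H : chart_w Y H \in unitmx ->
  invmx (chart_w Y H) = 1%:M + V0^t* *m chart Y H.
Proof.
move=> wu; rewrite /chart mulmxBr V0V0 mulmxA /chart_frame mulmxDr V0V0 mulmxA V0N.
by rewrite mul0mx addr0 mul1mx addrCA subrr addr0.
Qed.

(** The inverse chart: [chart_wV] solved for [w], from which [Y] and the antihermitian part [H] are
    read off. *)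
Definition inv_w V : 'M[C]_d := invmx (1%:M + V0^t* *m V).
Definition inv_Y V : 'M[C]_(m - d, d) := N^t* *m V *m inv_w V.
Definition inv_H V : 'M[C]_d := 2^-1 *: (inv_w V - (inv_w V)^t*).

Lemma inv_H_antiherm V : (inv_H V)^t* = - inv_H V.
Proof. by rewrite /inv_H trmxCZ conj_half trmxCB trmxCK -scalerN opprB. Qed.

Lemma chart_wK V : V^t* *m V = 1%:M -> 1%:M + V0^t* *m V \in unitmx ->
  chart_w (inv_Y V) (inv_H V) = inv_w V.
Proof.
move=> isoV wu; pose w := inv_w V; pose B := V0^t* *m V.
have Bw : B *m w = 1%:M - w.
  have := mulmxV wu; rewrite -/(inv_w V) -/w -/B mulmxDl mul1mx => <-.
  by rewrite addrAC subrr add0r.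
(* The isometry condition enters here: it identifies the Hermitian part of [inv_w V], while
   [inv_H V] is the antihermitian part by definition. *)
have YY : 1%:M + (inv_Y V)^t* *m inv_Y V = w + w^t*.
  rewrite /inv_Y -/w !trmxCM trmxCK.
  have -> : w^t* *m (V^t* *m N) *m (N^t* *m V *m w) =
     w^t* *m (V^t* *m (N *m N^t*) *m V) *m w by rewrite !mulmxA.
  have -> : N *m N^t* = 1%:M - V0 *m V0^t* by rewrite -VN1 addrC addKr.
  rewrite mulmxBr mulmx1 mulmxBl isoV.
  have -> : V^t* *m (V0 *m V0^t*) *m V = B^t* *m B by rewrite /B trmxCM trmxCK !mulmxA.
  rewrite mulmxBr mulmx1 mulmxBl mulmxA -[_ *m B *m w]mulmxA Bw -trmxCM Bw.
  rewrite trmxCB trmxC1 mulmxBr mulmx1 mulmxBl mul1mx.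
  by apply/matrixP => i j; rewrite !mxE; ring.
rewrite /chart_w YY /inv_H -/w -scalerDr.
have -> : w + w^t* + (w - w^t*) = w + w by rewrite addrACA subrr addr0.
by rewrite scalerDr half2.
Qed.

Lemma chartK V : V^t* *m V = 1%:M -> 1%:M + V0^t* *m V \in unitmx ->
  chart (inv_Y V) (inv_H V) = V.
Proof.
move=> isoV wu; rewrite /chart chart_wK //.
have -> : chart_frame (inv_Y V) = (V + V0) *m inv_w V.
  rewrite /chart_frame /inv_Y !mulmxA.
  have -> : N *m N^t* = 1%:M - V0 *m V0^t* by rewrite -VN1 addrC addKr.
  rewrite mulmxBl mul1mx mulmxBl.
  have := mulmxV wu; rewrite -/(inv_w V) mulmxDl mul1mx => h.
  have {1}-> : V0 = V0 *m (inv_w V + V0^t* *m V *m inv_w V) by rewrite h mulmx1.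
  rewrite mulmxDr mulmxDl !mulmxA.
  by rewrite addrACA addrN addr0 addrC.
rewrite -mulmxA mulmxV ?mulmx1 ?addrK //.
by rewrite /inv_w unitmx_inv.
Qed.

(** At [V = V0] the matrix to invert is twice the identity; [inv_perturb] applies once the factor 2
    is taken out. *)
Lemma unit_near V : n1 V0 * n1 (V - V0) <= 1 ->
  [/\ 1%:M + V0^t* *m V \in unitmx, n1 (inv_w V) <= n1 (1%:M : 'M[C]_d) &
      n1 (inv_w V - 2^-1 *: 1%:M) <= n1 (1%:M : 'M[C]_d) * (n1 V0 * n1 (V - V0))].
Proof.
move=> hV; pose D := 2^-1 *: (V0^t* *m (V - V0)).
have nh : normc (2^-1 : C) = 2^-1.
  have -> : (2^-1 : C) = (2^-1 : R)%:C by rewrite fmorphV rmorph_nat.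
  by rewrite normcR ger0_norm // invr_ge0.
have DE : 1%:M + V0^t* *m V = 2 *: (1%:M + D).
  rewrite /D scalerDr scalerA mulfV ?pnatr_eq0 // scale1r mulmxBr V0V0.
  rewrite scaler_nat mulr2n -!addrA; congr (_ + _).
  by rewrite addrCA subrr addr0.
have nVV : n1 (V0^t* *m (V - V0)) <= n1 V0 * n1 (V - V0).
  by apply: le_trans (n1M _ _) _; rewrite n1_conjt.
have nD : n1 D <= 2^-1 * (n1 V0 * n1 (V - V0)) by rewrite n1Z nh ler_wpM2l ?invr_ge0.
have [|u b1 b2] := @inv_perturb d D.
  by apply: le_trans nD _; rewrite -[leRHS]mulr1 ler_wpM2l ?invr_ge0.
have two : (2 : C) != 0 by rewrite pnatr_eq0.
have [su sE] := invmx_scaled two u.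
have invE : inv_w V = 2^-1 *: invmx (1%:M + D) by rewrite /inv_w DE.
split.
- by rewrite DE.
- by rewrite invE n1Z nh; lra.
rewrite invE -scalerBr n1Z nh.
have p0 : 0 <= n1 (1%:M : 'M[C]_d) * (n1 V0 * n1 (V - V0)) by rewrite !mulr_ge0 ?n1_ge0.
have := ler_wpM2l (n1_ge0 (1%:M : 'M[C]_d)) nD.
move: (n1 (_ - _)) (n1 D) b2 p0 => x y b2 p0; lra.
Qed.

Lemma chart_near Y H : n1 Y <= 1 -> n1 Y + 2 * n1 H <= 2^-1 ->
  chart_w Y H \in unitmx /\
  n1 (chart Y H - V0) <= 4 * n1 (1%:M : 'M[C]_d) * (n1 V0 + n1 N) * (n1 Y + 2 * n1 H).
Proof.
move=> hY hh; pose D := Y^t* *m Y + 2 *: H.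
have n2 : normc (2 : C) = 2.
  by rewrite -(rmorph_nat (real_complex R)) normcR ger0_norm.
have nh : normc (2^-1 : C) = 2^-1.
  have -> : (2^-1 : C) = (2^-1 : R)%:C by rewrite fmorphV rmorph_nat.
  by rewrite normcR ger0_norm // invr_ge0.
have two : (2 : C) != 0 by rewrite pnatr_eq0.
have nD : n1 D <= n1 Y + 2 * n1 H.
  apply: le_trans (n1D _ _) _; rewrite n1Z n2 lerD2r.
  by apply: le_trans (n1M _ _) _; rewrite n1_conjt ler_piMl ?n1_ge0.
have wE : chart_w Y H = 2^-1 *: (1%:M + D).
  rewrite /chart_w /D addrA [RHS]scalerDr scalerA mulVf ?scale1r //.
have [u b1 b2] := inv_perturb (le_trans nD hh).
have [wu wV] : chart_w Y H \in unitmx /\ invmx (chart_w Y H) = 2 *: invmx (1%:M + D).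
  by rewrite wE -[X in X *: invmx _]invrK; apply: invmx_scaled; rewrite ?invr_eq0.
split=> //.
clearbody D.
have -> : chart Y H - V0 = (N *m Y - V0 *m D) *m invmx (chart_w Y H).
  have e : 2 *: chart_w Y H = 1%:M + D by rewrite wE scalerA mulfV ?scale1r.
  have -> : N *m Y - V0 *m D = chart_frame Y - 2 *: (V0 *m chart_w Y H).
    by rewrite scalemxAr e mulmxDr mulmx1 opprD addrA /chart_frame [V0 + _]addrC addrK.
  rewrite mulmxBl -scalemxAl -mulmxA mulmxV // mulmx1 scaler_nat mulr2n.
  by rewrite /chart opprD addrA.
rewrite wV; apply: le_trans (n1M _ _) _; rewrite n1Z n2.
have e1 : n1 (N *m Y - V0 *m D) <= (n1 V0 + n1 N) * (n1 Y + 2 * n1 H).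
  apply: le_trans (n1B _ _) _; rewrite mulrDl addrC; apply: lerD.
    by apply: le_trans (n1M _ _) _; rewrite ler_wpM2l ?n1_ge0.
  apply: le_trans (n1M _ _) _; rewrite ler_wpM2l ?n1_ge0 //.
  by rewrite lerDl mulr_ge0 ?n1_ge0.
have -> : 4 * n1 (1%:M : 'M[C]_d) * (n1 V0 + n1 N) * (n1 Y + 2 * n1 H) =
  ((n1 V0 + n1 N) * (n1 Y + 2 * n1 H)) * (2 * (2 * n1 (1%:M : 'M[C]_d))) by ring.
apply: ler_pM => //; rewrite ?n1_ge0 ?mulr_ge0 ?n1_ge0 //.
by rewrite ler_wpM2l.
Qed.

End ChartAlgebra.

Section RealCoordinates.
Context {R : realType}.
Local Notation C := R[i].
Local Notation Re := complex.Re.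
Local Notation Im := complex.Im.
Variables p d : nat.

(* Real coordinates of a pair (Y, H) with H antihermitian. *)
Definition coord_idx : finType := ('I_p * 'I_d * bool + 'I_d * 'I_d)%type.
Implicit Types c : coord_idx -> R.

Lemma card_coord_idx : #|coord_idx| = (2 * (p * d) + d * d)%N.
Proof. by rewrite card_sum !card_prod !card_ord card_bool mulnC. Qed.

Definition Yof c : 'M[C]_(p, d) :=
  \matrix_(a, b) (c (inl (a, b, false)) +i* c (inl (a, b, true))).
(** One real number per position parametrizes the antihermitian matrices: the antisymmetric part of
    [c] gives the real entries, the symmetric part the imaginary ones. *)
Definition Hof c : 'M[C]_d :=
  \matrix_(a, b) ((c (inr (a, b)) - c (inr (b, a))) +i* (c (inr (a, b)) + c (inr (b, a)))).

Definition coord_of (Y : 'M[C]_(p, d)) (H : 'M[C]_d) (j : coord_idx) : R :=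
  match j with
  | inl (a, b, s) => if s then Im (Y a b) else Re (Y a b)
  | inr (a, b) => (Re (H a b) + Im (H a b)) / 2
  end.

Lemma Yof_coord Y H : Yof (coord_of Y H) = Y.
Proof. by apply/matrixP => a b; rewrite mxE /=; case: (Y a b). Qed.

Lemma Hof_coord Y H : H^t* = - H -> Hof (coord_of Y H) = H.
Proof.
move=> hH; apply/matrixP => a b; rewrite mxE /=.
have /matrixP/(_ b a) := hH; rewrite !mxE => h.
have := congr1 (@complex.Re R) h; rewrite ReJ ReN => hr.
have := congr1 (@complex.Im R) h; rewrite ImJ ImN => hi.
by apply: eqC => /=; lra.
Qed.

Lemma Hof_antiherm c : (Hof c)^t* = - Hof c.
Proof.
apply/matrixP => a b; rewrite !mxE; apply: eqC; first by rewrite ReJ ReN /=; ring.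
by rewrite ImJ ImN /=; ring.
Qed.

Lemma coord_inj c j : Yof c = 0 -> Hof c = 0 -> c j = 0.
Proof.
move=> hY hH; case: j => [[[a b] s]|[a b]].
  have /matrixP/(_ a b) := hY; rewrite !mxE => h.
  by case: s; [have := congr1 (@complex.Im R) h|have := congr1 (@complex.Re R) h].
have /matrixP/(_ a b) := hH; rewrite !mxE => h.
have /= := congr1 (@complex.Im R) h; have /= := congr1 (@complex.Re R) h; lra.
Qed.

Lemma Yof_linear (a : R) c c' : Yof (fun j => a * c j + c' j) = a%:C *: Yof c + Yof c'.
Proof. by apply/matrixP => u v; rewrite !mxE; apply: eqC; rewrite ?ReD ?ImD ?ReM ?ImM /=; ring. Qed.

Lemma Hof_linear (a : R) c c' : Hof (fun j => a * c j + c' j) = a%:C *: Hof c + Hof c'.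
Proof. by apply/matrixP => u v; rewrite !mxE; apply: eqC; rewrite ?ReD ?ImD ?ReM ?ImM /=; ring. Qed.

Lemma real_linear_sum q r (f : (coord_idx -> R) -> 'M[C]_(q, r)) (I : Type) (s : seq I)
    (a : I -> R) (e : I -> coord_idx -> R) :
  (forall (x : R) c c', f (fun j => x * c j + c' j) = x%:C *: f c + f c') ->
  f (fun j => \sum_(i <- s) a i * e i j) = \sum_(i <- s) (a i)%:C *: f (e i).
Proof.
move=> fl; elim: s => [|i s IH].
  rewrite big_nil (_ : (fun j => _) = (fun j => -1 * (0 : R) + 0)).
    by rewrite (fl (-1) (fun=> 0) (fun=> 0)) rmorphN1 scaleN1r addNr.
  by apply/funext => j; rewrite big_nil mulr0 addr0.
rewrite big_cons -IH -fl; congr f; apply/funext => j; exact: big_cons.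
Qed.

Definition coord_norm : R := 4 * (p * d + d * d)%:R.

Lemma coord_norm_ge0 : 0 <= coord_norm.
Proof. by rewrite mulr_ge0. Qed.

Lemma n1_coord_le c (e : R) : 0 <= e -> (forall j, `|c j| <= e) ->
  n1 (Yof c) <= coord_norm * e /\ n1 (Hof c) <= coord_norm * e.
Proof.
move=> e0 he.
have bound q r (X : 'M[C]_(q, r)) : (q * r <= p * d + d * d)%N ->
    (forall a b, normc (X a b) <= 4 * e) -> n1 X <= coord_norm * e.
  move=> qr hX; apply: (@le_trans _ _ (\sum_(a < q) \sum_(b < r) (4 * e))).
    by do 2 (apply: ler_sum => ? _).
  rewrite sumr_const sumr_const !card_ord -mulrnA -[leLHS]mulr_natr.
  by rewrite /coord_norm [leRHS]mulrAC ler_wpM2l ?mulr_ge0 // ler_nat mulnC.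
split; apply: bound => [|a b]; rewrite ?leq_addr ?leq_addl //.
  apply: le_trans (normc_leD _) _; rewrite mxE /=.
  have := he (inl (a, b, false)); have := he (inl (a, b, true)); lra.
apply: le_trans (normc_leD _) _; rewrite mxE /=.
have h1 := he (inr (a, b)); have h2 := he (inr (b, a)).
have h3 := ler_normB (c (inr (a, b))) (c (inr (b, a))).
have h4 := ler_normD (c (inr (a, b))) (c (inr (b, a))); lra.
Qed.

Lemma coord_le Y H j : `|coord_of Y H j| <= n1 Y + n1 H.
Proof.
case: j => [[[a b] s]|[a b]] /=.
  apply: (@le_trans _ _ (n1 Y)); last by rewrite lerDl n1_ge0.
  apply: le_trans (n1_entry Y a b); case: s; [exact: normc_Im|exact: normc_Re].
apply: (@le_trans _ _ (n1 H)); last by rewrite lerDr n1_ge0.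
apply: le_trans (n1_entry H a b).
have h1 := normc_Re (H a b); have h2 := normc_Im (H a b).
move: h1 h2; rewrite !ler_norml => /andP[h1 h2] /andP[h3 h4].
by apply/andP; split; lra.
Qed.

Section Functions.
Context {T : normedModType R}.

Lemma coord_msmooth (I : Type) (dir : I -> T) (U : set T) (c : T -> coord_idx -> R) :
  open U -> (forall n j, Cdir dir n U (fun x => c x j)) ->
  msmooth dir U (fun x => Yof (c x)) /\ msmooth dir U (fun x => Hof (c x)).
Proof.
move=> oU hc; split=> a b n; split; under eq_fun do rewrite mxE /=;
  rewrite ?hc //.
  by apply: CdirD => //; apply: CdirN.
exact: CdirD.
Qed.

Lemma coord_smooth (I : Type) (dir : I -> T) (U : set T)
    (Y : T -> 'M[C]_(p, d)) (H : T -> 'M[C]_d) n j :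
  open U -> msmooth dir U Y -> msmooth dir U H ->
  Cdir dir n U (fun x => coord_of (Y x) (H x) j).
Proof.
move=> oU hY hH; case: j => [[[a b] s]|[a b]] /=.
  by have [h1 h2] := hY a b n; case: s.
have [h1 h2] := hH a b n.
by apply: CdirM => //; [apply: CdirD|apply: Cdir_cst].
Qed.

Lemma coord_mder (w x : T) (c : T -> coord_idx -> R) (dc : coord_idx -> R) :
  (forall j, is_derive x w (fun y => c y j) (dc j)) ->
  mder w x (fun y => Yof (c y)) (Yof dc) /\ mder w x (fun y => Hof (c y)) (Hof dc).
Proof.
move=> hc; split=> a b; split; under eq_fun do rewrite mxE /=; rewrite mxE /=;
  rewrite ?hc //.
- exact: is_deriveB.
- exact: is_deriveD.
Qed.

Lemma mder_near (w x : T) q r (f g : T -> 'M[C]_(q, r)) df :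
  (\near x, f x = g x) -> mder w x f df -> mder w x g df.
Proof.
move=> fg hf a b; have [h1 h2] := hf a b.
split; [apply: near_eq_is_derive h1|apply: near_eq_is_derive h2];
  by apply: filterS fg => y ->.
Qed.

Lemma msmooth_mder (I : Type) (dir : I -> T) (U : set T) q r (f : T -> 'M[C]_(q, r)) i x :
  msmooth dir U f -> U x -> mder (dir i) x f
    (\matrix_(a, b) ('D_(dir i) (fun y => Re (f y a b)) x +i*
                     'D_(dir i) (fun y => Im (f y a b)) x)).
Proof.
move=> hf Ux a b; have [[_ h1] [_ h2]] := hf a b 1%N.
by rewrite mxE; split; [have [d1 _] := h1 i|have [d1 _] := h2 i];
  apply: DeriveDef (d1 x Ux) _.
Qed.

End Functions.
End RealCoordinates.

Section ChartCalculus.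
Context {R : realType} {T : normedModType R}.
Local Notation C := R[i].
Variables (m d : nat) (V0 : 'M[C]_(m, d)) (N : 'M[C]_(m, m - d)).
Hypothesis V0V0 : V0^t* *m V0 = 1%:M.
Hypothesis NN : N^t* *m N = 1%:M.
Hypothesis NV0 : N^t* *m V0 = 0.
Hypothesis VN1 : V0 *m V0^t* + N *m N^t* = 1%:M.
Local Notation J := (coord_idx (m - d) d).
Implicit Types c dc : J -> R.

Definition cw c : 'M[C]_d := chart_w (Yof c) (Hof c).
Definition chartc c : 'M[C]_(m, d) := chart V0 N (Yof c) (Hof c).
Definition dcw c dc : 'M[C]_d :=
  2^-1 *: ((Yof dc)^t* *m Yof c + (Yof c)^t* *m Yof dc) + Hof dc.

Lemma dcw_linear c (a : R) dc dc' :
  dcw c (fun j => a * dc j + dc' j) = a%:C *: dcw c dc + dcw c dc'.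
Proof.
rewrite /dcw Yof_linear Hof_linear trmxCD trmxCZ conjcRe mulmxDl mulmxDr.
rewrite -scalemxAl -scalemxAr.
move: (_ *m Yof c) (_ *m Yof c) (_ *m Yof dc) (_ *m Yof dc') => P1 P2 P3 P4.
move: (Hof dc) (Hof dc') (2^-1 : C) (a%:C) => H1 H2 x y.
by apply/matrixP => i j; rewrite !mxE; ring.
Qed.

Lemma mder_cw (w x : T) (c : T -> J -> R) dc :
  (forall j, is_derive x w (fun y => c y j) (dc j)) ->
  mder w x (fun y => cw (c y)) (dcw (c x) dc).
Proof.
move=> hc; have [hY hH] := coord_mder hc.
rewrite /cw /chart_w /dcw; apply: mderD hH; apply: mderZ.
have := mderD (mder_cst w x 1%:M) (mderM (mderJ hY) hY).
by rewrite add0r.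
Qed.

(** The chart is differentiated through [chart_frameE], a product identity, so that no inverse has
    to be differentiated. *)
Lemma mder_chart (w x : T) (c : T -> J -> R) dc F :
  (forall j, is_derive x w (fun y => c y j) (dc j)) ->
  (\near x, cw (c x) \in unitmx) -> mder w x (fun y => chartc (c y)) F ->
  F *m cw (c x) + (chartc (c x) + V0) *m dcw (c x) dc = N *m Yof dc.
Proof.
move=> hc wu hF; have [hY _] := coord_mder hc.
have h1 := mderM (mderD hF (mder_cst w x V0)) (mder_cw hc).
have h2 := mderD (mder_cst w x V0) (mderMl N hY).
rewrite addr0 in h1; rewrite add0r in h2.
apply: (mder_unique _ h2); apply: mder_near h1.
by apply: filterS wu => y wy; rewrite chart_frameE.
Qed.

(* [chartc c + V0] has the left inverse [cw c *m V0^*] on its range, while [N]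
   is orthogonal to [V0]; this separates the two unknowns [dcw c dc] and [Yof dc]. *)
Lemma chart_immersion c dc : cw c \in unitmx ->
  (chartc c + V0) *m dcw c dc = N *m Yof dc -> forall j, dc j = 0.
Proof.
move=> wu h j.
have D0 : dcw c dc = 0.
  have := congr1 (mulmx (V0^t*)) h; rewrite mulmxA [V0^t* *m (_ + V0)]mulmxDr V0V0 [_ + 1%:M]addrC.
  rewrite -(chart_wV V0V0 NV0) // mulmxA (V0N NV0) mul0mx => h2.
  by rewrite -[LHS]mul1mx -(mulmxV wu) -mulmxA h2 mulmx0.
have Y0 : Yof dc = 0.
  by rewrite -[LHS]mul1mx -NN -mulmxA -h D0 !mulmx0.
apply: coord_inj => //.
by move: D0; rewrite /dcw Y0 trmx0 map_mx0 mul0mx mulmx0 addr0 scaler0 add0r.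
Qed.

End ChartCalculus.

Section RowCoordinates.
Context {R : realType}.
Variable M : nat.
Local Notation rV := 'rV[R]_M.

Lemma is_derive_coord (x w : rV) l : is_derive x w (fun y : rV => y 0 l) (w 0 l).
Proof.
have h : (fun h : R => h^-1 *: ((fun y : rV => y 0 l) (h *: w + x) - x 0 l)) @ 0^' -->
    (w 0 l : R).
  apply: cvg_near_cst; near=> h; rewrite !mxE addrK /GRing.scale /= mulKf //.
  by near: h; exact: nbhs_dnbhs_neq.
by apply: DeriveDef; [apply/cvg_ex; exists (w 0 l)|exact: cvg_lim h].
Unshelve. all: by end_near. Qed.

Lemma Cdir_coord (I : Type) (dir : I -> rV) n (U : set rV) l : open U ->
  Cdir dir n U (fun y => y 0 l).
Proof.
move=> oU; case: n => [|n]; split=> //; try by move=> x _; exact: coord_continuous.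
move=> i; split=> [x _|]; first by have [] := is_derive_coord x (dir i) l.
apply: (Cdir_ext oU _ (Cdir_cst dir U n (dir i 0 l))) => x _.
by have [_ ->] := is_derive_coord x (dir i) l.
Qed.

Lemma ball_row (e : R) (x : rV) : 0 < e -> (ball 0 e x <-> forall l, `|x 0 l| < e).
Proof.
move=> e0; split.
  by move=> [_ h] l; have := h 0 l; rewrite -ball_normE /= mxE sub0r normrN.
move=> h; split=> // i j; rewrite -ball_normE /= mxE sub0r normrN.
by rewrite (ord1 i).
Qed.

Lemma Cn_onE n (U : set rV) f :
  Cn_on n U f <-> Cdir (fun i : 'I_M => delta_mx 0 i) n U f.
Proof.
elim: n f => [|n IH] f //=; split=> -[cf df]; split=> // i;
  by have [d1 d2] := df i; split=> //; apply/IH.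
Qed.

End RowCoordinates.

Lemma Cdir_sum {R : realType} {T : normedModType R} (I : Type) (dir : I -> T)
    (U : set T) n (J : Type) (r : seq J) (F : J -> T -> R) : open U ->
  (forall j, Cdir dir n U (F j)) -> Cdir dir n U (fun x => \sum_(j <- r) F j x).
Proof.
move=> oU hF; elim: r => [|j r IH].
  have -> : (fun x => \sum_(j <- [::]) F j x) = (fun=> 0); last exact: Cdir_cst.
  by apply/funext => x; rewrite big_nil.
have -> : (fun x => \sum_(i <- j :: r) F i x) = (fun x => F j x + \sum_(i <- r) F i x).
  by apply/funext => x; rewrite big_cons.
exact: CdirD.
Qed.

Section IsometryChart.
Context {R : realType}.
Local Notation C := R[i].
Local Notation Re := complex.Re.
Local Notation Im := complex.Im.
Variables d k : nat.
Local Notation op := 'M[C]_(d * k, d).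
Local Notation M := (dim_iso d k).
Local Notation J := (coord_idx (d * k - d) d).
Local Notation rV := 'rV[R]_M.
Variables (V0 : op) (N : 'M[C]_(d * k, d * k - d)).
Hypothesis V0V0 : V0^t* *m V0 = 1%:M.
Hypothesis NN : N^t* *m N = 1%:M.
Hypothesis NV0 : N^t* *m V0 = 0.
Hypothesis VN1 : V0 *m V0^t* + N *m N^t* = 1%:M.
Hypothesis cJ : #|J| = M.

Definition idx (j : J) : 'I_M := cast_ord cJ (enum_rank j).
Definition crd (x : rV) (j : J) : R := x 0 (idx j).
Definition row_of (c : J -> R) : rV := \row_l c (enum_val (cast_ord (esym cJ) l)).

Lemma crd_row c : crd (row_of c) = c.
Proof.
by apply/funext => j; rewrite /crd mxE /idx cast_ordK enum_rankK.
Qed.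

Lemma idx_enum l : idx (enum_val (cast_ord (esym cJ) l)) = l.
Proof. by rewrite /idx enum_valK cast_ordKV. Qed.

Definition param (x : rV) : op := chartc V0 N (crd x).

Local Notation dirs := (fun i : 'I_M => delta_mx 0 i : rV).

Lemma is_derive_crd (x w : rV) j : is_derive x w (fun y => crd y j) (crd w j).
Proof. exact: is_derive_coord. Qed.

Variable rho : R.
Hypothesis rho0 : 0 < rho.
Local Notation U := (ball (0 : rV) rho).
Hypothesis Uunit : forall x, U x -> cw (crd x) \in unitmx.
Hypothesis Uirr : forall x, U x -> irreducible (param x).

Lemma openU : open U. Proof. exact: ball_open. Qed.

Lemma param_smooth : msmooth dirs U param.
Proof.
have [hY hH] := coord_msmooth (c := crd) openU
  (fun n j => Cdir_coord dirs n (idx j) openU).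
have hw : msmooth dirs U (fun x => cw (crd x)).
  rewrite /cw /chart_w; apply: msmoothD hH => //; first exact: openU.
  apply: msmoothZ; first exact: openU.
  apply: msmoothD; first exact: openU.
    by apply: msmooth_cst; exact: openU.
  by apply: msmoothM => //; [exact: openU|apply: msmoothJ hY; exact: openU].
rewrite /param /chartc /chart; apply: msmoothB; first exact: openU.
  apply: msmoothM; first exact: openU.
    rewrite /chart_frame; apply: msmoothD; first exact: openU.
      by apply: msmooth_cst; exact: openU.
    by apply: msmoothM hY; [exact: openU|apply: msmooth_cst; exact: openU].
  by apply: msmoothV hw; [exact: openU|].
by apply: msmooth_cst; exact: openU.
Qed.

Lemma param_mder i x : U x -> mder (delta_mx 0 i) x param (mx_pderiv i param x).
Proof. move=> Ux; exact: (msmooth_mder i param_smooth Ux). Qed.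

Lemma param_pderivE i x : U x ->
  mx_pderiv i param x *m cw (crd x) + (param x + V0) *m dcw (crd x) (crd (delta_mx 0 i)) =
  N *m Yof (crd (delta_mx 0 i)).
Proof.
move=> Ux; apply: mder_chart (param_mder i Ux).
  by move=> j; exact: is_derive_crd.
by apply: (near_open openU _ Ux) => y; exact: Uunit.
Qed.

Lemma param_immersion x (c : 'I_M -> R) : U x ->
  \sum_i (c i)%:C *: mx_pderiv i param x = 0 -> forall i, c i = 0.
Proof.
move=> Ux h i; pose dc j := \sum_l c l * crd (delta_mx 0 l) j.
have dcE j : dc j = c (idx j).
  rewrite /dc (bigD1 (idx j)) //= /crd mxE !eqxx mulr1 big1 ?addr0 // => l lj.
  by rewrite mxE eqxx eq_sym (negPf lj) mulr0.
rewrite -(idx_enum i) -dcE.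
apply: (chart_immersion V0V0 NN NV0 (Uunit Ux)).
have -> : N *m Yof dc = \sum_l (c l)%:C *: (N *m Yof (crd (delta_mx 0 l))).
  rewrite (real_linear_sum (f := @Yof R (d * k - d) d)); last exact: Yof_linear.
  by rewrite mulmx_sumr; apply: eq_bigr => l _; rewrite scalemxAr.
have -> : dcw (crd x) dc = \sum_l (c l)%:C *: dcw (crd x) (crd (delta_mx 0 l)).
  by apply: (real_linear_sum (f := dcw (crd x))) => a e e'; exact: dcw_linear.
have h' : \sum_l (c l)%:C *: (mx_pderiv l param x *m cw (crd x)) = 0.
  have := congr1 (mulmx^~ (cw (crd x))) h; rewrite mul0mx mulmx_suml => h2.
  rewrite -[RHS]h2.
  by apply: eq_bigr => l _; rewrite scalemxAl.
transitivity (\sum_l (c l)%:C *: (mx_pderiv l param x *m cw (crd x)) +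
   (chartc V0 N (crd x) + V0) *m \sum_l (c l)%:C *: dcw (crd x) (crd (delta_mx 0 l))).
  by rewrite h' add0r.
rewrite mulmx_sumr -big_split; apply: eq_bigr => l _ /=; rewrite -scalemxAr -scalerDr.
by congr (_ *: _); exact: param_pderivE.
Qed.

Lemma param_local_coord : local_coord U param.
Proof.
split.
- exact: openU.
- by move=> u v; split=> n; apply/Cn_onE; have [] := param_smooth u v n.
- exact: Uirr.
- by move=> x Ux c; exact: param_immersion.
Qed.

Definition coord_field i x : op := - 'i *: mx_pderiv i param x.

Lemma coord_field_tangent i x : U x -> tangent (param x) (coord_field i x).
Proof.
move=> Ux; have F := param_mder i Ux.
have : mder (delta_mx 0 i) x (fun=> 1%:M)
    ((mx_pderiv i param x)^t* *m param x + (param x)^t* *m mx_pderiv i param x).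
  apply: mder_near (mderM (mderJ F) F).
  by apply: (near_open openU _ Ux) => y /Uirr[].
move=> /(mder_unique (mder_cst _ _ _)) h.
rewrite /tangent /= /coord_field trmxCZ conjcN conjCi opprK.
by rewrite -scalemxAl -scalemxAr scaleNr opprK -scalerDr -h scaler0.
Qed.

Variable nu : op -> op -> op -> R.
Hypothesis nuR : riemannian_metric nu.

Lemma nu_sum V (I : Type) (r : seq I) (c : I -> R) (F : I -> op) B :
  irreducible V -> (forall i, tangent V (F i)) -> tangent V B ->
  tangent V (\sum_(i <- r) (c i)%:C *: F i) /\
  nu V (\sum_(i <- r) (c i)%:C *: F i) B = \sum_(i <- r) c i * nu V (F i) B.
Proof.
move=> iV tF tB; have [lin _ _ _] := nuR.
have t0 : tangent V 0 by rewrite /tangent /= trmx0 map_mx0 mul0mx mulmx0 subrr.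
have n0 : nu V 0 B = 0.
  have := lin V iV 1 0 0 B t0 t0 tB.
  by rewrite scaler0 addr0 mul1r => /eqP; rewrite -subr_eq0 opprD addrA subrr sub0r oppr_eq0 => /eqP.
elim: r => [|i r [IH1 IH2]]; first by rewrite !big_nil.
rewrite !big_cons; split; last by rewrite lin // IH2.
have := tF i; move: IH1; rewrite /tangent /= => h1 h2.
have <- : (c i)%:C *: ((F i)^t* *m V - V^t* *m F i) + ((\sum_(j <- r) (c j)%:C *: F j)^t* *m V -
     V^t* *m (\sum_(j <- r) (c j)%:C *: F j)) = 0 by rewrite h1 h2 scaler0 addr0.
rewrite trmxCD trmxCZ conjcRe mulmxDl mulmxDr -scalemxAl -scalemxAr scalerBr.
by rewrite opprD addrACA.
Qed.

Definition gram_mx x : 'M[R]_M := \matrix_(u, v) metric_coef nu param u v x.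

(** A kernel vector yields a tangent vector orthogonal to all coordinate fields, hence to itself.
    Positivity of [nu] makes it zero, and [param_immersion] makes its coefficients zero. *)
Lemma gram_mx_unit x : U x -> gram_mx x \in unitmx.
Proof.
move=> Ux; have iV := Uirr Ux; have [_ sym pos _] := nuR.
rewrite -row_free_unit -kermx_eq0; apply/eqP/row_matrixP => i; rewrite row0.
set v := row i _; have hv : v *m gram_mx x = 0 by rewrite -row_mul mulmx_ker row0.
pose c l := v 0 l; pose L := \sum_l (c l)%:C *: coord_field l x.
have tF l : tangent (param x) (coord_field l x) by exact: coord_field_tangent.
have [tL _] := nu_sum (index_enum _) c iV tF (tF (idx (enum_val (cast_ord (esym cJ) i)))).
have nuL l : nu (param x) L (coord_field l x) = 0.
  have [_ ->] := nu_sum (index_enum _) c iV tF (tF l).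
  have /rowP/(_ l) := hv; rewrite !mxE => hl; rewrite -[RHS]hl.
  by apply: eq_bigr => j _; rewrite [gram_mx x j l]mxE.
have nuLL : nu (param x) L L = 0.
  rewrite {1}/L; have [_ ->] := nu_sum (index_enum _) c iV tF tL.
  by apply: big1 => l _; rewrite sym // nuL mulr0.
have L0 : L = 0.
  apply/eqP; apply/negPn/negP => Ln; have := pos _ iV L tL Ln.
  by rewrite nuLL ltxx.
apply/rowP => l; rewrite [RHS]mxE; apply: (param_immersion Ux (c := c)).
have : - 'i *: (\sum_l (c l)%:C *: mx_pderiv l param x) = L.
  rewrite scaler_sumr; apply: eq_bigr => j _; rewrite /coord_field scalerA mulrC.
  by rewrite -scalerA.
by rewrite L0 => /eqP; rewrite scaler_eq0 oppr_eq0 (negPf (neq0Ci _)) => /eqP.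
Qed.

Lemma christoffel_continuous l i j x : U x ->
  {for x, continuous (christoffel nu param l i j)}.
Proof.
have [_ _ _ sm] := nuR.
have gs u v n : Cdir dirs n U (metric_coef nu param u v).
  by apply/Cn_onE; exact: (sm _ _ param_local_coord u v n).
have invs u v : Cdir dirs 0 U (fun x => invmx (gram_mx x) u v).
  (* The real Gram matrix is inverted as a complex one, so that [msmoothV] applies. *)
  have h : msmooth dirs U (fun x => invmx (map_mx (real_complex R) (gram_mx x))).
    apply: msmoothV => [|y Uy|a b n]; first exact: openU.
      by rewrite map_unitmx gram_mx_unit.
    split; first by apply: (Cdir_ext openU _ (gs a b n)) => y _; rewrite !mxE.
    by apply: (Cdir_ext openU _ (Cdir_cst dirs U n 0)) => y _; rewrite !mxE.
  have [h1 _] := h u v 0%N.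
  by apply: (Cdir_ext openU _ h1) => y _; rewrite -map_invmx mxE.
have ds u v w : Cdir dirs 0 U (fun x => 'D_(delta_mx 0 u) (metric_coef nu param v w) x).
  by have [_ h] := gs v w 1%N; have [_] := h u.
have [] : Cdir dirs 0 U (christoffel nu param l i j); last by move=> h _ Ux; exact: h.
rewrite /christoffel; apply: CdirM; [exact: openU|exact: Cdir_cst|].
apply: (Cdir_sum _ openU (F := fun h x => invmx (gram_mx x) l h *
    ('D_(delta_mx 0 i) (metric_coef nu param j h) x +
     'D_(delta_mx 0 j) (metric_coef nu param i h) x -
     'D_(delta_mx 0 h) (metric_coef nu param i j) x))) => h.
apply: (CdirM openU (invs _ _)); apply: (CdirD openU); last exact: (CdirN openU).
exact: (CdirD openU).
Qed.

Lemma le_sum_ord (I : finType) (g : I -> R) j : (forall i, 0 <= g i) -> g j <= \sum_i g i.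
Proof. by move=> g0; rewrite (bigD1 j) //= lerDl; apply: sumr_ge0 => i _. Qed.

(** Continuity at the origin of the chart suffices: near it the finitely many symbols stay below 1
    plus the sum of their absolute values there. *)
Lemma christoffel_bounded : exists2 r1 : R, 0 < r1 <= rho & exists2 K : R, 0 <= K &
  forall x, ball 0 r1 x -> forall l i j, `|christoffel nu param l i j x| <= K.
Proof.
have U0 : U 0 by exact: ballxx.
pose K := 1 + \sum_l \sum_i \sum_j `|christoffel nu param l i j 0|.
have K0 : 0 <= K by rewrite addr_ge0 //; do 3 (apply: sumr_ge0 => ? _).
have near_le : \forall x \near (0 : rV), forall l i j, `|christoffel nu param l i j x| <= K.
  suff H l i j : \forall x \near (0 : rV), `|christoffel nu param l i j x| <= K.
    exact: (filter_forall _ (fun l => filter_forall _ (fun i => filter_forall _ (H l i)))).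
  have hc := christoffel_continuous (l := l) (i := i) (j := j) U0.
  have hn : (fun x => `|christoffel nu param l i j x|) @ (0 : rV) -->
     `|christoffel nu param l i j 0| by exact: cvg_norm hc.
  apply: (cvgr_le _ hn); rewrite /K; apply: (@le_lt_trans _ _
    (\sum_l \sum_i \sum_j `|christoffel nu param l i j 0|)); last by rewrite ltrDr.
  pose g l i j := `|christoffel nu param l i j 0|.
  apply: le_trans (le_sum_ord (g := g l i) j _) _; first by move=> ?; exact: normr_ge0.
  apply: le_trans (le_sum_ord (g := fun i => \sum_j g l i j) i _) _.
    by move=> ?; apply: sumr_ge0 => ? _; exact: normr_ge0.
  apply: (le_sum_ord (g := fun l => \sum_i \sum_j g l i j)) => ?.
  by do 2 (apply: sumr_ge0 => ? _); exact: normr_ge0.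
have [e /= e0 he] := (nbhs_ballP _ _).1 near_le.
exists (Num.min e rho); first by rewrite lt_min e0 rho0 ge_min lexx orbT.
exists K => // x hx; apply: he.
by move: hx; apply: le_ball; rewrite ge_min lexx.
Qed.

End IsometryChart.

(** * Curves whose acceleration is quadratic in the velocity *)

Section SmoothCurves.
Context {R : realType}.
Local Notation C := R[i].
Local Notation Re := complex.Re.
Local Notation Im := complex.Im.

Definition unit_dir (_ : unit) : R := 1.

Definition otime (a b : R) : set R := [set t | a < t < b].

Lemma open_otime a b : open (otime a b).
Proof.
have := @interval_open R (BRight a) (BLeft b) isT isT.
by congr open; apply/seteqP; split=> x /=; rewrite in_itv.
Qed.

Lemma smooth_curveE a b (f : R -> R) :
  smooth_curve a b f <-> forall n, Cdir unit_dir n (otime a b) f.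
Proof.
split=> [hf n|hf n t tab].
  have cont g : smooth_curve a b g -> forall t, otime a b t -> {for t, continuous g}.
    move=> hg t tab; apply: differentiable_continuous; apply/derivable1_diffP.
    exact: (hg 0%N t tab).
  elim: n f hf => [|n IH] f hf; split=> //; try exact: cont.
  move=> []; split=> [t tab|]; first exact: (hf 0%N t tab).
  have -> : (fun x => 'D_(unit_dir tt) f x) = derive1 f.
    by apply/funext => x; rewrite derive1E.
  by apply: IH => m t tab; rewrite -derive1Sn; exact: hf.
elim: n f hf => [|n IH] f hf.
  by have [_ /(_ tt) [h _]] := hf 1%N; exact: h.
rewrite derive1Sn; apply: IH => m; have [_ /(_ tt) [_ h]] := hf m.+1.
by have <- : (fun x => 'D_(unit_dir tt) f x) = derive1 f
  by apply/funext => x; rewrite derive1E.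
Qed.

Lemma smooth_curve_sub a b a' b' (f : R -> R) : a <= a' -> b' <= b ->
  smooth_curve a b f -> smooth_curve a' b' f.
Proof.
move=> aa bb hf n t /andP[t1 t2]; apply: hf.
by rewrite (le_lt_trans aa t1) (lt_le_trans t2 bb).
Qed.

Lemma smooth_curve_derive a b (f : R -> R) : smooth_curve a b f ->
  smooth_curve a b (derive1 f).
Proof. by move=> hf n t tab; rewrite -derive1Sn; exact: hf. Qed.

Lemma smooth_curve_is_derive a b (f : R -> R) t : smooth_curve a b f -> a < t < b ->
  is_derive t 1 f (derive1 f t).
Proof. by move=> hf tab; apply: DeriveDef; [exact: (hf 0%N)|rewrite derive1E]. Qed.

Definition msmooth_curve p q (a b : R) (f : R -> 'M[C]_(p, q)) : Prop :=
  forall u v, smooth_curve a b (fun t => Re (f t u v)) /\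
              smooth_curve a b (fun t => Im (f t u v)).

Lemma msmooth_curveE p q a b (f : R -> 'M[C]_(p, q)) :
  msmooth_curve a b f <-> msmooth unit_dir (otime a b) f.
Proof.
split=> hf u v.
  move=> n; have [h1 h2] := hf u v.
  by split; [exact: ((smooth_curveE a b _).1 h1 n)|exact: ((smooth_curveE a b _).1 h2 n)].
by split; apply/smooth_curveE => n; have [] := hf u v n.
Qed.

Lemma msmooth_curve_velocity p q a b (f : R -> 'M[C]_(p, q)) :
  msmooth_curve a b f -> msmooth_curve a b (mx_velocity f).
Proof.
move=> hf u v; have [h1 h2] := hf u v.
by split; under eq_fun do rewrite mxE /=; exact: smooth_curve_derive.
Qed.

Lemma mder_velocity p q a b (f : R -> 'M[C]_(p, q)) t : msmooth_curve a b f ->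
  a < t < b -> mder (1 : R) t f (mx_velocity f t).
Proof.
move=> hf tab u v; have [h1 h2] := hf u v; rewrite mxE.
by split; exact: (smooth_curve_is_derive _ tab).
Qed.

Lemma n1_continuous p q a b (f : R -> 'M[C]_(p, q)) t : msmooth_curve a b f ->
  a < t < b -> {for t, continuous (fun s => n1 (f s))}.
Proof.
move=> /msmooth_curveE hf tab.
have : Cdir unit_dir 0 (otime a b) (fun s => n1 (f s)).
  apply: Cdir_sum => [|u]; first exact: open_otime.
  apply: Cdir_sum => [|v]; first exact: open_otime.
  have [h1 h2] := hf u v 0%N.
  have o := @open_otime a b.
  have [h _] := CdirD o (CdirM o h1 h1) (CdirM o h2 h2).
  split=> // s sab.
  have -> : (fun s => normc (f s u v)) =
      Num.sqrt \o (fun s => Re (f s u v) * Re (f s u v) + Im (f s u v) * Im (f s u v)).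
    by apply/funext => x /=; rewrite -!expr2 -sqr_normcE sqrtr_sqr ger0_norm ?normc_ge0.
  by apply: continuous_comp; [exact: h|exact: sqrt_continuous].
by move=> [h _]; exact: h.
Qed.

(* Real induction on [0, 1]: a strict bound propagates as long as the weak one
   implies it. *)
Lemma bootstrap (F : R -> R) (B : R) :
  (forall t, 0 <= t <= 1 -> {for t, continuous F}) ->
  (forall t, 0 <= t <= 1 -> (forall s, 0 <= s < t -> F s <= B) -> F t < B) ->
  forall t, 0 <= t <= 1 -> F t < B.
Proof.
move=> cF step.
pose S := [set t : R | 0 <= t <= 1 /\ forall s, 0 <= s < t -> F s <= B].
have S0 : S 0 by split=> [|s /andP[s0 s1]]; rewrite ?lexx ?ler01 //; move: (le_lt_trans s0 s1); rewrite ltxx.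
have supS : has_sup S by split; [exists 0|exists 1 => t [/andP[]]].
pose T := sup S.
have T0 : 0 <= T by exact: ub_le_sup supS.2 _ S0.
have T1 : T <= 1 by apply: ge_sup; [exists 0|move=> t [/andP[]]].
have T01 : 0 <= T <= 1 by rewrite T0.
have bT s : 0 <= s < T -> F s <= B.
  move=> /andP[s0 sT]; have [|t [t01 ht] st] := @sup_gt R S s _ sT; first by exists 0.
  by apply: ht; rewrite s0.
have FT : F T < B by exact: step.
have T1E : T = 1.
  apply/eqP; rewrite eq_le T1 leNgt; apply/negP => Tlt.
  have /nbhs_ballP[e /= e0 he] : \forall x \near T, F x < B by exact: cvgr_lt (cF T T01) _ FT.
  pose t' := Num.min 1 (T + e / 2).
  have tT : T < t' by rewrite lt_min Tlt ltrDl divr_gt0.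
  have : S t'.
    split; first by rewrite (le_trans T0 (ltW tT)) ge_min lexx.
    move=> s /andP[s0 st]; have [sT|Ts] := ltP s T; first by rewrite bT // s0.
    apply: ltW; apply: he; rewrite -ball_normE /= ler0_norm ?subr_le0 // opprB.
    rewrite ltrBlDl; apply: lt_trans st _; rewrite gt_min; apply/orP; right.
    by rewrite ltrD2l; lra.
  by move=> /(sup_upper_bound supS); rewrite leNgt tT.
move=> t /andP[t0 t1]; apply: step; first by rewrite t0.
by move=> s /andP[s0 st]; apply: bT; rewrite s0 T1E (lt_le_trans st).
Qed.

(** The mean value theorem on the real and the imaginary part of each entry, whence the factor
    [2 p q]. *)
Lemma mvt_n1 p q a b (f : R -> 'M[C]_(p, q)) (A : 'M[C]_(p, q)) (t B : R) :
  msmooth_curve a b f -> a < 0 -> 0 <= t -> t < b ->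
  (forall s, 0 <= s < t -> n1 (mx_velocity f s - A) <= B) ->
  n1 (f t - f 0 - t%:C *: A) <= 2 * (p * q)%:R * (B * t).
Proof.
move=> hf a0; rewrite le_eqVlt => /orP[/eqP <- _ _|t0 tb hB].
  by rewrite subrr sub0r scale0r oppr0 n10 !mulr0.
have real (g : R -> R) (x : R) : smooth_curve a b g ->
    (forall s, 0 <= s < t -> `|derive1 g s - x| <= B) -> `|g t - g 0 - t * x| <= B * t.
  move=> hg hx; have tab s : 0 <= s -> s <= t -> a < s < b.
    by move=> s0 st; rewrite (lt_le_trans a0 s0) (le_lt_trans st tb).
  have [c||c hc ->] := @MVT R g (derive1 g) 0 t t0.
  - rewrite in_itv => /andP[c0 ct].
    by apply: smooth_curve_is_derive hg (tab _ _ _); exact: ltW.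
  - apply: derivable_within_continuous => c; rewrite in_itv => /andP[c0 ct].
    exact: hg 0%N c (tab _ c0 ct).
  move: hc; rewrite in_itv /= => /andP[c0 ct]; rewrite subr0 mulrC -mulrBr normrM.
  by rewrite (gtr0_norm t0) mulrC ler_wpM2r ?(ltW t0) // hx // ct ltW.
have ent u v : normc ((f t - f 0 - t%:C *: A) u v) <= 2 * (B * t).
  have [h1 h2] := hf u v.
  have b1 : `|Re (f t u v) - Re (f 0 u v) - t * Re (A u v)| <= B * t.
    apply: real h1 _ => s hs; apply: le_trans (hB s hs).
    apply: le_trans (n1_entry _ u v); apply: le_trans (normc_Re _).
    by rewrite !mxE ReD ReN.
  have b2 : `|Im (f t u v) - Im (f 0 u v) - t * Im (A u v)| <= B * t.
    apply: real h2 _ => s hs; apply: le_trans (hB s hs).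
    apply: le_trans (n1_entry _ u v); apply: le_trans (normc_Im _).
    by rewrite !mxE ImD ImN.
  apply: le_trans (normc_leD _) _; rewrite mulr_natl mulr2n; apply: lerD.
    by apply: le_trans b1; rewrite !mxE !ReD !ReN ReM /= mul0r subr0.
  by apply: le_trans b2; rewrite !mxE !ImD !ImN ImM /= mul0r addr0.
apply: (@le_trans _ _ (\sum_(u < p) \sum_(v < q) (2 * (B * t)))).
  by do 2 (apply: ler_sum => ? _).
rewrite sumr_const sumr_const !card_ord -mulrnA -[leLHS]mulr_natr.
by rewrite mulrAC [(q * p)%N]mulnC.
Qed.

(** While the speed is at most [2 h] the curve stays within [r] of [V] and its acceleration below
    [4 K h^2]; the velocity then moves by at most [h / 2], so the speed is at most [3 h / 2] and the
    bootstrap closes. Integrating the velocity once more gives the quadratic error. *)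
Lemma curve_quadratic p q (g : R -> 'M[C]_(p, q)) (V A : 'M[C]_(p, q)) (e r K h : R) :
  0 < e -> msmooth_curve (- e) (1 + e) g -> g 0 = V -> mx_velocity g 0 = 'i *: A ->
  (forall t, 0 <= t <= 1 -> n1 (g t - V) < r ->
     n1 (mx_velocity (mx_velocity g) t) <= K * n1 (mx_velocity g t) ^+ 2) ->
  0 <= K -> 0 < h -> n1 A <= h -> 2 * (p * q)%:R * (2 * h) < r ->
  2 * (p * q)%:R * (K * (2 * h) ^+ 2) <= h / 2 ->
  n1 (g 1 - V - 'i *: A) <= (2 * (p * q)%:R) ^+ 2 * 4 * K * h ^+ 2.
Proof.
move=> e0 sg g0 v0 acc K0 h0 hA hr hK; set L := 2 * (p * q)%:R.
have L0 : 0 <= L by rewrite mulr_ge0.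
have ne : - e < 0 by rewrite oppr_lt0.
have in_e t : t <= 1 -> t < 1 + e by move=> t1; rewrite (le_lt_trans t1) // ltrDl.
have sv := msmooth_curve_velocity sg.
have niA : n1 ('i *: A) = n1 A.
  by rewrite n1Z /= expr0n add0r expr1n sqrtr1 mul1r.
have velocity_close t : 0 <= t <= 1 ->
    (forall s, 0 <= s < t -> n1 (mx_velocity g s) <= 2 * h) ->
    n1 (mx_velocity g t - 'i *: A) <= L * (K * (2 * h) ^+ 2).
  move=> /andP[t0 t1] ht; have te := in_e t t1.
  have accB s : 0 <= s < t -> n1 (mx_velocity (mx_velocity g) s - 0) <= K * (2 * h) ^+ 2.
    move=> /andP[s0 st]; rewrite subr0; have s1 := le_trans (ltW st) t1.
    apply: le_trans (acc s _ _) _.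
    - by rewrite s0 s1.
    - have hs u : 0 <= u < s -> n1 (mx_velocity g u - 0) <= 2 * h.
        by move=> /andP[u0 us]; rewrite subr0 ht // u0 (lt_trans us).
      have := mvt_n1 sg ne s0 (in_e s s1) hs; rewrite scaler0 subr0 g0 => hh.
      apply: le_lt_trans hh _; apply: le_lt_trans hr; apply: ler_wpM2l => //.
      by rewrite ler_piMr // mulr_ge0 // ltW.
    - by rewrite ler_wpM2l // lerXn2r ?nnegrE ?n1_ge0 ?mulr_ge0 ?(ltW h0) // ht // s0.
  have := mvt_n1 sv ne t0 te accB; rewrite scaler0 subr0 v0 => hh.
  apply: le_trans hh _; apply: ler_wpM2l => //; rewrite ler_piMr // mulr_ge0 //.
  exact: sqr_ge0.
have slow := @bootstrap (fun t => n1 (mx_velocity g t)) (2 * h).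
have {}slow t : 0 <= t <= 1 -> n1 (mx_velocity g t) < 2 * h.
  apply: slow => {t} [t /andP[t0 t1]|t t01 ht].
    by apply: n1_continuous sv _; rewrite (lt_le_trans ne t0) in_e.
  have c := le_trans (velocity_close t t01 ht) hK.
  have := n1D (mx_velocity g t - 'i *: A) ('i *: A); rewrite subrK niA => c2.
  apply: le_lt_trans c2 _; apply: (@le_lt_trans _ _ (h / 2 + h)); first exact: lerD.
  lra.
have h1 s : 0 <= s < 1 -> n1 (mx_velocity g s - 'i *: A) <= L * (K * (2 * h) ^+ 2).
  move=> /andP[s0 s1]; apply: velocity_close => [|u /andP[u0 us]]; first by rewrite s0 ltW.
  by apply: ltW; apply: slow; rewrite u0 ltW // (lt_trans us).
have := mvt_n1 sg ne ler01 (in_e 1 (lexx 1)) h1; rewrite g0 scale1r mulr1 -/L.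
by congr (_ <= _); ring.
Qed.

End SmoothCurves.

(** * From coordinate acceleration to matrix acceleration *)

Section Acceleration.
Context {R : realType}.
Local Notation C := R[i].
Local Notation Re := complex.Re.
Local Notation Im := complex.Im.
Variables d k : nat.
Local Notation op := 'M[C]_(d * k, d).
Local Notation J := (coord_idx (d * k - d) d).
Variables (V0 : op) (N : 'M[C]_(d * k, d * k - d)).
Hypothesis V0V0 : V0^t* *m V0 = 1%:M.
Hypothesis NN : N^t* *m N = 1%:M.
Hypothesis NV0 : N^t* *m V0 = 0.
Hypothesis VN1 : V0 *m V0^t* + N *m N^t* = 1%:M.

Definition curve_coord (g : R -> op) (t : R) (j : J) : R :=
  coord_of (inv_Y V0 N (g t)) (inv_H V0 (g t)) j.

Lemma Yof_curve g t : Yof (curve_coord g t) = inv_Y V0 N (g t).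
Proof. exact: Yof_coord. Qed.

Lemma Hof_curve g t : Hof (curve_coord g t) = inv_H V0 (g t).
Proof. by apply: Hof_coord; exact: inv_H_antiherm. Qed.

Lemma cw_curve g t : Defs.isometry (g t) -> 1%:M + V0^t* *m g t \in unitmx ->
  cw (curve_coord g t) = inv_w V0 (g t).
Proof. by move=> iso wu; rewrite /cw Yof_curve Hof_curve (chart_wK VN1). Qed.

Lemma chartc_curve g t : Defs.isometry (g t) -> 1%:M + V0^t* *m g t \in unitmx ->
  chartc V0 N (curve_coord g t) = g t.
Proof. by move=> iso wu; rewrite /chartc Yof_curve Hof_curve (chartK VN1). Qed.

Section Curve.
Variables (a b : R) (g : R -> op).
Hypothesis sg : msmooth_curve a b g.
Hypothesis isog : forall t, a < t < b -> Defs.isometry (g t).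
Hypothesis ug : forall t, a < t < b -> 1%:M + V0^t* *m g t \in unitmx.

Lemma curve_w_smooth : msmooth_curve a b (fun t => inv_w V0 (g t)).
Proof.
have o := @open_otime R a b; apply/msmooth_curveE; apply: (msmoothV o) => //.
apply: (msmoothD o); first exact: msmooth_cst.
by apply: (msmoothM o); [exact: msmooth_cst|exact/msmooth_curveE].
Qed.

Lemma curve_coord_smooth j : smooth_curve a b (fun t => curve_coord g t j).
Proof.
have o := @open_otime R a b; apply/smooth_curveE => n.
have hw := (msmooth_curveE _ _ _).1 curve_w_smooth.
apply: (coord_smooth _ _ o).
  apply: (msmoothM o) => //; apply: (msmoothM o); first exact: msmooth_cst.
  exact/msmooth_curveE.
apply: (msmoothZ o); apply: (msmoothB o) => //; exact: (msmoothJ o).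
Qed.

Definition vel_coord (t : R) (j : J) : R := derive1 (fun s => curve_coord g s j) t.
Definition acc_coord (t : R) (j : J) : R := derive1n 2 (fun s => curve_coord g s j) t.

Lemma is_derive_curve_coord t j : a < t < b ->
  is_derive t 1 (fun s => curve_coord g s j) (vel_coord t j).
Proof. by apply: smooth_curve_is_derive; exact: curve_coord_smooth. Qed.

Lemma is_derive_vel_coord t j : a < t < b ->
  is_derive t 1 (fun s => vel_coord s j) (acc_coord t j).
Proof.
apply: smooth_curve_is_derive; apply: smooth_curve_derive.
exact: curve_coord_smooth.
Qed.

Local Notation g1 := (mx_velocity g).
Local Notation g2 := (mx_velocity (mx_velocity g)).

Lemma near_time (P : R -> Prop) t : (forall s, a < s < b -> P s) -> a < t < b ->
  \near t, P t.
Proof. exact: (near_open (@open_otime R a b)). Qed.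

Lemma curve_cwE t : a < t < b -> cw (curve_coord g t) = inv_w V0 (g t).
Proof. by move=> tab; exact: cw_curve (isog tab) (ug tab). Qed.

Lemma curve_chartE t : a < t < b -> chartc V0 N (curve_coord g t) = g t.
Proof. by move=> tab; exact: chartc_curve (isog tab) (ug tab). Qed.

Lemma velocity_identity t : a < t < b ->
  g1 t *m inv_w V0 (g t) + (g t + V0) *m dcw (curve_coord g t) (vel_coord t) =
  N *m Yof (vel_coord t).
Proof.
move=> tab; have hg := mder_velocity sg tab.
have hc j := is_derive_curve_coord j tab.
have wun : \near t, cw (curve_coord g t) \in unitmx.
  apply: (near_time _ tab) => s sab; rewrite (curve_cwE sab) unitmx_inv; exact: ug.
have hch : mder (1 : R) t (fun s => chartc V0 N (curve_coord g s)) (g1 t).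
  apply: mder_near hg; apply: (near_time _ tab) => s sab.
  exact: esym (curve_chartE sab).
by have := mder_chart hc wun hch; rewrite (curve_cwE tab) (curve_chartE tab).
Qed.

Definition dcw2 t : 'M[C]_d :=
  2^-1 *: (((Yof (acc_coord t))^t* *m Yof (curve_coord g t) +
            (Yof (vel_coord t))^t* *m Yof (vel_coord t)) +
           ((Yof (vel_coord t))^t* *m Yof (vel_coord t) +
            (Yof (curve_coord g t))^t* *m Yof (acc_coord t))) + Hof (acc_coord t).

(** Differentiating the product of [inv_w] and its inverse [1 + V0^* g], which is constant,
    expresses the derivative of [cw] by the velocity of [g]. *)
Lemma velocity_w t : a < t < b ->
  dcw (curve_coord g t) (vel_coord t) =
  - (inv_w V0 (g t) *m V0^t* *m g1 t *m inv_w V0 (g t)).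
Proof.
move=> tab; have wu := ug tab; set w := inv_w V0 (g t).
have hg := mder_velocity sg tab.
have hw : mder (1 : R) t (fun s => inv_w V0 (g s)) (dcw (curve_coord g t) (vel_coord t)).
  apply: mder_near (mder_cw (fun j => is_derive_curve_coord j tab)).
  by apply: (near_time _ tab) => s sab; rewrite curve_cwE.
have h1 := mderM hw (mderD (mder_cst (1 : R) t 1%:M) (mderMl (V0^t*) hg)).
have h2 : mder (1 : R) t (fun s => inv_w V0 (g s) *m (1%:M + V0^t* *m g s)) 0.
  apply: mder_near (mder_cst (1 : R) t 1%:M); apply: (near_time _ tab) => s sab.
  exact: esym (mulVmx (ug sab)).
have := mder_unique h1 h2; rewrite add0r -/w => h.
have e : dcw (curve_coord g t) (vel_coord t) *m (1%:M + V0^t* *m g t) =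
   - (w *m (V0^t* *m g1 t)) by apply/eqP; rewrite -addr_eq0 h.
rewrite -[LHS]mulmx1 -(mulmxV wu) mulmxA e mulNmx -/(inv_w V0 (g t)) -/w.
by rewrite !mulmxA.
Qed.

Lemma velocity_Y t : a < t < b ->
  Yof (vel_coord t) = N^t* *m g1 t *m inv_w V0 (g t) +
    N^t* *m g t *m dcw (curve_coord g t) (vel_coord t).
Proof.
move=> tab; have hg := mder_velocity sg tab.
have hw : mder (1 : R) t (fun s => inv_w V0 (g s)) (dcw (curve_coord g t) (vel_coord t)).
  apply: mder_near (mder_cw (fun j => is_derive_curve_coord j tab)).
  by apply: (near_time _ tab) => s sab; rewrite curve_cwE.
have [hY _] := coord_mder (fun j => is_derive_curve_coord j tab).
apply: (mder_unique hY); apply: mder_near (mderM (mderMl (N^t*) hg) hw).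
by apply: (near_time _ tab) => s sab; rewrite Yof_curve.
Qed.

Lemma velocity_H t : a < t < b ->
  Hof (vel_coord t) = 2^-1 *: (dcw (curve_coord g t) (vel_coord t) -
                               (dcw (curve_coord g t) (vel_coord t))^t*).
Proof.
move=> tab.
have hw : mder (1 : R) t (fun s => inv_w V0 (g s)) (dcw (curve_coord g t) (vel_coord t)).
  apply: mder_near (mder_cw (fun j => is_derive_curve_coord j tab)).
  by apply: (near_time _ tab) => s sab; rewrite curve_cwE.
have [_ hH] := coord_mder (fun j => is_derive_curve_coord j tab).
apply: (mder_unique hH); apply: mder_near (mderZ 2^-1 (mderB hw (mderJ hw))).
by apply: (near_time _ tab) => s sab; rewrite Hof_curve.
Qed.

(** The derivative of [velocity_identity]. Multiplied on the right by the inverse of [inv_w], it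
    yields the acceleration of [g] from velocities and coordinate accelerations. *)
Lemma acceleration_identity t : a < t < b ->
  g2 t *m inv_w V0 (g t) + g1 t *m dcw (curve_coord g t) (vel_coord t) +
  (g1 t *m dcw (curve_coord g t) (vel_coord t) + (g t + V0) *m dcw2 t) =
  N *m Yof (acc_coord t).
Proof.
move=> tab; have hg := mder_velocity sg tab.
have hg1 := mder_velocity (msmooth_curve_velocity sg) tab.
have hw : mder (1 : R) t (fun s => inv_w V0 (g s)) (dcw (curve_coord g t) (vel_coord t)).
  apply: mder_near (mder_cw (fun j => is_derive_curve_coord j tab)).
  by apply: (near_time _ tab) => s sab; rewrite curve_cwE.
have [hY hH] := coord_mder (fun j => is_derive_curve_coord j tab).
have [hY1 hH1] := coord_mder (fun j => is_derive_vel_coord j tab).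
have hd : mder (1 : R) t (fun s => dcw (curve_coord g s) (vel_coord s)) (dcw2 t).
  by apply: mderD hH1; apply: mderZ; apply: mderD; apply: mderM => //; exact: mderJ.
have hl := mderD (mderM hg1 hw) (mderM (mderD hg (mder_cst (1 : R) t V0)) hd).
rewrite addr0 in hl.
apply: (mder_unique hl); apply: mder_near (mderMl N hY1).
by apply: (near_time _ tab) => s sab; rewrite velocity_identity.
Qed.

End Curve.

Lemma normc_half : normc (2^-1 : C) = 2^-1.
Proof.
have -> : (2^-1 : C) = (2^-1 : R)%:C by rewrite fmorphV rmorph_nat.
by rewrite normcR ger0_norm // invr_ge0.
Qed.

(* All the derivatives of the chart coordinates are controlled by the velocity,
   once the coordinate accelerations are quadratic in the coordinate velocities. *)
Lemma acceleration_bound (Kc : R) : 0 <= Kc -> exists2 K : R, 0 <= K &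
  forall (a b : R) (g : R -> op) t, msmooth_curve a b g ->
  (forall s, a < s < b -> Defs.isometry (g s)) ->
  (forall s, a < s < b -> 1%:M + V0^t* *m g s \in unitmx) ->
  a < t < b -> n1 (g t - V0) <= 1 -> n1 (inv_w V0 (g t)) <= n1 (1%:M : 'M[C]_d) ->
  (forall v, (forall j, `|vel_coord g t j| <= v) ->
     forall j, `|acc_coord g t j| <= Kc * v ^+ 2) ->
  n1 (mx_velocity (mx_velocity g) t) <= K * n1 (mx_velocity g t) ^+ 2.
Proof.
move=> Kc0; pose om := n1 (1%:M : 'M[C]_d); pose ga := n1 V0 + 1; pose nu := n1 N.
pose ka := coord_norm (R := R) (d * k - d) d.
have om0 : 0 <= om by exact: n1_ge0. have nu0 : 0 <= nu by exact: n1_ge0.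
have ga0 : 0 <= ga by rewrite addr_ge0 // n1_ge0.
have ka0 : 0 <= ka by exact: coord_norm_ge0.
have nV : 0 <= n1 V0 by exact: n1_ge0.
have [be [be0 beE]] : exists be, 0 <= be /\ be = om + n1 V0 * ga.
  by exists (om + n1 V0 * ga); rewrite addr_ge0 // mulr_ge0.
have [D1 [D10 D1E]] : exists D1, 0 <= D1 /\ D1 = om * n1 V0 * om.
  by exists (om * n1 V0 * om); rewrite !mulr_ge0.
have [D2 [D20 D2E]] : exists D2, 0 <= D2 /\ D2 = nu * om + nu * ga * D1.
  by exists (nu * om + nu * ga * D1); rewrite addr_ge0 // !mulr_ge0.
have [D3 [D30 D3E]] : exists D3, 0 <= D3 /\ D3 = D2 + D1.
  by exists (D2 + D1); rewrite addr_ge0.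
have [D4 [D40 D4E]] : exists D4, 0 <= D4 /\ D4 = ka * (Kc * D3 ^+ 2).
  by exists (ka * (Kc * D3 ^+ 2)); rewrite !mulr_ge0 // sqr_ge0.
have [y [y0 yE]] : exists y, 0 <= y /\ y = nu * ga * om.
  by exists (nu * ga * om); rewrite !mulr_ge0.
have [D5 [D50 D5E]] : exists D5, 0 <= D5 /\ D5 = 2 * (D4 * y + (ka * D3) ^+ 2) + D4.
  exists (2 * (D4 * y + (ka * D3) ^+ 2) + D4); split=> //.
  by rewrite addr_ge0 // mulr_ge0 // addr_ge0 ?sqr_ge0 // mulr_ge0.
exists ((nu * D4 + 2 * D1 + (ga + n1 V0) * D5) * be).
  by rewrite mulr_ge0 // !addr_ge0 // !mulr_ge0 // addr_ge0.
move=> a b g t sg isog ug tab close wb accH.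
set v := n1 (mx_velocity g t); have v0 : 0 <= v by exact: n1_ge0.
set w := inv_w V0 (g t); set c := curve_coord g t.
set c1 := vel_coord g t in accH *; set c2 := acc_coord g t in accH *.
have gB : n1 (g t) <= ga.
  rewrite -[g t](subrK V0); apply: le_trans (n1D _ _) _.
  by rewrite addrC lerD2l.
have dB : n1 (dcw c c1) <= D1 * v.
  rewrite /c /c1 (velocity_w sg isog ug tab) n1N -/w.
  apply: le_trans (n1M _ _) _; rewrite D1E.
  have -> : om * n1 V0 * om * v = om * n1 V0 * v * om by rewrite mulrAC.
  apply: ler_pM; rewrite ?n1_ge0 //; apply: le_trans (n1M _ _) _.
  apply: ler_pM; rewrite ?n1_ge0 //; apply: le_trans (n1M _ _) _; rewrite n1_conjt.
  by apply: ler_pM; rewrite ?n1_ge0.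
have YB1 : n1 (Yof c1) <= D2 * v.
  rewrite /c1 (velocity_Y sg isog ug tab) -/w -/c -/c1 D2E mulrDl.
  apply: le_trans (n1D _ _) _; apply: lerD.
    apply: le_trans (n1M _ _) _.
    have -> : nu * om * v = nu * v * om by rewrite mulrAC.
    apply: ler_pM; rewrite ?n1_ge0 //; apply: le_trans (n1M _ _) _; rewrite n1_conjt.
    by apply: ler_pM; rewrite ?n1_ge0.
  apply: le_trans (n1M _ _) _; rewrite -[nu * ga * D1 * v]mulrA.
  apply: ler_pM; rewrite ?n1_ge0 //; apply: le_trans (n1M _ _) _; rewrite n1_conjt.
  by apply: ler_pM; rewrite ?n1_ge0.
have HB1 : n1 (Hof c1) <= D1 * v.
  rewrite /c1 (velocity_H sg isog ug tab) n1Z normc_half -/c -/c1.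
  have := n1B (dcw c c1) ((dcw c c1)^t*); rewrite n1_conjt => h; lra.
have c1B j : `|c1 j| <= D3 * v.
  have : c1 j = coord_of (Yof c1) (Hof c1) j.
    case: (j) => [[[u s] [|]]|[u s]]; rewrite /= !mxE //=.
    by field.
  move=> ->; apply: le_trans (coord_le _ _ _) _; rewrite D3E mulrDl; exact: lerD.
have c2B := accH _ c1B.
have Dv : 0 <= D3 * v by rewrite mulr_ge0.
have [KY KH] := n1_coord_le (mulr_ge0 Kc0 (sqr_ge0 (D3 * v))) c2B.
have [LY LH] := n1_coord_le Dv c1B.
have D4v : ka * (Kc * (D3 * v) ^+ 2) = D4 * v ^+ 2 by rewrite D4E; ring.
rewrite -/ka D4v in KY KH; rewrite -/ka mulrA in LY.
have YB : n1 (Yof c) <= y.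
  rewrite /c Yof_curve /inv_Y -/w yE; apply: le_trans (n1M _ _) _.
  apply: ler_pM; rewrite ?n1_ge0 //; apply: le_trans (n1M _ _) _; rewrite n1_conjt.
  by apply: ler_pM; rewrite ?n1_ge0.
have ddB : n1 (dcw2 g t) <= D5 * v ^+ 2.
  have p1 : n1 ((Yof c2)^t* *m Yof c) <= D4 * y * v ^+ 2.
    apply: le_trans (n1M _ _) _; rewrite n1_conjt mulrAC.
    by apply: ler_pM; rewrite ?n1_ge0.
  have p2 : n1 ((Yof c1)^t* *m Yof c1) <= (ka * D3) ^+ 2 * v ^+ 2.
    apply: le_trans (n1M _ _) _; rewrite n1_conjt -exprMn expr2.
    by apply: ler_pM; rewrite ?n1_ge0.
  have p3 : n1 ((Yof c)^t* *m Yof c2) <= D4 * y * v ^+ 2.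
    apply: le_trans (n1M _ _) _; rewrite n1_conjt mulrAC mulrC.
    by apply: ler_pM; rewrite ?n1_ge0.
  rewrite /dcw2; apply: le_trans (n1D _ _) _; rewrite n1Z normc_half.
  have s1 := n1D ((Yof c2)^t* *m Yof c) ((Yof c1)^t* *m Yof c1).
  have s2 := n1D ((Yof c1)^t* *m Yof c1) ((Yof c)^t* *m Yof c2).
  have s3 := n1D ((Yof c2)^t* *m Yof c + (Yof c1)^t* *m Yof c1)
                 ((Yof c1)^t* *m Yof c1 + (Yof c)^t* *m Yof c2).
  have s4 := le_trans s3 (lerD (le_trans s1 (lerD p1 p2)) (le_trans s2 (lerD p2 p3))).
  have s5 : 2^-1 * n1 (((Yof c2)^t* *m Yof c + (Yof c1)^t* *m Yof c1) +
                 ((Yof c1)^t* *m Yof c1 + (Yof c)^t* *m Yof c2)) <=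
      2 * (D4 * y + (ka * D3) ^+ 2) * v ^+ 2.
    have q0 : 0 <= (D4 * y + (ka * D3) ^+ 2) * v ^+ 2.
      by rewrite mulr_ge0 ?sqr_ge0 // addr_ge0 ?sqr_ge0 // mulr_ge0.
    apply: le_trans (ler_wpM2l _ s4) _; first by rewrite invr_ge0.
    have -> : 2^-1 * (D4 * y * v ^+ 2 + (ka * D3) ^+ 2 * v ^+ 2 +
       ((ka * D3) ^+ 2 * v ^+ 2 + D4 * y * v ^+ 2)) =
       (D4 * y + (ka * D3) ^+ 2) * v ^+ 2 by field.
    by rewrite -[leRHS]mulrA ler_peMl // ler1n.
  by rewrite D5E mulrDl; exact: lerD s5 KH.
have wV : w *m (1%:M + V0^t* *m g t) = 1%:M by rewrite mulVmx // ug.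
have wVB : n1 (1%:M + V0^t* *m g t) <= be.
  apply: le_trans (n1D _ _) _; rewrite beE lerD2l; apply: le_trans (n1M _ _) _.
  by rewrite n1_conjt ler_wpM2l.
have := acceleration_identity sg isog ug tab; rewrite -/w -/c -/c1 -/c2.
move: (dcw2 g t) ddB => dd ddB; move: (dcw c c1) dB => d1 d1B.
move=> h.
have e : mx_velocity (mx_velocity g) t *m w =
   N *m Yof c2 - (mx_velocity g t *m d1 + (mx_velocity g t *m d1 + (g t + V0) *m dd)).
  by rewrite -h -[X in _ = X - _]addrA addrK.
rewrite -[mx_velocity (mx_velocity g) t]mulmx1 -wV mulmxA e.
apply: le_trans (n1M _ _) _; rewrite [leRHS]mulrAC; apply: ler_pM; rewrite ?n1_ge0 //.
apply: le_trans (n1B _ _) _; rewrite -[_ * _ + _ + _]addrA mulrDl; apply: lerD.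
  by rewrite -mulrA; apply: le_trans (n1M _ _) _; rewrite ler_wpM2l.
have q1 : n1 (mx_velocity g t *m d1) <= D1 * v ^+ 2.
  apply: le_trans (n1M _ _) _; rewrite expr2 mulrCA -/v.
  by rewrite ler_wpM2l.
have q2 : n1 ((g t + V0) *m dd) <= (ga + n1 V0) * D5 * v ^+ 2.
  apply: le_trans (n1M _ _) _; rewrite -[leRHS]mulrA; apply: ler_pM; rewrite ?n1_ge0 //.
  by apply: le_trans (n1D _ _) _; rewrite lerD2r.
apply: le_trans (n1D _ _) _; apply: le_trans (lerD q1 (le_trans (n1D _ _) (lerD q1 q2))) _.
by rewrite le_eqVlt; apply/orP; left; apply/eqP; ring.
Qed.

End Acceleration.

(** * Second-order expansion of the exponential map *)

Section ExponentialMap.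
Context {R : realType}.
Local Notation C := R[i].
Local Notation Re := complex.Re.
Local Notation Im := complex.Im.
Variables d k : nat.
Local Notation op := 'M[C]_(d * k, d).
Local Notation J := (coord_idx (d * k - d) d).
Variable V0 : op.
Hypothesis iV : irreducible V0.

Lemma irreducible_dims : (0 < d)%N /\ (0 < k)%N.
Proof.
have [[[_ r1] _] _ _ _] := rho_ssP iV.
have d0 : (0 < d)%N.
  rewrite lt0n; apply/eqP => d0; move: r1; rewrite /mxtrace big1 => [/eqP|i _].
    by rewrite eq_sym oner_eq0.
  by have := ltn_ord i; rewrite {2}d0.
split=> //; rewrite lt0n; apply/eqP => k0.
have /matrixP/(_ (Ordinal d0) (Ordinal d0)) := iV.1; rewrite !mxE eqxx big1 => [/eqP|i _].
  by rewrite eq_sym oner_eq0.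
by have := ltn_ord i; rewrite {2}k0 muln0.
Qed.

(** Both sides use truncated subtraction; [k > 0], from [irreducible_dims], makes them agree. *)
Lemma card_coords : #|J| = dim_iso d k.
Proof.
rewrite card_coord_idx /dim_iso; have [_] := irreducible_dims.
case: k => // k' _; rewrite mulnS addKn.
by rewrite mulnSr -addnBA ?leq_pmull // -mulnn; nia.
Qed.

Variable nu : op -> op -> op -> R.
Hypothesis nuR : riemannian_metric nu.

Lemma chart_radius (N : 'M[C]_(d * k, d * k - d)) : N^t* *m N = 1%:M -> N^t* *m V0 = 0 ->
  exists2 rho : R, 0 < rho & forall c : J -> R, (forall j, `|c j| <= rho) ->
    cw c \in unitmx /\ irreducible (chartc V0 N c).
Proof.
move=> NN NV0; have [e0 e00 he] := irreducible_open iV.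
have [ka [ka0 kaE]] : exists ka : R, 0 <= ka /\ coord_norm (d * k - d) d = ka.
  by eexists; split; last reflexivity; exact: coord_norm_ge0.
have [Q [Q0 QE]] : exists Q : R, 0 <= Q /\ Q = 4 * n1 (1%:M : 'M[C]_d) * (n1 V0 + n1 N).
  by eexists; split; last reflexivity; rewrite !mulr_ge0 ?addr_ge0 ?n1_ge0.
have Z0 : 0 <= 3 * ka * Q / e0 by rewrite divr_ge0 ?(ltW e00) // (mulr_ge0 (mulr_ge0 (ler0n R 3) ka0) Q0).
(* The summand [6 ka] gives the smallness in [chart_near], and the last one keeps the chart within
   [e0] of [V0], where isometries are irreducible. *)
pose z := 1 + 6 * ka + 3 * ka * Q / e0.
have z0 : 0 < z by rewrite /z -addrA ltr_pwDl // addr_ge0 // mulr_ge0.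
exists z^-1 => [|c hc]; first by rewrite invr_gt0.
have zi : 0 <= z^-1 by rewrite invr_ge0 ltW.
have zz : z * z^-1 = 1 by rewrite mulfV // gt_eqF.
have ka6 := mulr_ge0 (ler0n R 6) ka0.
have b1 : 6 * ka * z^-1 <= 1.
  by rewrite -[leRHS]zz ler_wpM2r // /z; move: (3 * ka * Q / e0) Z0 => Z Z0; lra.
have b2 : 3 * ka * Q / e0 * z^-1 <= 1.
  by rewrite -[leRHS]zz ler_wpM2r // /z; move: (3 * ka * Q / e0) Z0 => Z Z0; lra.
have [hY hH] := n1_coord_le zi hc; rewrite kaE in hY hH.
have kz : 0 <= ka * z^-1 by rewrite mulr_ge0.
have y1 : n1 (Yof c) <= 1 by move: b1; rewrite -mulrA; lra.
have y2 : n1 (Yof c) + 2 * n1 (Hof c) <= 2^-1 by move: b1; rewrite -mulrA; lra.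
have [wu hV] := chart_near V0 N y1 y2; split=> //; apply: he.
  exact: (chart_isometry iV.1 NN NV0 (Hof_antiherm c) wu).
apply: le_trans hV _; rewrite -QE.
have b3 : 3 * ka * Q * z^-1 <= e0.
  by move: b2; rewrite mulrAC ler_pdivrMr // mul1r.
apply: le_trans b3; have -> : 3 * ka * Q * z^-1 = Q * (3 * (ka * z^-1)) by ring.
by apply: ler_wpM2l => //; lra.
Qed.

(** The geodesic equation bounds coordinate accelerations by Christoffel symbols times squared
    coordinate velocities, and [acceleration_bound] removes the coordinates. The statement is
    pointwise in [t], so the curve may leave the chart at other times. *)
Lemma geodesic_acceleration : exists r K : R, [/\ 0 < r, 0 <= K &
  forall a b g t, geodesic nu a b g -> a < t < b -> n1 (g t - V0) < r ->
    n1 (mx_velocity (mx_velocity g) t) <= K * n1 (mx_velocity g t) ^+ 2].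
Proof.
have V0V0 : V0^t* *m V0 = 1%:M := iV.1.
have [N [NN NV0 VN1]] := isometry_complement V0V0.
have [rho rho0 hrho] := chart_radius NN NV0.
have cJ := card_coords; pose phi := param V0 N cJ.
have Uc (x : 'rV[R]_(dim_iso d k)) : ball 0 rho x -> forall j, `|crd cJ x j| <= rho.
  by move=> /(ball_row _ rho0) h j; apply: ltW; exact: h.
have Uu x : ball 0 rho x -> cw (crd cJ x) \in unitmx by move=> /Uc /hrho[].
have Ui x : ball 0 rho x -> irreducible (phi x) by move=> /Uc /hrho[].
have lc := param_local_coord V0V0 NN NV0 Uu Ui.
have [r1 /andP[r10 r1rho] [Kg Kg0 hKg]] :=
  christoffel_bounded V0V0 NN NV0 rho0 Uu Ui nuR.
pose M := dim_iso d k; pose Kc : R := (M * M)%:R * Kg.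
have Kc0 : 0 <= Kc by rewrite mulr_ge0.
have [K K0 hK] := acceleration_bound VN1 Kc0.
pose om := n1 (1%:M : 'M[C]_d).
have om0 : 0 <= om by exact: n1_ge0.
have [Q [Q0 QE]] : exists Q : R, 0 <= Q /\ Q = n1 N * om + om * n1 V0.
  by eexists; split; last reflexivity; rewrite addr_ge0 // mulr_ge0 ?n1_ge0.
pose z := 1 + n1 V0 + Q / r1.
have z0 : 0 < z by rewrite /z -addrA ltr_pwDl // addr_ge0 ?n1_ge0 // divr_ge0 // ltW.
exists z^-1, K; split=> //; first by rewrite invr_gt0.
move=> a b g t geo tab near.
have zd (V : op) : n1 (V - V0) < z^-1 -> [/\ n1 V0 * n1 (V - V0) <= 1, n1 (V - V0) <= 1 &
    forall j, `|coord_of (inv_Y V0 N V) (inv_H V0 V) j| < r1].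
  move=> hV; have hz : z * n1 (V - V0) < 1 by rewrite mulrC -ltr_pdivlMr // mul1r.
  have dV := n1_ge0 (V - V0).
  have q1 : 0 <= n1 V0 * n1 (V - V0) by rewrite mulr_ge0 ?n1_ge0.
  have q2 : 0 <= Q / r1 * n1 (V - V0) by rewrite mulr_ge0 // divr_ge0 // ltW.
  have {}hz : n1 (V - V0) + n1 V0 * n1 (V - V0) + Q / r1 * n1 (V - V0) < 1.
    by apply: le_lt_trans hz; rewrite le_eqVlt; apply/orP; left; apply/eqP; rewrite /z; ring.
  have u1 : n1 V0 * n1 (V - V0) <= 1 by lra.
  split=> //; first by lra.
  move=> j; apply: le_lt_trans (coord_le _ _ _) _.
  have [wu wb wc] := unit_near V0V0 u1.
  have y1 : n1 (inv_Y V0 N V) <= n1 N * om * n1 (V - V0).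
    have -> : inv_Y V0 N V = N^t* *m (V - V0) *m inv_w V0 V.
      by rewrite /inv_Y mulmxBr NV0 subr0.
    apply: le_trans (n1M _ _) _.
    have -> : n1 N * om * n1 (V - V0) = n1 N * n1 (V - V0) * om by rewrite mulrAC.
    apply: ler_pM; rewrite ?n1_ge0 //; apply: le_trans (n1M _ _) _.
    by rewrite n1_conjt.
  have y2 : n1 (inv_H V0 V) <= om * n1 V0 * n1 (V - V0).
    have -> : inv_H V0 V = 2^-1 *: ((inv_w V0 V - 2^-1 *: 1%:M) -
        (inv_w V0 V - 2^-1 *: 1%:M)^t*).
      rewrite /inv_H trmxCB trmxCZ conj_half trmxC1; congr (_ *: _).
      by rewrite opprB addrA subrK.
    rewrite n1Z normc_half; have := n1B (inv_w V0 V - 2^-1 *: 1%:M)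
      ((inv_w V0 V - 2^-1 *: 1%:M)^t*); rewrite n1_conjt -mulrA.
    move: wc; rewrite -/om; move: (n1 (_ - _ *: _)) (n1 (_ - _^t*)) => u1' u2' h1 h2; lra.
  have hz2 : Q / r1 * n1 (V - V0) < 1 by lra.
  move: hz2; rewrite mulrAC ltr_pdivrMr // mul1r; apply: le_lt_trans.
  by rewrite QE [leRHS]mulrDl; exact: lerD.
have [irr sm ode] := geo.
(* Around [t] the curve stays in the chart; the geodesic equation is local and is used on [(a', b')]
   only. *)
have [eta eta0 heta] : exists2 eta : R, 0 < eta &
    forall s, t - eta < s < t + eta -> a < s < b /\ n1 (g s - V0) < z^-1.
  have sg0 : msmooth_curve a b (fun s => g s - V0).
    apply/msmooth_curveE; apply: (msmoothB (@open_otime R a b)).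
      exact/msmooth_curveE.
    exact: msmooth_cst.
  have hc := n1_continuous sg0 tab.
  have h1 : \forall s \near t, n1 (g s - V0) < z^-1 by exact: cvgr_lt hc _ near.
  have h2 : \forall s \near t, a < s < b by exact: (near_time (P := fun s => a < s < b) _ tab).
  have : \forall s \near t, a < s < b /\ n1 (g s - V0) < z^-1.
    by apply: filterS2 h1 h2 => s.
  move=> /nbhs_ballP[e /= e0 he]; exists e => // s /andP[s1 s2]; apply: he.
  by rewrite -ball_normE /= ltr_norml; apply/andP; split; lra.
pose eta' := Num.min eta (Num.min (t - a) (b - t)).
have /andP[ta tb] := tab.
have eta'0 : 0 < eta' by rewrite !lt_min eta0 !subr_gt0 ta tb.
pose a' := t - eta'; pose b' := t + eta'.
have aa : a <= a'.
  by rewrite /a' lerBrDl -lerBrDr !ge_min; apply/orP; right; rewrite lexx.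
have bb : b' <= b.
  by rewrite /b' -lerBrDl !ge_min lexx !orbT.
have ee : eta' <= eta by rewrite ge_min lexx.
have tab' : a' < t < b' by rewrite /a' /b' ltrDl gtrDl oppr_lt0 eta'0.
have inside s : a' < s < b' -> a < s < b /\ n1 (g s - V0) < z^-1.
  move=> /andP[s1 s2]; apply: heta; apply/andP; split.
    by apply: le_lt_trans s1; rewrite /a' lerD2l lerN2.
  by apply: lt_le_trans s2 _; rewrite /b' lerD2l.
have sg : msmooth_curve a' b' g.
  by move=> u v; have [h1 h2] := sm u v; split; exact: smooth_curve_sub aa bb _.
have isog s : a' < s < b' -> Defs.isometry (g s) by move=> /inside[/irr[]].
have ug s : a' < s < b' -> 1%:M + V0^t* *m g s \in unitmx.
  by move=> /inside[_ /zd[h _ _]]; have [] := unit_near V0V0 h.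
have [n1t n2t n3t] := zd _ near; have [_ wb _] := unit_near V0V0 n1t.
apply: (hK a' b' g t) => // v hv j.
pose c := curve_coord V0 N g; pose x s := row_of cJ (c s).
have xE s l : x s 0 l = c s (enum_val (cast_ord (esym cJ) l)) by rewrite mxE.
have x_small s : a' < s < b' -> forall l, `|x s 0 l| < r1.
  by move=> /inside[_ /zd[_ _ h]] l; rewrite xE; exact: h.
have hx1 l : smooth_curve a' b' (fun s => x s 0 l).
  have -> : (fun s => x s 0 l) =
      (fun s => curve_coord V0 N g s (enum_val (cast_ord (esym cJ) l))).
    by apply/funext => s; exact: xE.
  exact: curve_coord_smooth.
have hx2 s : a' < s < b' -> ball 0 rho (x s) /\ phi (x s) = g s.
  move=> hs; split.
    by apply/(ball_row _ rho0) => l; apply: lt_le_trans (x_small s hs l) r1rho.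
  by rewrite /phi /param crd_row; exact: (curve_chartE VN1 isog ug).
have := ode _ _ lc a' b' x aa bb hx1 hx2 t tab' (idx cJ j).
have acE : derive1n 2 (fun s => x s 0 (idx cJ j)) t = acc_coord V0 N g t j.
  rewrite /acc_coord; congr (derive1n 2 _ t); apply/funext => s.
  by rewrite -[LHS]/(crd cJ (x s) j) crd_row.
have veE l : derive1 (fun s => x s 0 l) t = vel_coord V0 N g t (enum_val (cast_ord (esym cJ) l)).
  by rewrite /vel_coord; congr (derive1 _ t); apply/funext => s; rewrite xE.
rewrite acE => /eqP; rewrite addr_eq0 => /eqP ->; rewrite normrN.
have v0 : 0 <= v by apply: le_trans (hv j); exact: normr_ge0.
apply: le_trans (ler_norm_sum _ _ _) _.
apply: (@le_trans _ _ (\sum_(i < M) \sum_(l < M) (Kg * v ^+ 2))).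
  apply: ler_sum => i _; apply: le_trans (ler_norm_sum _ _ _) _; apply: ler_sum => l _.
  have hG : `|christoffel nu (param V0 N cJ) (idx cJ j) i l (x t)| <= Kg.
    by apply: hKg; apply/(ball_row _ r10) => i'; exact: x_small.
  rewrite !veE 2!normrM expr2 mulrA.
  exact: (ler_pM (mulr_ge0 (normr_ge0 _) (normr_ge0 _)) (normr_ge0 _)
    (ler_pM (normr_ge0 _) (normr_ge0 _) hG (hv _)) (hv _)).
by rewrite sumr_const sumr_const !card_ord -mulrnA -[leLHS]mulr_natl /Kc mulrA.
Qed.

Hypothesis nuC : id_compatible nu.
Variable E : op -> op.
Hypothesis expE : exponential_map nu V0 E.

Lemma exponential_quadratic : exists e0 Kp : R, [/\ 0 < e0, 0 <= Kp &
  forall A h, 0 < h -> h <= e0 -> tangent_id V0 A -> n1 A <= h ->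
    Defs.isometry (E A) /\ n1 (E A - V0 - 'i *: A) <= Kp * h ^+ 2].
Proof.
have [r [K [r0 K0 acc]]] := geodesic_acceleration.
have [re re0 hE] := expE.
pose L : R := 2 * (d * k * d)%:R; have L0 : 0 <= L by rewrite mulr_ge0.
pose q := n1 (rho_ss V0); have q0 : 0 <= q by exact: n1_ge0.
have t1 : 0 <= 2 * L / r by rewrite divr_ge0 ?mulr_ge0 // ltW.
have t2 : 0 <= 8 * L * K by rewrite !mulr_ge0.
have t3 : 0 <= q / re ^+ 2 by rewrite divr_ge0 // sqr_ge0.
(* Each summand secures one smallness condition on [h]: [h <= 1], staying within [r] of [V0], the
   margin [h / 2] of the bootstrap, and the domain of [E]. *)
pose z := 1 + 2 * L / r + 8 * L * K + q / re ^+ 2.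
have z1 : 1 <= z by rewrite /z; lra.
have z0 : 0 < z by apply: lt_le_trans z1.
exists z^-1, (L ^+ 2 * 4 * K); split.
- by rewrite invr_gt0.
- by rewrite !mulr_ge0 ?sqr_ge0.
move=> A h h0 hz tA hA.
have zh : z * h <= 1 by rewrite mulrC -ler_pdivlMr // mul1r.
have p1 : 0 <= 2 * L / r * h by rewrite mulr_ge0 // ltW.
have p2 : 0 <= 8 * L * K * h by rewrite mulr_ge0 // ltW.
have p3 : 0 <= q / re ^+ 2 * h by rewrite mulr_ge0 // ltW.
have zhE : z * h = h + 2 * L / r * h + 8 * L * K * h + q / re ^+ 2 * h by rewrite /z; ring.
have oA := tangent_id_orth iV tA.
have tgA : tangent V0 A.
  rewrite /tangent /= oA -[_ *m V0]trmxCK trmxCM trmxCK oA trmx0 map_mx0.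
  by rewrite subrr.
(* On identifiable directions the metric is [ip_id], so a small [n1 A] puts [A] in the domain of the
   exponential map. *)
have nuA : nu V0 A A < re ^+ 2.
  have [_ /(_ A tA) hn] := nuC iV.
  have : `|nu V0 A A| <= q * (n1 A * n1 A).
    by rewrite -normcR hn; exact: ip_id_n1.
  move=> h1; apply: le_lt_trans (ler_norm _) _; apply: le_lt_trans h1 _.
  have h2 : q / re ^+ 2 * h < 1 by lra.
  have hh1 : h <= 1 by lra.
  move: h2; rewrite mulrAC ltr_pdivrMr ?exprn_gt0 // mul1r; apply: le_lt_trans.
  apply: ler_wpM2l => //; apply: le_trans (ler_pM _ _ hA hA) _; rewrite ?n1_ge0 //.
  by rewrite ler_piMr // ltW.
have [e [g [e0 geo g0 v0 <-]]] := hE A tgA nuA.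
have [irr sm _] := geo; split.
  by have [] := irr 1; rewrite // ltrDl e0 andbT (lt_trans _ ltr01) // oppr_lt0.
apply: (curve_quadratic e0 sm g0 v0 _ K0 h0 hA (r := r)).
- move=> t /andP[s0 s1] near; apply: acc geo _ near.
  by rewrite (lt_le_trans _ s0) ?oppr_lt0 // (le_lt_trans s1) // ltrDl.
- rewrite -/L; have h2 : 2 * L / r * h < 1 by lra.
  move: h2; rewrite mulrAC ltr_pdivrMr // mul1r; apply: le_lt_trans.
  by rewrite mulrA [L * 2]mulrC.
rewrite -/L; have h2 : 8 * L * K * h <= 1 by lra.
have -> : L * (K * (2 * h) ^+ 2) = (8 * L * K * h) * (h / 2) by field.
by rewrite ler_piMl // divr_ge0 // ltW.
Qed.

End ExponentialMap.

(** * Le Cam bound at fixed [n] *)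

Section Assembly.
Context {R : realType}.
Local Notation C := R[i].
Local Notation Re := complex.Re.

Lemma deficiency_ext (H1 H2 : hilbert R) (Theta : Type) (B : set Theta)
    (Q Q' : Theta -> hidx H1 -> hidx H1 -> C) (G G' : Theta -> hidx H2 -> hidx H2 -> C) :
  (forall t, B t -> Q t = Q' t) -> (forall t, B t -> G t = G' t) ->
  deficiency B Q G = deficiency B Q' G'.
Proof.
move=> hQ hG; rewrite /deficiency; congr ereal_inf; apply: eq_imagel => T _.
by congr ereal_sup; apply: eq_imagel => t Bt; rewrite hQ // hG.
Qed.

Lemma projector_phase (I : Type) (u : C) (f : I -> C) : normc u = 1 ->
  projector (fun i => u * f i) = projector f.
Proof.
move=> u1; apply/funext => i; apply/funext => j; rewrite /projector conjcM mulrACA.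
by rewrite [u * _]mulrC mulJc u1 expr1n mul1r.
Qed.

Variables d k : nat.
Local Notation op := 'M[C]_(d * k, d).
Local Notation D := (d ^ 2 * (k - 1))%N.
Variables (V0 : op) (E : op -> op) (phi : 'cV[C]_d) (b : 'I_D -> op).
Hypothesis iV : irreducible V0.
Hypothesis onb : onb_id V0 b.
Hypothesis phi1 : phi^t* *m phi = 1%:M.

Definition coords (A : op) (i : 'I_D) : C := ip_id V0 (b i) A.

Lemma of_coords A : tangent_id V0 A -> of_coord b (coords A) = A.
Proof. by have [_ _ h] := onb => /h {2}->. Qed.

Lemma coords_sqn A : tangent_id V0 A ->
  Re (ip_id V0 A A) = \sum_l normc (coords A l) ^+ 2.
Proof.
move=> tA; rewrite -{1 2}(of_coords tA) (ip_id_coord iV onb).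
by rewrite Re_sum; apply: eq_bigr => l _; rewrite mulJc.
Qed.

Lemma coherent_coords A : tangent_id V0 A -> coherent V0 b A = coh (coords A).
Proof.
by move=> tA; apply/funext => w; rewrite /coherent /coh coords_sqn.
Qed.

Variables (e0 Kp : R).
Hypothesis e00 : 0 < e0.
Hypothesis Kp0 : 0 <= Kp.
Hypothesis expE : forall A h, 0 < h -> h <= e0 -> tangent_id V0 A -> n1 A <= h ->
  Defs.isometry (E A) /\ n1 (E A - V0 - 'i *: A) <= Kp * h ^+ 2.

Lemma local_models_bound : exists K0 K : R, [/\ 0 <= K0, 0 <= K &
  forall n (r : R), (0 < n)%N -> 1 <= r -> K0 * r <= Num.sqrt n%:R ->
  D%:R * expR (- r ^+ 2) + K * (r ^+ (3 + 2 * D) / Num.sqrt n%:R) <= 1 ->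
  (0 <= @le_cam R (output_space d k n) (fock_space D) op (ball_id V0 r)
        (output_model E phi (n := n)) (gaussian_model V0 b)
     <= (5 * Num.sqrt (D%:R * expR (- r ^+ 2) +
           K * (r ^+ (3 + 2 * D) / Num.sqrt n%:R)))%:E)%E].
Proof.
have [d0 k0] := irreducible_dims iV.
have [K0 [K [K00 K0' gram]]] := phased_output_gram iV onb phi1 e00 Kp0 expE.
(* Frame points are larger than the parameters, so the Gram estimate is used at radius [s r], with
   the squared radius of [models_deficiency]. *)
pose s : R := Num.sqrt (4 * D%:R + 1).
have s2 : s ^+ 2 = 4 * D%:R + 1 by rewrite sqr_sqrtr // addr_ge0 ?mulr_ge0.
have s0 : 0 <= s by exact: sqrtr_ge0.
have s1 : 1 <= s by rewrite -(sqrtr1 R) ler_wsqrtr // lerDr mulr_ge0.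
exists (K0 * s), (5 * ((K + 1) * s ^+ 3 * 4 ^+ D)); split.
- by rewrite mulr_ge0.
- by rewrite !mulr_ge0 ?addr_ge0 ?exprn_ge0.
move=> n r n0 r1 hn; set eta := _ + _ => eta1.
have r0 : 0 < r by apply: lt_le_trans r1.
have q0 : 0 < Num.sqrt (n%:R : R) by rewrite sqrtr_gt0 ltr0n.
have sr1 : 1 <= s * r by rewrite -[leLHS]mulr1 ler_pM.
have hn' : K0 * (s * r) <= Num.sqrt n%:R by rewrite mulrA.
have [norm_out gram_out] := gram n (s * r) n0 sr1 hn'.
have sr2 : (s * r) ^+ 2 = (4 * D%:R + 1) * r ^+ 2 by rewrite exprMn s2.
(* [K + 1] in place of [K], because [models_deficiency] asks for a positive [eps]. *)
pose eps := (K + 1) * ((s * r) ^+ 3 / Num.sqrt n%:R).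
have base0 : 0 < (s * r) ^+ 3 / Num.sqrt n%:R.
  by rewrite divr_gt0 // exprn_gt0 // mulr_gt0 // (lt_le_trans _ s1).
have eps0 : 0 < eps by rewrite mulr_gt0 // ltr_wpDl.
have etaE : D%:R * expR (- r ^+ 2) + 5 * (eps * (4 * r ^+ 2) ^+ D) = eta.
  have e1 : r ^+ (3 + 2 * D) = r ^+ 3 * (r ^+ 2) ^+ D by rewrite exprD exprM.
  have e2 : (4 * r ^+ 2) ^+ D = 4 ^+ D * (r ^+ 2) ^+ D by rewrite exprMn.
  have e3 : (s * r) ^+ 3 = s ^+ 3 * r ^+ 3 by rewrite exprMn.
  rewrite /eta /eps e1 e2 e3.
  set x1 := (r ^+ 2) ^+ D; set x2 := 4 ^+ D; set x3 := s ^+ 3; set x4 := r ^+ 3.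
  by ring.
pose out0 : 'I_d * n.-tuple 'I_k := (Ordinal d0, [tuple of nseq n (Ordinal k0)]).
have zB A : ball_id V0 r A -> \sum_l normc (coords A l) ^+ 2 <= r ^+ 2.
  move=> [tA hA]; rewrite -coords_sqn //.
  by move: hA; rewrite lecE => /andP[_].
have tB A : ball_id V0 r A -> tangent_id V0 A by case.
have scaled A : tangent_id V0 A ->
    E (((Num.sqrt (n%:R : R))^-1)%:C *: A) = scaled_op E b n (coords A).
  by move=> tA; rewrite /scaled_op of_coords.
have norm1 z : \sum_l normc (z l) ^+ 2 <= (4 * D%:R + 1) * r ^+ 2 ->
    \sum_p (phased_output V0 E phi b z p)^* * phased_output V0 E phi b (n := n) z p = 1.
  by rewrite -sr2 => /norm_out[].
have gram1 z z' M : \sum_l normc (z l) ^+ 2 <= (4 * D%:R + 1) * r ^+ 2 ->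
    \sum_l normc (z' l) ^+ 2 <= (4 * D%:R + 1) * r ^+ 2 -> (n < M)%N ->
    normc (\sum_p (phased_output V0 E phi b z p)^* * phased_output V0 E phi b (n := n) z' p -
           \sum_(w <- words D M) (coh z w)^* * coh z' w) <= eps.
  rewrite -sr2 => hz hz' nM; apply: le_trans (gram_out _ _ _ hz hz' nM) _.
  by apply: ler_wpM2r; [exact: ltW|rewrite lerDl].
have eta1' : D%:R * expR (- r ^+ 2) + 5 * (eps * (4 * r ^+ 2) ^+ D) <= 1 by rewrite etaE.
have [] := @models_deficiency R d k n D op (ball_id V0 r) coords
  (phased_output V0 E phi b (n := n)) r eps out0 n r1 eps0 zB norm1 gram1 eta1'.
rewrite etaE => def1 def2.
have QE A : ball_id V0 r A ->
    output_model E phi (n := n) A = projector (phased_output V0 E phi b (n := n) (coords A)).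
  move=> BA; rewrite /output_model (scaled _ (tB _ BA)).
  rewrite -(@projector_phase _ ((tangent_phase V0 (scaled_op E b n (coords A)))^* ^+ n)) //.
  have [|u1 _] := norm_out (coords A); last by rewrite normcX normcJ u1 expr1n.
  rewrite sr2; apply: le_trans (zB A BA) _.
  by rewrite [leRHS]mulrDl mul1r lerDr mulr_ge0 ?sqr_ge0 ?mulr_ge0.
have GE A : ball_id V0 r A -> gaussian_model V0 b A = projector (coh (coords A)).
  by move=> BA; rewrite /gaussian_model (coherent_coords (tB _ BA)).
apply/andP; split.
  apply: (@le_cam_ge0 R _ _ _ _ 0); split; first by rewrite /tangent_id /= mulmx0.
  by rewrite ip_idE mulmx0 mulmx0 linear0 lecR sqr_ge0.
rewrite /le_cam ge_max (deficiency_ext (H1 := output_space d k n) (H2 := fock_space D) QE GE).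
by rewrite (deficiency_ext (H1 := fock_space D) (H2 := output_space d k n) GE QE) def1.
Qed.

End Assembly.

(** * Rates in [n] and the two limits *)

Section Rates.
Context {R : realType}.

Lemma powRN_cvg0 (a : R) : 0 < a -> n%:R `^ (- a) @[n --> \oo] --> (0 : R).
Proof.
move=> a0; apply/cvgrPdist_lt => e e0.
have : \forall n \near \oo, (e^-1) `^ (a^-1) < n%:R :> R by exact: nbhs_infty_gtr.
apply: filterS => n hn; rewrite sub0r normrN ger0_norm ?powR_ge0 //.
have n0 : 0 < n%:R :> R by apply: le_lt_trans hn; exact: powR_ge0.
rewrite powRN -[ltRHS]invrK ltf_pV2 ?posrE ?invr_gt0 ?powR_gt0 //.
have := gt0_ltr_powR a0 (x := (e^-1) `^ (a^-1)) (y := n%:R).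
rewrite !nnegrE powR_ge0 ler0n => /(_ isT isT hn).
by rewrite -powRrM mulVf ?gt_eqF // powRr1 // invr_ge0 ltW.
Qed.

(** A cubic bound fits the rate: with [u = r^2] it gives [n^(-6 delta)], which beats the
    [n^(4 delta)] that the weight [n^(2 delta)] becomes under the square root. *)
Lemma expRN_le (u : R) : 0 < u -> expR (- u) <= 6 / u ^+ 3.
Proof.
move=> u0; rewrite expRN -[leRHS]invrK lef_pV2 ?posrE ?expR_gt0 ?invr_gt0 ?divr_gt0 ?exprn_gt0 //.
rewrite invf_div; apply: le_trans (expR_partial 4 (ltW u0)).
rewrite !big_ord_recr big_ord0 /= !factS fact0 !muln1.
have p1 : 0 <= u ^+ 2 / 2%:R by rewrite divr_ge0 ?sqr_ge0.
rewrite expr0 expr1 !divr1 add0r (_ : (3 * 2)%N = 6%N) //; lra.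
Qed.

Variables (C delta gam : R) (D : nat) (K0 K : R) (L : nat -> \bar R).
Hypothesis C0 : 0 < C.
Hypothesis delta0 : 0 < delta.
Hypothesis gam0 : 0 <= gam.
Hypothesis gam1 : 2 * gam < 6 * delta.
Hypothesis gam2 : 2 * gam + (3 + 2 * D)%:R * delta < 2^-1.
Hypothesis K00 : 0 <= K0.
Hypothesis KK0 : 0 <= K.
Local Notation r n := (C * n%:R `^ delta).
Local Notation eta n :=
  (D%:R * expR (- r n ^+ 2) + K * (r n ^+ (3 + 2 * D) / Num.sqrt n%:R)).
Hypothesis Lbound : forall n, (0 < n)%N -> 1 <= r n -> K0 * r n <= Num.sqrt n%:R ->
  eta n <= 1 -> (0 <= L n <= (5 * Num.sqrt (eta n))%:E)%E.

Lemma weighted_rate : ((n%:R `^ gam)%:E * L n)%E @[n --> \oo] --> 0%E.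
Proof.
pose m := (3 + 2 * D)%N.
pose K1 := D%:R * (6 / C ^+ 6); pose K2 := K * C ^+ m.
have K10 : 0 <= K1 by rewrite mulr_ge0 // divr_ge0 // exprn_ge0 // ltW.
have K20 : 0 <= K2 by rewrite mulr_ge0 // exprn_ge0 // ltW.
(* The decay exponents of the exponential term and of the Gram error; [gam1] and [gam2] say that
   both exceed [2 gam], the weight moved under the square root. *)
pose p1 := 6 * delta; pose p2 := 2^-1 - m%:R * delta.
pose w n : R := K1 * n%:R `^ (- p1) + K2 * n%:R `^ (- p2).
have pw n (x : R) j : (0 < n)%N -> (n%:R `^ x) ^+ j = n%:R `^ (j%:R * x) :> R.
  by move=> n0; rewrite -powR_mulrn ?powR_ge0 // -powRrM mulrC.
have nR n : (0 < n)%N -> n%:R != 0 :> R by move=> n0; rewrite pnatr_eq0 -lt0n.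
have sq n : Num.sqrt n%:R = n%:R `^ 2^-1 :> R by rewrite powR12_sqrt.
have etaw n : (0 < n)%N -> eta n <= w n.
  move=> n0; apply: lerD.
    rewrite /K1 -mulrA ler_wpM2l //.
    have u0 : 0 < r n ^+ 2 by rewrite exprn_gt0 // mulr_gt0 // powR_gt0 // ltr0n.
    apply: le_trans (expRN_le u0) _; rewrite -exprM exprMn invfM mulrA pw //.
    by rewrite powRN /p1.
  rewrite /K2 -mulrA ler_wpM2l // exprMn -mulrA ler_wpM2l ?exprn_ge0 ?(ltW C0) //.
  rewrite pw // sq -powRN -powRD; last by rewrite nR ?implybT.
  by rewrite /p2 opprB.
have w0 n : 0 <= w n by rewrite addr_ge0 // mulr_ge0 // powR_ge0.
have wg n : (0 < n)%N -> (n%:R `^ gam) ^+ 2 * w n =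
    K1 * n%:R `^ (- (p1 - 2 * gam)) + K2 * n%:R `^ (- (p2 - 2 * gam)).
  move=> n0; rewrite pw // /w mulrDr !opprB.
  have sp x : n%:R `^ (2 * gam + x) = n%:R `^ (2 * gam) * n%:R `^ x :> R.
    by rewrite powRD // nR // implybT.
  by rewrite !sp; congr (_ + _); rewrite mulrCA.
pose W n : R := K1 * n%:R `^ (- (p1 - 2 * gam)) + K2 * n%:R `^ (- (p2 - 2 * gam)).
have Wlim : W n @[n --> \oo] --> (0 : R).
  have -> : (0 : R) = K1 * 0 + K2 * 0 by rewrite !mulr0 addr0.
  apply: cvgD; apply: cvgMr; apply: powRN_cvg0; first by rewrite subr_gt0.
  by rewrite /p2 subr_gt0 ltrBrDr.
have wlim : w n @[n --> \oo] --> (0 : R).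
  have -> : (0 : R) = K1 * 0 + K2 * 0 by rewrite !mulr0 addr0.
  apply: cvgD; apply: cvgMr; apply: powRN_cvg0; first by rewrite mulr_gt0.
  by move: gam2 gam0; rewrite /p2 -/m; lra.
have hlim : (5 * Num.sqrt (W n)) @[n --> \oo] --> (0 : R).
  have -> : (0 : R) = 5 * Num.sqrt 0 by rewrite sqrtr0 mulr0.
  apply: cvgMr; apply: (cvg_comp _ _ Wlim); exact: sqrt_continuous.
apply: (squeeze_cvge (f := fun=> 0%E) (h := fun n => (5 * Num.sqrt (W n))%:E) _
  (cvg_cst 0%E)); last first.
  by apply: cvg_EFin hlim; exact: nearW.
have ev1 : \forall n \near \oo, (0 < n)%N by exact: nbhs_infty_ge 1%N.
have ev2 : \forall n \near \oo, 1 <= r n.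
  have h : n%:R `^ (- delta) @[n --> \oo] --> (0 : R) by exact: powRN_cvg0.
  have h2 : \forall n \near \oo, n%:R `^ (- delta) < C by exact: cvgr_lt h _ C0.
  apply: filterS2 ev1 h2 => n n0 hn; have p0 : 0 < n%:R `^ delta :> R by rewrite powR_gt0 // ltr0n.
  by move: hn; rewrite powRN => /ltW; rewrite -ler_pdivrMr // div1r.
(* This makes [r n] negligible against [sqrt n], the third premise of [Lbound]. *)
have dhalf : delta < 2^-1.
  have : delta <= (3 + 2 * D)%:R * delta by rewrite ler_peMl ?(ltW delta0) // ler1n.
  by move: gam2 gam0; lra.
have ev3 : \forall n \near \oo, K0 * r n <= Num.sqrt n%:R.
  have h : n%:R `^ (- (2^-1 - delta)) @[n --> \oo] --> (0 : R).
    by apply: powRN_cvg0; rewrite subr_gt0.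
  have c0 : 0 < (K0 * C + 1)^-1 by rewrite invr_gt0 ltr_wpDl // mulr_ge0 // ltW.
  have h2 : \forall n \near \oo, n%:R `^ (- (2^-1 - delta)) < (K0 * C + 1)^-1.
    exact: cvgr_lt h _ c0.
  apply: filterS2 ev1 h2 => n n0 hn.
  have p0 : 0 < n%:R `^ 2^-1 :> R by rewrite powR_gt0 // ltr0n.
  have e : n%:R `^ delta = n%:R `^ (- (2^-1 - delta)) * n%:R `^ 2^-1 :> R.
    by rewrite -powRD ?nR ?implybT // opprB subrK.
  rewrite sq e mulrA mulrA ler_piMl ?(ltW p0) //.
  have h3 : K0 * C * n%:R `^ (- (2^-1 - delta)) <= (K0 * C + 1) * (K0 * C + 1)^-1.
    apply: ler_pM; rewrite ?powR_ge0 ?mulr_ge0 ?(ltW C0) ?(ltW hn) //.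
    by rewrite lerDl.
  by apply: le_trans h3 _; rewrite mulfV // gt_eqF // -invr_gt0.
have ev4 : \forall n \near \oo, w n < 1 by exact: cvgr_lt wlim _ ltr01.
apply: filterS2 (filterI ev1 ev2) (filterI ev3 ev4) => n [n0 h1] [h2 h3].
have /andP[L0 L1] := Lbound n0 h1 h2 (le_trans (etaw n n0) (ltW h3)).
have g0 : 0 <= n%:R `^ gam :> R by exact: powR_ge0.
apply/andP; split; first by rewrite mule_ge0 // lee_fin.
apply: le_trans (lee_wpmul2l _ L1) _; first by rewrite lee_fin.
rewrite -EFinM lee_fin mulrCA ler_wpM2l //.
have -> : n%:R `^ gam = Num.sqrt ((n%:R `^ gam) ^+ 2) :> R by rewrite sqrtr_sqr ger0_norm.
rewrite -sqrtrM ?sqr_ge0 // ler_wsqrtr // /W -wg //.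
by rewrite ler_wpM2l ?sqr_ge0 // etaw.
Qed.

End Rates.

Theorem theorem11 (R : realType) (d k : nat)
    (nu : 'M[R[i]]_(d * k, d) -> 'M[R[i]]_(d * k, d) ->
          'M[R[i]]_(d * k, d) -> R)
    (V0 : 'M[R[i]]_(d * k, d))
    (E : 'M[R[i]]_(d * k, d) -> 'M[R[i]]_(d * k, d))
    (phi : 'cV[R[i]]_d)
    (b : 'I_(d ^ 2 * (k - 1)) -> 'M[R[i]]_(d * k, d))
    (C delta : R) :
  riemannian_metric nu -> gauge_invariant nu -> id_compatible nu ->
  irreducible V0 -> exponential_map nu V0 E ->
  phi^t* *m phi = 1%:M ->
  onb_id V0 b ->
  0 < C -> 0 < delta -> delta < (2 * ((d_id d k)%:R + 3))^-1 ->
  (local_le_cam V0 E phi b C delta n @[n --> \oo] --> 0%E) /\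
  (delta < (2 * (11 + 2 * (d_id d k)%:R))^-1 ->
   ((n%:R `^ (2 * delta))%:E * local_le_cam V0 E phi b C delta n)%E
     @[n --> \oo] --> 0%E).
Proof.
move=> nuR _ nuC iV expE phi1 onb C0 delta0 hdelta.
have [e0 [Kp [e00 Kp0 quad]]] := exponential_quadratic iV nuR nuC expE.
have [K0 [K [K00 KK0 bound]]] := local_models_bound iV onb phi1 e00 Kp0 quad.
set D := (d ^ 2 * (k - 1))%N in onb bound *.
(* [D] counts complex modes and [d_id] real parameters: the thresholds read [(3 + 2 D) delta < 1/2]
   and [(11 + 4 D) delta < 1/2]. *)
have dE : (d_id d k)%:R = 2 * D%:R :> R by rewrite /d_id natrM.
have mE : (3 + 2 * D)%:R = 3 + 2 * D%:R :> R by rewrite natrD natrM.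
have D0 : 0 <= D%:R :> R by [].
(* [gam = 0] will give the first limit and [gam = 2 delta] the weighted one. *)
have main gam : 0 <= gam -> 2 * gam < 6 * delta ->
    2 * gam + (3 + 2 * D)%:R * delta < 2^-1 ->
    ((n%:R `^ gam)%:E * local_le_cam V0 E phi b C delta n)%E @[n --> \oo] --> 0%E.
  move=> g0 g1 g2; apply: (weighted_rate C0 delta0 g0 g1 g2 K00 KK0) => n n0 h1 h2 h3.
  exact: bound.
have bnd (x : R) : 0 < x -> delta < (2 * x)^-1 -> x * delta < 2^-1.
  by move=> x0; rewrite invfM [_ * x^-1]mulrC ltr_pdivlMl.
have h1 : (3 + 2 * D%:R) * delta < 2^-1.
  by apply: bnd; [lra|move: hdelta; rewrite dE addrC].
split.
  have := main 0 (lexx 0); rewrite mulr0 mulr_gt0 // add0r mE => /(_ isT h1).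
  under eq_fun do rewrite powRr0 mul1e.
  by [].
rewrite dE => h2; apply: main.
- by rewrite mulr_ge0 // ltW.
- by rewrite mulrA -subr_gt0 -mulrBl mulr_gt0 //; lra.
have h3 : (11 + 2 * (2 * D%:R)) * delta < 2^-1 by apply: bnd => //; lra.
have h4 : 0 <= D%:R * delta by rewrite mulr_ge0 // ltW.
(* The condition to meet is [(7 + 2 D) delta < 1/2], and [h3] bounds [(11 + 4 D) delta]. *)
rewrite mE; move: h3 h4; move: D%:R => x.
have -> : (11 + 2 * (2 * x)) * delta = 11 * delta + 4 * (x * delta) by ring.
have -> : 2 * (2 * delta) + (3 + 2 * x) * delta = 7 * delta + 2 * (x * delta) by ring.
by move: (x * delta) delta0 => y; lra.
Qed.
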